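(* Let $0<\alpha\le1$ and let the two scales $h$ and $\epsilon$ satisfy $\epsilon=C_2h^{2/(3+\alpha)}$ for an arbitrary constant $C_2>0$. Suppose that the solution $u$ of $A(x):D^2u(x)=f(x)$ in $\Omega$, $u=0$ on $\partial\Omega$, belongs to $C^{3,\alpha}(\overline\Omega)$, that the coefficient matrix $A$ satisfies $$\Big(\sum_{x_i\in\mathcal{N}_h}\int_{\omega_i}|A(x)-\bar A(x_i)|^d\,dx\Big)^{1/d}\le C(A)\,h^\beta\qquad\text{with } \tfrac{2+2\alpha}{3+\alpha}\le\beta\le1,$$ and that the meshes $\mathcal{T}_h$ are face weakly acute. Then the finite element solution $u_h^\epsilon$ satisfies $$\|u-u_h^\epsilon\|_{L^\infty(\Omega)}\le C\,h^{2(1+\alpha)/(3+\alpha)}|\ln h|\,\Big(|u|_{C^{3,\alpha}(\overline\Omega)}+|u|_{W^2_\infty(\Omega)}\Big),$$ where $C$ is independent of $h$ and $u$ and depends on $\sigma,\Omega,d,\lambda$ (through the constant of the discrete Alexandroff-Bakelman-Pucci estimate), on $C(A)$ and on $C_2$.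
   Context: Domain and data: $d\ge2$; $\Omega\subset\mathbb{R}^d$ is a bounded domain with (at least) $C^{1,1}$ boundary; $A:\Omega\to\mathbb{R}^{d\times d}$ is measurable with symmetric values and $\lambda I\le A(x)\le\Lambda I$ for a.e. $x$, $0<\lambda\le\Lambda$; $f\in L^d(\Omega)$. $Q:=(\Lambda-\lambda/2)^{1/2}$. $|u|_{C^{3,\alpha}(\overline\Omega)}$ is the $\alpha$-Hölder seminorm of $D^3u$ and $|u|_{W^2_\infty(\Omega)}$ the $L^\infty$ norm of $D^2u$. Kernel: $\varphi\ge0$ is a fixed smooth radially symmetric function on $\mathbb{R}^d$ with compact support in the unit ball and $\int_{\mathbb{R}^d}|y|^2\varphi(y)\,dy=d$. Meshes: $\{\mathcal{T}_h\}$ is a family of conforming, quasi-uniform (meshsize $h$), uniformly shape regular (constant $\sigma$, bounding the ratio of element diameter to inscribed ball diameter) partitions into simplices of polytopes $\Omega_h$ whose boundary nodes lie on $\partial\Omega$. Simplifying convention of the paper: the discrepancy between $\Omega_h$ and $\Omega$ is ignored, i.e. $\Omega_h=\Omega$ is assumed; under it the Galerkin projection $u_G\in\mathbb{V}_h^0$, defined by $\int_\Omega\nabla u_G\cdot\nabla v_h=\int_\Omega\nabla u\cdot\nabla v_h$ for all $v_h\in\mathbb{V}_h^0$, is known to satisfy $\|u-u_G\|_{L^\infty(\Omega)}\le Ch^2|\ln h|\,|u|_{W^2_\infty(\Omega)}$. $\mathcal{N}_h$: interior nodes; $\mathbb{V}_h$: continuous functions affine on each $K\in\mathcal{T}_h$;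 $\mathbb{V}_h^0$: those vanishing on $\partial\Omega$; $\phi_i$: hat function of node $x_i$; $\omega_i=\operatorname{supp}\phi_i$. The regime is $h\to0$: $h$ (hence $\epsilon$) is sufficiently small. The data $\Lambda$, $\varphi$ and the quasi-uniformity constant are fixed. Face weak acuteness: for every interior face $F$ of $\mathcal{T}_h$, with $\omega_F$ the union of the two elements containing $F$, $\int_{\omega_F}\nabla\phi_i\cdot\nabla\phi_j\le0$ for all nodes $x_i\ne x_j$ (boundary nodes included). Second differences: for $x$ with $\operatorname{dist}(x,\partial\Omega)>Q\epsilon$ put $\theta(x)=1$; for $x\in\Omega$ with $\operatorname{dist}(x,\partial\Omega)\le Q\epsilon$ let $\theta(x)\in(0,1]$ be the largest number such that $x\pm\theta y\in\Omega$ for all $y\in B_{Q\epsilon}(0)$. Set $\delta v(x,y):=\theta^{-2}[v(x+\theta y)+v(x-\theta y)-2v(x)]$, $\theta=\theta(x)$. Discrete problem: $\bar A(x_i)=|\omega_i|^{-1}\int_{\omega_i}A$ is the mean of $A$ over the star; $M(x_i)=(\bar A(x_i)-\frac\lambda2I)^{1/2}$; $I_\epsilon v(x_i)=\int_{\mathbb{R}^d}\frac{\delta v(x_i,y)}{\epsilon^{d+2}\det M(x_i)}\varphi\big(\frac{M(x_i)^{-1}y}{\epsilon}\big)dy$; $\Delta_hv_h(x_i)=-(\int_\Omega\phi_i)^{-1}\int_\Omega\nabla v_h\cdot\nabla\phi_i$; $L_h^\epsilon v_h(x_i)=\frac\lambda2\Delta_hv_h(x_i)+I_\epsilon v_h(x_i)$.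 The finite element solution $u_h^\epsilon\in\mathbb{V}_h^0$ satisfies $L_h^\epsilon u_h^\epsilon(x_i)=f_i:=\int_\Omega f\phi_i/\int_\Omega\phi_i$ for all $x_i\in\mathcal{N}_h$. The discrete Alexandroff-Bakelman-Pucci estimate referred to: if $v_h\in\mathbb{V}_h$, $v_h\ge0$ on $\partial\Omega$ and $L_h^\epsilon v_h(x_i)\le g_i$ for all $x_i\in\mathcal{N}_h$, then $\sup_\Omega v_h^-\le C(\sigma,d,\lambda,\Omega)\big(\sum_{x_i\in\mathcal{N}_h}|g_i^+|^d|\omega_i|\big)^{1/d}$.
   Formalization: The assumptions of a C^{1,1} boundary and of Ω_h = Ω with Ω_h a polytope cannot hold together; the convention Ω_h = Ω is kept literally, so Ω is a bounded domain exactly triangulated by the mesh, and the C^{1,1} assumption is dropped. *)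

(* Defs.v *)
From HB Require Import structures.
From mathcomp Require Import all_boot all_order all_algebra.
From mathcomp Require Import all_classical all_reals all_analysis.

Set Implicit Arguments.
Unset Strict Implicit.
Unset Printing Implicit Defensive.

Import Order.TTheory GRing.Theory Num.Theory.
Import numFieldNormedType.Exports.

Local Open Scope classical_set_scope.
Local Open Scope ring_scope.

(** * Lebesgue measure on [R^n]

    The one-dimensional [lebesgue_measure] is iterated with the product measure
    on [n]-tuples, carried over to row vectors, and completed, so that
    measurable sets are the Lebesgue (not only the Borel) measurable ones. *)

Section cons_measure.
Context (R : realType) d (T : measurableType d) (n : nat).
Variable m1 : {sigma_finite_measure set T -> \bar R}.
Variable m2 : {sigma_finite_measure set (n.-tuple T) -> \bar R}.

Definition tcons (p : T * n.-tuple T) : n.+1.-tuple T := [tuple of p.1 :: p.2].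

Lemma measurable_tcons : measurable_fun [set: T * n.-tuple T] tcons.
Proof.
exact: measurable_cons.
Qed.

Definition cons_measure : set (n.+1.-tuple T) -> \bar R :=
  pushforward (m1 \x m2)%E tcons.

Let measurable_preimage_tcons A : measurable A -> measurable (tcons @^-1` A).
Proof.
by move=> mA; rewrite -[X in measurable X]setTI; exact: measurable_tcons.
Qed.

Let cons_measure0 : cons_measure set0 = 0%E.
Proof. by rewrite /cons_measure /pushforward preimage_set0 measure0. Qed.

Let cons_measure_ge0 A : (0 <= cons_measure A)%E.
Proof. by rewrite /cons_measure /pushforward; exact: measure_ge0. Qed.

Let cons_measure_sigma_additive : semi_sigma_additive cons_measure.
Proof.
move=> F mF tF mUF; rewrite /cons_measure /pushforward preimage_bigcup.
apply: measure_semi_sigma_additive.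
- by move=> k; exact: measurable_preimage_tcons.
- apply/trivIsetP => /= i j _ _ ij; rewrite -preimage_setI.
  by move/trivIsetP : tF => /(_ _ _ _ _ ij) ->//; rewrite preimage_set0.
- by rewrite -preimage_bigcup; exact: measurable_preimage_tcons.
Qed.

HB.instance Definition _ := isMeasure.Build _ _ _ cons_measure
  cons_measure0 cons_measure_ge0 cons_measure_sigma_additive.

Let cons_measure_sigma_finite : sigma_finite setT cons_measure.
Proof.
have /sigma_finiteP[F [TF ndF Foo]] := sigma_finiteT m1.
have /sigma_finiteP[G [TG ndG Goo]] := sigma_finiteT m2.
pose uncons (t : n.+1.-tuple T) := (thead t, [tuple of behead t]).
have muncons : measurable_fun [set: n.+1.-tuple T] uncons.
  apply: measurable_fun_pair; first exact: measurable_tnth.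
  exact: measurable_behead.
have tconsK : uncons \o tcons = id.
  by apply/funext => -[x t]; rewrite /uncons/= theadE; congr pair; exact/val_inj.
exists (fun i => uncons @^-1` (F i `*` G i)).
  apply/esym/seteqP; split => // t _.
  have [[i _ Fi] [j _ Gj]] : (\bigcup_i F i) (thead t) /\
      (\bigcup_i G i) [tuple of behead t] by rewrite -TF -TG.
  exists (maxn i j) => //; split => /=.
    by move: Fi; apply/subsetPset/ndF/leq_maxl.
  by move: Gj; apply/subsetPset/ndG/leq_maxr.
move=> i; have [mFi Fioo] := Foo i; have [mGi Gioo] := Goo i; split.
  by rewrite -[X in measurable X]setTI; apply: muncons => //; exact: measurableX.
rewrite /cons_measure /pushforward -comp_preimage tconsK preimage_id.
by rewrite product_measure1E// lte_mul_pinfty// ge0_fin_numE.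
Qed.

HB.instance Definition _ := Measure_isSigmaFinite.Build _ _ _ cons_measure
  cons_measure_sigma_finite.

End cons_measure.

Section lebesgue_row.
Context (R : realType).
Local Notation mR := (measurableTypeR R).

Fixpoint lebesgue_tuple (n : nat) :
    {sigma_finite_measure set (n.-tuple mR) -> \bar R} :=
  match n with
  | 0 => \d_([tuple] : 0.-tuple mR)
  | k.+1 => cons_measure lebesgue_measure (lebesgue_tuple k)
  end.

Variable n : nat.

Definition row_of_tuple (t : n.-tuple mR) : 'rV[R]_n := \row_i tnth t i.

Definition lebesgue_outer (A : set 'rV[R]_n) : \bar R :=
  (lebesgue_tuple n)^*%mu (row_of_tuple @^-1` A).

Let lebesgue_outer0 : lebesgue_outer set0 = 0%E.
Proof. by rewrite /lebesgue_outer preimage_set0 outer_measure0. Qed.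

Let lebesgue_outer_ge0 A : (0 <= lebesgue_outer A)%E.
Proof. exact: outer_measure_ge0. Qed.

Let le_lebesgue_outer :
  {homo lebesgue_outer : A B / A `<=` B >-> (A <= B)%E}.
Proof.
by move=> A B AB; apply: le_outer_measure; exact: preimage_subset.
Qed.

Let lebesgue_outer_sigma_subadditive : sigma_subadditive lebesgue_outer.
Proof.
move=> F; rewrite /lebesgue_outer preimage_bigcup.
exact: outer_measure_sigma_subadditive.
Qed.

HB.instance Definition _ := isOuterMeasure.Build R 'rV[R]_n lebesgue_outer
  lebesgue_outer0 lebesgue_outer_ge0 le_lebesgue_outer
  lebesgue_outer_sigma_subadditive.

Definition Rn := caratheodory_type lebesgue_outer.

HB.instance Definition _ := Measurable.on Rn.

Definition lebesgue : set Rn -> \bar R := lebesgue_outer.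

HB.instance Definition _ := isMeasure.Build _ Rn R lebesgue
  (@caratheodory_measure0 _ _ lebesgue_outer)
  (@caratheodory_measure_ge0 _ _ lebesgue_outer)
  (@caratheodory_measure_sigma_additive _ _ lebesgue_outer).

End lebesgue_row.

Section analysis.
Context (R : realType) (d : nat).
Implicit Types (D Omega : set 'rV[R]_d) (v : 'rV[R]_d -> R) (x y z : 'rV[R]_d).

Definition integ D v : R := \int[@lebesgue R d]_(x in D) v x.

Definition vol D : R := fine (@lebesgue R d D).

Definition Linf_norm D v : \bar R := ('N[@lebesgue R d]_+oo[EFin \o (v \_ D)])%E.

(** The library norm of a matrix is the maximum of its entries; [enorm] is the
    Euclidean norm of vectors and the Frobenius norm of matrices. *)
Definition enorm m n (B : 'M[R]_(m, n)) : R :=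
  Num.sqrt (\sum_i \sum_j B i j ^+ 2).

Definition dot x y : R := \sum_i x 0 i * y 0 i.

Definition quad (B : 'M[R]_d) x : R := (x *m B *m x^T) 0 0.

Definition boundary D : set 'rV[R]_d := closure D `\` interior D.

Definition dist x D : R := inf [set enorm (x - z) | z in D].

Definition dpart (s : seq 'I_d) v : 'rV[R]_d -> R :=
  foldr (fun k w => 'D_(delta_mx 0 k) w) v s.

Definition grad v x : 'rV[R]_d := \row_k dpart [:: k] v x.

Definition hess v x : 'M[R]_d := \matrix_(k, l) dpart [:: k; l] v x.

Definition Ck_on Omega (k : nat) v : Prop :=
  forall s : seq 'I_d, (size s <= k)%N -> forall x, Omega x ->
    {for x, continuous (dpart s v)} /\
    ((size s < k)%N -> forall j, derivable (dpart s v) x (delta_mx 0 j)).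

Definition holder_seminorm3 Omega (alpha : R) v : \bar R :=
  ereal_sup [set (Num.sqrt (\sum_i \sum_j \sum_k
      (dpart [:: i; j; k] v p.1 - dpart [:: i; j; k] v p.2) ^+ 2)
      / enorm (p.1 - p.2) `^ alpha)%:E |
    p in [set p : 'rV[R]_d * 'rV[R]_d |
      [/\ Omega p.1, Omega p.2 & p.1 != p.2]]].

(** [C^{3,alpha}] up to the boundary: the derivatives of order at most three
    extend continuously to the closure. *)
Definition C3alpha Omega (alpha : R) v : Prop :=
  [/\ Ck_on Omega 3 v,
      {within closure Omega, continuous v},
      (forall s : seq 'I_d, (0 < size s <= 3)%N ->
        exists g : 'rV[R]_d -> R, {within closure Omega, continuous g} /\
          (forall x, Omega x -> g x = dpart s v x)) &
      (holder_seminorm3 Omega alpha v < +oo)%E].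

Definition W2inf_seminorm Omega v : \bar R :=
  Linf_norm Omega (fun x => enorm (hess v x)).

Definition kernel_function (phi : 'rV[R]_d -> R) : Prop :=
  [/\ (forall x, 0 <= phi x),
      (forall k, Ck_on setT k phi),
      (forall x y, enorm x = enorm y -> phi x = phi y),
      closure [set x | phi x != 0] `<=` [set x | enorm x <= 1] &
      integ setT (fun y => enorm y ^+ 2 * phi y) = d%:R].

Definition is_sqrtmx (M B : 'M[R]_d) : Prop :=
  [/\ M^T = M, (forall x, 0 <= quad M x) & M *m M = B].

Definition coefficient_field Omega (lambda Lambda : R)
    (A : 'rV[R]_d -> 'M[R]_d) : Prop :=
  [/\ (forall k l, measurable_fun (Omega : set (Rn R d))
        ((fun x => A x k l) : Rn R d -> R)),
      (forall x, Omega x -> (A x)^T = A x) &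
      {ae (@lebesgue R d), forall x, Omega x -> forall xi : 'rV[R]_d,
        lambda * enorm xi ^+ 2 <= quad (A x) xi <= Lambda * enorm xi ^+ 2}].

Definition in_Ld Omega v : Prop :=
  measurable_fun (Omega : set (Rn R d)) (v : Rn R d -> R) /\
  ('N[@lebesgue R d]_(d%:R%:E)[EFin \o (v \_ Omega)] < +oo)%E.

(** [r] stands for [Q * eps]. The ball [B_r(0)] is open: otherwise the largest
    [theta] would not exist. *)
Definition theta Omega (r : R) x : R :=
  if r < dist x (boundary Omega) then 1
  else sup [set t | 0 < t <= 1 /\ forall y, enorm y < r ->
                    Omega (x + t *: y) /\ Omega (x - t *: y)].

Definition second_difference Omega (r : R) v x y : R :=
  let t := theta Omega r x in
  t ^- 2 * (v (x + t *: y) + v (x - t *: y) - 2 * v x).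

(** [M] is symmetric, so that [y *m invmx M] is the transpose of [M^-1 y]. *)
Definition Ieps Omega (phi : 'rV[R]_d -> R) (r eps : R) (M : 'M[R]_d) v x : R :=
  integ setT (fun y => second_difference Omega r v x y
    / (eps ^+ (d + 2) * \det M) * phi (eps^-1 *: (y *m invmx M))).

End analysis.

Section meshes.
Context (R : realType) (d : nat).

(** An element is given by the set of (indices of) its vertices. *)
Record mesh := Mesh {
  nnodes : nat;
  node : 'I_nnodes -> 'rV[R]_d;
  elements : {set {set 'I_nnodes}} }.

Variable T : mesh.
Local Notation I := 'I_(nnodes T).

Definition hull (K : {set I}) : set 'rV[R]_d :=
  [set x | exists w : I -> R,
    [/\ (forall i, 0 <= w i), (forall i, i \notin K -> w i = 0),
        \sum_i w i = 1 & x = \sum_i w i *: node i]].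

Definition affinely_independent (K : {set I}) : Prop :=
  forall c : I -> R, (forall i, i \notin K -> c i = 0) ->
    \sum_i c i = 0 -> \sum_i c i *: node i = 0 -> forall i, c i = 0.

Definition conforming : Prop :=
  [/\ injective (@node T),
      (forall i, exists2 K, K \in elements T & i \in K),
      (forall K, K \in elements T -> #|K| = d.+1 /\ affinely_independent K) &
      (forall K L, K \in elements T -> L \in elements T ->
        hull K `&` hull L = hull (K :&: L)%SET)].

(** The polytope [Omega_h]. Identifying it with [Omega] forces [Omega] to be
    a polytope, so that no smoothness of the boundary of [Omega] can be
    required at the same time. *)
Definition polytope : set 'rV[R]_d :=
  interior (\bigcup_(K in [set K | K \in elements T]) hull K).

Definition diam (K : {set I}) : R :=
  sup [set enorm (p.1 - p.2) | p in hull K `*` hull K].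

Definition inradius (K : {set I}) : R :=
  sup [set r | 0 <= r /\
    exists c, forall x, enorm (x - c) <= r -> hull K x].

Definition meshsize : R := \big[Num.max/0]_(K in elements T) diam K.

Definition shape_regular (sigma : R) : Prop :=
  forall K, K \in elements T -> diam K <= sigma * (2 * inradius K).

Definition quasi_uniform (kappa : R) : Prop :=
  forall K, K \in elements T -> kappa * meshsize <= diam K.

Section fe_space.
Variable Omega : set 'rV[R]_d.

Definition fe_space (v : 'rV[R]_d -> R) : Prop :=
  {within closure Omega, continuous v} /\
  forall K, K \in elements T -> exists (a : 'rV[R]_d) (b : R),
    forall x, hull K x -> v x = dot a x + b.

Definition fe_space0 (v : 'rV[R]_d -> R) : Prop :=
  fe_space v /\ forall x, boundary Omega x -> v x = 0.

(** Hat functions are extended by zero outside the closure of [Omega]. *)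
Definition hat (i : I) : 'rV[R]_d -> R :=
  xget (fun=> 0) [set v | [/\ fe_space v,
    (forall j, v (node j) = (j == i)%:R) &
    (forall x, ~ closure Omega x -> v x = 0)]].

Definition star (i : I) : set 'rV[R]_d := closure [set x | hat i x != 0].

Definition face_weakly_acute : Prop :=
  forall K L, K \in elements T -> L \in elements T -> K != L ->
    #|(K :&: L)%SET| = d -> forall i j : I, i != j ->
    integ (hull K `|` hull L)
      (fun x => dot (grad (hat i) x) (grad (hat j) x)) <= 0.

Definition galerkin_projection (u uG : 'rV[R]_d -> R) : Prop :=
  fe_space0 uG /\ forall v, fe_space0 v ->
    integ Omega (fun x => dot (grad uG x) (grad v x)) =
    integ Omega (fun x => dot (grad u x) (grad v x)).

(** [A] is only given on [Omega], which fills the star up to a null set. *)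
Definition mean_coefficient (A : 'rV[R]_d -> 'M[R]_d) (i : I) : 'M[R]_d :=
  \matrix_(k, l) ((vol (star i))^-1 *
    integ (star i `&` Omega) (fun x => A x k l)).

Definition coefficient_oscillation (A : 'rV[R]_d -> 'M[R]_d) : R :=
  (\sum_(i | node i \in Omega)
     integ (star i `&` Omega)
       (fun x => enorm (A x - mean_coefficient A i) ^+ d)) `^ (d%:R^-1).

Definition discrete_laplacian (v : 'rV[R]_d -> R) (i : I) : R :=
  - (integ Omega (hat i))^-1 *
    integ Omega (fun x => dot (grad v x) (grad (hat i) x)).

Definition discrete_operator (lambda Lambda eps : R) (phi : 'rV[R]_d -> R)
    (M : I -> 'M[R]_d) (v : 'rV[R]_d -> R) (i : I) : R :=
  lambda / 2 * discrete_laplacian v i +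
  Ieps Omega phi (Num.sqrt (Lambda - lambda / 2) * eps) eps (M i) v (node i).

Definition discrete_rhs (f : 'rV[R]_d -> R) (i : I) : R :=
  integ Omega (fun x => f x * hat i x) / integ Omega (hat i).

Definition discrete_solution (lambda Lambda eps : R) (phi : 'rV[R]_d -> R)
    (M : I -> 'M[R]_d) (f uh : 'rV[R]_d -> R) : Prop :=
  fe_space0 uh /\ forall i, Omega (node i) ->
    discrete_operator lambda Lambda eps phi M uh i = discrete_rhs f i.

End fe_space.
End meshes.

(* Main.v *)
(** Write e for the nodal difference of u_h and the Galerkin projection u_G. Integrating by
    parts, the discrete operator applied to e at an interior node splits into the oscillation
    of A over the star, weighted by the hat function, the variation of D^2 u over the star,
    the Taylor error of I_eps u, and I_eps (u - u_G), which is at most C E / (theta eps)^2 with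
    E the maximum norm error of u_G. Choosing eps = C2 h^(2 / (3 + alpha)) balances the last
    two terms where theta = 1. At nodes within Q eps of the boundary theta eps is only bounded
    below by a multiple of h, and E / h^2 is of order |ln h|; this is absorbed by a barrier with
    values in [0, 1] whose image under the operator is at most - c / (Q eps)^2 there.
    The oscillation enters through its l^d norm, which the discrete Alexandroff estimate
    turns into a maximum norm: the slopes of the planes touching e from below at one node
    fill a set of diameter at most C h times the discrete Laplacian, since every direction
    points into some element of the star and acuteness makes all off-diagonal stiffness
    entries nonnegative, while all these sets together cover a ball of radius comparable to
    the depth of the negative part. As Omega is the polytope of a mesh it has exterior balls
    of proportional radius at all boundary points and small scales; the barrier is a minimum
    of functions 1 - (c0 r / |x - z|)^(2 q) centred at such balls. *)

Require Import Defs.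
From HB Require Import structures.
From mathcomp Require Import all_boot all_order all_algebra.
From mathcomp Require Import all_classical all_reals all_analysis.
From mathcomp Require Import measurable_realfun ess_sup_inf ring lra.

Set Implicit Arguments.
Unset Strict Implicit.
Unset Printing Implicit Defensive.

Import Order.TTheory GRing.Theory Num.Theory.
Import numFieldNormedType.Exports.

Local Open Scope classical_set_scope.
Local Open Scope ring_scope.

(** * Affine images of Lebesgue measurable sets *)

Section scaling.
Context (R : realType).
Local Notation mR := (measurableTypeR R).
Local Notation mu := (@lebesgue_tuple R).

(** The comparison function is the Galerkin projection because its discrete Laplacian at a node is
    exactly the mean of the Laplacian of u weighted by the hat function. The price is I_eps (u -
    u_G), of order |ln h| near the boundary. An l^d norm cannot absorb this load: a strip of width
    of order eps would only gain a factor eps^(1/d). The barrier, multiplied by load times (Q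
    eps)^2, turns it into eps^2 |ln h|, and eps^2 is small enough since alpha <= 1. Third
    derivatives enter the consistency error through their maximum, which has to be bounded by the
    Hölder seminorm and the Hessian. Constants must depend on Omega and not on the mesh: exterior
    balls, diameter and volume are read off from one fixed mesh of Omega. Affine changes of
    variables are established for the completed measure first; integration by parts, the moments of
    the kernel and the null hyperplanes rest on them. *)

Definition tuple_of_row n (x : 'rV[R]_n) : n.-tuple mR := [tuple x 0 j | j < n].

Lemma tuple_of_rowK n : cancel (@tuple_of_row n) (@row_of_tuple R n).
Proof. by move=> x; apply/rowP => j; rewrite mxE tnth_mktuple. Qed.

Lemma row_of_tupleK n : cancel (@row_of_tuple R n) (@tuple_of_row n).
Proof. by move=> t; apply: eq_from_tnth => j; rewrite tnth_mktuple mxE. Qed.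

Definition tuple_affine n (M : 'M[R]_n) (w : 'rV[R]_n) (t : n.-tuple mR) :
  n.-tuple mR := tuple_of_row (row_of_tuple t *m M + w).

Lemma measurable_tuple_affine n (M : 'M[R]_n) w :
  measurable_fun setT (tuple_affine M w).
Proof.
apply/measurable_fun_tnthP => j.
have -> : (@tnth n mR ^~ j) \o tuple_affine M w =
    (fun t : n.-tuple mR => \sum_k (tnth t k * M k j) + w 0 j).
  apply/funext => t /=; rewrite tnth_mktuple !mxE; congr (_ + _).
  by apply: eq_bigr => k _; rewrite mxE.
apply: measurable_funD; last exact: measurable_cst.
apply: measurable_sum => k.
by apply: measurable_funM; [exact: measurable_tnth|exact: measurable_cst].
Qed.

Lemma measurable_preimage_affine n (M : 'M[R]_n) w A :
  measurable A -> measurable (tuple_affine M w @^-1` A).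
Proof.
by move=> mA; rewrite -[X in measurable X]setTI; exact: measurable_tuple_affine.
Qed.

Definition scales n (M : 'M[R]_n) (w : 'rV[R]_n) := forall A, measurable A ->
  mu n (tuple_affine M w @^-1` A) = (`|\det M|^-1%:E * mu n A)%E.

Lemma scalesM n (M N : 'M[R]_n) v w :
  scales M v -> scales N w -> scales (M *m N) (v *m N + w).
Proof.
move=> sM sN A mA.
have -> : tuple_affine (M *m N) (v *m N + w) = tuple_affine N w \o tuple_affine M v.
  apply/funext => t /=; rewrite /tuple_affine tuple_of_rowK.
  by rewrite mulmxDl mulmxA addrA.
rewrite comp_preimage sM; last exact: measurable_preimage_affine.
by rewrite sN// muleA -EFinM det_mulmx normrM invfM.
Qed.

(** Consing becomes a block row, so that block matrix algebra can follow the recursion by which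
    [lebesgue_tuple] is built. *)
Lemma row_of_tcons n (p : mR * n.-tuple mR) :
  row_of_tuple (tcons p) = row_mx p.1%:M (row_of_tuple p.2) :> 'rV[R]_(1 + n).
Proof.
apply/rowP => j; rewrite mxE; case: (split_ordP j) => k ->.
  by rewrite (ord1 k) row_mxEl mxE/= [lshift _ _](_ : _ = ord0)//; exact/val_inj.
rewrite row_mxEr mxE (_ : rshift 1 k = lift ord0 k); last exact/val_inj.
by rewrite tnthS.
Qed.

Section scales_real.
Variables a b : R.

Definition real_affine (x : mR) : mR := a * x + b.

Lemma measurable_real_affine : measurable_fun setT real_affine.
Proof.
apply: measurable_funD; last exact: measurable_cst.
by apply: measurable_funM; [exact: measurable_cst|exact: measurable_id].
Qed.

Lemma scales_real (A : set mR) : a != 0 -> measurable A ->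
  lebesgue_measure ((fun x => a * x + b) @^-1` A) =
  (`|a|^-1%:E * lebesgue_measure A)%E.
Proof.
move=> a0 mA; have na : 0 <= `|a| by [].
pose nu m : {measure set mR -> \bar R} :=
  mscale (NngNum na) (measure_function_pushforward__canonical__measure_function_Measure
    lebesgue_measure m).
have := @lebesgue_measure_unique R (nu _ measurable_real_affine).
move=> /(_ _ A mA) ->; last first.
  move=> _ [[u v]] _ <-.
  rewrite -[RHS]/(`|a|%:E * lebesgue_measure ((fun x : mR => (a * x + b)%R) @^-1` `]u, v]%classic))%E.
  (* A negative slope moves the closed end of the interval to the left, but both kinds of half-open
     interval have the same length. *)
  have [a1|a1] : a < 0 \/ 0 < a by case: ltgtP a0 => //; [left|right].
    rewrite [X in (_ * lebesgue_measure X)%E](_ : _ =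
        `[(v - b) / a, (u - b) / a[%classic); last first.
      apply/seteqP; split=> x /=; rewrite !in_itv/=.
        by move=> /andP[ux xv]; rewrite ler_ndivrMr// ltr_ndivlMr//; lra.
      by rewrite ler_ndivrMr// ltr_ndivlMr//; lra.
    rewrite !lebesgue_measure_itv/= !lte_fin ltr_nM2r ?invr_lt0// ltrD2r.
    case: ltP => // _; last by rewrite mule0.
    by rewrite -!EFinB -EFinM ltr0_norm//; congr EFin; field; rewrite lt_eqF.
  rewrite [X in (_ * lebesgue_measure X)%E](_ : _ =
      `](u - b) / a, (v - b) / a]%classic); last first.
    apply/seteqP; split=> x /=; rewrite !in_itv/=.
      by move=> /andP[ux xv]; rewrite ler_pdivlMr// ltr_pdivrMr//; lra.
    by rewrite ler_pdivlMr// ltr_pdivrMr//; lra.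
  rewrite !lebesgue_measure_itv/= !lte_fin ltr_pM2r ?invr_gt0// ltrD2r.
  case: ltP => // _; last by rewrite mule0.
  by rewrite -!EFinB -EFinM gtr0_norm//; congr EFin; field; rewrite gt_eqF.
rewrite -[nu _ _ A]/(`|a|%:E * lebesgue_measure ((fun x : mR => (a * x + b)%R) @^-1` A))%E.
rewrite muleA -EFinM mulVf ?mul1e//.
by rewrite normr_eq0.
Qed.

End scales_real.

Lemma measurable_preimage_tcons n (A : set (n.+1.-tuple mR)) :
  measurable A -> measurable (@tcons _ mR n @^-1` A).
Proof.
by move=> mA; rewrite -[X in measurable X]setTI; exact: measurable_tcons.
Qed.

(** The first coordinate is kept and each slice undergoes [S] and a translation that depends on the
    slice, so slicing along the first coordinate suffices. This is why [S] is assumed to scale with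
    every translation. *)
Lemma scales_ublock n (S : 'M[R]_n) (u : 'rV[R]_n) (w : 'rV[R]_n) :
  (forall w', scales S w') ->
  @scales (1 + n) (block_mx 1%:M u 0 S) (row_mx 0 w).
Proof.
move=> sS A mA.
rewrite det_ublock det1 mul1r /= /cons_measure /pushforward /product_measure1.
rewrite -ge0_integralZl//; last first.
  by apply: measurable_fun_xsection; exact: measurable_preimage_tcons.
apply: eq_integral => x _ /=.
rewrite -(sS (x *: u + w)); last first.
  by apply: measurable_xsection; exact: measurable_preimage_tcons.
congr (lebesgue_tuple R n _); apply/seteqP.
have E y : tuple_affine (block_mx 1%:M u 0 S : 'M[R]_(1 + n)) (row_mx 0 w) (tcons (x, y)) =
    tcons (x, tuple_affine S (x *: u + w) y).
  apply: (can_inj (@row_of_tupleK n.+1)); rewrite [RHS]row_of_tcons/= tuple_of_rowK.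
  rewrite (row_of_tcons (x, y)) mul_row_block add_row_mx tuple_of_rowK/=.
  rewrite mulmx0 !addr0 mulmx1 mul_scalar_mx.
  by rewrite (addrC (x *: u)) addrA.
by split => y; rewrite /xsection/= !inE /preimage/= E.
Qed.

(** Here the last coordinates are kept and the first one undergoes a real affine map, so the slices
    run the other way; uniqueness of the product measure exchanges the order of slicing. *)
Lemma scales_lblock n (a : R) (l : 'cV[R]_n) (b : R) : a != 0 ->
  @scales (1 + n) (block_mx a%:M 0 l 1%:M) (row_mx b%:M 0).
Proof.
move=> a0 A mA.
rewrite det_lblock det1 mulr1 det_scalar1 /= /cons_measure /pushforward.
have mA' := measurable_preimage_tcons mA.
pose B := tuple_affine (block_mx a%:M 0 l 1%:M : 'M[R]_(1 + n)) (row_mx b%:M 0) @^-1` A.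
have mB : measurable B by exact: (measurable_preimage_affine (n := 1 + n)).
have mB' := measurable_preimage_tcons mB.
have P C : measurable C -> (lebesgue_measure \x mu n)%E C =
    (lebesgue_measure \x^ mu n)%E C.
  apply: product_measure_unique => X Y mX mY.
  exact: product_measure2E.
rewrite !P// /product_measure2 -ge0_integralZl//; last first.
  exact: measurable_fun_ysection.
apply: eq_integral => y _ /=.
rewrite -(@scales_real a ((row_of_tuple y *m l) 0 0 + b))//; last first.
  exact: measurable_ysection.
congr (lebesgue_measure _); apply/seteqP.
have E x : tuple_affine (block_mx a%:M 0 l 1%:M : 'M[R]_(1 + n)) (row_mx b%:M 0) (tcons (x, y)) =
    tcons (a * x + ((row_of_tuple y *m l) 0 0 + b), y).
  apply: (can_inj (@row_of_tupleK n.+1)); rewrite [RHS]row_of_tcons/= tuple_of_rowK.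
  rewrite (row_of_tcons (x, y)) mul_row_block add_row_mx/=.
  rewrite mulmx0 add0r addr0 mulmx1.
  suff -> : x%:M *m a%:M + row_of_tuple y *m l + b%:M =
    (a * x + ((row_of_tuple y *m l) 0 0 + b))%:M :> 'rV_1 by [].
  apply/rowP => k; rewrite (ord1 k) !mxE big_ord1 !mxE eqxx !mulr1n.
  by rewrite mulrC addrA.
by split => x; rewrite /ysection/= !inE /preimage/= E.
Qed.

(** Induction on the dimension by one step of Gaussian elimination: a nonzero pivot splits [M] into
    the two block triangular shapes above, with the Schur complement as the smaller matrix. A zero
    pivot is repaired by adding to the first row a row whose first entry is nonzero. *)
Lemma scales_unitmx n (M : 'M[R]_n) w : M \in unitmx -> scales M w.
Proof.
elim: n M w => [|n IH] M w uM.
  move=> A mA; rewrite det_mx00 normr1 invr1 mul1e; congr (mu 0 _).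
  by apply/seteqP; split => t; rewrite /preimage/= [tuple_affine _ _ _]tuple0 [t]tuple0.
have H1 (N : 'M[R]_(1 + n)) (v : 'rV[R]_(1 + n)) : N \in unitmx -> N 0 0 != 0 ->
    @scales (1 + n) N v.
  move=> uN a0; set a := N 0 0 in a0.
  pose r := ursubmx N; pose c := dlsubmx N; pose D := drsubmx N.
  pose S := D - a^-1 *: (c *m r).
  have NE : N = block_mx a%:M 0 c 1%:M *m block_mx 1%:M (a^-1 *: r) 0 S.
    rewrite mulmx_block !mulmx1 !mulmx0 !mul0mx !mul1mx !addr0.
    rewrite mul_scalar_mx scalerA mulfV// scale1r -scalemxAr /S addrCA subrr addr0.
    rewrite -[LHS]submxK; congr block_mx.
    apply/matrixP => i j; rewrite !ord1 !mxE eqxx mulr1n /a; congr (N _ _);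
    exact/val_inj.
  have uS : S \in unitmx.
    move: uN; rewrite NE unitmx_mul => /andP[_].
    by rewrite !unitmxE det_ublock det1 mul1r.
  pose w0 := v 0 0; pose v' : 'rV[R]_n := rsubmx v - w0 *: (a^-1 *: r).
  have vE : v = row_mx w0%:M 0 *m block_mx 1%:M (a^-1 *: r) 0 S + row_mx 0 v'.
    rewrite mul_row_block !mul0mx !addr0 mulmx1 mul_scalar_mx add_row_mx addr0.
    rewrite /v' addrC subrK -[LHS]hsubmxK; congr row_mx.
    by apply/rowP => j; rewrite !ord1 !mxE eqxx mulr1n; congr (v _ _); apply/val_inj.
  rewrite vE NE; apply: scalesM; first exact: scales_lblock.
  by apply: scales_ublock => w'; exact: IH.
rewrite -[n.+1]/(1 + n)%N in M w uM *.
have [M00|] := eqVneq (M 0 0) 0; last exact: H1.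
have [i Mi] : exists i : 'I_n, M (rshift 1 i) 0 != 0.
  apply/existsP; apply: contraTT uM; rewrite negb_exists => /forallP Mz.
  apply/negP => uM0; have : M *m (delta_mx 0 0 : 'cV_(1 + n)) = 0.
    rewrite -colE; apply/colP => k; rewrite !mxE.
    case: (split_ordP k) => l ->; last by move/(_ l): Mz => /negPn/eqP.
    by rewrite -M00; congr (M _ _); rewrite (ord1 l); apply: val_inj.
  move/(congr1 (mulmx (invmx M))); rewrite mulKmx// mulmx0 => /matrixP/(_ 0 0)/eqP.
  by rewrite !mxE !eqxx oner_eq0.
pose E (s : R) : 'M[R]_(1 + n) := block_mx 1%:M (s *: delta_mx 0 i) 0 1%:M.
have EE : E (-1) *m E 1 = 1%:M.
  rewrite /E mulmx_block !mulmx1 !mulmx0 !mul0mx !mul1mx !addr0 ?add0r.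
  by rewrite -scalerDl subrr scale0r -scalar_mx_block.
have sE (s : R) : @scales (1 + n) (E s) (row_mx 0 0).
  by apply: scales_ublock => w'; apply: IH; exact: unitmx1.
have uE : E 1 \in unitmx by rewrite unitmxE det_ublock !det1 mulr1 unitr1.
have -> : M = E (-1) *m (E 1 *m M) by rewrite mulmxA EE mul1mx.
have -> : w = row_mx 0 0 *m (E 1 *m M) + w by rewrite row_mx0 mul0mx add0r.
apply: scalesM => //; apply: H1; first by rewrite unitmx_mul uE.
rewrite mxE big_split_ord/= big_ord1 (bigD1 i)//= big1 ?addr0 => [|j ji].
  have -> : E 1 0 (lshift n 0) = 1.
    by rewrite (_ : 0 = lshift n 0 :> 'I_(1 + n)) ?block_mxEul ?mxE//; exact: val_inj.
  have -> : E 1 0 (rshift 1 i) = 1.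
    rewrite (_ : 0 = lshift n 0 :> 'I_(1 + n)); last exact: val_inj.
    by rewrite block_mxEur !mxE !eqxx mulr1.
  rewrite (_ : lshift n 0 = 0 :> 'I_(1 + n)); last exact: val_inj.
  by rewrite M00 mulr0 add0r mul1r.
rewrite (_ : E 1 0 _ = 0) ?mul0r//.
rewrite (_ : 0 = lshift n 0 :> 'I_(1 + n)); last exact: val_inj.
by rewrite block_mxEur !mxE eqxx/= (negbTE ji) mulr0.
Qed.

End scaling.

Section lebesgue_affine.
Context (R : realType) (d : nat).
Local Notation mR := (measurableTypeR R).
Local Notation leb := (@lebesgue R d).
Implicit Types (A : set 'rV[R]_d) (M : 'M[R]_d) (w : 'rV[R]_d).

Lemma row_of_tuple_affine M w A :
  @row_of_tuple R d @^-1` ((fun x => x *m M + w) @^-1` A) =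
  tuple_affine M w @^-1` (@row_of_tuple R d @^-1` A).
Proof. by apply/seteqP; split => t /=; rewrite /tuple_affine tuple_of_rowK. Qed.

Let outer_affine_le M w A : M \in unitmx ->
  (lebesgue_outer ((fun x => x *m M + w)%R @^-1` A) <=
   `|\det M|^-1%:E * lebesgue_outer A)%E.
Proof.
move=> uM; have c0 : 0 < `|\det M|.
  by rewrite normr_gt0 -unitfE -unitmxE.
rewrite /lebesgue_outer row_of_tuple_affine.
rewrite muleC lee_pdivlMr// muleC.
apply: le_ereal_inf_tmp => _ [F [mF AF] <-].
have mF' k : measurable (tuple_affine M w @^-1` F k).
  exact: measurable_preimage_affine.
rewrite -lee_pdivlMl//.
rewrite -nneseriesZl//; apply: ereal_inf_lbound.
exists (fun k => tuple_affine M w @^-1` F k).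
  by split => // t /AF[k _ Fk]; exists k.
by apply: eq_eseriesr => k _; rewrite scales_unitmx.
Qed.

Lemma affineK M w : M \in unitmx ->
  cancel (fun x : 'rV[R]_d => x *m M + w)
         (fun x => x *m invmx M + (- w *m invmx M)).
Proof.
by move=> uM x; rewrite mulmxDl mulmxK// mulNmx addrK.
Qed.

(** The upper bound, used for the inverse matrix and the preimage of [A], is the lower bound. *)
Lemma lebesgue_outer_affine M w A : M \in unitmx ->
  lebesgue_outer ((fun x => x *m M + w) @^-1` A) =
   (`|\det M|^-1%:E * lebesgue_outer A)%E.
Proof.
move=> uM; apply/eqP; rewrite eq_le outer_affine_le//=.
have c0 : 0 < `|\det M| by rewrite normr_gt0 -unitfE -unitmxE.
rewrite lee_pdivrMl//.
have uiM : invmx M \in unitmx by rewrite unitmx_inv.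
have := @outer_affine_le (invmx M) (- w *m invmx M)
  ((fun x => x *m M + w) @^-1` A) uiM.
rewrite det_inv normfV invrK; apply: le_trans.
apply: le_outer_measure => x Ax /=.
by have := affineK (- w *m invmx M) uiM x; rewrite !invmxK !mulNmx opprK mulmxKV// => ->.
Qed.

(** The Carathéodory criterion is invariant: a test set [X] is carried by the inverse map to a test
    set [Y] for [A], and all outer measures get the same factor. *)
Lemma measurable_preimage_row_affine M w (A : set (Rn R d)) : M \in unitmx ->
  measurable A -> measurable ((fun x : Rn R d => x *m M + w) @^-1` A : set (Rn R d)).
Proof.
move=> uM mA.
suff : (@lebesgue_outer R d).-caratheodory ((fun x => x *m M + w) @^-1` A) by [].
move=> X.
pose g (x : 'rV[R]_d) := x *m invmx M + (- w *m invmx M).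
have uiM : invmx M \in unitmx by rewrite unitmx_inv.
pose Y := g @^-1` X.
have YE (B : set 'rV[R]_d) : (fun x => x *m M + w) @^-1` (Y `&` B) =
    X `&` (fun x => x *m M + w) @^-1` B.
  by rewrite preimage_setI; congr (_ `&` _); apply/seteqP; split => x; rewrite /Y/preimage/= /g affineK.
have : lebesgue_outer Y = (lebesgue_outer (Y `&` A) + lebesgue_outer (Y `&` ~` A))%E.
  exact: mA.
move=> /(congr1 (fun e => `|\det M|^-1%:E * e)%E).
rewrite ge0_muleDr ?outer_measure_ge0//.
rewrite -!(lebesgue_outer_affine w) // !YE => <-.
by have := YE setT; rewrite preimage_setT !setIT => ->.
Qed.

Lemma measurable_row_affine M w : M \in unitmx ->
  measurable_fun setT ((fun x => x *m M + w) : Rn R d -> Rn R d).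
Proof.
by move=> uM _ A mA; rewrite setTI; exact: measurable_preimage_row_affine.
Qed.

Local Open Scope ereal_scope.

Lemma ge0_integral_affine M w (g : Rn R d -> \bar R) : M \in unitmx ->
  measurable_fun setT g -> (forall x, 0 <= g x) ->
  \int[leb]_x g (x *m M + w)%R = `|\det M|^-1%:E * \int[leb]_x g x.
Proof.
move=> uM mg g0.
have c0 : (0 <= `|\det M|^-1)%R by rewrite invr_ge0.
have mf := measurable_row_affine w uM.
rewrite -(ge0_integral_mscale leb measurableT (NngNum c0))//.
rewrite (_ : \int[leb]_x g (x *m M + w)%R = \int[leb]_(x in
  ((fun x => x *m M + w)%R : Rn R d -> Rn R d) @^-1` setT) (g \o (fun x => x *m M + w)%R) x)//.
rewrite -ge0_integral_pushforward//.
by apply: eq_measure_integral => A mA _; exact: lebesgue_outer_affine.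
Qed.

Local Close Scope ereal_scope.

Definition intble (D : set 'rV[R]_d) (f : 'rV[R]_d -> R) : Prop :=
  leb.-integrable (D : set (Rn R d)) (EFin \o f).

Lemma integ_affine M w (g : 'rV[R]_d -> R) : M \in unitmx -> intble setT g ->
  intble setT (fun x => g (x *m M + w)) /\
  integ setT (fun x => g (x *m M + w)) = `|\det M|^-1 * integ setT g.
Proof.
move=> uM ig.
have [mg goo] := integrableP _ _ _ ig.
pose f (x : Rn R d) : Rn R d := x *m M + w.
have mf : measurable_fun setT f by exact: measurable_row_affine.
have igf : intble setT (g \o f).
  apply/integrableP; split.
    exact: (measurableT_comp mg mf).
  rewrite (ge0_integral_affine w (g := fun x => `|(g x)%:E|)%E)//.
    by rewrite lte_mul_pinfty// lee_fin invr_ge0.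
  by apply: (measurableT_comp (f := abse)).
split => //; rewrite /integ /Rintegral.
have c0 : 0 <= `|\det M|^-1 by rewrite invr_ge0.
rewrite integralE (funepos_comp (EFin \o g) f) (funeneg_comp (EFin \o g) f).
rewrite (ge0_integral_affine w (g := (EFin \o g)^\+%E))//; last exact: measurable_funepos.
rewrite (ge0_integral_affine w (g := (EFin \o g)^\-%E))//; last exact: measurable_funeneg.
rewrite [X in _ = _ * fine X]integralE -muleBr//; last first.
  by rewrite fin_num_adde_defl// fin_numN integrable_neg_fin_num.
rewrite fineM// fin_numB.
by rewrite integrable_pos_fin_num// integrable_neg_fin_num.
Qed.

End lebesgue_affine.

(** * Boxes, open sets and null sets *)

Section open_and_null.
Context (R : realType) (d : nat).
Local Notation mR := (measurableTypeR R).
Local Notation leb := (@lebesgue R d).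

Lemma row_coord_le (x : 'rV[R]_d) j : `|x 0 j| <= `|x|.
Proof.
by rewrite [`|x|]mx_normrE; apply: (le_bigmax _ (fun i => `|x i.1 i.2|) (0, j)).
Qed.

Lemma row_openP (U : set 'rV[R]_d) : open U <->
  forall x, U x -> exists2 e, 0 < e &
    forall y : 'rV[R]_d, (forall j, `|y 0 j - x 0 j| < e) -> U y.
Proof.
split=> [oU x Ux|H].
  have /nbhs_ballP[e /= e0 eU] : nbhs x U by exact: open_nbhs_nbhs.
  exists e => // y xy; apply: eU; split => // i j; rewrite (ord1 i).
  by rewrite /ball/= distrC.
rewrite openE => x /H[e e0 eU]; apply/nbhs_ballP; exists e => //= y [_ xy].
by apply: eU => j; have := xy 0 j; rewrite /ball/= distrC.
Qed.

Lemma lebesgue_box (c r : 'I_d -> R) : (forall j, 0 <= r j) ->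
  leb [set x : 'rV[R]_d | forall j, `|x 0 j - c j| <= r j] = (\prod_j (2 * r j))%:E.
Proof.
move=> r0.
have H n (b s : 'I_n -> R) : (forall j, 0 <= s j) ->
   let B := [set t : n.-tuple mR | forall j, `|tnth t j - b j| <= s j] in
   measurable B /\ lebesgue_tuple R n B = (\prod_j (2 * s j))%:E.
  elim: n b s => [|n IH] b s s0 /=.
    have -> : [set t : 0.-tuple mR | forall j, `|tnth t j - b j| <= s j] = setT.
      by apply/seteqP; split => // t _ [].
    by split; [exact: measurableT|rewrite diracT big_ord0].
  have m1 (k : nat) (b1 s1 : 'I_k -> R) :
      measurable [set t : k.-tuple mR | forall j, `|tnth t j - b1 j| <= s1 j].
    have -> : [set t : k.-tuple mR | forall j, `|tnth t j - b1 j| <= s1 j] =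
        \bigcap_(j in [set: 'I_k]) ((@tnth k mR ^~ j) @^-1` `[b1 j - s1 j, b1 j + s1 j]).
      apply/seteqP; split=> t /= h j.
        by move=> _; rewrite /= in_itv/= -ler_distl h.
      by move: (h j I); rewrite /= in_itv/= -ler_distl.
    apply: fin_bigcap_measurable => //= j _; rewrite -[X in measurable X]setTI.
    exact: measurable_tnth.
  split=> //; rewrite /= /cons_measure /pushforward.
  pose B' := [set t : n.-tuple mR | forall j, `|tnth t j - b (lift ord0 j)| <= s (lift ord0 j)].
  rewrite [X in (_ \x _)%E X](_ : _ = `[b ord0 - s ord0, b ord0 + s ord0]%classic `*` B').
    have [mB' B'E] := IH (fun j => b (lift ord0 j)) (fun j => s (lift ord0 j)) (fun=> s0 _).
    transitivity (lebesgue_measure `[(b ord0 - s ord0)%R, (b ord0 + s ord0)%R]%classic * lebesgue_tuple R n B')%E.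
      exact: product_measure1E.
    rewrite B'E lebesgue_measure_itv/= lte_fin ltrBlDr.
    rewrite big_ord_recl [in RHS]EFinM.
    have := s0 ord0; rewrite le_eqVlt => /predU1P[<-|s1].
      by rewrite !addr0 ltxx mulr0 mul0e.
    rewrite (_ : _ < _)%R; last by lra.
    by congr (_ * _)%E; rewrite -EFinB; congr EFin; ring.
  apply/seteqP; split=> -[x t] /=.
    move=> h; split=> /=; first by rewrite in_itv/= -ler_distl; have := h ord0.
    by move=> j; have := h (lift ord0 j); rewrite tnthS.
  case=> /=; rewrite in_itv/= -ler_distl => hx ht j.
  by case: (unliftP ord0 j) => [k ->|->] //; rewrite tnthS.
have [mB <-] := H d c r r0; rewrite -(measurable_mu_extE _ mB).
have <- : @row_of_tuple R d @^-1` [set x | forall j, `|x 0 j - c j| <= r j] =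
    [set t : d.-tuple mR | forall j, `|tnth t j - c j| <= r j].
  by apply/seteqP; split=> t /= h j; have := h j; rewrite mxE.
by [].
Qed.

(** An open set is the union of the countably many open cubes with rational centre and half side
    1/(n+1) that it contains. Measurability of its tuples then gives the Carathéodory criterion. *)
Lemma open_measurable_row (U : set 'rV[R]_d) : open U -> measurable (U : set (Rn R d)).
Proof.
move=> oU; suff mU : measurable (@row_of_tuple R d @^-1` U).
  suff : (@lebesgue_outer R d).-caratheodory U by [].
  move=> X; rewrite /lebesgue_outer !preimage_setI.
  exact: (sub_caratheodory (lebesgue_tuple R d) (sub_gen_smallest mU)).
pose Q (p : 'rV[rat]_d * nat) := [set t : d.-tuple mR |
  forall j, `|tnth t j - ratr (p.1 0 j)| < p.2.+1%:R^-1].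
have -> : @row_of_tuple R d @^-1` U =
    \bigcup_(p in [set p | Q p `<=` @row_of_tuple R d @^-1` U]) Q p.
  apply/seteqP; split=> [t /= Ut|t [p pU pt]]; last exact: pU.
  have [e e0 eU] := (row_openP U).1 oU _ Ut.
  pose n := Num.trunc (2 / e).
  have ne : 2 / n.+1%:R < e.
    by rewrite ltr_pdivrMr// mulrC -ltr_pdivrMr// truncnS_gt.
  have n0 : 0 < n.+1%:R^-1 :> R by rewrite invr_gt0.
  have q_ j : {q : rat | `|tnth t j - ratr q| < n.+1%:R^-1}.
    have /rat_in_itvoo H : tnth t j - n.+1%:R^-1 < tnth t j + n.+1%:R^-1.
      by rewrite ltrBlDr -addrA ltrDl addr_gt0.
    apply/cid; have [q] := H; rewrite in_itv/= => qq; exists q.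
    by rewrite distrC ltr_distl.
  pose p : 'rV[rat]_d * nat := (\row_j sval (q_ j), n).
  exists p; last by move=> j; rewrite /p/= mxE; exact: (svalP (q_ j)).
  move=> s sp /=; apply: eU => j; rewrite !mxE.
  have h1 := sp j; rewrite /p/= mxE in h1; have h2 := svalP (q_ j).
  rewrite -(subrKA (ratr (sval (q_ j)))); apply: le_lt_trans (ler_normD _ _) _.
  rewrite (distrC (ratr _)); apply: le_lt_trans ne; rewrite -[2]/(1 + 1) mulrDl !mul1r.
  exact: lerD (ltW h1) (ltW h2).
rewrite bigcup_mkcond; apply: countable_bigcupT_measurable => [//|p].
case: ifP => // _; have -> : Q p =
    \bigcap_(j in [set: 'I_d]) ((@tnth d mR ^~ j) @^-1`
       `]ratr (p.1 0 j) - p.2.+1%:R^-1, ratr (p.1 0 j) + p.2.+1%:R^-1[).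
  apply/seteqP; split=> t /= h j.
    by move=> _; rewrite /= in_itv/= -ltr_distl h.
  by move: (h j I); rewrite /= in_itv/= -ltr_distl.
apply: fin_bigcap_measurable => //= j _; rewrite -[X in measurable X]setTI.
exact: measurable_tnth.
Qed.

Lemma closed_measurable_row (F : set 'rV[R]_d) : closed F -> measurable (F : set (Rn R d)).
Proof.
move=> cF; rewrite -[F]setCK; apply: measurableC; apply: open_measurable_row.
exact: closed_openC.
Qed.

Lemma lebesgue_cube (c : 'rV[R]_d) (r : R) : 0 <= r ->
  leb [set x | forall j, `|x 0 j - c 0 j| <= r] = ((2 * r) ^+ d)%:E.
Proof. by move=> r0; rewrite lebesgue_box// prodr_const card_ord. Qed.

Lemma le_lebesgue (A B : set 'rV[R]_d) : A `<=` B -> (leb A <= leb B)%E.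
Proof. exact: le_outer_measure. Qed.

Lemma lebesgue_fin_cube (c : 'rV[R]_d) (r : R) (A : set 'rV[R]_d) :
  (forall x, A x -> forall j, `|x 0 j - c 0 j| <= r) -> (leb A < +oo)%E.
Proof.
move=> Ar; apply: (@le_lt_trans _ _ (leb [set x | forall j, `|x 0 j - c 0 j| <= `|r|])).
  by apply: le_lebesgue => x /Ar H j; apply: le_trans (H j) (ler_norm _).
by rewrite lebesgue_cube// ltry.
Qed.

(** Completeness: a set of outer measure zero splits every test set additively. *)
Lemma measurable_null (N : set 'rV[R]_d) : leb N = 0%E -> measurable (N : set (Rn R d)).
Proof.
move=> N0; suff : (@lebesgue_outer R d).-caratheodory N by [].
apply: le_caratheodory_measurable => X.
rewrite [X in (X + _)%E](_ : _ = 0%E); last first.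
  apply/eqP; rewrite eq_le outer_measure_ge0 andbT -N0.
  exact: le_outer_measure.
by rewrite add0e; apply: le_outer_measure.
Qed.

Lemma lebesgue_null_bigcup (F : nat -> set 'rV[R]_d) :
  (forall n, leb (F n) = 0%E) -> leb (\bigcup_n F n) = 0%E.
Proof.
move=> F0; apply/eqP; rewrite eq_le outer_measure_ge0 andbT.
apply: le_trans (outer_measure_sigma_subadditive _ _) _.
by rewrite eseries0// => n _ _; exact: F0.
Qed.

Lemma lebesgue_null_finite (I : finType) (F : I -> set 'rV[R]_d) :
  (forall n, leb (F n) = 0%E) -> leb (\bigcup_(n in [set: I]) F n) = 0%E.
Proof.
move=> F0; apply/eqP; rewrite eq_le outer_measure_ge0 andbT.
rewrite -(lebesgue_null_bigcup (F := fun n => if unpickle n is Some i then F i else set0)).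
  by apply: le_lebesgue => x [i _ Fi]; exists (pickle i) => //; rewrite pickleK.
by move=> n; case: unpickle => // ; exact: outer_measure0.
Qed.

(** The hyperplane is covered by countably many boxes with one side of length zero. *)
Lemma lebesgue_coordinate_hyperplane (k : 'I_d) (b : R) :
  leb [set x : 'rV[R]_d | x 0 k = b] = 0%E.
Proof.
apply/eqP; rewrite eq_le outer_measure_ge0 andbT.
pose F (n : nat) := [set x : 'rV[R]_d | forall j,
   `|x 0 j - (if j == k then b else 0)| <= (if j == k then 0 else n%:R)].
rewrite -(@lebesgue_null_bigcup F).
  apply: le_lebesgue => x /= xk.
  exists (Num.trunc `|x|).+1 => // j; case: eqP => [->|_]; first by rewrite xk subrr normr0.
  rewrite subr0; apply: le_trans (ltW (truncnS_gt _)).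
  exact: row_coord_le.
move=> n; rewrite lebesgue_box; last by move=> j; case: eqP.
by rewrite (bigD1 k)//= eqxx mulr0 mul0r.
Qed.

Lemma lebesgue_hyperplane (a : 'rV[R]_d) (b : R) : a != 0 ->
  leb [set x | dot a x + b = 0] = 0%E.
Proof.
move=> a0; have [k ak] : exists k, a 0 k != 0.
  apply/existsP; apply: contraNT a0; rewrite negb_exists => /forallP h.
  by apply/eqP/rowP => k; rewrite mxE; have /negPn/eqP := h k.
(* Column [k] of the identity is replaced by [a], so that coordinate [k] of [x *m P] is [dot a x]:
   the hyperplane is the preimage of a coordinate hyperplane. *)
pose P : 'M[R]_d := \matrix_(i, j) (if j == k then a 0 i else (i == j)%:R).
have xP (x : 'rV[R]_d) j : (x *m P) 0 j = if j == k then dot a x else x 0 j.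
  rewrite mxE; case: (eqVneq j k) => jk.
    by apply: eq_bigr => i _; rewrite mxE jk eqxx mulrC.
  rewrite (bigD1 j)//= big1 ?addr0 => [|i ij]; rewrite mxE (negbTE jk) ?eqxx ?mulr1//.
  by rewrite (negbTE ij) mulr0.
have uP : P \in unitmx.
  rewrite unitmxE unitfE; apply/negP => /det0P[x x0 xP0].
  move/eqP: x0; apply; apply/rowP => j; rewrite mxE.
  have xj i : i != k -> x 0 i = 0.
    by move=> ik; have := xP x i; rewrite xP0 mxE (negbTE ik).
  case: (eqVneq j k) => [->|]; last exact: xj.
  have := xP x k; rewrite xP0 mxE eqxx /dot (bigD1 k)//= big1 ?addr0; last first.
    by move=> i ik; rewrite xj// mulr0.
  by move/esym/eqP; rewrite mulf_eq0 (negbTE ak) => /eqP.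
have := lebesgue_outer_affine 0 [set x : 'rV[R]_d | x 0 k = - b] uP.
have -> : lebesgue_outer [set x : 'rV[R]_d | x 0 k = - b] = 0%E.
  exact: lebesgue_coordinate_hyperplane.
rewrite mule0 => <-; congr lebesgue_outer; apply/seteqP; split => x /=.
  by move=> /eqP; rewrite addr_eq0 addr0 xP eqxx => /eqP.
by rewrite addr0 xP eqxx => ->; rewrite addNr.
Qed.

End open_and_null.

(** * Integrals of real functions *)

Section integration_tools.
Context (R : realType) (d : nat).
Local Notation leb := (@lebesgue R d).
Implicit Types (D : set 'rV[R]_d) (f g : 'rV[R]_d -> R).

Definition mset D : Prop := measurable (D : set (Rn R d)).

Definition mfn D f : Prop := measurable_fun (D : set (Rn R d)) (f : Rn R d -> R).

Lemma mfn_continuous D f : open D -> (forall x, D x -> {for x, continuous f}) ->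
  mfn D f.
Proof.
move=> oD cf mD; apply: (measurability _ (RGenOInfty.measurableE R)) => //.
move=> /= _ [_ [a ->] <-]; apply: open_measurable_row.
rewrite openE => x [Dx fx]; rewrite /interior.
near=> y; split; first by near: y; exact: open_nbhs_nbhs.
near: y; apply: (cf x Dx); apply: open_nbhs_nbhs; split => //.
Unshelve. all: by end_near. Qed.

Lemma mfnS D E f : mset E -> D `<=` E -> mfn E f -> mfn D f.
Proof. by move=> mE DE; exact: measurable_funS. Qed.

Lemma intble_bounded D f c : mset D -> (leb D < +oo)%E -> mfn D f ->
  (forall x, D x -> `|f x| <= c) -> intble D f.
Proof.
move=> mD fD mf fc; apply: measurable_bounded_integrable => //.
exists c; split; first exact: num_real.
by move=> M cM x Dx /=; apply: le_trans (fc _ Dx) (ltW cM).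
Qed.

Lemma intble_mfn D f : intble D f -> mfn D f.
Proof. by move=> /integrableP[/measurable_EFinP]. Qed.

Lemma eq_intble D f g : mset D -> (forall x, D x -> f x = g x) -> intble D f -> intble D g.
Proof.
move=> mD fg mf; apply: eq_integrable mf => //.
by move=> x /set_mem Dx /=; rewrite fg.
Qed.

Lemma intbleD D f g : mset D -> intble D f -> intble D g ->
  intble D (fun x => f x + g x).
Proof.
by move=> mD mf mg; apply: eq_integrable (integrableD mD mf mg) => // x _ /=.
Qed.

Lemma intbleZ D f k : mset D -> intble D f -> intble D (fun x => k * f x).
Proof.
move=> mD mf; apply: eq_integrable (integrableZl mD k mf) => // x _ /=.
Qed.

Lemma intbleB D f g : mset D -> intble D f -> intble D g ->
  intble D (fun x => f x - g x).
Proof.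
by move=> mD mf mg; apply: eq_integrable (integrableB mD mf mg) => // x _ /=.
Qed.

Lemma intble_sum (I : Type) (r : seq I) (P : pred I) D (f : I -> 'rV[R]_d -> R) :
  mset D -> (forall i, intble D (f i)) -> intble D (fun x => \sum_(i <- r | P i) f i x).
Proof.
move=> mD mf; elim: r => [|i r IH].
  apply: eq_integrable (integrable0 _ _) => // x _ /=; by rewrite big_nil.
case Pi: (P i); last by apply: eq_intble mD _ IH => x _; rewrite big_cons Pi.
by apply: eq_intble mD _ (intbleD mD (mf i) IH) => x _; rewrite big_cons Pi.
Qed.

Lemma intble_norm D f : mset D -> intble D f -> intble D (fun x => `|f x|).
Proof. by move=> mD mf; have := integrable_abse mf. Qed.

Lemma intbleS D E f : mset D -> mset E -> D `<=` E -> intble E f -> intble D f.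
Proof. by move=> mD mE DE; exact: integrableS. Qed.

Lemma intbleM D f g c : mset D -> mfn D g -> (forall x, D x -> `|g x| <= c) ->
  intble D f -> intble D (fun x => f x * g x).
Proof.
move=> mD mg gc mf.
apply: (le_integrable mD _ _ (intbleZ c mD (intble_norm mD mf))) => //.
  by apply/measurable_EFinP/measurable_funM => //; exact: intble_mfn.
move=> x Dx /=; rewrite lee_fin normrM [leRHS]ger0_norm; last first.
  by rewrite mulr_ge0//; exact: le_trans (gc _ Dx).
by rewrite mulrC; apply: ler_wpM2r => //; exact: gc.
Qed.

Lemma integD D f g : mset D -> intble D f -> intble D g ->
  integ D (fun x => f x + g x) = integ D f + integ D g.
Proof. exact: RintegralD. Qed.

Lemma integB D f g : mset D -> intble D f -> intble D g ->
  integ D (fun x => f x - g x) = integ D f - integ D g.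
Proof. exact: RintegralB. Qed.

Lemma integZ D f k : mset D -> intble D f ->
  integ D (fun x => k * f x) = k * integ D f.
Proof. by move=> mD mf; exact: RintegralZl. Qed.

Lemma eq_integ D f g : (forall x, D x -> f x = g x) -> integ D f = integ D g.
Proof. by move=> fg; apply: eq_Rintegral => x /set_mem/fg. Qed.

Lemma integ0 D : integ D (fun=> 0) = 0.
Proof. by rewrite /integ /Rintegral integral0. Qed.

Lemma integ_sum (I : Type) (r : seq I) (P : pred I) D (f : I -> 'rV[R]_d -> R) :
  mset D -> (forall i, intble D (f i)) ->
  integ D (fun x => \sum_(i <- r | P i) f i x) = \sum_(i <- r | P i) integ D (f i).
Proof.
move=> mD mf; elim: r => [|i r IH].
  by rewrite big_nil -[RHS](integ0 D); apply: eq_integ => x _; rewrite big_nil.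
rewrite big_cons -IH; case Pi: (P i); last by apply: eq_integ => x _; rewrite big_cons Pi.
rewrite -integD//; last exact: intble_sum.
by apply: eq_integ => x _; rewrite big_cons Pi.
Qed.

Lemma le_integ D f g : mset D -> intble D f -> intble D g ->
  (forall x, D x -> f x <= g x) -> integ D f <= integ D g.
Proof. exact: le_Rintegral. Qed.

Lemma integ_ge0 D f : (forall x, D x -> 0 <= f x) -> 0 <= integ D f.
Proof. by move=> f0; rewrite /integ; apply: Rintegral_ge0. Qed.

Lemma norm_integ D f : mset D -> intble D f ->
  `|integ D f| <= integ D (fun x => `|f x|).
Proof. exact: le_normr_Rintegral. Qed.

Lemma integ_cst D k : mset D -> integ D (fun=> k) = k * vol D.
Proof. by move=> mD; exact: Rintegral_cst. Qed.

Lemma intble_cst D k : mset D -> (leb D < +oo)%E -> intble D (fun=> k).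
Proof.
by move=> mD fD; apply: (@intble_bounded _ _ `|k|) => //; exact: measurable_cst.
Qed.

Lemma integ_patch D E f : D `<=` E -> (forall x, E x -> ~ D x -> f x = 0) ->
  integ E f = integ D f.
Proof.
move=> DE f0; rewrite /integ (Rintegral_mkcond leb E) (Rintegral_mkcond leb D).
apply: eq_Rintegral => x _; rewrite !patchE.
have [xD|xD] := boolP (x \in D).
  by rewrite ifT// inE; apply: DE; exact: set_mem.
case: ifPn => // xE; apply: f0; first exact: set_mem.
by move/mem_set; rewrite (negbTE xD).
Qed.

Lemma intble_patch D E f : mset D -> mset E -> D `<=` E ->
  (forall x, E x -> ~ D x -> f x = 0) -> intble D f -> intble E f.
Proof.
move=> mD mE DE f0 mf; apply: (eq_intble (f := f \_ D)) => //.
  move=> x Ex; rewrite patchE; case: ifPn => // xD; rewrite f0// => /mem_set.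
  by rewrite (negbTE xD).
apply: (intbleS mE (E := setT)) => //.
  exact: measurableT.
have := (integrable_mkcond _ mD).1 mf.
by rewrite restrict_EFin.
Qed.

Lemma vol_ge0 D : 0 <= vol D.
Proof. by rewrite fine_ge0. Qed.

Lemma le_vol D E : (leb E < +oo)%E -> D `<=` E -> vol D <= vol E.
Proof.
move=> fE DE; have le := le_lebesgue DE.
by rewrite fine_le// ge0_fin_numE//; exact: le_lt_trans fE.
Qed.

Lemma vol_cube (c : 'rV[R]_d) (r : R) : 0 <= r ->
  vol [set x | forall j, `|x 0 j - c 0 j| <= r] = (2 * r) ^+ d.
Proof. by move=> r0; rewrite /vol lebesgue_cube. Qed.

Lemma mset_cube (c : 'rV[R]_d) (r : R) :
  mset [set x | forall j, `|x 0 j - c 0 j| <= r].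
Proof.
suff : closed [set x : 'rV[R]_d | forall j, `|x 0 j - c 0 j| <= r] by exact: closed_measurable_row.
rewrite (_ : [set x | _] =
    \bigcap_(j in [set: 'I_d]) ((fun x : 'rV[R]_d => `|x 0 j - c 0 j|) @^-1` [set y | y <= r])); last first.
  by apply/seteqP; split => x /= h j; [move=> _; exact: h|exact: (h j I)].
apply: closed_bigI => j _; apply: preimage_closed; last exact: closed_le.
move=> x _; apply: (@continuous_comp _ _ _ (fun x : 'rV[R]_d => x 0 j - c 0 j) (fun y : R => `|y|));
  last exact: norm_continuous.
by apply: continuousB; [exact: coord_continuous|exact: cst_continuous].
Qed.

Lemma integ_indic D P : mset D -> mset P -> integ D (\1_P) = vol (P `&` D).
Proof. by move=> mD mP; rewrite /integ /Rintegral integral_indic. Qed.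

Lemma intble_indic D P : mset D -> mset P -> (leb D < +oo)%E -> intble D (\1_P).
Proof.
move=> mD mP fD; apply: (@intble_bounded _ _ 1) => //.
  exact: measurable_indic.
by move=> x _; rewrite indicE; case: (x \in P); rewrite ?normr1 ?normr0.
Qed.

Lemma mfn_null D N f : mset D -> leb N = 0%E -> mfn (D `\` N) f -> mfn D f.
Proof.
move=> mD N0 mf _ B mB.
have mN := measurable_null N0.
have -> : D `&` f @^-1` B = ((D `\` N) `&` f @^-1` B) `|` (D `&` N `&` f @^-1` B).
  apply/seteqP; split=> x /=.
    by move=> [Dx fx]; case: (pselect (N x)) => Nx; [right|left].
  by move=> [[[? ?] ?]|[[? ?] ?]].
apply: measurableU; first by apply: mf => //; exact: measurableD.
apply: measurable_null; apply/eqP; rewrite eq_le outer_measure_ge0 andbT -N0.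
by apply: le_lebesgue => x [[]].
Qed.

Lemma eq_intble_null D N f g : mset D -> leb N = 0%E -> intble D g ->
  (forall x, D x -> ~ N x -> f x = g x) -> intble D f /\ integ D f = integ D g.
Proof.
move=> mD N0 ig fg; have mN := measurable_null N0.
have mDN : mset (D `\` N) by exact: measurableD.
have fg' x : (D `\` N) x -> g x = f x by case=> Dx Nx; rewrite fg.
have mf : mfn D f.
  apply: (mfn_null mD N0); apply: intble_mfn.
  by apply: (eq_intble mDN fg'); apply: intbleS ig => // x [].
have ae : ae_eq leb (D : set (Rn R d)) (EFin \o f) (EFin \o g).
  exists N; split => // x /= h; apply: contrapT => Nx; apply: h => Dx.
  by rewrite /= fg.
have [mg goo] := integrableP _ _ _ ig.
have mf' : measurable_fun (D : set (Rn R d)) (EFin \o f) by exact/measurable_EFinP.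
split; last by rewrite /integ /Rintegral; congr fine; exact: ae_eq_integral.
apply/integrableP; split => //.
rewrite [ltLHS](_ : _ = \int[leb]_(x in D) `|(EFin \o g) x|)%E//.
apply: ae_eq_integral => //.
- by apply: measurableT_comp.
- by apply: measurableT_comp.
- by case: ae => A [? ? AD]; exists A; split => // x /= h; apply: AD => /= h'; apply: h => /h' /= [->].
Qed.

Lemma integ_dominated D (F : nat -> 'rV[R]_d -> R) f N (c : R) : mset D ->
  (leb D < +oo)%E -> leb N = 0%E -> (forall n, mfn D (F n)) -> mfn D f ->
  (forall x, D x -> ~ N x -> F n x @[n --> \oo] --> f x) ->
  (forall n x, D x -> `|F n x| <= c) ->
  integ D (F n) @[n --> \oo] --> integ D f.
Proof.
move=> mD fD N0 mF mf Ff Fc; have mN := measurable_null N0.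
have [] := @dominated_convergence _ _ R leb D mD (fun n => EFin \o F n) (EFin \o f)
  (cst c%:E).
- by move=> n; apply/measurable_EFinP; exact: mF.
- exact/measurable_EFinP.
- exists N; split => // x /= h; apply: contrapT => Nx; apply: h => Dx.
  by apply/cvg_EFin; [exact: nearW|exact: Ff].
- by have := intble_cst c mD fD.
- by apply: aeW => x n Dx /=; rewrite lee_fin; exact: Fc.
move=> iff _ cv; rewrite /integ /Rintegral.
by apply: fine_cvg; rewrite fineK//; exact: integrable_fin_num.
Qed.

End integration_tools.

(** * The Euclidean norm *)

Section euclidean.
Context (R : realType).

Lemma cauchy_schwarz_sum (I : finType) (a b : I -> R) :
  `|\sum_i a i * b i| <= Num.sqrt (\sum_i a i ^+ 2) * Num.sqrt (\sum_i b i ^+ 2).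
Proof.
set A := \sum_i a i ^+ 2; set B := \sum_i b i ^+ 2; set C := \sum_i _.
have A0 : 0 <= A by apply: sumr_ge0 => i _; exact: sqr_ge0.
have B0 : 0 <= B by apply: sumr_ge0 => i _; exact: sqr_ge0.
rewrite -sqrtrM// -sqrtr_sqr ler_wsqrtr//.
(* Cauchy-Schwarz as nonnegativity of a quadratic form in (s, t). The point (-C, A) settles A > 0,
   the point (B, -C) settles B > 0, and (1, -C) forces C = 0 when A = B = 0. *)
have H (s t : R) : 0 <= s ^+ 2 * A + 2 * (s * t) * C + t ^+ 2 * B.
  have -> : s ^+ 2 * A + 2 * (s * t) * C + t ^+ 2 * B = \sum_i (s * a i + t * b i) ^+ 2.
    rewrite /A /B /C !mulr_sumr -!big_split/=; apply: eq_bigr => i _; ring.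
  by apply: sumr_ge0 => i _; exact: sqr_ge0.
have := H (- C) A; have := H B (- C); have := H 1 (- C); have := H (- C) 1.
case: (eqVneq A 0) => [A00|A1]; last first.
  by have {A1 A0} : 0 < A; [rewrite lt_def A1|nra].
case: (eqVneq B 0) => [B00|B1].
  by rewrite A00 B00; nra.
by have {B1 B0} : 0 < B; [rewrite lt_def B1|nra].
Qed.

Lemma enorm_ge0 m n (B : 'M[R]_(m, n)) : 0 <= enorm B.
Proof. exact: sqrtr_ge0. Qed.

Lemma enormE m n (B : 'M[R]_(m, n)) : enorm B = Num.sqrt (\sum_p B p.1 p.2 ^+ 2).
Proof. by rewrite /enorm pair_bigA. Qed.

Lemma enorm_sqr m n (B : 'M[R]_(m, n)) : enorm B ^+ 2 = \sum_p B p.1 p.2 ^+ 2.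
Proof. by rewrite enormE sqr_sqrtr// sumr_ge0// => p _; exact: sqr_ge0. Qed.

Lemma frobenius_cauchy m n (A B : 'M[R]_(m, n)) :
  `|\sum_i \sum_j A i j * B i j| <= enorm A * enorm B.
Proof.
by rewrite pair_bigA/= !enormE (cauchy_schwarz_sum (fun p => A p.1 p.2) (fun p => B p.1 p.2)).
Qed.

Lemma enormD m n (A B : 'M[R]_(m, n)) : enorm (A + B) <= enorm A + enorm B.
Proof.
rewrite -(@ler_pXn2r _ 2)// ?nnegrE ?addr_ge0 ?enorm_ge0//.
rewrite sqrrD !enorm_sqr; have := frobenius_cauchy A B.
rewrite pair_bigA/= ler_norml => /andP[_ h].
have -> : \sum_p (A + B) p.1 p.2 ^+ 2 = \sum_p A p.1 p.2 ^+ 2 +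
    (\sum_p A p.1 p.2 * B p.1 p.2) *+ 2 + \sum_p B p.1 p.2 ^+ 2.
  rewrite -sumrMnl -!big_split/=; apply: eq_bigr => p _.
  by rewrite mxE sqrrD.
by rewrite lerD2r lerD2l lerMn2r h orbT.
Qed.

Lemma enormZ m n a (A : 'M[R]_(m, n)) : enorm (a *: A) = `|a| * enorm A.
Proof.
rewrite !enormE -sqrtr_sqr -sqrtrM ?sqr_ge0// mulr_sumr; congr Num.sqrt.
by apply: eq_bigr => p _; rewrite mxE exprMn.
Qed.

Lemma enormN m n (A : 'M[R]_(m, n)) : enorm (- A) = enorm A.
Proof. by rewrite -scaleN1r enormZ normrN1 mul1r. Qed.

Lemma enormBC m n (A B : 'M[R]_(m, n)) : enorm (A - B) = enorm (B - A).
Proof. by rewrite -enormN opprB. Qed.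

Lemma enorm0 m n : enorm (0 : 'M[R]_(m, n)) = 0.
Proof. by rewrite -(scale0r 0) enormZ normr0 mul0r. Qed.

Lemma enormB m n (A B : 'M[R]_(m, n)) : enorm (A - B) <= enorm A + enorm B.
Proof. by apply: le_trans (enormD _ _) _; rewrite enormN. Qed.

Lemma enorm_triangle m n (A B C : 'M[R]_(m, n)) :
  enorm (A - C) <= enorm (A - B) + enorm (B - C).
Proof. by rewrite -(subrKA B A) enormD. Qed.

Lemma enorm_sum m n (I : finType) (P : pred I) (F : I -> 'M[R]_(m, n)) :
  enorm (\sum_(i | P i) F i) <= \sum_(i | P i) enorm (F i).
Proof.
elim/big_ind2 : _ => [|x1 x2 y1 y2 h1 h2|//]; first by rewrite enorm0.
by apply: le_trans (enormD _ _) (lerD h1 h2).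
Qed.

Lemma le_entry_enorm m n (B : 'M[R]_(m, n)) i j : `|B i j| <= enorm B.
Proof.
rewrite enormE -sqrtr_sqr ler_wsqrtr// (bigD1 (i, j))//= lerDl.
by apply: sumr_ge0 => p _; exact: sqr_ge0.
Qed.

Lemma enorm_eq0 m n (B : 'M[R]_(m, n)) : enorm B = 0 -> B = 0.
Proof.
move=> B0; apply/matrixP => i j; rewrite mxE; apply/eqP.
by rewrite -normr_le0 -B0 le_entry_enorm.
Qed.

Lemma enorm_gt0 m n (B : 'M[R]_(m, n)) : B != 0 -> 0 < enorm B.
Proof.
by move=> B0; rewrite lt_def enorm_ge0 andbT; apply: contraNneq B0 => /enorm_eq0 ->.
Qed.

Section rows.
Context (d : nat).
Implicit Types x y z : 'rV[R]_d.

Lemma dotC x y : dot x y = dot y x.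
Proof. by apply: eq_bigr => i _; rewrite mulrC. Qed.

Lemma dotDr x y z : dot x (y + z) = dot x y + dot x z.
Proof. by rewrite -big_split/=; apply: eq_bigr => i _; rewrite mxE mulrDr. Qed.

Lemma dotZr a x y : dot x (a *: y) = a * dot x y.
Proof. by rewrite mulr_sumr; apply: eq_bigr => i _; rewrite mxE mulrCA. Qed.

Lemma dotDl x y z : dot (x + y) z = dot x z + dot y z.
Proof. by rewrite !(dotC _ z) dotDr. Qed.

Lemma dotNr x y : dot x (- y) = - dot x y.
Proof. by rewrite -scaleN1r dotZr mulN1r. Qed.

Lemma dotNl x y : dot (- x) y = - dot x y.
Proof. by rewrite dotC dotNr dotC. Qed.

Lemma dotBr x y z : dot x (y - z) = dot x y - dot x z.
Proof. by rewrite dotDr dotNr. Qed.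

Lemma dotBl x y z : dot (x - y) z = dot x z - dot y z.
Proof. by rewrite dotDl dotNl. Qed.

Lemma dot0r x : dot x 0 = 0.
Proof. by rewrite -(scale0r 0) dotZr mul0r. Qed.

Lemma dot0l x : dot 0 x = 0.
Proof. by rewrite dotC dot0r. Qed.

Lemma dot_sumr (I : finType) (P : pred I) (F : I -> 'rV[R]_d) x :
  dot x (\sum_(i | P i) F i) = \sum_(i | P i) dot x (F i).
Proof.
by elim/big_ind2 : _ => [|x1 x2 y1 y2 <- <-|//]; [rewrite dot0r|rewrite dotDr].
Qed.

Lemma dot_delta x k : dot x (delta_mx 0 k) = x 0 k.
Proof.
rewrite /dot (bigD1 k)//= big1 ?addr0 => [|i ik]; rewrite mxE eqxx.
  by rewrite eqxx mulr1.
by rewrite (negbTE ik) mulr0.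
Qed.

Lemma enorm_dot x : enorm x ^+ 2 = dot x x.
Proof.
rewrite enorm_sqr -(pair_bigA _ (fun i j => x i j ^+ 2)) big_ord1.
by apply: eq_bigr => i _; rewrite expr2.
Qed.

Lemma cauchy_dot x y : `|dot x y| <= enorm x * enorm y.
Proof. by have := frobenius_cauchy x y; rewrite big_ord1. Qed.

Lemma enormD_sqr x y : enorm (x + y) ^+ 2 = enorm x ^+ 2 + 2 * dot x y + enorm y ^+ 2.
Proof. by rewrite !enorm_dot dotDl !dotDr (dotC y x); ring. Qed.

Lemma enorm_le_coords x r : (forall j, `|x 0 j| <= r) -> enorm x <= d%:R * r.
Proof.
move=> xr; rewrite {1}(row_sum_delta x); apply: le_trans (enorm_sum _ _) _.
rewrite -[d in d%:R]card_ord mulr_natl -sumr_const; apply: ler_sum => j _.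
rewrite enormZ; suff -> : enorm (delta_mx 0 j : 'rV[R]_d) = 1 by rewrite mulr1.
apply/eqP; rewrite -(@eqrXn2 _ 2)// ?enorm_ge0// enorm_dot dot_delta.
by rewrite mxE !eqxx expr1n.
Qed.

Lemma enorm_delta j : enorm (delta_mx 0 j : 'rV[R]_d) = 1.
Proof.
apply/eqP; rewrite -(@eqrXn2 _ 2)// ?enorm_ge0// enorm_dot dot_delta.
by rewrite mxE !eqxx expr1n.
Qed.

Lemma quadE (B : 'M[R]_d) x : quad B x = \sum_k \sum_l B k l * (x 0 k * x 0 l).
Proof.
rewrite /quad mxE exchange_big/=; apply: eq_bigr => l _; rewrite !mxE mulr_suml.
by apply: eq_bigr => k _; ring.
Qed.

Lemma quad_le (B : 'M[R]_d) x : `|quad B x| <= enorm B * enorm x ^+ 2.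
Proof.
rewrite quadE; pose X : 'M[R]_d := \matrix_(k, l) (x 0 k * x 0 l).
have -> : \sum_k \sum_l B k l * (x 0 k * x 0 l) = \sum_k \sum_l B k l * X k l.
  by apply: eq_bigr => k _; apply: eq_bigr => l _; rewrite mxE.
apply: le_trans (frobenius_cauchy _ _) _; rewrite ler_wpM2l ?enorm_ge0//.
rewrite -(@ler_pXn2r _ 2)// ?nnegrE ?exprn_ge0 ?enorm_ge0//.
rewrite [in leLHS]enorm_sqr enorm_dot expr2.
rewrite -(pair_bigA _ (fun i j => X i j ^+ 2))/= /dot mulr_suml.
rewrite le_eqVlt; apply/orP; left; apply/eqP; apply: eq_bigr => i _.
by rewrite mulr_sumr; apply: eq_bigr => j _; rewrite mxE; ring.
Qed.

(** Rows carry the topology of the maximum norm, which [enorm] exceeds at most by the factor d. From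
    here on neighbourhoods are Euclidean balls. *)
Lemma open_enorm (U : set 'rV[R]_d) : open U <->
  forall x, U x -> exists2 e, 0 < e & forall y, enorm (y - x) < e -> U y.
Proof.
rewrite row_openP; split=> H x /H[e e0 eU].
  exists e => // y yx; apply: eU => j; apply: le_lt_trans yx.
  by have := le_entry_enorm (y - x) 0 j; rewrite !mxE.
have e1 : 0 < e / d.+1%:R by rewrite divr_gt0.
exists (e / d.+1%:R) => // y yx; apply: eU.
apply: (@le_lt_trans _ _ (d%:R * (e / d.+1%:R))).
  by apply: enorm_le_coords => j; have := yx j; rewrite !mxE => /ltW.
by rewrite mulrCA gtr_pMr// ltr_pdivrMr// mul1r ltr_nat.
Qed.

Lemma nbhs_enorm (U : set 'rV[R]_d) x : nbhs x U <->
  exists2 e, 0 < e & forall y, enorm (y - x) < e -> U y.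
Proof.
split.
  rewrite nbhsE => -[V [oV Vx] VU]; have [e e0 eV] := (open_enorm V).1 oV x Vx.
  by exists e => // y /eV/VU.
move=> [e e0 eU]; rewrite nbhsE; exists [set y | enorm (y - x) < e]; last exact: eU.
split; last by rewrite /= subrr enorm0.
apply/open_enorm => y /= yx; exists (e - enorm (y - x)); first by rewrite subr_gt0.
by move=> z zy; apply: le_lt_trans (enorm_triangle z y x) _; rewrite -ltrBrDr.
Qed.

Lemma closure_enorm (D : set 'rV[R]_d) x : closure D x <->
  forall e, 0 < e -> exists2 y, D y & enorm (y - x) < e.
Proof.
split=> [cD e e0|H B /nbhs_enorm[e e0 eB]].
  have [] := cD [set y | enorm (y - x) < e]; first by apply/nbhs_enorm; exists e.
  by move=> y [Dy ye]; exists y.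
by have [y Dy ye] := H e e0; exists y; split => //; exact: eB.
Qed.

Lemma continuous_enormP (f : 'rV[R]_d -> R) x : {for x, continuous f} <->
  forall e, 0 < e -> exists2 t, 0 < t & forall y, enorm (y - x) < t -> `|f y - f x| < e.
Proof.
split=> [cf e e0|H].
  have /cvgrPdist_lt/(_ e e0)/nbhs_enorm[t t0 ht] := cf.
  by exists t => // y /ht; rewrite distrC.
apply/(@cvgrPdist_lt _ _ _ _ (nbhs_filter x)) => e e0; apply/nbhs_enorm; have [t t0 ht] := H e e0.
by exists t => // y /ht; rewrite distrC.
Qed.

Lemma continuous_within_enormP (D : set 'rV[R]_d) (f : 'rV[R]_d -> R) :
  {within D, continuous f} <->
  forall x, D x -> forall e, 0 < e ->
    exists2 t, 0 < t & forall y, D y -> enorm (y - x) < t -> `|f y - f x| < e.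
Proof.
split=> [/subspace_continuousP cf x Dx e e0|H].
  have /cvgrPdist_lt/(_ e e0)/nbhs_enorm[t t0 ht] := cf x Dx.
  by exists t => // y Dy yx; rewrite distrC; exact: ht.
apply/subspace_continuousP => x Dx; apply/cvgrPdist_lt => e e0.
apply/nbhs_enorm; have [t t0 ht] := H x Dx e e0.
by exists t => // y yx Dy; rewrite distrC; exact: ht.
Qed.

Lemma bounded_enorm (D : set 'rV[R]_d) : bounded_set D ->
  exists2 r, 0 < r & forall x, D x -> enorm x <= r.
Proof.
move=> [M [_ HM]]; exists (d%:R * (`|M| + 1) + 1); first by rewrite ltr_wpDl// mulr_ge0.
move=> x Dx; apply: ler_wpDr => //; apply: enorm_le_coords => j.
apply: le_trans (row_coord_le x j) _; apply: HM => //.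
by rewrite ltr_pwDr// ler_norm.
Qed.

Lemma lebesgue_fin_enorm (D : set 'rV[R]_d) c r :
  (forall x, D x -> enorm (x - c) <= r) -> (@lebesgue R d D < +oo)%E.
Proof.
move=> Dr; apply: (@lebesgue_fin_cube _ _ c r) => x /Dr h j; apply: le_trans h.
by have := le_entry_enorm (x - c) 0 j; rewrite !mxE.
Qed.

Lemma vol_le_enorm (D : set 'rV[R]_d) c r : 0 <= r ->
  (forall x, D x -> enorm (x - c) <= r) -> vol D <= (2 * r) ^+ d.
Proof.
move=> r0 Dr; rewrite -(vol_cube c r0); apply: le_vol.
  by rewrite lebesgue_cube// ltry.
move=> x /Dr h j; apply: le_trans h.
by have := le_entry_enorm (x - c) 0 j; rewrite !mxE.
Qed.

Lemma vol_ge_enorm (D : set 'rV[R]_d) c r : 0 <= r -> (@lebesgue R d D < +oo)%E ->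
  (forall x, enorm (x - c) <= d%:R * r -> D x) -> (2 * r) ^+ d <= vol D.
Proof.
move=> r0 fD Dr; rewrite -(vol_cube c r0); apply: le_vol => // x /= h.
by apply: Dr; apply: enorm_le_coords => j; have := h j; rewrite !mxE.
Qed.

End rows.
End euclidean.

(** * Differentiation along lines and Taylor expansion *)

Section calculus.
Context (R : realType).

Lemma mvt_eq (f f' : R -> R) (a b : R) : a <= b ->
  (forall t, a <= t <= b -> is_derive t 1 f (f' t)) ->
  exists2 t, a <= t <= b & f b - f a = f' t * (b - a).
Proof.
rewrite le_eqVlt => /predU1P[->|ab] df.
  by exists b; rewrite ?lexx// !subrr mulr0.
have [t tab ->] : exists2 t, t \in `]a, b[%R & f b - f a = f' t * (b - a).
  apply: MVT => //.
    by move=> t; rewrite in_itv/= => /andP[/ltW ta /ltW tb]; apply: df; rewrite ta.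
  apply: continuous_in_subspaceT => t; rewrite inE/= in_itv/= => tab.
  by apply: differentiable_continuous; apply/derivable1_diffP; have [] := df t tab.
exists t => //.
by move: tab; rewrite in_itv/= => /andP[/ltW -> /ltW ->].
Qed.

Lemma mvt_bound (f f' : R -> R) (a b C : R) : a <= b ->
  (forall t, a <= t <= b -> is_derive t 1 f (f' t)) ->
  (forall t, a <= t <= b -> `|f' t| <= C) -> `|f b - f a| <= C * (b - a).
Proof.
move=> ab df fC; have [t tab ->] := mvt_eq ab df.
have ba : 0 <= b - a by rewrite subr_ge0.
by rewrite normrM (ger0_norm ba) ler_wpM2r// fC.
Qed.

Lemma is_derive_scale (w s : R) : is_derive s 1 (fun s : R => s * w) w.
Proof.
rewrite (_ : (fun s : R => s * w) = w \*: (@id R)); last first.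
  by apply/funext => u; rewrite /= mulrC.
by have := is_deriveZ w (is_derive_id s (1 : R)); rewrite [w *: 1]mulr1.
Qed.

Context (d : nat).
Implicit Types (x y z : 'rV[R]_d) (g v : 'rV[R]_d -> R).

Lemma is_derive_line g x y (t : R) : derivable g (x + t *: y) y ->
  is_derive t 1 (fun s : R => g (x + s *: y)) ('D_y g (x + t *: y)).
Proof.
move=> dg.
have E : (fun h : R => h^-1 *: ((fun s : R => g (x + s *: y)) (h *: 1 + t) - g (x + t *: y))) =
    (fun h : R => h^-1 *: (g (h *: y + (x + t *: y)) - g (x + t *: y))).
  apply/funext => h; congr (_ *: (g _ - _)).
  by rewrite -mulr_algl mulr1 scaler1 scalerDl addrCA.
by apply: DeriveDef; rewrite /derivable /derive /= E.
Qed.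

Definition partial k g : 'rV[R]_d -> R := 'D_(delta_mx 0 k) g.

Definition C1_at g x : Prop :=
  forall k, derivable g x (delta_mx 0 k) /\ {for x, continuous (partial k g)}.

(** [Ck_on] only knows derivatives along coordinate directions. The increment is therefore
    telescoped along a path that changes one coordinate at a time, with the mean value theorem on
    each piece and continuity of the partial derivatives to move their arguments back to [z]. *)
Lemma C1_increment g z : (exists2 e, 0 < e & forall w, enorm w < e -> C1_at g (z + w)) ->
  forall e, 0 < e -> exists2 t, 0 < t & forall w, enorm w < t ->
    `|g (z + w) - g z - \sum_k w 0 k * partial k g z| <= e * \sum_k `|w 0 k|.
Proof.
move=> [r r0 Cg] e e0.
have [t t0 ht] : exists2 t, 0 < t & forall k y, enorm (y - z) < t ->
    `|partial k g y - partial k g z| < e.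
  have H k : exists2 t, 0 < t & forall y, enorm (y - z) < t ->
      `|partial k g y - partial k g z| < e.
    have := Cg 0; rewrite enorm0 addr0 => /(_ r0 k)[_ /continuous_enormP]; exact.
  have /choice[T HT] : forall k, exists t, 0 < t /\ forall y, enorm (y - z) < t ->
      `|partial k g y - partial k g z| < e.
    by move=> k; have [t ? ?] := H k; exists t.
  exists (\big[Num.min/1]_k T k).
    by apply/bigmin_gtP; split => // k _; have [] := HT k.
  move=> k y yz; apply: (HT k).2; apply: lt_le_trans yz _.
  exact: bigmin_le_cond.
exists (Num.min r t); first by rewrite lt_min r0.
move=> w; rewrite lt_min => /andP[wr wt].
(* [c n] keeps the first n coordinates of [w], so it runs from 0 to [w]. *)
pose c (n : nat) : 'rV[R]_d := \row_k (if (k < n)%N then w 0 k else 0).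
have c_le (n : nat) (s : R) (k : 'I_d) : 0 <= s <= 1 -> n = k :> nat ->
    enorm (c n + (s * w 0 k) *: delta_mx 0 k) <= enorm w.
  move=> /andP[s0 s1] nk; rewrite /enorm ler_wsqrtr// !big_ord1; apply: ler_sum => j _.
  rewrite !mxE eqxx/= nk; case: (ltngtP j k) => jk.
  - by rewrite -val_eqE/= ltn_eqF//= mulr0 addr0.
  - by rewrite -val_eqE/= gtn_eqF//= mulr0 addr0 expr0n sqr_ge0.
  rewrite -val_eqE/= jk eqxx mulr1 add0r exprMn -[leRHS]mul1r (ord_inj jk).
  by rewrite ler_wpM2r ?sqr_ge0// -[leRHS](expr1n _ 2) lerXn2r// nnegrE.
have cS (k : 'I_d) : c k.+1 = c k + w 0 k *: delta_mx 0 k.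
  apply/rowP => j; rewrite !mxE eqxx/= ltnS leq_eqVlt -val_eqE/=.
  by case: ltngtP => jk; rewrite ?mulr0 ?addr0 ?mulr1 ?add0r// (ord_inj jk).
have step (k : 'I_d) : `|g (z + c k.+1) - g (z + c k) - w 0 k * partial k g z| <=
    e * `|w 0 k|.
  pose f (s : R) := g (z + c k + s *: (w 0 k *: delta_mx 0 k)).
  pose f' s := partial k g (z + c k + (s * w 0 k) *: delta_mx 0 k) * w 0 k.
  have df (s : R) : 0 <= s <= 1 -> is_derive s 1 f (f' s).
    move=> s01.
    have pe : enorm (c k + (s * w 0 k) *: delta_mx 0 k) < r.
      exact: le_lt_trans (c_le k s k s01 erefl) wr.
    have [dk _] := Cg _ pe k; rewrite addrA in dk.
    have -> : f = (fun u : R => g (z + c k + u *: delta_mx 0 k)) \o (fun s0 : R => s0 * w 0 k).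
      by apply/funext => u /=; rewrite /f scalerA.
    have h1 := is_derive_line dk.
    have h2 := is_derive_scale (w 0 k) s.
    exact: (@is_derive1_comp R (fun u : R => g (z + c k + u *: delta_mx 0 k)) (fun s0 : R => s0 * w 0 k) s _ _ h1 h2).
  have [s s01] := mvt_eq ler01 df.
  rewrite /f scale1r scale0r addr0 -(addrA z) -cS subr0 mulr1 => ->.
  rewrite /f' -addrA mulrC -mulrBr normrM mulrC ler_wpM2r// ltW// ht//.
  by rewrite [z + _]addrC addrK; exact: le_lt_trans (c_le k s k s01 erefl) wt.
have -> : g (z + w) - g z - \sum_k w 0 k * partial k g z =
    \sum_(k < d) (g (z + c k.+1) - g (z + c k) - w 0 k * partial k g z).
  rewrite big_split/= sumrN; congr (_ - _).
  rewrite -(big_mkord xpredT (fun k => g (z + c k.+1) - g (z + c k))) telescope_sumr//.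
  congr (g _ - g _).
    by congr (_ + _); apply/rowP => k; rewrite mxE ltn_ord.
  by rewrite -[LHS]addr0; congr (_ + _); apply/rowP => k; rewrite !mxE.
apply: le_trans (ler_norm_sum _ _ _) _; rewrite mulr_sumr.
by apply: ler_sum => k _; exact: step.
Qed.

Lemma is_derive_C1 g x y (t : R) :
  (exists2 e, 0 < e & forall w, enorm w < e -> C1_at g (x + t *: y + w)) ->
  is_derive t 1 (fun s : R => g (x + s *: y)) (\sum_k y 0 k * partial k g (x + t *: y)).
Proof.
set z := x + t *: y => /C1_increment H.
suff cv : h^-1 *: (g (x + (h *: 1 + t) *: y) - g z) @[h --> 0^'] -->
    (\sum_k y 0 k * partial k g z : R^o).
  by apply: DeriveDef; [apply/cvg_ex; eexists; exact: cv|exact: cvg_lim cv].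
apply/cvgrPdist_lt => e e0.
pose Y := \sum_k `|y 0 k|; have Y0 : 0 <= Y by exact: sumr_ge0.
have [r r0 hr] := H (e / (Y + 1)) (divr_gt0 e0 (ltr_wpDl Y0 ltr01)).
pose N := enorm y + 1; have N0 : 0 < N by rewrite ltr_wpDl ?enorm_ge0.
near=> h.
have h0 : h != 0 by near: h; exact: nbhs_dnbhs_neq.
have hN : enorm (h *: y) < r.
  rewrite enormZ; apply: (@le_lt_trans _ _ (`|h| * N)); first by rewrite ler_wpM2l// lerDl.
  rewrite -ltr_pdivlMr//; near: h.
  apply: dnbhs0_lt; exact: divr_gt0.
have -> : x + (h *: 1 + t) *: y = z + h *: y.
  by rewrite /z -mulr_algl mulr1 scaler1 scalerDl addrCA addrC.
have := hr _ hN.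
have -> : \sum_k (h *: y) 0 k * partial k g z = h * \sum_k y 0 k * partial k g z.
  by rewrite mulr_sumr; apply: eq_bigr => k _; rewrite mxE mulrA.
have -> : \sum_k `|(h *: y) 0 k| = `|h| * Y.
  by rewrite mulr_sumr; apply: eq_bigr => k _; rewrite mxE normrM.
rewrite mulrCA -ler_pdivrMl ?normr_gt0// -normfV -normrM distrC => hh.
set G := g (z + h *: y) - g z in hh *; set S := \sum_k _ in hh *.
have -> : h^-1 *: G - S = h^-1 * (G - h * S) by rewrite mulrBr mulKf.
apply: le_lt_trans hh _; rewrite mulrAC ltr_pdivrMr ?ltr_wpDl//.
by rewrite ltr_pM2l// ltrDl.
Unshelve. all: by end_near. Qed.

End calculus.

(** * Taylor expansion with Hölder continuous third derivatives *)

Section taylor.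
Context (R : realType) (d : nat).
Implicit Types (x y z : 'rV[R]_d) (v : 'rV[R]_d -> R) (Omega : set 'rV[R]_d).

Lemma norm_sum_le n (F : 'I_n -> R) c : (forall k, `|F k| <= c) ->
  `|\sum_k F k| <= n%:R * c.
Proof.
move=> Fc; apply: le_trans (ler_norm_sum _ _ _) _.
rewrite -[n in n%:R]card_ord mulr_natl -sumr_const; exact: ler_sum.
Qed.

Lemma is_derive_dpart Omega v n s x y (t : R) : open Omega -> Ck_on Omega n v ->
  (size s < n)%N -> Omega (x + t *: y) ->
  is_derive t 1 (fun u : R => dpart s v (x + u *: y))
    (\sum_k y 0 k * dpart (k :: s) v (x + t *: y)).
Proof.
move=> oO Cv sn Oz; apply: is_derive_C1.
have [e e0 eO] := (open_enorm Omega).1 oO _ Oz.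
exists e => // w we k.
have Ow : Omega (x + t *: y + w) by apply: eO; rewrite addrAC subrr add0r.
have [_ dv] := Cv s (ltnW sn) _ Ow; split; first exact: dv.
by have [] := Cv (k :: s) sn _ Ow.
Qed.

Lemma dpart_lipschitz Omega v n s x z C : open Omega -> Ck_on Omega n v ->
  (size s < n)%N -> (forall t : R, 0 <= t <= 1 -> Omega (x + t *: (z - x))) ->
  (forall k p, Omega p -> `|dpart (k :: s) v p| <= C) ->
  `|dpart s v z - dpart s v x| <= d%:R * C * enorm (z - x).
Proof.
move=> oO Cv sn seg hC.
have [t t01] := mvt_eq ler01 (fun t t01 => is_derive_dpart oO Cv sn (seg t t01)).
rewrite scale1r scale0r addr0 [x + (z - x)]addrC subrK subr0 mulr1 => ->.
rewrite -mulrA; apply: norm_sum_le => k; rewrite normrM mulrC ler_pM//; first by apply: hC; exact: seg.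
exact: le_entry_enorm.
Qed.

Definition third v x : 'I_d -> 'I_d -> 'I_d -> R := fun i j k => dpart [:: i; j; k] v x.

(* The third-order terms of the two one-sided expansions cancel. *)
Lemma taylor_symmetric Omega v x y H a : open Omega -> Ck_on Omega 3 v -> 0 <= a -> 0 <= H ->
  (forall p q, Omega p -> Omega q -> forall i j k,
    `|third v p i j k - third v q i j k| <= H * enorm (p - q) `^ a) ->
  (forall t : R, -1 <= t <= 1 -> Omega (x + t *: y)) ->
  `|v (x + y) + v (x - y) - 2 * v x - quad (hess v x) y| <=
    2 * d%:R ^+ 3 * H * enorm y ^+ 3 * (2 * enorm y) `^ a.
Proof.
move=> oO Cv a0 H0 hH seg.
set B := 2 * _ * _ * _ * _.
have P (t : R) : 0 <= t <= 1 -> Omega (x + t *: y) by move=> /andP[? ?]; apply: seg; lra.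
have N (t : R) : 0 <= t <= 1 -> Omega (x + t *: - y).
  by move=> /andP[? ?]; rewrite scalerN -scaleNr; apply: seg; lra.
(* With e = (-1)^(size s) these are the components of the derivative of order size s of t |-> v (x +
   t y) + v (x - t y); each differentiation flips the sign [e]. The first derivative vanishes at t =
   0, and for order three the difference is what the Hölder bound controls. *)
pose F (s : seq 'I_d) (e : R) (t : R) := dpart s v (x + t *: y) + e * dpart s v (x + t *: - y).
have dF s (e t : R) : (size s < 3)%N -> 0 <= t <= 1 ->
    is_derive t 1 (F s e) (\sum_k y 0 k * F (k :: s) (- e) t).
  move=> s3 t01.
  have h1 := is_derive_dpart oO Cv s3 (P t t01).
  have h2 := is_derive_dpart oO Cv s3 (N t t01).
  have h3 := is_deriveD h1 (is_deriveZ e h2).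
  apply: is_derive_eq h3 _.
  rewrite -[e *: _]/(e * _) mulr_sumr -big_split; apply: eq_bigr => k _.
  by rewrite mxE /F /dpart /=; ring.
have F3 i j k (t : R) : 0 <= t <= 1 -> `|F [:: i; j; k] (-1) t| <= H * (2 * enorm y) `^ a.
  move=> t01; rewrite /F mulN1r; apply: le_trans (hH _ _ (P t t01) (N t t01) i j k) _.
  rewrite ler_wpM2l// ge0_ler_powR ?nnegrE ?mulr_ge0 ?enorm_ge0//.
  rewrite opprD addrACA subrr add0r scalerN opprK -scalerDl enormZ.
  by case/andP: t01 => ? ?; rewrite ler_wpM2r ?enorm_ge0// ger0_norm; lra.
pose G1 t := \sum_k y 0 k * F [:: k] (-1) t.
pose G2 t := \sum_k y 0 k * \sum_l y 0 l * F [:: l; k] 1 t.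
pose G3 t := \sum_k y 0 k * \sum_l y 0 l * \sum_m y 0 m * F [:: m; l; k] (-1) t.
have sumd (c : 'I_d -> R) (b : R) : (forall k, `|c k| <= b) ->
    `|\sum_k y 0 k * c k| <= d%:R * enorm y * b.
  by move=> cb; rewrite -mulrA; apply: norm_sum_le => k; rewrite normrM ler_pM// le_entry_enorm.
have G3b (t : R) : 0 <= t <= 1 -> `|G3 t| <= B.
  move=> t01; apply: le_trans (sumd _ _ (fun k => sumd _ _ (fun l => sumd _ _ (fun m => F3 m l k t t01)))) _.
  rewrite /B; set p := powR _ _; have p0 : 0 <= p by exact: powR_ge0.
  set D := d%:R : R; set E := enorm y.
  have -> : D * E * (D * E * (D * E * (H * p))) = D ^+ 3 * H * E ^+ 3 * p by ring.
  have : 0 <= D ^+ 3 * H * E ^+ 3 * p.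
    by rewrite !mulr_ge0// ?exprn_ge0// /E ?enorm_ge0// /D.
  lra.
have dG0 (t : R) : 0 <= t <= 1 -> is_derive t 1 (F [::] 1) (G1 t).
  by move=> t01; exact: dF.
have dsum (f g : 'I_d -> R -> R) (t : R) : (forall k, is_derive t 1 (f k) (g k t)) ->
    is_derive t 1 (fun t => \sum_k y 0 k * f k t) (\sum_k y 0 k * g k t).
  move=> h; have := @is_derive_sum _ _ _ _ (fun k => y 0 k \*: f k) t 1 _
    (fun k => is_deriveZ (y 0 k) (h k)).
  by rewrite (_ : \sum_k _ = (fun t => \sum_k y 0 k * f k t))//; apply/funext => u; rewrite fct_sumE.
have dG1 (t : R) : 0 <= t <= 1 -> is_derive t 1 G1 (G2 t).
  move=> t01; apply: (dsum (fun k => F [:: k] (-1)) (fun k t => \sum_l y 0 l * F [:: l; k] 1 t)) => k.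
  by have := dF [:: k] (-1) t isT t01; rewrite opprK.
have dG2 (t : R) : 0 <= t <= 1 -> is_derive t 1 G2 (G3 t).
  move=> t01; apply: (dsum (fun k t => \sum_l y 0 l * F [:: l; k] 1 t)
    (fun k t => \sum_l y 0 l * \sum_m y 0 m * F [:: m; l; k] (-1) t)) => k.
  apply: (dsum (fun l => F [:: l; k] 1) (fun l t => \sum_m y 0 m * F [:: m; l; k] (-1) t)) => l.
  exact: dF.
have sub (t u : R) : 0 <= t <= 1 -> 0 <= u <= t -> 0 <= u <= 1.
  by move=> /andP[? ?] /andP[? ?]; lra.
have B0 : 0 <= B by apply: le_trans (G3b 0 _); rewrite ?normr_ge0// lexx ler01.
have b2 (t : R) : 0 <= t <= 1 -> `|G2 t - G2 0| <= B.
  move=> t01; have /andP[t0 t1] := t01.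
  have := mvt_bound t0 (fun u ut => dG2 u (sub t u t01 ut)) (fun u ut => G3b u (sub t u t01 ut)).
  by rewrite subr0 => /le_trans; apply; rewrite -[leRHS]mulr1 ler_wpM2l.
have b1 (t : R) : 0 <= t <= 1 -> `|G1 t - t * G2 0| <= B.
  move=> t01; have /andP[t0 t1] := t01.
  have dd (u : R) : 0 <= u <= t -> is_derive u 1 (fun t => G1 t - t * G2 0) (G2 u - G2 0).
    by move=> ut; apply: is_deriveB (dG1 u (sub t u t01 ut)) (is_derive_scale _ _).
  have := mvt_bound t0 dd (fun u ut => b2 u (sub t u t01 ut)).
  have -> : G1 0 = 0.
    by rewrite /G1 big1// => k _; rewrite /F scale0r scale0r addr0 mulN1r subrr mulr0.
  by rewrite mul0r !subr0 => /le_trans; apply; rewrite -[leRHS]mulr1 ler_wpM2l.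
have dd (u : R) : 0 <= u <= 1 -> is_derive u 1 (fun t => F [::] 1 t - t ^+ 2 / 2 * G2 0) (G1 u - u * G2 0).
  move=> u01; have h := is_deriveZ (G2 0 / 2) (is_deriveX 2 (is_derive_id u (1 : R))).
  have hq : is_derive u 1 (fun t : R => t ^+ 2 / 2 * G2 0) (u * G2 0).
    have -> : (fun t : R => t ^+ 2 / 2 * G2 0) = (G2 0 / 2) \*: (@id R ^+ 2).
      by apply/funext => t; rewrite /= -[RHS]/(G2 0 / 2 * t ^+ 2); lra.
    have -> : u * G2 0 = (G2 0 / 2) *: ((2%:R * u ^+ 1) *: 1).
      by rewrite -[RHS]/(G2 0 / 2 * (2 * u ^+ 1 * 1)) expr1; lra.
    exact: h.
  exact: is_deriveB (dG0 u u01) hq.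
have := mvt_bound ler01 dd b1; rewrite subr0 mulr1 expr1n expr0n/= !mul0r subr0.
have -> : F [::] 1 1 = v (x + y) + v (x - y) by rewrite /F !scale1r mul1r.
have -> : F [::] 1 0 = 2 * v x by rewrite /F !scale0r addr0 mul1r mulr_natl.
have -> : G2 0 = 2 * quad (hess v x) y.
  rewrite quadE exchange_big/= mulr_sumr; apply: eq_bigr => k _.
  rewrite !mulr_sumr; apply: eq_bigr => l _.
  by rewrite /F !scale0r addr0 mxE; ring.
by rewrite [1 / 2 * _]mulrA div1r mulVf// mul1r addrAC.
Qed.

(** The final estimate only offers the Hölder seminorm and the Hessian. On a segment of length e / 2
    around a fixed point, the mean value theorem makes a third derivative equal to a difference
    quotient of the Hessian, hence at most 4 W / e somewhere; Hölder continuity carries this bound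
    to every point of the bounded set. *)
Lemma third_bounded Omega a D : open Omega -> Omega !=set0 -> 0 <= a -> 0 <= D ->
  (forall p q, Omega p -> Omega q -> enorm (p - q) <= D) ->
  exists2 C, 0 <= C & forall v H W, Ck_on Omega 3 v -> 0 <= H ->
  (forall p q, Omega p -> Omega q -> forall i j k,
    `|third v p i j k - third v q i j k| <= H * enorm (p - q) `^ a) ->
  (forall p k l, Omega p -> `|hess v p k l| <= W) ->
  forall p i j k, Omega p -> `|third v p i j k| <= C * (H + W).
Proof.
move=> oO [z Oz] a0 D0 dD; have [e e0 eO] := (open_enorm Omega).1 oO _ Oz.
exists (4 / e + D `^ a); first by rewrite addr_ge0 ?powR_ge0// divr_ge0// ltW.
move=> v H W Cv H0 hH hW p i j k Op.
pose y : 'rV[R]_d := (e / 2) *: delta_mx 0 i.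
have seg (t : R) : 0 <= t <= 1 -> Omega (z + t *: y).
  move=> /andP[t0 t1]; apply: eO; rewrite addrAC subrr add0r /y scalerA enormZ enorm_delta mulr1.
  by rewrite ger0_norm; nra.
have W0 : 0 <= W by apply: le_trans (hW z i i Oz); exact: normr_ge0.
have [t t01] := mvt_eq ler01 (fun t t01 => @is_derive_dpart _ v 3 [:: j; k] z y t oO Cv isT (seg t t01)).
rewrite (bigD1 i)//= big1 ?addr0 => [|m mi]; last first.
  by rewrite !mxE (negbTE mi) andbF mulr0 mul0r.
rewrite subr0 mulr1 scale0r addr0 scale1r !mxE !eqxx mulr1 => E.
have h1 : `|third v (z + t *: y) i j k| <= 4 / e * W.
  have e2 : 0 < e / 2 by rewrite divr_gt0.
  rewrite -(ler_pM2l e2) -{1}(gtr0_norm e2) -normrM -E.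
  apply: le_trans (ler_normB _ _) _.
  have O1 : Omega (z + y) by have := seg 1; rewrite scale1r; apply; rewrite ler01 lexx.
  have := hW _ j k O1; have := hW _ j k Oz; rewrite !mxE => w1 w2.
  apply: le_trans (lerD w2 w1) _; rewrite le_eqVlt; apply/orP; left; apply/eqP.
  by field; rewrite gt_eqF.
have h2 := hH _ _ Op (seg t t01) i j k.
have h3 : H * enorm (p - (z + t *: y)) `^ a <= H * D `^ a.
  by rewrite ler_wpM2l// ge0_ler_powR ?nnegrE ?enorm_ge0//; apply: dD => //; exact: seg.
rewrite -(subrK (third v (z + t *: y) i j k) (third v p i j k)).
apply: le_trans (ler_normD _ _) _; apply: le_trans (lerD (le_trans h2 h3) h1) _.
have : 0 <= 4 / e by rewrite divr_ge0// ltW.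
have := powR_ge0 D a; set u := D `^ a; set w := 4 / e; nra.
Qed.

End taylor.

(** * Simplicial meshes and hat functions *)

Section barycentric.
Context (R : realType) (d : nat) (T : mesh R d).
Hypothesis conf : conforming T.
Local Notation I := 'I_(nnodes T).
Local Notation elt := (elements T).
Implicit Types (K L : {set I}) (x y : 'rV[R]_d).

Definition barycentric K x (w : I -> R) : Prop :=
  [/\ (forall i, i \notin K -> w i = 0), \sum_i w i = 1 & \sum_i w i *: node i = x].

(** No sign condition is imposed, so each coordinate is an affine function on the whole space and is
    meaningful outside the simplex. *)
Definition blam K x : I -> R := xget (fun=> 0) (barycentric K x).

Lemma card_element K : K \in elt -> #|K| = d.+1.
Proof. by case: conf => _ _ h _ /h[]. Qed.

(** The matrix [B] with rows (1, vertex) is square up to the identity #|K| = d + 1. Affine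
    independence makes its rows free, hence it has full rank and (1, x) is a combination of them.
    [sp] turns coefficients of the rows into a function on all nodes that vanishes off [K]. *)
Lemma barycentric_exists K x : K \in elt -> exists w, barycentric K x w.
Proof.
move=> KT; have [cK aK] : #|K| = d.+1 /\ affinely_independent K by case: conf => _ _ h _; exact: h.
pose sp (c : 'rV[R]_#|K|) (i : I) := \sum_(a | enum_val a == i) c 0 a.
have spE (V : lmodType R) (c : 'rV[R]_#|K|) (F : I -> V) :
    \sum_i sp c i *: F i = \sum_a c 0 a *: F (enum_val a).
  under eq_bigr do rewrite scaler_suml.
  rewrite (exchange_big_dep xpredT)//=; apply: eq_bigr => a _.
  by rewrite (big_pred1 (enum_val a)).
have sp0 c i : i \notin K -> sp c i = 0.
  move=> iK; rewrite /sp big_pred0// => a; apply/negP => /eqP ai.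
  by move: iK; rewrite -ai enum_valP.
pose B : 'M[R]_(#|K|, 1 + d) := \matrix_a row_mx 1%:M (node (enum_val a)).
have cB (c : 'rV_#|K|) : c *m B = row_mx (\sum_i sp c i)%:M (\sum_i sp c i *: node i).
  rewrite spE (eq_bigr (fun i => sp c i *: (1 : R^o))); last by move=> i _; rewrite [RHS]mulr1.
  rewrite (spE R^o c (fun=> 1)); rewrite mulmx_sum_row.
  rewrite (eq_bigr (fun a => row_mx (c 0 a)%:M (c 0 a *: node (enum_val a)))); last first.
    move=> a _; rewrite rowK scale_row_mx; congr row_mx.
    by rewrite scale_scalar_mx mulr1.
  rewrite (eq_bigr (fun a => c 0 a : R)); last by move=> a _; rewrite [LHS]mulr1.
  elim/big_rec3 : _ => [|a y1 y2 y3 _ ->]; first by rewrite raddf0 row_mx0.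
  by rewrite add_row_mx raddfD.
have fB : row_free B.
  rewrite -kermx_eq0; apply/rowV0P => c /sub_kermxP; rewrite cB => /eqP.
  rewrite row_mx_eq0 => /andP[/eqP c1 /eqP c2].
  have c3 : \sum_i sp c i = 0 by move/matrixP/(_ 0 0) : c1; rewrite !mxE eqxx.
  have := aK (sp c) (sp0 c) c3 c2 => h; apply/rowP => a; rewrite mxE.
  by have := h (enum_val a); rewrite /sp (big_pred1 a)// => b; rewrite (inj_eq enum_val_inj) eq_sym.
have uB : row_full B by rewrite /row_full (eqP fB) cK.
have /submxP[c Ec] := submx_full (row_mx 1%:M x : 'M[R]_(1, 1 + d)) uB.
exists (sp c); move: Ec; rewrite cB => /eq_row_mx[e1 e2]; split => //; first exact: sp0.
by move/matrixP/(_ 0 0) : e1; rewrite !mxE eqxx !mulr1n.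
Qed.

Lemma blamP K x : K \in elt -> barycentric K x (blam K x).
Proof. by move=> KT; have [w h] := barycentric_exists x KT; exact: (xgetI _ h). Qed.

Lemma blam_out K x i : K \in elt -> i \notin K -> blam K x i = 0.
Proof. by move=> KT; case: (blamP x KT) => h _ _ /h. Qed.

Lemma blam_sum K x : K \in elt -> \sum_i blam K x i = 1.
Proof. by case/(blamP x). Qed.

Lemma blam_node K x : K \in elt -> \sum_i blam K x i *: node i = x.
Proof. by case/(blamP x). Qed.

Lemma blam_unique K x w : K \in elt -> barycentric K x w -> w =1 blam K x.
Proof.
move=> KT [w0 w1 wx] i; have [_ aK] : #|K| = d.+1 /\ affinely_independent K by case: conf => _ _ h _; exact: h.
apply/eqP; rewrite -subr_eq0; apply/eqP.
apply: (aK (fun i => w i - blam K x i)) => [j jK||].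
- by rewrite w0// blam_out// subrr.
- by rewrite sumrB w1 blam_sum// subrr.
by under eq_bigr do rewrite scalerBl; rewrite sumrB wx blam_node// subrr.
Qed.

Definition bgrad K i : 'rV[R]_d := \row_k (blam K (delta_mx 0 k) i - blam K 0 i).

(** The affine interpolation of the coordinates at 0 and at the unit vectors satisfies the
    barycentric equations at [x], and these have one solution. *)
Lemma blam_affine K x i : K \in elt -> blam K x i = dot (bgrad K i) x + blam K 0 i.
Proof.
move=> KT; rewrite -(@blam_unique K x (fun i => dot (bgrad K i) x + blam K 0 i))//.
have E j : dot (bgrad K j) x + blam K 0 j =
   \sum_k x 0 k * (blam K (delta_mx 0 k) j - blam K 0 j) + blam K 0 j.
  by congr (_ + _); apply: eq_bigr => k _; rewrite mxE mulrC.
split=> [j jK||].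
- rewrite E big1 => [|k _]; last by rewrite !blam_out// subrr mulr0.
  by rewrite blam_out// addr0.
- under eq_bigr do rewrite E; rewrite big_split/= blam_sum// exchange_big/= big1 ?add0r// => k _.
  by rewrite -mulr_sumr sumrB !blam_sum// subrr mulr0.
under eq_bigr do rewrite E scalerDl; rewrite big_split/= blam_node// addr0.
under eq_bigr do rewrite scaler_suml; rewrite exchange_big/= [RHS]row_sum_delta.
apply: eq_bigr => k _.
under eq_bigr do rewrite -scalerA; rewrite -scaler_sumr; congr (_ *: _).
by under eq_bigr do rewrite scalerBl; rewrite sumrB !blam_node// subr0.
Qed.

Lemma blamB K x y i : K \in elt -> blam K y i - blam K x i = dot (bgrad K i) (y - x).
Proof. by move=> KT; rewrite (blam_affine y i KT) (blam_affine x i KT) dotBr; ring. Qed.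

Lemma bgrad_out K i : K \in elt -> i \notin K -> bgrad K i = 0.
Proof. by move=> KT iK; apply/rowP => k; rewrite !mxE !blam_out// subrr. Qed.

Lemma blam_vertex K i j : K \in elt -> j \in K -> blam K (node j) i = (i == j)%:R.
Proof.
move=> KT jK; rewrite -(@blam_unique K (node j) (fun i => (i == j)%:R))//; split=> [k kK||].
- by case: eqP kK => // ->; rewrite jK.
- by rewrite (bigD1 j)//= eqxx big1 ?addr0// => k /negbTE ->.
rewrite (bigD1 j)//= eqxx scale1r big1 ?addr0// => k /negbTE ->.
by rewrite scale0r.
Qed.

Lemma sum_bgrad K : K \in elt -> \sum_i bgrad K i = 0.
Proof.
move=> KT; apply/rowP => k; rewrite summxE mxE.
by under eq_bigr do rewrite mxE; rewrite sumrB !blam_sum// subrr.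
Qed.

Lemma sum_dot_bgrad K q : K \in elt -> \sum_i dot (bgrad K i) q *: node i = q.
Proof.
move=> KT; have := blam_node q KT; under eq_bigr do rewrite (blam_affine q)// scalerDl.
by rewrite big_split/= blam_node// addr0.
Qed.

Lemma hullP K x : K \in elt -> (hull K x <-> forall i, 0 <= blam K x i).
Proof.
move=> KT; split=> [[w [w0 wK w1 xw]] i|h].
  by rewrite -(@blam_unique K x w).
exists (blam K x); split; [exact: h|by move=> i; exact: blam_out|exact: blam_sum|].
by rewrite blam_node.
Qed.

Lemma hull_node K i : i \in K -> hull K (node i).
Proof.
move=> iK; exists (fun j => (j == i)%:R); split=> [j|j jK||].
- by case: eqP.
- by case: eqP jK => // ->; rewrite iK.
- by rewrite (bigD1 i)//= eqxx big1 ?addr0// => k /negbTE ->.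
rewrite (bigD1 i)//= eqxx scale1r big1 ?addr0// => k /negbTE ->.
by rewrite scale0r.
Qed.

Lemma blam_le1 K x i : K \in elt -> hull K x -> blam K x i <= 1.
Proof.
move=> KT /(hullP x KT) h; rewrite -(blam_sum x KT) (bigD1 i)//= lerDl.
exact: sumr_ge0.
Qed.

Lemma hull_segment K x y (t : R) : K \in elt -> hull K x -> hull K y -> 0 <= t <= 1 ->
  hull K (x + t *: (y - x)).
Proof.
move=> KT /(hullP x KT) hx /(hullP y KT) hy /andP[t0 t1]; apply/hullP => // i.
have -> : blam K (x + t *: (y - x)) i = (1 - t) * blam K x i + t * blam K y i.
  by rewrite (blam_affine x i KT) (blam_affine y i KT) (blam_affine (_ + _) i KT) dotDr dotZr dotBr; ring.
by rewrite addr_ge0// mulr_ge0// subr_ge0.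
Qed.

Definition ohull K : set 'rV[R]_d := [set x | forall i, i \in K -> 0 < blam K x i].

Lemma continuous_dot (a : 'rV[R]_d) : continuous (dot a).
Proof.
move=> x; apply/continuous_enormP => e e0.
have N0 : 0 < enorm a + 1 by rewrite ltr_wpDl ?enorm_ge0.
exists (e / (enorm a + 1)); first exact: divr_gt0.
move=> y; rewrite ltr_pdivlMr// mulrC => yx; rewrite -dotBr.
apply: le_lt_trans (cauchy_dot _ _) _; apply: le_lt_trans yx.
by rewrite ler_wpM2r ?enorm_ge0// lerDl.
Qed.

Lemma continuous_blam K i : K \in elt -> continuous (fun x => blam K x i).
Proof.
move=> KT; rewrite (_ : (fun x => _) = (fun x => dot (bgrad K i) x + blam K 0 i)); last first.
  by apply/funext => x; rewrite (blam_affine x).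
by move=> x; apply: continuousD; [exact: continuous_dot|exact: cst_continuous].
Qed.

Lemma open_ohull K : K \in elt -> open (ohull K).
Proof.
move=> KT; rewrite -[ohull K]setCK; apply: closed_openC.
have -> : ~` ohull K = \bigcup_(i in [set i | i \in K]) ((fun x => blam K x i) @^-1` [set t | t <= 0]).
  apply/seteqP; split=> x.
    by move=> /existsNP[i /not_implyP[iK /negP]]; rewrite -leNgt => xi; exists i.
  by move=> [i iK /= xi] /(_ i iK); rewrite ltNge xi.
apply: closed_bigcup => // i _; apply: preimage_closed; last exact: closed_le.
by move=> x _; exact: continuous_blam.
Qed.

Lemma closed_hull K : K \in elt -> closed (hull K).
Proof.
move=> KT; have -> : hull K = \bigcap_(i in [set: I]) ((fun x => blam K x i) @^-1` [set t | 0 <= t]).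
  apply/seteqP; split=> x; first by move=> /(hullP x KT) h i _ /=.
  by move=> h; apply/(hullP x KT) => i; exact: h.
apply: closed_bigI => i _; apply: preimage_closed; last exact: closed_ge.
by move=> x _; exact: continuous_blam.
Qed.

Lemma ohull_hull K : K \in elt -> ohull K `<=` hull K.
Proof.
move=> KT x h; apply/(hullP x KT) => i; case: (boolP (i \in K)) => [/h/ltW//|iK].
by rewrite blam_out.
Qed.

Definition union : set 'rV[R]_d := \bigcup_(K in [set K | K \in elt]) hull K.

(** By conformity a common point is a convex combination of common vertices, and such weights are
    barycentric for both elements. This makes the piecewise definition of [hatf] consistent. *)
Lemma blam_agree K L x : K \in elt -> L \in elt -> hull K x -> hull L x ->
  blam K x =1 blam L x.
Proof.
move=> KT LT xK xL; have : hull (K :&: L) x.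
  by case: conf => _ _ _ /(_ K L KT LT) <-.
move=> [w [w0 wKL w1 xw]] i.
rewrite -(@blam_unique K x w)// -?(@blam_unique L x w)//.
- by split => // j jL; apply: wKL; rewrite inE (negbTE jL) andbF.
- by split => // j jK; apply: wKL; rewrite inE (negbTE jK).
Qed.

Lemma ohull_mem K L x : K \in elt -> L \in elt -> ohull K x -> hull L x -> K = L.
Proof.
move=> KT LT xK xL; apply/eqP; rewrite eqEcard (card_element KT) (card_element LT) leqnn andbT.
apply/fintype.subsetP => i iK; apply: contraTT isT => iL.
have := blam_agree KT LT (ohull_hull KT xK) xL i.
by rewrite (blam_out x LT iL) => h; have := xK i iK; rewrite h ltxx.
Qed.

Lemma ohull_polytope K : K \in elt -> ohull K `<=` polytope T.
Proof.
move=> KT x xK; have oK := open_ohull KT.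
rewrite /polytope /interior; rewrite nbhsE; exists (ohull K) => //.
by move=> y yK; exists K => //; exact: ohull_hull.
Qed.

Lemma closed_union : closed union.
Proof. by apply: closed_bigcup => // K; exact: closed_hull. Qed.

Lemma polytope_union : polytope T `<=` union.
Proof. exact: interior_subset. Qed.

Lemma closure_polytope_union : closure (polytope T) `<=` union.
Proof.
rewrite closureE => x; apply; split; [exact: closed_union|exact: polytope_union].
Qed.

(* Moving from a point of the simplex towards the barycentre enters the open simplex at once. *)
Lemma hull_approx K x : K \in elt -> hull K x ->
  exists c, forall t : R, 0 < t <= 1 -> ohull K (x + t *: (c - x)).
Proof.
move=> KT /(hullP x KT) hx; pose w (i : I) : R := (i \in K)%:R / d.+1%:R.
exists (\sum_i w i *: node i) => t /andP[t0 t1] i iK.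
have E := @blam_unique K (\sum_i w i *: node i) w KT.
have wE : w =1 blam K (\sum_i w i *: node i).
  apply: E; split => // [j jK|]; first by rewrite /w (negbTE jK) mul0r.
  rewrite -mulr_suml (_ : \sum_i _ = d.+1%:R) ?divff//.
  rewrite -(card_element KT) -sum1_card natr_sum [RHS]big_mkcond/=.
  by apply: eq_bigr => j _; case: ifP.
rewrite -(subrK (blam K x i) (blam K _ i)) (blamB _ _ _ KT) addrAC subrr add0r dotZr.
rewrite -(blamB _ _ _ KT) -wE /w iK mul1r.
have := hx i; have : 0 < d.+1%:R^-1 :> R by rewrite invr_gt0.
set u := d.+1%:R^-1; set b := blam K x i; nra.
Qed.

Lemma union_closure_polytope : union `<=` closure (polytope T).
Proof.
move=> x [K KT xK]; apply/closure_enorm => e e0.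
have [c hc] := hull_approx KT xK.
pose t : R := Num.min 1 (e / (enorm (c - x) + 1)).
have N0 : 0 < enorm (c - x) + 1 by rewrite ltr_wpDl ?enorm_ge0.
have t0 : 0 < t by rewrite lt_min ltr01 divr_gt0.
have t1 : t <= 1 by rewrite ge_min lexx.
exists (x + t *: (c - x)); first by apply: (ohull_polytope KT); apply: hc; rewrite t0.
rewrite addrAC subrr add0r enormZ gtr0_norm//.
apply: (@le_lt_trans _ _ (e / (enorm (c - x) + 1) * enorm (c - x))).
  by rewrite ler_wpM2r ?enorm_ge0// ge_min lexx orbT.
by rewrite mulrAC ltr_pdivrMr// ltr_pM2l// ltrDl.
Qed.

(** Whole hyperplanes rather than the faces of the simplices: a null set off which every point of
    the mesh lies in an open simplex. *)
Definition faces : set 'rV[R]_d :=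
  \bigcup_(p in [set: {set I} * I])
    [set x | [/\ p.1 \in elt, p.2 \in p.1 & blam p.1 x p.2 = 0]].

Lemma bgrad_neq0 K i : (0 < d)%N -> K \in elt -> i \in K -> bgrad K i != 0.
Proof.
move=> d0 KT iK; apply/eqP => b0.
have [j jK ji] : exists2 j, j \in K & j != i.
  have : (0 < #|K :\ i|)%N by have := cardsD1 i K; rewrite iK (card_element KT) add1n => -[] <-.
  by case/card_gt0P => j; rewrite !inE => /andP[]; exists j.
have h : blam K (node j) i = blam K (node i) i.
  by apply/eqP; rewrite -subr_eq0 blamB// b0 dot0l.
move: h; rewrite !blam_vertex// eqxx eq_sym (negbTE ji) => /eqP.
by rewrite eq_sym oner_eq0.
Qed.

Lemma lebesgue_faces : (0 < d)%N -> @lebesgue R d faces = 0%E.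
Proof.
move=> d0; apply: lebesgue_null_finite => -[K i] /=.
case: (boolP ((K \in elt) && (i \in K))) => [/andP[KT iK]|h].
  apply/eqP; rewrite eq_le outer_measure_ge0 andbT.
  rewrite -(lebesgue_hyperplane (blam K 0 i) (bgrad_neq0 d0 KT iK)).
  by apply: le_lebesgue => x [_ _] /=; rewrite (blam_affine x).
rewrite (_ : [set x | _] = set0); first exact: outer_measure0.
by apply/seteqP; split => // x [KT iK _]; move: h; rewrite KT iK.
Qed.

Lemma union_faces x : union x -> ~ faces x -> exists2 K, K \in elt & ohull K x.
Proof.
move=> [K KT xK] nf; exists K => // i iK; rewrite lt_def (hullP x KT).1// andbT.
by apply/eqP => b0; apply: nf; exists (K, i).
Qed.

Definition meshpick x : {set I} := xget finset.set0 [set K | K \in elt /\ hull K x].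

(** An explicit form of [hat]; the choice of the element made by [meshpick] is immaterial by
    [blam_agree]. *)
Definition hatf (j : I) x : R := if x \in union then blam (meshpick x) x j else 0.

Lemma hatfE K j x : K \in elt -> hull K x -> hatf j x = blam K x j.
Proof.
move=> KT xK; rewrite /hatf mem_set; last by exists K.
have [MT xM] : meshpick x \in elt /\ hull (meshpick x) x.
  exact: (@xgetI _ _ [set K | K \in elt /\ hull K x] K).
exact: blam_agree.
Qed.

Lemma hatf_out j x : ~ union x -> hatf j x = 0.
Proof. by move=> nx; rewrite /hatf; case: ifPn => // /set_mem. Qed.

Lemma hatf_ge0 j x : 0 <= hatf j x.
Proof.
case: (pselect (union x)) => [[K KT xK]|nx]; last by rewrite hatf_out.
by rewrite (hatfE j KT xK); apply: (hullP x KT).1.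
Qed.

Lemma hatf_le1 j x : hatf j x <= 1.
Proof.
case: (pselect (union x)) => [[K KT xK]|nx]; last by rewrite hatf_out.
by rewrite (hatfE j KT xK) blam_le1.
Qed.

Lemma node_element i : exists2 K, K \in elt & i \in K.
Proof. by case: conf => _ h _ _; exact: h. Qed.

Lemma union_node (i : I) : union (node i).
Proof. by have [K KT iK] := node_element i; exists K => //; exact: hull_node. Qed.

Lemma hatf_node (i j : I) : hatf i (node j) = (i == j)%:R.
Proof.
have [K KT jK] := node_element j.
by rewrite (hatfE i KT (hull_node jK)) blam_vertex.
Qed.

Lemma sum_hatf x : union x -> \sum_j hatf j x = 1.
Proof.
move=> [K KT xK]; rewrite -(blam_sum x KT); apply: eq_bigr => j _.
exact: hatfE.
Qed.

Lemma sum_hatf_node x : union x -> \sum_j hatf j x *: node j = x.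
Proof.
move=> [K KT xK]; rewrite -[RHS](blam_node x KT); apply: eq_bigr => j _.
by rewrite (hatfE j KT xK).
Qed.

End barycentric.

(** * Hat functions and the local structure of the mesh *)

Section hats.
Context (R : realType) (d : nat) (T : mesh R d).
Hypothesis conf : conforming T.
Local Notation I := 'I_(nnodes T).
Local Notation elt := (elements T).
Implicit Types (K L : {set I}) (x y q : 'rV[R]_d) (i j k : I).

Lemma nbhs_all (P : set 'rV[R]_d) x : (forall y, P y) -> nbhs x P.
Proof. by move=> h; apply/nbhs_enorm; exists 1 => // y _; exact: h. Qed.

Lemma nbhsS (P Q : set 'rV[R]_d) x : P `<=` Q -> nbhs x P -> nbhs x Q.
Proof. by move=> PQ; exact: filterS. Qed.

Lemma nbhs_forall (F : finType) (P : F -> set 'rV[R]_d) x :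
  (forall a, nbhs x (P a)) -> nbhs x [set y | forall a, P a y].
Proof.
move=> h; have /choice[t ht] : forall a, exists t, 0 < t /\ forall y, enorm (y - x) < t -> P a y.
  by move=> a; have [t ? ?] := (nbhs_enorm _ _).1 (h a); exists t.
apply/nbhs_enorm; exists (\big[Num.min/1]_a t a).
  by apply/bigmin_gtP; split => // a _; have [] := ht a.
move=> y yx a; apply: (ht a).2; apply: lt_le_trans yx _.
exact: bigmin_le_cond.
Qed.

Lemma closure_polytope : closure (polytope T) = union T.
Proof.
apply/seteqP; split; [exact: closure_polytope_union|exact: union_closure_polytope].
Qed.

(** The finitely many closed simplices that miss [x] stay away from a neighbourhood of [x]. *)
Lemma local_hulls x : nbhs x [set y | union T y ->
  exists2 K, K \in elt & hull K x /\ hull K y].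
Proof.
have H K : nbhs x [set y | K \in elt -> hull K y -> hull K x].
  case: (pselect (K \in elt /\ ~ hull K x)) => [[KT nx]|h].
    have : nbhs x (~` hull K).
      by apply: open_nbhs_nbhs; split => //; apply/closed_openC/closed_hull.
    by apply: filterS => y ny _ /ny.
  apply: nbhs_all => y KT yK; apply: contrapT => nx; exact: h.
by apply: (nbhsS _ (nbhs_forall H)) => y h [K KT yK]; exists K => //; split => //; exact: h.
Qed.

Lemma mem_hull_node K i : K \in elt -> hull K (node i) -> i \in K.
Proof.
move=> KT /(hatfE conf i KT); rewrite hatf_node// eqxx; apply: contra_eqT => iK.
by rewrite blam_out// oner_eq0.
Qed.

Lemma continuous_hatf i : {within closure (polytope T), continuous (hatf i)}.
Proof.
rewrite closure_polytope; apply/continuous_within_enormP => x Ux e e0.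
have H K : nbhs x [set y | K \in elt -> `|blam K y i - blam K x i| < e].
  case: (boolP (K \in elt)) => KT; last exact: nbhs_all.
  have /continuous_enormP/(_ e e0)[t t0 ht] := @continuous_blam _ _ _ conf K i KT x.
  by apply/nbhs_enorm; exists t => // y yx _; exact: ht.
have hI := filterI (nbhs_forall H) (local_hulls x).
have [t t0 ht] := (nbhs_enorm _ _).1 (hI (nbhs_filter x)).
exists t => // y Uy /ht[h1 /(_ Uy)[K KT [xK yK]]].
by rewrite !(hatfE conf i KT)//; exact: h1.
Qed.

Lemma fe_space_hatf i : fe_space T (polytope T) (hatf i).
Proof.
split; first exact: continuous_hatf.
move=> K KT; exists (bgrad K i), (blam K 0 i) => x xK.
by rewrite (hatfE conf i KT xK) (blam_affine conf x).
Qed.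

Lemma fe_spaceE v x : fe_space T (polytope T) v -> union T x ->
  v x = \sum_(j : I) hatf j x * v (node j).
Proof.
move=> [_ av] [K KT xK]; have [a [b ab]] := av K KT.
rewrite ab// -{1}(blam_node conf x KT) dot_sumr -[b]mul1r -(blam_sum conf x KT) mulr_suml -big_split/=.
apply: eq_bigr => j _; rewrite (hatfE conf j KT xK) dotZr -mulrDr.
case: (boolP (j \in K)) => jK; last by rewrite blam_out// !mul0r.
by rewrite -ab//; exact: hull_node.
Qed.

(** Finite element functions are determined by their nodal values, so the choice operator in [hat]
    has a single candidate. *)
Lemma hat_hatf i : hat (polytope T) i = hatf i.
Proof.
apply: xget_unique => [|v [fv vn v0]].
  split; first exact: fe_space_hatf.
    by move=> j; rewrite hatf_node// eq_sym.
  by move=> x; rewrite closure_polytope => /hatf_out; exact.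
apply/funext => x; case: (pselect (union T x)) => Ux; last first.
  by rewrite hatf_out// v0// closure_polytope.
rewrite (fe_spaceE fv Ux) (bigD1 i)//= vn eqxx mulr1 big1 ?addr0// => j ji.
by rewrite vn (negbTE ji) mulr0.
Qed.

(** A short step from an interior node in direction [q] ends in an element that contains the node.
    The coordinates at its other vertices vanish at the node and are nonnegative at the end of the
    step, so their slopes along [q] are nonnegative. *)
Lemma star_directions i q : polytope T (node i) ->
  exists K, [/\ K \in elt, i \in K & forall k, k != i -> 0 <= dot (bgrad K k) q].
Proof.
move=> Oi; have /nbhs_enorm[e e0 he] : nbhs (node i) (polytope T).
  by apply: open_nbhs_nbhs; split => //; exact: open_interior.
have /nbhs_enorm[t t0 ht] := local_hulls (node i).
have N0 : 0 < enorm q + 1 by rewrite ltr_wpDl ?enorm_ge0.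
pose s := Num.min e t / (enorm q + 1).
have m0 : 0 < Num.min e t by rewrite lt_min e0.
have s0 : 0 < s by rewrite divr_gt0.
have sq : enorm (node i + s *: q - node i) < Num.min e t.
  rewrite addrAC subrr add0r enormZ gtr0_norm// /s mulrAC ltr_pdivrMr// ltr_pM2l//.
  by rewrite ltrDl.
have [K KT [iK qK]] : exists2 K, K \in elt & hull K (node i) /\ hull K (node i + s *: q).
  apply: ht; first by apply: lt_le_trans sq _; rewrite ge_min lexx orbT.
  by apply: polytope_union; apply: he; apply: lt_le_trans sq _; rewrite ge_min lexx.
exists K; have iK' := mem_hull_node KT iK; split => // k ki.
have := (hullP conf _ KT).1 qK k; rewrite -(subrK (blam K (node i) k) (blam K _ k)).
rewrite (blamB conf _ _ _ KT) addrAC subrr add0r dotZr blam_vertex// (negbTE ki) addr0.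
by rewrite pmulr_rge0.
Qed.

(** Every y near x lies in the cone, seen from the node, of some element L. If x is in that cone
    too, then L and K overlap near the node on the segment towards x, so their affine coordinates at
    the node agree at x; being positive there, the coordinate stays positive near x and puts y into
    L. If x is not in the cone, points near x are not either. *)
Lemma hatf_pos_polytope i x : polytope T (node i) -> 0 < hatf i x -> polytope T x.
Proof.
move=> Oi xi; have [K KT xK] : union T x.
  by apply: contrapT => /hatf_out h; move: xi; rewrite h ltxx.
rewrite (hatfE conf i KT xK) in xi.
have iK : i \in K by apply: contraTT xi => iK; rewrite blam_out// ltxx.
have H L : nbhs x [set y | L \in elt -> i \in L ->
    (forall k, k != i -> 0 <= dot (bgrad L k) (y - node i)) -> hull L y].
  case: (boolP ((L \in elt) && (i \in L))) => [/andP[LT iL]|h]; last first.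
    by apply: nbhs_all => y LT iL; rewrite LT iL in h.
  have cb k : nbhs x [set y | `|blam L y k - blam L x k| < `|blam L x k| \/ blam L x k = 0].
    case: (eqVneq (blam L x k) 0) => [->|b0]; first by apply: nbhs_all => y; right.
    have b1 : 0 < `|blam L x k| by rewrite normr_gt0.
    have /continuous_enormP/(_ _ b1)[t t0 ht] := @continuous_blam _ _ _ conf L k LT x.
    by apply/nbhs_enorm; exists t => // y /ht; left.
  have bL (y : 'rV[R]_d) k : k != i -> blam L y k = dot (bgrad L k) (y - node i).
    by move=> ki; rewrite -(blamB conf _ _ _ LT) blam_vertex// (negbTE ki) subr0.
  case: (pselect (forall k, k != i -> 0 <= dot (bgrad L k) (x - node i))) => [h|].
    have xiL : blam L x i = blam K x i.
      have e1 := blamB conf (node i) x i LT; rewrite blam_vertex// eqxx in e1.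
      have e2 := blamB conf (node i) x i KT; rewrite blam_vertex// eqxx in e2.
      apply: (addIr (- 1)); rewrite e1 e2.
      (* So small that the coordinate at the node stays nonnegative in both elements, which puts the
         point into K and into L. *)
      pose s := (1 + `|dot (bgrad L i) (x - node i)| + `|dot (bgrad K i) (x - node i)|)^-1.
      have s0 : 0 < s by rewrite invr_gt0 ltr_wpDr// ltr_wpDr.
      have sM M : M = K \/ M = L -> hull M (node i + s *: (x - node i)).
        have sn (a : R) : `|a| <= `|dot (bgrad L i) (x - node i)| + `|dot (bgrad K i) (x - node i)| ->
            0 <= 1 + s * a.
          move=> ha; have : - `|a| <= a by rewrite lerNl ler_normr lerN2 lexx orbT.
          have sE : s * (1 + `|dot (bgrad L i) (x - node i)| + `|dot (bgrad K i) (x - node i)|) = 1.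
            by rewrite mulVf// gt_eqF// -invr_gt0.
          nra.
        move=> MKL; have [MT iM] : M \in elt /\ i \in M by case: MKL => ->.
        apply/(hullP conf) => // k.
        rewrite -(subrK (blam M (node i) k) (blam M _ k)) (blamB conf _ _ _ MT).
        rewrite addrAC subrr add0r dotZr blam_vertex//; case: (eqVneq k i) => [->|ki].
          by rewrite addrC; apply: sn; case: MKL => ->; rewrite ?lerDl ?lerDr.
        rewrite addr0 mulr_ge0 ?(ltW s0)//; case: MKL => ->; last exact: h.
        rewrite -(blamB conf _ _ _ KT) blam_vertex// (negbTE ki) subr0.
        exact: (hullP conf _ KT).1.
      have := blam_agree conf KT LT (sM K (or_introl erefl)) (sM L (or_intror erefl)) i.
      move=> /(congr1 (fun u => u - 1)).
      have e3 := blamB conf (node i) (node i + s *: (x - node i)) i KT.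
      have e4 := blamB conf (node i) (node i + s *: (x - node i)) i LT.
      rewrite blam_vertex// eqxx in e3; rewrite blam_vertex// eqxx in e4.
      by rewrite e3 e4 addrAC subrr add0r !dotZr => /(mulfI (lt0r_neq0 s0)) ->.
    apply: (nbhsS _ (cb i)) => y h1 LT' iL' hy; apply/(hullP conf) => // k.
    case: (eqVneq k i) => [->|ki]; last by rewrite bL// hy.
    rewrite xiL in h1; case: h1 => [|b0]; last by rewrite b0 ltxx in xi.
    by rewrite (gtr0_norm xi) ltr_distl subrr => /andP[/ltW].
  move=> /existsNP[k /not_implyP[ki /negP]]; rewrite -ltNge => kn.
  apply: (nbhsS _ (cb k)) => y h1 _ _ /(_ k ki).
  rewrite -(bL y k ki); rewrite -(bL x k ki) in kn.
  case: h1 => [|b0]; last by rewrite b0 ltxx in kn.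
  by rewrite (ltr0_norm kn) ltr_distl opprK addrC subrr => /andP[_]; rewrite leNgt => ->.
rewrite /polytope /interior; apply: (nbhsS _ (nbhs_forall H)) => y h.
have [L [LT iL hL]] := star_directions (y - node i) Oi.
by exists L => //; exact: h.
Qed.

Lemma interior_face K i j : polytope T (node i) -> K \in elt -> i \in K -> j \in K -> j != i ->
  exists2 L, L \in elt & K != L /\ (K :&: L)%SET = (K :\ j)%SET.
Proof.
move=> Oi KT iK jK ji.
(* Moving by [s] along [c] gives weight [s] to every vertex of the face other than [i], whose own
   weight 1 - s (d - 1) stays positive for s <= 1 / (d + 1). *)
pose c := \sum_(k in K :\ j) (node k - node i).
have dotc k : dot (bgrad K k) c = (if k \in K :\ j then 1 else 0) - (k == i)%:R * d%:R.
  rewrite /c dot_sumr (eq_bigr (fun l => (k == l)%:R - (k == i)%:R)); last first.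
    move=> l; rewrite !inE => /andP[_ lK].
    by rewrite -(blamB conf _ _ _ KT) !blam_vertex.
  rewrite sumrB sumr_const (_ : #|_| = d); last first.
    by have := cardsD1 j K; rewrite jK (card_element conf KT) add1n => -[].
  rewrite -[X in _ - X]mulr_natr; congr (_ - _).
  case: ifPn => kK.
    by rewrite (bigD1 k)//= eqxx big1 ?addr0// => l /andP[_ /negbTE]; rewrite eq_sym => ->.
  by rewrite big1// => l lK; case: eqP kK => // ->; rewrite lK.
have /nbhs_enorm[e e0 he] : nbhs (node i) (polytope T).
  by apply: open_nbhs_nbhs; split => //; exact: open_interior.
have N0 : 0 < enorm c + 1 by rewrite ltr_wpDl ?enorm_ge0.
pose s := Num.min (e / (enorm c + 1)) d.+1%:R^-1.
have s0 : 0 < s by rewrite lt_min divr_gt0// invr_gt0 ltr0n.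
pose p := node i + s *: c.
have Op : polytope T p.
  apply: he; rewrite addrAC subrr add0r enormZ gtr0_norm//.
  apply: (@le_lt_trans _ _ (e / (enorm c + 1) * enorm c)).
    by rewrite ler_wpM2r ?enorm_ge0// ge_min lexx.
  by rewrite mulrAC ltr_pdivrMr// ltr_pM2l// ltrDl.
have pk (l : I) : blam K p l = s * (if l \in K :\ j then 1 else 0) + (l == i)%:R * (1 - s * d%:R).
  rewrite -(subrK (blam K (node i) l) (blam K _ l)) (blamB conf _ _ _ KT).
  by rewrite addrAC subrr add0r dotZr blam_vertex// dotc;
    set X := (if _ then _ else _); set D := (l == i)%:R; ring.
have sd : s * d%:R < 1.
  apply: (@le_lt_trans _ _ (d.+1%:R^-1 * d%:R)); first by rewrite ler_wpM2r// ge_min lexx orbT.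
  by rewrite mulrC ltr_pdivrMr// mul1r ltr_nat.
have pF k : k \in K :\ j -> 0 < blam K p k.
  move=> kF; rewrite pk kF mulr1 ltr_wpDr// mulr_ge0// subr_ge0 ltW//.
have pj : blam K p j = 0.
  by rewrite pk (negbTE ji) !inE eqxx/= mulr0 mul0r addr0.
have pK : hull K p.
  apply/(hullP conf) => // k; case: (eqVneq k j) => [->|kj]; first by rewrite pj.
  case: (boolP (k \in K)) => kK; last by rewrite blam_out.
  by apply/ltW/pF; rewrite !inE kj.
have /nbhs_enorm[r r0 hr] : nbhs p [set y | polytope T y /\ (union T y ->
    exists2 L, L \in elt & hull L p /\ hull L y)].
  apply: filterI; last exact: local_hulls.
  by apply: open_nbhs_nbhs; split => //; exact: open_interior.
have M0 : 0 < enorm (node i - node j) + 1 by rewrite ltr_wpDl ?enorm_ge0.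
pose t := r / (enorm (node i - node j) + 1).
have t0 : 0 < t by rewrite divr_gt0.
have [|Oy] := hr (p + t *: (node i - node j)).
  rewrite addrAC subrr add0r enormZ gtr0_norm// /t mulrAC ltr_pdivrMr//.
  by rewrite ltr_pM2l// ltrDl.
case=> [|L LT [pL yL]]; first exact: polytope_union.
have KL : K != L.
  apply/eqP => KL; have := (hullP conf _ KT).1 (eq_ind_r (fun M => hull M _) yL KL) j.
  rewrite -(subrK (blam K p j) (blam K _ j)) (blamB conf _ _ _ KT) pj addr0.
  rewrite addrAC subrr add0r dotZr -(blamB conf _ _ _ KT) !blam_vertex// eqxx (negbTE ji).
  by rewrite mulr0n sub0r mulrN1 oppr_ge0 leNgt t0.
have FL : (K :\ j \subset K :&: L)%SET.
  apply/fintype.subsetP => k kF; rewrite inE; have := kF; rewrite !inE => /andP[_ ->] /=.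
  have := pF k kF; rewrite (blam_agree conf KT LT pK pL k); apply: contraTT => kL.
  by rewrite blam_out// ltxx.
exists L => //; split => //; apply/eqP; rewrite eq_sym eqEcard FL/=.
have cF : #|K :\ j| = d by have := cardsD1 j K; rewrite jK (card_element conf KT) add1n => -[].
rewrite cF -ltnS -(card_element conf KT); apply: proper_card.
rewrite finset.properEneq finset.subsetIl andbT; apply: contra_neq KL => KLK.
apply/eqP; rewrite eqEcard (card_element conf KT) (card_element conf LT) leqnn andbT.
by rewrite -KLK finset.subsetIr.
Qed.

End hats.

(** * Diameters, gradients and volumes of elements *)

Section sizes.
Context (R : realType) (d : nat) (T : mesh R d).
Hypothesis conf : conforming T.
Hypothesis d0 : (0 < d)%N.
Local Notation I := 'I_(nnodes T).
Local Notation elt := (elements T).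
Implicit Types (K L : {set I}) (x y q : 'rV[R]_d) (i j k : I).

Lemma hull_bounded K x : hull K x -> enorm x <= \sum_(i : I) enorm (node i).
Proof.
move=> [w [w0 _ w1 ->]]; apply: le_trans (enorm_sum _ _) _.
apply: ler_sum => i _; rewrite enormZ ger0_norm// -[leRHS]mul1r ler_wpM2r ?enorm_ge0//.
by rewrite -w1 (bigD1 i)//= lerDl sumr_ge0.
Qed.

Lemma le_diam K x y : hull K x -> hull K y -> enorm (x - y) <= diam K.
Proof.
move=> xK yK; apply: ub_le_sup; last by exists (x, y).
exists (\sum_(i : I) enorm (node i) + \sum_(i : I) enorm (node i)) => _ [[u v] [/= uK vK] <-].
by apply: le_trans (enormB _ _) _; apply: lerD; [exact: hull_bounded uK|exact: hull_bounded vK].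
Qed.

Lemma le_meshsize K x y : K \in elt -> hull K x -> hull K y -> enorm (x - y) <= meshsize T.
Proof.
move=> KT xK yK; apply: le_trans (le_diam xK yK) _.
exact: (@le_bigmax_cond _ _ _ 0 K (fun K => K \in elt) (@diam R d T) KT).
Qed.

Lemma diam_gt0 K : K \in elt -> 0 < diam K.
Proof.
move=> KT; have : (1 < #|K|)%N by rewrite (card_element conf KT) ltnS.
case/card_gt1P => i [j [iK jK ij]].
apply: lt_le_trans (le_diam (hull_node iK) (hull_node jK)).
apply: enorm_gt0; rewrite subr_eq0; apply: contra_neq ij => nij.
by case: conf => inj _ _ _; exact: inj.
Qed.

(** Shape regularity and quasi-uniformity give an inradius of at least kappa h / (2 sigma); half of
    it is given away because the supremum in [inradius] need not be attained. The ratio kappa / (4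
    sigma) is the constant [g] of all later sections. *)
Lemma inball sigma kappa K : 0 < kappa -> shape_regular T sigma -> quasi_uniform T kappa ->
  K \in elt -> 0 < sigma /\ exists c, forall x,
    enorm (x - c) <= kappa / (4 * sigma) * meshsize T -> hull K x.
Proof.
move=> k0 sr qu KT; have D0 := diam_gt0 KT.
have h1 := sr K KT; have h2 := qu K KT.
have r0 : 0 <= inradius K.
  case: (pselect (has_sup [set r : R | 0 <= r /\ exists c, forall x, enorm (x - c) <= r -> hull K x])).
    move=> hs; have [[r [r0 hr]] _] := hs; apply: (le_trans r0).
    exact: (ub_le_sup hs.2 (conj r0 hr)).
  by move=> /sup_out; rewrite /inradius => ->.
have s0 : 0 < sigma.
  rewrite ltNge; apply/negP => s0; have := lt_le_trans D0 h1.
  by rewrite ltNge mulr_le0_ge0// mulr_ge0.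
split => //.
have h0 : 0 < meshsize T.
  apply: lt_le_trans D0 _.
  exact: (@le_bigmax_cond _ _ _ 0 K (fun K => K \in elt) (@diam R d T) KT).
have rr : kappa / (4 * sigma) * meshsize T < inradius K.
  apply: (@lt_le_trans _ _ (kappa * meshsize T / (2 * sigma))).
    rewrite mulrAC ltr_pM2l ?mulr_gt0// ltf_pV2 ?posrE ?mulr_gt0// ltr_pM2r//; lra.
  by rewrite ler_pdivrMr ?mulr_gt0//; nra.
have rp : 0 <= kappa / (4 * sigma) * meshsize T.
  by rewrite mulr_ge0 ?divr_ge0 ?mulr_ge0// ltW.
have hs : has_sup [set r : R | 0 <= r /\ exists c, forall x, enorm (x - c) <= r -> hull K x].
  apply: contrapT => /sup_out; rewrite -/(inradius K) => z.
  by move: (le_lt_trans rp rr); rewrite z ltxx.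
have [|r [_ [c hc]] rlt] := sup_adherent (_ : 0 < inradius K - kappa / (4 * sigma) * meshsize T) hs.
  by rewrite subr_gt0.
exists c => x hx; apply: hc; apply: le_trans hx _.
by move: rlt; rewrite -/(inradius K) subKr => /ltW.
Qed.

Section constants.
Variables h g : R.
Hypothesis h0 : 0 < h.
Hypothesis g0 : 0 < g.
Hypothesis hulls_le : forall K x y, K \in elt -> hull K x -> hull K y -> enorm (x - y) <= h.
Hypothesis hulls_ge : forall K, K \in elt -> exists c, forall x, enorm (x - c) <= g * h -> hull K x.

(** Moving by g h along its gradient inside the inscribed ball, the coordinate grows by g h times
    the gradient norm, but it stays between 0 and 1. *)
Lemma bgrad_bound K i : K \in elt -> enorm (bgrad K i) <= (g * h)^-1.
Proof.
move=> KT; have [c hc] := hulls_ge KT; set a := bgrad K i; have gh := mulr_gt0 g0 h0.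
case: (eqVneq a 0) => [->|a0]; first by rewrite enorm0 invr_ge0 ltW.
have ea := enorm_gt0 a0.
pose x := c + (g * h / enorm a) *: a.
have xc : enorm (x - c) = g * h.
  by rewrite /x addrAC subrr add0r enormZ gtr0_norm ?divr_gt0// divfK// gt_eqF.
have xK : hull K x by apply: hc; rewrite xc.
have cK : hull K c by apply: hc; rewrite subrr enorm0 ltW.
have := blamB conf c x i KT; rewrite -/a {2}/x addrAC subrr add0r dotZr -enorm_dot.
have -> : g * h / enorm a * enorm a ^+ 2 = g * h * enorm a.
  by rewrite expr2 mulrA divfK// gt_eqF.
have := blam_le1 conf i KT xK; have := (hullP conf c KT).1 cK i => b1 b2 E.
rewrite -[(g * h)^-1]mul1r ler_pdivlMr// mulrC -E; lra.
Qed.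

Lemma vol_ohull_ge K : K \in elt -> (2 * (g * h / d%:R)) ^+ d <= vol (ohull K).
Proof.
move=> KT; have [c hc] := hulls_ge KT.
have dR : 0 < d%:R :> R by rewrite ltr0n.
have f1 : (@lebesgue R d (hull K) < +oo)%E.
  by apply: (@lebesgue_fin_enorm _ _ _ 0 (\sum_(i : I) enorm (node i))) => x /hull_bounded; rewrite subr0.
apply: (@le_trans _ _ (vol (hull K))).
  apply: (@vol_ge_enorm _ _ _ c) => //; first by rewrite divr_ge0// mulr_ge0// ltW.
  by move=> x; rewrite mulrCA divff ?mulr1 ?gt_eqF//; exact: hc.
have le1 : (@lebesgue R d (hull K) <= @lebesgue R d (ohull K))%E.
  apply: (@le_trans _ _ (@lebesgue R d (ohull K `|` faces T))).
    apply: le_lebesgue => x xK; case: (pselect (faces T x)) => fx; [by right|left].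
    have [L LT xL] := union_faces conf (ex_intro2 _ _ K KT xK) fx.
    by rewrite -(ohull_mem conf LT KT xL xK).
  apply: le_trans (outer_measureU2 _ _ _) _.
  by rewrite [X in (_ + X)%E](lebesgue_faces conf d0) adde0.
have f2 : (@lebesgue R d (ohull K) < +oo)%E.
  by apply: le_lt_trans f1; apply: le_lebesgue; exact: ohull_hull.
by rewrite /vol fine_le// ge0_fin_numE.
Qed.

Lemma vol_ohull_gt0 K : K \in elt -> 0 < vol (ohull K).
Proof.
move=> KT; apply: lt_le_trans (vol_ohull_ge KT).
by rewrite exprn_gt0// mulr_gt0// divr_gt0 ?mulr_gt0// ltr0n.
Qed.

End constants.
End sizes.

(** * Exterior balls of a polytope *)

Section exterior.
Context (R : realType) (d : nat) (T : mesh R d).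
Hypothesis conf : conforming T.
Local Notation I := 'I_(nnodes T).
Local Notation elt := (elements T).

(* The complement of the closed polytope is covered by the finitely many open convex
   cells cut out by one negative barycentric coordinate for each element; a boundary
   point lies in the closure of such a cell, which contains a fixed ball. *)
Lemma exterior_balls : exists c0 r0 : R, [/\ 0 < c0, 0 < r0 &
  forall (x : 'rV[R]_d) (r : R), boundary (polytope T) x -> 0 < r -> r <= r0 ->
    exists2 z, enorm (z - x) <= r & forall y, enorm (y - z) < c0 * r -> ~ closure (polytope T) y].
Proof.
pose cell (f : {ffun {set I} -> I}) : set 'rV[R]_d :=
  [set y | forall K, K \in elt -> blam K y (f K) < 0].
have cell_out f y : cell f y -> ~ union T y.
  by move=> cy [K KT /(hullP conf _ KT)/(_ (f K))]; rewrite leNgt cy.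
have open_cell f y : cell f y -> exists2 e, 0 < e & forall z, enorm (z - y) < e -> cell f z.
  move=> cy; apply/nbhs_enorm; apply: nbhs_forall => K.
  case: (boolP (K \in elt)) => KT; last exact: nbhs_all.
  have b0 : 0 < - blam K y (f K) by rewrite oppr_gt0 cy.
  have /continuous_enormP/(_ _ b0)[t t0 ht] := @continuous_blam _ _ _ conf K (f K) KT y.
  apply/nbhs_enorm; exists t => // z /ht; rewrite ltr_distl => /andP[_ + _].
  by rewrite subrr.
have bd f : exists p : 'rV[R]_d * R, 0 < p.2 /\ (cell f !=set0 -> forall z, enorm (z - p.1) < p.2 -> cell f z).
  case: (pselect (cell f !=set0)) => [[y cy]|h]; last by exists (0, 1).
  by have [e e0 he] := open_cell f y cy; exists (y, e).
have [p hp] := choice bd.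
pose N := 1 + \big[Num.max/0]_(K in elt) diam K + \sum_f enorm (p f).1 + \sum_(i : I) enorm (node i).
pose e := \big[Num.min/1]_f (p f).2.
have e0 : 0 < e by apply/bigmin_gtP; split => // f _; have [] := hp f.
have M0 : 0 <= \big[Num.max/0]_(K in elt) diam K by apply: bigmax_ge_id.
have S0 : 0 <= \sum_f enorm (p f).1 by apply: sumr_ge0 => f _; exact: enorm_ge0.
have S1 : 0 <= \sum_(i : I) enorm (node i) by apply: sumr_ge0 => f _; exact: enorm_ge0.
have N0 : 0 < N by rewrite /N -!addrA ltr_wpDr// !addr_ge0.
(* The homothety with centre x and ratio r / (2 N) brings the fixed ball of a cell, of radius at
   least [e], to distance at most r from x, with radius at least e r / (2 N). *)
exists (e / (2 * N)), N; split=> [||x r [cx nx] r0 rN] //.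
  by rewrite divr_gt0// mulr_gt0.
have xU := closure_polytope_union conf cx.
have nU : forall t, 0 < t -> exists2 y, ~ union T y & enorm (y - x) < t.
  move=> t t0; apply: contrapT => h; apply: nx; rewrite (interior_id _).1; last exact: open_interior.
  rewrite /polytope /interior; apply/nbhs_enorm; exists t => // y yx.
  by apply: contrapT => ny; apply: h; exists y.
(* Points off the closed polytope lie in some cell and there are finitely many cells, so one of them
   accumulates at x. *)
have [f hf] : exists f, forall t, 0 < t -> exists2 y, cell f y & enorm (y - x) < t.
  apply: contrapT => /forallNP h.
  have : nbhs x [set y | forall f, ~ cell f y].
    apply: nbhs_forall => f; have /existsNP[t /not_implyP[t0 ht]] := h f.
    by apply/nbhs_enorm; exists t => // y yx cy; apply: ht; exists y.
  move=> /nbhs_enorm[t t0 ht]; have [y ny yx] := nU t t0.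
  have : forall K, exists i, K \in elt -> blam K y i < 0.
    move=> K; case: (boolP (K \in elt)) => KT.
      apply: contrapT => /forallNP hK; apply: ny; exists K => //; apply/(hullP conf) => // i.
      by have /not_implyP[_ /negP] := hK i; rewrite -leNgt.
    have [K' K'T _] := xU; have : (0 < #|K'|)%N by rewrite (card_element conf K'T).
    by case/card_gt0P => i _; exists i.
  move=> /choice[F hF]; apply: (ht y yx [ffun K => F K]) => K KT.
  by rewrite ffunE; exact: hF.
have [_ /(_ _)] := hp f; set q := (p f).1; set s := (p f).2 => hq.
have {}hq : forall z, enorm (z - q) < s -> cell f z.
  by apply: hq; have [y ? _] := hf 1 ltr01; exists y.
have es : e <= s by exact: bigmin_le_cond.
have qx : enorm (q - x) <= N - 1.
  apply: le_trans (enormB _ _) _; rewrite /N.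
  have : enorm q <= \sum_f enorm (p f).1 by rewrite (bigD1 f)//= lerDl sumr_ge0// => i _; exact: enorm_ge0.
  have [K KT xK] := xU; have := hull_bounded xK; lra.
pose t := r / (2 * N).
have t0 : 0 < t by rewrite divr_gt0// mulr_gt0.
have t1 : t < 1 by rewrite ltr_pdivrMr ?mulr_gt0//; lra.
exists (x + t *: (q - x)).
  rewrite addrAC subrr add0r enormZ gtr0_norm//.
  apply: (@le_trans _ _ (t * N)); first by rewrite ler_wpM2l ?(ltW t0)//; lra.
  rewrite /t; have -> : r / (2 * N) * N = r / 2 by field; rewrite gt_eqF.
  lra.
move=> y hy; rewrite (closure_polytope conf); apply: (cell_out f).
(* [y] is a convex combination of x, where the coordinates selected by the cell are at most 0 as
   limits, and of [q'], which lies in the fixed ball of the cell; so [y] is in the cell. *)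
pose q' := x + t^-1 *: (y - x).
have tn : t != 0 by rewrite gt_eqF.
have q'q : enorm (q' - q) < s.
  have -> : q' - q = t^-1 *: (y - (x + t *: (q - x))).
    rewrite opprD addrA [in RHS]scalerBr scalerA mulVf// scale1r opprB.
    by rewrite /q' addrA [x + _]addrC.
  rewrite enormZ gtr0_norm ?invr_gt0// mulrC ltr_pdivrMr//.
  apply: lt_le_trans hy _; rewrite /t mulrA (mulrAC e) ler_pM2r ?invr_gt0 ?mulr_gt0//.
  by rewrite ler_pM2r.
move=> K KT.
have yE : blam K y (f K) = (1 - t) * blam K x (f K) + t * blam K q' (f K).
  have -> : y = (1 - t) *: x + t *: q'.
    by rewrite /q' scalerDr scalerA mulfV// scale1r scalerBl scale1r addrA subrK addrC subrK.
  rewrite (blam_affine conf (_ + _) _ KT) (blam_affine conf x _ KT) (blam_affine conf q' _ KT).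
  by rewrite dotDr !dotZr; ring.
have xle : blam K x (f K) <= 0.
  rewrite leNgt; apply/negP => b0.
  have /continuous_enormP/(_ _ b0)[t' t'0 ht] := @continuous_blam _ _ _ conf K (f K) KT x.
  have [y' cy' /ht] := hf t' t'0; rewrite ltr_distl subrr => /andP[+ _].
  by rewrite ltNge ltW// cy'.
have := hq q' q'q K KT; rewrite yE; nra.
Qed.
End exterior.

(** * Stiffness matrix and integration by parts *)

Section stiffness.
Context (R : realType) (d : nat) (T : mesh R d).
Hypothesis conf : conforming T.
Hypothesis d0 : (0 < d)%N.
Local Notation I := 'I_(nnodes T).
Local Notation elt := (elements T).
Local Notation Omega := (polytope T).
Local Notation leb := (@lebesgue R d).
Implicit Types (K L : {set I}) (x y q : 'rV[R]_d) (i j k : I).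

Lemma derive_near_affine (v : 'rV[R]_d -> R) (a : 'rV[R]_d) (b : R) x :
  nbhs x [set y | v y = dot a y + b] ->
  forall l, derivable v x (delta_mx 0 l) /\ partial l v x = a 0 l.
Proof.
move=> /nbhs_enorm[e e0 he] l.
have vx : v x = dot a x + b by apply: he; rewrite subrr enorm0.
have cv : h^-1 *: (v (h *: delta_mx 0 l + x) - v x) @[h --> 0^'] --> (a 0 l : R^o).
  apply: cvg_near_cst; near=> h.
  have h0 : h != 0 by near: h; exact: nbhs_dnbhs_neq.
  rewrite he; last first.
    rewrite addrK enormZ enorm_delta mulr1; near: h.
    exact: dnbhs0_lt.
  rewrite vx dotDr dotZr dot_delta opprD addrACA subrr addr0 addrK.
  by rewrite -[LHS]/(h^-1 * _) mulKf.
by split; [apply/cvg_ex; eexists; exact: cv|exact: cvg_lim cv].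
Unshelve. all: by end_near. Qed.

Lemma grad_near_affine (v : 'rV[R]_d -> R) (a : 'rV[R]_d) (b : R) x :
  nbhs x [set y | v y = dot a y + b] -> grad v x = a.
Proof.
move=> h; apply/rowP => l; rewrite mxE.
by have [_ ] := derive_near_affine h l.
Qed.

Lemma ohull_nbhs K x : K \in elt -> ohull K x -> nbhs x (ohull K).
Proof. by move=> KT xK; apply: open_nbhs_nbhs; split => //; exact: open_ohull. Qed.

Lemma fe_affine_ohull v K x : fe_space T Omega v -> K \in elt -> ohull K x ->
  nbhs x [set y | v y = dot (\sum_(j : I) v (node j) *: bgrad K j) y +
                        \sum_(j : I) v (node j) * blam K 0 j].
Proof.
move=> fv KT xK; apply: nbhsS (ohull_nbhs KT xK) => y /(ohull_hull conf KT) yK /=.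
rewrite (fe_spaceE conf fv); last by exists K.
rewrite dotC dot_sumr -big_split/=; apply: eq_bigr => j _.
by rewrite (hatfE conf j KT yK) (blam_affine conf y j KT) dotZr [dot y _]dotC; ring.
Qed.

Lemma grad_fe v K x : fe_space T Omega v -> K \in elt -> ohull K x ->
  grad v x = \sum_(j : I) v (node j) *: bgrad K j.
Proof. by move=> fv KT xK; exact: grad_near_affine (fe_affine_ohull fv KT xK). Qed.

Lemma grad_hatf i K x : K \in elt -> ohull K x -> grad (hatf i) x = bgrad K i.
Proof.
move=> KT xK; rewrite (grad_fe (fe_space_hatf conf i) KT xK) (bigD1 i)//= hatf_node// eqxx.
by rewrite scale1r big1 ?addr0// => j ji; rewrite hatf_node// eq_sym (negbTE ji) scale0r.
Qed.

Lemma union_enorm x : union T x -> enorm x <= \sum_(i : I) enorm (node i).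
Proof. by move=> [K KT xK]; exact: hull_bounded xK. Qed.

Lemma leb_union_fin (D : set 'rV[R]_d) : D `<=` union T -> (leb D < +oo)%E.
Proof.
move=> DU; apply: (@lebesgue_fin_enorm _ _ _ 0 (\sum_(i : I) enorm (node i))) => x /DU.
by rewrite subr0; exact: union_enorm.
Qed.

Lemma leb_polytope_fin : (leb Omega < +oo)%E.
Proof. by apply: leb_union_fin; exact: polytope_union. Qed.

Lemma mset_polytope : mset Omega.
Proof. by apply: open_measurable_row; exact: open_interior. Qed.

Lemma mset_ohull K : K \in elt -> mset (ohull K).
Proof. by move=> KT; apply: open_measurable_row; exact: open_ohull. Qed.

(** Integral of a function that is constant on each open element. It is stated for a family of
    elements that fills [D] up to [faces], to serve for the polytope, for a pair of neighbours and
    for a star. *)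
Lemma integ_step (E : {set {set I}}) (D : set 'rV[R]_d) (f : 'rV[R]_d -> R) (c : {set I} -> R) :
  {subset E <= elt} -> mset D -> (leb D < +oo)%E ->
  (forall x, D x -> ~ faces T x -> exists2 K, K \in E & ohull K x) ->
  (forall K, K \in E -> ohull K `<=` D) ->
  (forall K x, K \in E -> ohull K x -> f x = c K) ->
  intble D f /\ integ D f = \sum_(K in E) c K * vol (ohull K).
Proof.
move=> EE mD fD DE ED fc.
pose g x := \sum_(K in E) c K * \1_(ohull K) x.
pose G K x := if K \in E then c K * \1_(ohull K) x else 0 : R.
have iG K : intble D (G K).
  rewrite /G; case: (boolP (K \in E)) => KE; last exact: (intble_cst 0 mD fD).
  by apply: intbleZ => //; apply: intble_indic => //; apply/mset_ohull/EE.
have gE x : g x = \sum_K G K x by rewrite /g big_mkcond.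
have ig : intble D g.
  by apply: eq_intble mD _ (intble_sum (index_enum _) xpredT mD iG) => x _; rewrite gE.
have [|i1 ->] := @eq_intble_null _ _ D (faces T) f g mD (lebesgue_faces conf d0) ig.
  move=> x Dx /(DE x Dx)[K KE xK]; rewrite (fc K x KE xK) /g (bigD1 K)//= indicE mem_set// mulr1.
  rewrite big1 ?addr0// => L /andP[LE LK]; rewrite indicE memNset ?mulr0// => xL.
  by rewrite (ohull_mem conf (EE _ KE) (EE _ LE) xK (ohull_hull conf (EE _ LE) xL)) eqxx in LK.
split => //; rewrite (eq_integ (fun x _ => gE x)) integ_sum// [RHS]big_mkcond/=.
apply: eq_bigr => K _; rewrite /G; case: ifPn => KE; last first.
  by rewrite integ0.
rewrite integZ//; last by apply: intble_indic => //; apply/mset_ohull/EE.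
rewrite integ_indic//; last by apply/mset_ohull/EE.
by rewrite setIidl//; exact: ED.
Qed.

Lemma integ_polytope (f : 'rV[R]_d -> R) (c : {set I} -> R) :
  (forall K x, K \in elt -> ohull K x -> f x = c K) ->
  intble Omega f /\ integ Omega f = \sum_(K in elt) c K * vol (ohull K).
Proof.
move=> fc; apply: integ_step => //.
- exact: mset_polytope.
- exact: leb_polytope_fin.
- by move=> x /polytope_union Ux nf; have [K KT xK] := union_faces conf Ux nf; exists K.
- by move=> K KT; exact: ohull_polytope.
Qed.

(** The negative of the usual element stiffness matrix: with this sign the off-diagonal entries are
    nonnegative and [kap] divided by [mass] is the discrete Laplacian itself. *)
Definition stiff K i j : R := - (vol (ohull K) * dot (bgrad K i) (bgrad K j)).

Definition kap i j : R := \sum_(K in elt) stiff K i j.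

Definition mass i : R := integ Omega (hatf i).

Lemma integ_grad_hatf v i : fe_space T Omega v ->
  integ Omega (fun x => dot (grad v x) (grad (hatf i) x)) = - \sum_j kap i j * v (node j).
Proof.
move=> fv; have [|_ ->] := @integ_polytope (fun x => dot (grad v x) (grad (hatf i) x))
    (fun K => dot (\sum_(j : I) v (node j) *: bgrad K j) (bgrad K i)).
  by move=> K x KT xK; rewrite (grad_fe fv KT xK) (grad_hatf i KT xK).
rewrite /kap; under [in RHS]eq_bigr do rewrite mulr_suml.
rewrite exchange_big/= -sumrN; apply: eq_bigr => K KT.
rewrite dotC dot_sumr mulr_suml -sumrN; apply: eq_bigr => j _.
by rewrite dotZr /stiff; ring.
Qed.

Lemma discrete_laplacianE v i : fe_space T Omega v ->
  discrete_laplacian Omega v i = (mass i)^-1 * \sum_j kap i j * v (node j).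
Proof.
by move=> fv; rewrite /discrete_laplacian !hat_hatf// integ_grad_hatf// mulrN mulNr opprK.
Qed.

Lemma sum_kap i : \sum_j kap i j = 0.
Proof.
rewrite exchange_big/= big1// => K KT; rewrite /stiff sumrN -mulr_sumr -dot_sumr.
by rewrite sum_bgrad// dot0r mulr0 oppr0.
Qed.

Lemma sum_stiff_dot K i q : K \in elt ->
  \sum_j stiff K i j * dot q (node j) = - (vol (ohull K) * dot (bgrad K i) q).
Proof.
move=> KT; rewrite -[X in _ = - (_ * dot X q)](sum_dot_bgrad conf (bgrad K i) KT).
have -> : dot (\sum_(j : I) dot (bgrad K j) (bgrad K i) *: node j) q =
    \sum_(j : I) dot (bgrad K j) (bgrad K i) * dot q (node j).
  by rewrite dotC dot_sumr; apply: eq_bigr => j _; rewrite dotZr.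
rewrite mulr_sumr -sumrN; apply: eq_bigr => j _.
by rewrite /stiff [dot (bgrad K j) _]dotC; ring.
Qed.

Hypothesis acute : face_weakly_acute T Omega.
Hypothesis vol_pos : forall K, K \in elt -> 0 < vol (ohull K).

(** Acuteness is tested on the two elements that share the face opposite to [j]. The hat function of
    [j] vanishes on the neighbour, so the integral reduces to [K] and the sign holds element by
    element. *)
Lemma stiff_ge0 K i j : Omega (node i) -> K \in elt -> i != j -> 0 <= stiff K i j.
Proof.
move=> Oi KT ij; case: (boolP (i \in K)) => iK; last first.
  by rewrite /stiff bgrad_out// dot0l mulr0 oppr0.
case: (boolP (j \in K)) => jK; last first.
  by rewrite /stiff (bgrad_out conf KT jK) dot0r mulr0 oppr0.
have ji : j != i by rewrite eq_sym.
have [L LT [KL KLE]] := interior_face conf Oi KT iK jK ji.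
have cKL : #|(K :&: L)%SET| = d.
  by rewrite KLE; have := cardsD1 j K; rewrite jK (card_element conf KT) add1n => -[].
have := acute KT LT KL cKL ij; rewrite !hat_hatf//.
have KLs : {subset [set K; L]%SET <= elt}.
  by move=> M; rewrite !inE => /orP[] /eqP ->.
have sub : hull K `|` hull L `<=` union T.
  by move=> x [xK|xL]; [exists K|exists L].
have [|||||_ ->] := @integ_step [set K; L]%SET (hull K `|` hull L)
  (fun x => dot (grad (hatf i) x) (grad (hatf j) x)) (fun M => dot (bgrad M i) (bgrad M j)) KLs.
- apply: measurableU; apply: closed_measurable_row; exact: closed_hull.
- exact: leb_union_fin.
- move=> x xKL nf; have [M MT xM] := union_faces conf (sub x xKL) nf; exists M => //.
  by case: xKL => [/(ohull_mem conf MT KT xM)|/(ohull_mem conf MT LT xM)] ->; rewrite !inE eqxx ?orbT.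
- by move=> M; rewrite !inE => /orP[] /eqP -> x; [left|right]; apply: ohull_hull.
- by move=> M x /KLs MT xM; rewrite !(grad_hatf _ MT xM).
rewrite (big_setD1 K) ?inE ?eqxx//= (_ : ([set K; L] :\ K)%SET = [set L]%SET); last first.
  apply/setP => M; rewrite !inE; case: (eqVneq M K) => [->|] //=; by rewrite (negbTE KL).
rewrite big_set1 (_ : bgrad L j = 0); last first.
  apply: bgrad_out => //; apply/negP => jL.
  have jKL : j \in (K :&: L)%SET by rewrite inE jK.
  by move: jKL; rewrite KLE !inE eqxx.
rewrite dot0r mul0r addr0 pmulr_lle0; last exact: vol_pos.
by move=> h; rewrite /stiff oppr_ge0 pmulr_rle0//; exact: vol_pos.
Qed.

Lemma kap_ge0 i j : Omega (node i) -> i != j -> 0 <= kap i j.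
Proof. by move=> Oi ij; apply: sumr_ge0 => K KT; exact: stiff_ge0. Qed.

End stiffness.

(** Continuous induction on [0, 1]. It spares counting the elements that a segment crosses. *)
Lemma locally_lipschitz (R : realType) (f : R -> R) (L : R) : 0 <= L ->
  (forall t, 0 <= t <= 1 -> exists2 e, 0 < e & forall s, `|s - t| < e -> `|f s - f t| <= L * `|s - t|) ->
  `|f 1 - f 0| <= L.
Proof.
move=> L0 lf.
pose S := [set t : R | 0 <= t <= 1 /\ `|f t - f 0| <= L * t].
have S0 : S 0 by split; rewrite ?lexx ?ler01// subrr normr0 mulr0.
have uS : ubound S 1 by move=> t [/andP[]].
have hs : has_sup S by split; [exists 0|exists 1].
pose s := sup S.
have s0 : 0 <= s by apply: ub_le_sup => //; exists 1.
have s1 : s <= 1 by apply: ge_sup => //; exists 0.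
have [e e0 he] := lf s (introT andP (conj s0 s1)).
have step t u : t <= u -> `|f t - f 0| <= L * t -> `|f u - f t| <= L * (u - t) -> `|f u - f 0| <= L * u.
  move=> tu h1 h2; rewrite -(subrKA (f t)); apply: le_trans (ler_normD _ _) _.
  by apply: le_trans (lerD h2 h1) _; rewrite -mulrDr subrK.
have Ss : S s.
  split; first by rewrite s0.
  have [t [t01 ht] st] := sup_adherent e0 hs.
  have ts : t <= s by apply: ub_le_sup => //; exists 1.
  apply: (step t) => //; rewrite distrC -[s - t]ger0_norm ?subr_ge0// [`|s - t|]distrC.
  by apply: he; rewrite distrC ger0_norm ?subr_ge0// ltrBlDl -ltrBlDr.
suff s11 : s = 1 by have [_] := Ss; rewrite s11 mulr1.
apply/eqP; rewrite eq_le s1 leNgt; apply/negP => slt.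
pose u := Num.min 1 (s + e / 2).
have su : s < u by rewrite lt_min slt/= ltrDl divr_gt0.
have : u <= s.
  apply: ub_le_sup; first by exists 1.
  split; first by rewrite (le_trans s0 (ltW su)) ge_min lexx.
  apply: (step s) => //; first exact: ltW.
    by have [] := Ss.
  rewrite -[u - s]ger0_norm ?subr_ge0 ?(ltW su)//; apply: he.
  rewrite ger0_norm ?subr_ge0 ?(ltW su)// ltrBlDl.
  apply: (@le_lt_trans _ _ (s + e / 2)); first by rewrite ge_min lexx orbT.
  by rewrite ltrD2l ltr_pdivrMr// ltr_pMr// ltr1n.
by rewrite leNgt su.
Qed.

(** * Lipschitz bound for hat functions and integration by parts *)

Section hat_lipschitz.
Context (R : realType) (d : nat) (T : mesh R d).
Hypothesis conf : conforming T.
Hypothesis d0 : (0 < d)%N.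
Local Notation I := 'I_(nnodes T).
Local Notation elt := (elements T).
Local Notation Omega := (polytope T).
Local Notation leb := (@lebesgue R d).
Variables (i : I) (Lc : R).
Hypothesis Oi : Omega (node i).
Hypothesis Lc0 : 0 <= Lc.
Hypothesis Lcb : forall K j, K \in elt -> enorm (bgrad K j) <= Lc.

Lemma hatf_zero x : ~ Omega x -> hatf i x = 0.
Proof.
move=> nx; apply/eqP; rewrite eq_le hatf_ge0// andbT leNgt.
by apply/negP => /(hatf_pos_polytope conf Oi).
Qed.

(** Locally two points of the closed polytope share an element. The bound holds on the whole space
    because the hat function of an interior node vanishes off [Omega]. *)
Lemma hatf_lipschitz x y : `|hatf i y - hatf i x| <= Lc * enorm (y - x).
Proof.
pose f t := hatf i (x + t *: (y - x)).
have -> : hatf i y = f 1 by rewrite /f scale1r [x + _]addrC subrK.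
have -> : hatf i x = f 0 by rewrite /f scale0r addr0.
apply: locally_lipschitz; first by rewrite mulr_ge0 ?enorm_ge0.
move=> t _; set z := x + t *: (y - x).
have H : nbhs z [set w | `|hatf i w - hatf i z| <= Lc * enorm (w - z)].
  have z1 : nbhs z [set w | union T w -> `|hatf i w - hatf i z| <= Lc * enorm (w - z)].
    apply: nbhsS (local_hulls conf z) => w h /h [K KT [zK wK]].
    rewrite (hatfE conf i KT zK) (hatfE conf i KT wK) blamB//.
    by apply: le_trans (cauchy_dot _ _) _; rewrite ler_wpM2r ?enorm_ge0// Lcb.
  case: (pselect (Omega z)) => [Oz|nz].
    have Oz' : nbhs z Omega by apply: open_nbhs_nbhs; split => //; exact: open_interior.
    apply: (nbhsS _ (@filterI _ (nbhs z) (nbhs_filter z) _ _ z1 Oz')) => w [h Ow].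
    by apply: h; exact: polytope_union.
  apply: nbhsS z1 => w h; case: (pselect (union T w)) => [/h//|nw] /=.
  by rewrite (hatf_zero nz) hatf_out// subrr normr0 mulr_ge0 ?enorm_ge0.
have /nbhs_enorm[e e0 he] := H.
have N0 : 0 < enorm (y - x) + 1 by rewrite ltr_wpDl ?enorm_ge0.
have E s : x + s *: (y - x) - z = (s - t) *: (y - x).
  by rewrite /z opprD addrACA subrr add0r scalerBl.
exists (e / (enorm (y - x) + 1)); first exact: divr_gt0.
move=> s st; apply: le_trans (he _ _) _.
  rewrite E enormZ; apply: (@le_lt_trans _ _ (`|s - t| * (enorm (y - x) + 1))).
    by rewrite ler_wpM2l// lerDl.
  by rewrite -ltr_pdivlMr.
by rewrite E enormZ [`|s - t| * _]mulrC mulrA.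
Qed.

Lemma mfn_hatf : mfn Omega (hatf i).
Proof.
apply: mfn_continuous; first exact: open_interior.
move=> x Ox; apply/continuous_enormP => e e0.
have N0 : 0 < Lc + 1 by rewrite ltr_wpDl.
exists (e / (Lc + 1)); first exact: divr_gt0.
move=> y; rewrite ltr_pdivlMr// => yx; apply: le_lt_trans (hatf_lipschitz _ _) _.
apply: le_lt_trans yx; rewrite mulrC ler_wpM2l ?enorm_ge0// lerDl//.
Qed.

Lemma intble_hatfM (f : 'rV[R]_d -> R) : intble Omega f -> intble Omega (fun x => f x * hatf i x).
Proof.
move=> mf; apply: (intbleM (c := 1)) => //; [exact: mset_polytope|exact: mfn_hatf|].
by move=> x _; rewrite ger0_norm ?hatf_ge0// hatf_le1.
Qed.

Lemma intble_hatf : intble Omega (hatf i).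
Proof.
apply: (intble_bounded (c := 1)); [exact: mset_polytope|exact: leb_polytope_fin|exact: mfn_hatf|].
by move=> x _; rewrite ger0_norm ?hatf_ge0// hatf_le1.
Qed.

Section ibp.
Variables (g : 'rV[R]_d -> R) (k : 'I_d) (C0 C1 : R).
Hypothesis g_derivable : forall x, Omega x -> derivable g x (delta_mx 0 k).
Hypothesis g_le : forall x, Omega x -> `|g x| <= C0.
Hypothesis dg_le : forall x, Omega x -> `|partial k g x| <= C1.
Hypothesis mg : mfn Omega g.
Hypothesis mdg : mfn Omega (partial k g).

(* Difference quotients are shifted from the hat function to g by translation
   invariance; they stay bounded because the hat function is Lipschitz and vanishes
   outside Omega, so where the shifted point leaves Omega it is at most Lc times the step. *)
Lemma integration_by_parts :
  intble Omega (fun x => g x * partial k (hatf i) x) /\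
  integ Omega (fun x => g x * partial k (hatf i) x) =
  - integ Omega (fun x => partial k g x * hatf i x).
Proof.
have mO := @mset_polytope _ _ T; have fO := leb_polytope_fin T.
pose e : 'rV[R]_d := delta_mx 0 k.
pose t (n : nat) : R := n.+1%:R^-1.
have t0 n : 0 < t n by rewrite invr_gt0.
pose G := g \_ Omega.
have GE x : Omega x -> G x = g x by move=> Ox; rewrite /G patchE mem_set.
have G0 x : ~ Omega x -> G x = 0 by move=> Ox; rewrite /G patchE memNset.
have [z Oz] : exists z, Omega z by exists (node i).
have C00 : 0 <= C0 by apply: le_trans (g_le Oz).
have C10 : 0 <= C1 by apply: le_trans (dg_le Oz).
have Gb x : `|G x| <= C0.
  by case: (pselect (Omega x)) => Ox; [rewrite GE// g_le|rewrite G0// normr0].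
have mG : mfn setT G by exact: (measurable_restrictT (g : Rn R d -> R) mO).1 mg.
have unit1 : (1%:M : 'M[R]_d) \in unitmx by exact: unitmx1.
have shift (w : 'rV[R]_d) (F : 'rV[R]_d -> R) : intble setT F ->
    intble setT (fun x => F (x + w)) /\ integ setT (fun x => F (x + w)) = integ setT F.
  move=> iF; have [] := integ_affine w unit1 iF; rewrite det1 normr1 invr1 mul1r.
  rewrite (_ : (fun x => F (x *m 1%:M + w)) = (fun x => F (x + w)))//.
  by apply/funext => x; rewrite mulmx1.
have mshift (w : 'rV[R]_d) (F : 'rV[R]_d -> R) : mfn setT F -> mfn setT (fun x => F (x + w)).
  move=> mF; have mf := measurable_row_affine w unit1.
  have := measurableT_comp mF mf; apply: eq_measurable_fun => x _ /=.
  by rewrite mulmx1.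
have iOG (w : 'rV[R]_d) : intble Omega (fun x => G (x + w) * hatf i x).
  apply: intble_hatfM; apply: (intble_bounded (c := C0)) => //.
  by apply: mfnS (mshift w G mG) => //; exact: measurableT.
have hatshift (w : 'rV[R]_d) : mfn setT (fun x => hatf i (x + w)).
  apply: mshift; have -> : hatf i = (hatf i) \_ Omega.
    apply/funext => x; rewrite patchE; case: ifPn => // /negP nx.
    by rewrite hatf_zero// => Ox; apply: nx; rewrite inE.
  exact: (measurable_restrictT (hatf i : Rn R d -> R) mO).1 mfn_hatf.
have hatb (w x : 'rV[R]_d) : `|hatf i (x + w)| <= 1 by rewrite ger0_norm ?hatf_ge0// hatf_le1.
have igH (w : 'rV[R]_d) : intble Omega (fun x => g x * hatf i (x + w)).
  apply: (intbleM (c := 1)) => //; last exact: intble_bounded g_le.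
  by apply: mfnS (hatshift w) => //; exact: measurableT.
have swap (w : 'rV[R]_d) : integ Omega (fun x => g x * hatf i (x - w)) =
    integ Omega (fun x => G (x + w) * hatf i x).
  pose F x := G x * hatf i (x - w).
  have FO : integ setT F = integ Omega (fun x => g x * hatf i (x - w)).
    rewrite (@integ_patch _ _ Omega setT F)//; last by move=> x _ /G0; rewrite /F => ->; rewrite mul0r.
    by apply: eq_integ => x Ox; rewrite /F GE.
  have iF : intble setT F.
    apply: (intble_patch mO measurableT) => //; first by move=> x _ /G0; rewrite /F => ->; rewrite mul0r.
    by apply: eq_intble mO _ (igH (- w)) => x Ox; rewrite /F GE.
  rewrite -FO -((shift w F iF).2).
  rewrite (@integ_patch _ _ Omega setT (fun x => F (x + w)))//.
    by apply: eq_integ => x Ox; rewrite /F addrK.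
  by move=> x _ nx; rewrite /F addrK hatf_zero// mulr0.
pose A n x := (t n)^-1 * (g x * hatf i (x - t n *: e) - g x * hatf i x).
pose B n x := (t n)^-1 * (G (x + t n *: e) * hatf i x - G (x + 0) * hatf i x).
have AB n : integ Omega (A n) = integ Omega (B n).
  have i0 : intble Omega (fun x => g x * hatf i x).
    by apply: eq_intble mO _ (igH 0) => x _; rewrite addr0.
  rewrite /A /B !integZ//; [|exact: intbleB|exact: intbleB].
  rewrite !integB// swap; congr (_ * (_ - _)).
  by apply: eq_integ => x Ox; rewrite addr0 GE.
have mA n : mfn Omega (A n).
  apply: intble_mfn; apply: intbleZ => //; apply: intbleB => //.
  by apply: eq_intble mO _ (igH 0) => x _; rewrite addr0.
have mB n : mfn Omega (B n).
  by apply: intble_mfn; apply: intbleZ => //; apply: intbleB.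
have N0 := lebesgue_faces conf d0.
have tcvg : t n @[n --> \oo] --> (0 : R) by exact: cvg_harmonic.
have seg x n : Omega x -> exists2 r, 0 < r & t n < r -> forall s, `|s| <= t n -> Omega (x + s *: e).
  move=> Ox; have [r r0 hr] := (open_enorm Omega).1 (@open_interior _ _) _ Ox.
  exists r => // tr s st; apply: hr; rewrite addrAC subrr add0r enormZ enorm_delta mulr1.
  exact: le_lt_trans st tr.
(* Off the faces the hat function is affine near x, so the quotients are eventually constant. *)
have cvA x : Omega x -> ~ faces T x -> A n x @[n --> \oo] --> - (g x * partial k (hatf i) x).
  move=> Ox nf; have [K KT xK] := union_faces conf (polytope_union Ox) nf.
  pose a := \sum_(j : I) hatf i (node j) *: bgrad K j.
  pose b := \sum_(j : I) hatf i (node j) * blam K 0 j.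
  have h : nbhs x [set y | hatf i y = dot a y + b].
    exact: fe_affine_ohull (fe_space_hatf conf i) KT xK.
  have [_ ->] := derive_near_affine h k.
  have /nbhs_enorm[r r0 hr] := h; apply: cvg_near_cst.
  have xE : hatf i x = dot a x + b by apply: hr; rewrite subrr enorm0.
  near=> n.
  have tr : t n < r by near: n; exact: (cvgr_lt _ tcvg).
  rewrite /A hr; last by rewrite addrAC subrr add0r enormN enormZ enorm_delta mulr1 gtr0_norm.
  rewrite xE dotBr dotZr dot_delta; field.
  by rewrite gt_eqF.
have cvB x : Omega x -> B n x @[n --> \oo] --> partial k g x * hatf i x.
  move=> Ox; have dgx := g_derivable Ox.
  have cv : h^-1 *: (g (h *: e + x) - g x) @[h --> 0^'] --> partial k g x by exact: dgx.
  apply/cvgrPdist_lt => r r0; have /cvgrPdist_lt/(_ r r0) H := cv.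
  have /nbhs_ballP[u u0 hu] : nbhs (0 : R) [set h : R | h != 0 ->
    `|partial k g x - h^-1 *: (g (h *: e + x) - g x)| < r] by exact: H.
  have [v v0 hv] := (open_enorm Omega).1 (@open_interior _ _) _ Ox.
  near=> n.
  have tu : t n < u by near: n; exact: (cvgr_lt _ tcvg).
  have tv : t n < v by near: n; exact: (cvgr_lt _ tcvg).
  have Oy : Omega (x + t n *: e).
    by apply: hv; rewrite addrAC subrr add0r enormZ enorm_delta mulr1 gtr0_norm.
  have := hu (t n); rewrite /ball/= sub0r normrN gtr0_norm// => /(_ tu).
  rewrite gt_eqF// => /(_ isT) hh.
  rewrite /B addr0 !GE// -mulrBl mulrA [x + _]addrC -mulrBl normrM.
  apply: le_lt_trans hh; rewrite -[leRHS]mulr1 ler_wpM2l//.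
  by rewrite ger0_norm ?hatf_ge0// hatf_le1.
have Ab n x : Omega x -> `|A n x| <= C0 * Lc.
  move=> Ox; rewrite /A -mulrBr normrM gtr0_norm ?invr_gt0// mulrC ler_pdivrMr//.
  rewrite normrM -mulrA; apply: ler_pM => //; first exact: g_le.
  apply: le_trans (hatf_lipschitz _ _) _.
  by rewrite addrAC subrr add0r enormN enormZ enorm_delta mulr1 gtr0_norm.
have Bb n x : Omega x -> `|B n x| <= Num.max C1 (2 * C0 * Lc).
  move=> Ox; rewrite /B addr0 -mulrBl normrM gtr0_norm ?invr_gt0// mulrC ler_pdivrMr//.
  rewrite normrM (ger0_norm (hatf_ge0 conf i x)).
  case: (pselect (forall s, 0 <= s <= t n -> Omega (x + s *: e))) => [sg|].
    have [s s01 E] := mvt_eq (ltW (t0 n)) (fun s st => is_derive_line (g_derivable (sg s st))).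
    have O1 : Omega (x + t n *: e) by apply: sg; rewrite lexx ltW.
    rewrite !GE// -{2}(addr0 x) -(scale0r e) E subr0 normrM (gtr0_norm (t0 n)).
    rewrite mulrAC ler_wpM2r ?(ltW (t0 n))//.
    apply: (@le_trans _ _ (C1 * 1)); last by rewrite mulr1 le_max lexx.
    apply: ler_pM => //; [exact: hatf_ge0|exact: dg_le (sg s s01)|exact: hatf_le1].
  move=> /existsNP[s /not_implyP[/andP[s0 st] ns]].
  have hx : hatf i x <= Lc * t n.
    have := hatf_lipschitz (x + s *: e) x; rewrite (hatf_zero ns) subr0 ger0_norm ?hatf_ge0//.
    rewrite opprD addrA subrr add0r enormN enormZ enorm_delta mulr1 ger0_norm// => /le_trans; apply.
    by rewrite ler_wpM2l.
  apply: (@le_trans _ _ (2 * C0 * (Lc * t n))).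
    apply: ler_pM => //; first exact: hatf_ge0.
    by apply: le_trans (ler_normB _ _) _; have := Gb x; have := Gb (x + t n *: e); lra.
  by rewrite mulrA ler_wpM2r ?(ltW (t0 n))// le_max lexx orbT.
have iD : intble Omega (partial k (hatf i)).
  have [] := @integ_polytope _ _ _ conf d0 (partial k (hatf i)) (fun K => bgrad K i 0 k) _ => //.
  move=> K x KT xK.
  by have [_ ->] := derive_near_affine (fe_affine_ohull conf (fe_space_hatf conf i) KT xK) k;
     have := grad_hatf conf i KT xK; rewrite (grad_fe conf (fe_space_hatf conf i) KT xK) => ->.
have iGD : intble Omega (fun x => g x * partial k (hatf i) x).
  by apply: eq_intble mO _ (intbleM mO mg g_le iD) => x _; rewrite mulrC.
split => //.
have iGDN : intble Omega (fun x => - (g x * partial k (hatf i) x)).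
  by apply: eq_intble mO _ (intbleZ (-1) mO iGD) => x _; rewrite mulN1r.
have LA := integ_dominated mO fO N0 mA (intble_mfn iGDN) cvA Ab.
have LB := integ_dominated mO fO N0 mB (measurable_funM mdg mfn_hatf) (fun x Ox _ => cvB x Ox) Bb.
have E : integ Omega (fun x => - (g x * partial k (hatf i) x)) =
    integ Omega (fun x => partial k g x * hatf i x).
  have AB' : (fun n => integ Omega (A n)) = (fun n => integ Omega (B n)) by apply/funext.
  rewrite -(cvg_lim _ LA)// AB'; exact: cvg_lim LB.
rewrite -E (_ : (fun x => - (g x * partial k (hatf i) x)) = (fun x => (-1) * (g x * partial k (hatf i) x))).
  by rewrite integZ// mulN1r opprK.
by apply/funext => x; rewrite mulN1r.
Unshelve. all: by end_near. Qed.

End ibp.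
End hat_lipschitz.

(** * The discrete Alexandroff estimate *)

Section node_estimates.
Context (R : realType) (d : nat) (T : mesh R d).
Hypothesis conf : conforming T.
Hypothesis d0 : (0 < d)%N.
Local Notation I := 'I_(nnodes T).
Local Notation elt := (elements T).
Local Notation Omega := (polytope T).
Local Notation leb := (@lebesgue R d).
Variables h g : R.
Hypothesis h0 : 0 < h.
Hypothesis g0 : 0 < g.
Hypothesis hulls_le : forall K x y, K \in elt -> hull K x -> hull K y -> enorm (x - y) <= h.
Hypothesis hulls_ge : forall K, K \in elt -> exists c, forall x, enorm (x - c) <= g * h -> hull K x.
Hypothesis acute : face_weakly_acute T Omega.
Implicit Types (K L : {set I}) (x y q : 'rV[R]_d) (i : I).

Let gh : 0 < g * h. Proof. exact: mulr_gt0. Qed.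
Let gh' : 0 <= (g * h)^-1. Proof. by rewrite invr_ge0 ltW. Qed.
Let Lcb K (j : I) : K \in elt -> enorm (bgrad K j) <= (g * h)^-1.
Proof. by move=> KT; exact: (bgrad_bound conf h0 g0 hulls_ge). Qed.
Let vpos K : K \in elt -> 0 < vol (ohull K).
Proof. by move=> KT; exact: (vol_ohull_gt0 conf d0 h0 g0 hulls_ge). Qed.

Lemma hatf_near (j : I) x : hatf j x != 0 -> enorm (node j - x) <= h.
Proof.
move=> jx; have [K KT xK] : union T x by apply: contrapT => /(hatf_out j) E; rewrite E eqxx in jx.
apply: (hulls_le KT) => //; apply: hull_node; apply: contraNT jx => jK.
by rewrite (hatfE conf j KT xK) blam_out.
Qed.

Section interior.
Variable i : I.
Hypothesis Oi : Omega (node i).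

Let lip := hatf_lipschitz conf Oi gh' Lcb.

(** The hat function is 1 at the node and has slope at most 1 / (g h), so it is positive on this
    ball. This is the source of every lower bound for [theta]. *)
Lemma node_ball x : enorm (x - node i) < g * h -> Omega x.
Proof.
move=> xi; apply: (hatf_pos_polytope conf Oi).
have := lip (node i) x; rewrite hatf_node// eqxx ler_distl => /andP[+ _].
by apply: lt_le_trans; rewrite subr_gt0 mulrC ltr_pdivrMr// mul1r.
Qed.

Lemma sum_vol_star : \sum_(K in elt | i \in K) vol (ohull K) <= (2 * h) ^+ d.
Proof.
pose E := [set K in elt | i \in K]%SET.
pose D := \bigcup_(K in [set K | K \in E]) ohull K.
have ET : {subset E <= elt} by move=> K; rewrite inE => /andP[].
have Dh x : D x -> enorm (x - node i) <= h.
  move=> [K]; rewrite /= inE => /andP[KT iK] xK.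
  by apply: (hulls_le KT); [exact: ohull_hull|exact: hull_node].
have mD : mset D.
  apply: open_measurable_row; apply: bigcup_open => K; rewrite /= inE => /andP[KT _].
  exact: open_ohull.
have [|K KE x xK|K x _ _|_ E1] := @integ_step _ _ _ conf d0 E D (fun=> 1) (fun=> 1) ET mD
  (lebesgue_fin_enorm Dh).
- by move=> x [K KE xK] _; exists K.
- by exists K.
- by [].
have <- : integ D (fun=> 1) = \sum_(K in elt | i \in K) vol (ohull K).
  by rewrite E1; apply: eq_big => K; rewrite ?inE// mul1r.
by rewrite integ_cst// mul1r; apply: vol_le_enorm Dh; exact: ltW.
Qed.

(** Row sums vanish, so the sum is minus the diagonal entry, which is a sum of squared gradients
    over the star. *)
Lemma sum_kap_le : \sum_(j | j != i) kap i j <= (g * h)^-1 ^+ 2 * (2 * h) ^+ d.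
Proof.
have -> : \sum_(j | j != i) kap i j = - kap i i.
  by apply/eqP; rewrite -addr_eq0 addrC; have := sum_kap conf i; rewrite (bigD1 i)//= => ->.
apply: (@le_trans _ _ ((g * h)^-1 ^+ 2 * \sum_(K in elt | i \in K) vol (ohull K))); last first.
  by rewrite ler_wpM2l ?exprn_ge0// sum_vol_star.
rewrite /kap -sumrN mulr_sumr [leRHS]big_mkcondr/=; apply: ler_sum => K KT.
rewrite /stiff opprK -enorm_dot mulrC; case: ifPn => iK.
  by rewrite ler_wpM2r ?vol_ge0// lerXn2r ?nnegrE ?enorm_ge0// Lcb.
by rewrite bgrad_out// enorm0 expr0n mul0r.
Qed.

(** Integration by parts against the constant 1 shows that the gradient of the hat function has
    integral zero, so linear functions are discretely harmonic at interior nodes. *)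
Lemma sum_kap_node q : \sum_j kap i j * dot q (node j) = 0.
Proof.
have mO := @mset_polytope _ _ T; have fO := leb_polytope_fin T.
have P k : \sum_(K in elt) bgrad K i 0 k * vol (ohull K) = 0.
  have d1 x : derivable (fun=> 1 : R) x (delta_mx 0 k : 'rV[R]_d) by exact: derivable_cst.
  have d2 x : partial k (fun=> 1 : R) x = 0 by exact: derive_cst.
  have [||||_] := @integration_by_parts _ _ _ conf d0 i _ Oi gh' Lcb (fun=> 1) k 1 0 (fun x _ => d1 x).
  - by move=> x _; rewrite normr1.
  - by move=> x _; rewrite d2 normr0.
  - exact: measurable_cst.
  - by rewrite (_ : partial k _ = fun=> 0); [exact: measurable_cst|apply/funext].
  rewrite (_ : (fun x => partial k _ x * _) = fun=> 0); last first.
    by apply/funext => x; rewrite d2 mul0r.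
  rewrite integ0 oppr0 => E1.
  transitivity (integ Omega (fun x => 1 * partial k (hatf i) x)); last exact: E1.
  have [|_ ->] := @integ_polytope _ _ _ conf d0 (fun x => 1 * partial k (hatf i) x) (fun K => bgrad K i 0 k).
    move=> K x KT xK; rewrite mul1r.
    have [_ ->] := derive_near_affine (fe_affine_ohull conf (fe_space_hatf conf i) KT xK) k.
    by have := grad_hatf conf i KT xK; rewrite (grad_fe conf (fe_space_hatf conf i) KT xK) => ->.
  by [].
under eq_bigr do rewrite /kap mulr_suml.
rewrite exchange_big/= (eq_bigr (fun K => - \sum_k q 0 k * (bgrad K i 0 k * vol (ohull K)))); last first.
  move=> K KT; rewrite (sum_stiff_dot conf)//; congr (- _); rewrite mulr_sumr.
  by apply: eq_bigr => k _; ring.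
rewrite sumrN exchange_big/= big1 ?oppr0// => k _.
by rewrite -mulr_sumr P mulr0.
Qed.

Lemma sum_kapB q : \sum_j kap i j * dot q (node j - node i) = 0.
Proof.
under eq_bigr do rewrite dotBr mulrBr; rewrite sumrB sum_kap_node -mulr_suml.
by rewrite sum_kap// mul0r subr0.
Qed.

Definition vmin : R := (2 * (g * h / d%:R)) ^+ d.

(* The element whose cone at the node contains q already contributes the bound. *)
Lemma direction_bound q :
  vmin * enorm q / h <= \sum_j kap i j * Num.max 0 (dot q (node j - node i)).
Proof.
have [K [KT iK hK]] := star_directions conf q Oi.
pose s := \sum_(k | k != i) dot (bgrad K k) q.
have sE : - dot (bgrad K i) q = s.
  apply/eqP; rewrite eq_sym -addr_eq0 addrC /s.
  have := congr1 (fun a => dot a q) (sum_bgrad conf KT).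
  rewrite dotC dot_sumr dot0l (bigD1 i)//= => E; apply/eqP; rewrite -[RHS]E dotC; congr (_ + _).
  by apply: eq_bigr => k _; rewrite dotC.
(* In the cone of [K], [q] is a combination of edges from the node, of length at most h, with the
   slopes as nonnegative coefficients. *)
have qs : enorm q <= h * s.
  have -> : q = \sum_(k | k != i) dot (bgrad K k) q *: (node k - node i).
    rewrite -{1}(sum_dot_bgrad conf q KT) (bigD1 i)//=.
    under [in RHS]eq_bigr do rewrite scalerBr; rewrite sumrB -scaler_suml -/s -sE scaleNr opprK.
    by rewrite addrC.
  apply: le_trans (enorm_sum _ _) _; rewrite mulr_sumr; apply: ler_sum => k ki.
  rewrite enormZ ger0_norm ?hK// mulrC.
  case: (boolP (k \in K)) => kK; last by rewrite bgrad_out// dot0l !mulr0.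
  by rewrite ler_wpM2r ?hK//; apply: (hulls_le KT); exact: hull_node.
apply: (@le_trans _ _ (vol (ohull K) * s)).
  rewrite -mulrA; apply: ler_pM => //.
  - by rewrite exprn_ge0// mulr_ge0// divr_ge0// ltW.
  - by rewrite divr_ge0 ?enorm_ge0// ltW.
  - exact: (vol_ohull_ge conf d0 h0 g0 hulls_ge).
  - by rewrite ler_pdivrMr// mulrC.
have -> : vol (ohull K) * s = \sum_j stiff K i j * dot q (node j - node i).
  under eq_bigr do rewrite dotBr mulrBr; rewrite sumrB sum_stiff_dot// -mulr_suml.
  rewrite (_ : \sum_j stiff K i j = 0) ?mul0r ?subr0; first by rewrite -sE mulrN.
  by rewrite /stiff sumrN -mulr_sumr -dot_sumr sum_bgrad// dot0r mulr0 oppr0.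
apply: ler_sum => j _; case: (eqVneq j i) => [->|ji].
  by rewrite subrr dot0r maxxx !mulr0.
have st0 L : L \in elt -> 0 <= stiff L i j.
  by move=> LT; apply: (stiff_ge0 conf d0 acute vpos) => //; rewrite eq_sym.
apply: (@le_trans _ _ (stiff K i j * Num.max 0 (dot q (node j - node i)))).
  by rewrite ler_wpM2l ?st0// le_max lexx orbT.
by rewrite ler_wpM2r ?le_max ?lexx// /kap (bigD1 K)//= lerDl sumr_ge0// => L /andP[LT _]; exact: st0.
Qed.

Lemma mass_le : mass i <= (2 * h) ^+ d.
Proof.
have mO := @mset_polytope _ _ T; have fO := leb_polytope_fin T.
pose P := [set x : 'rV[R]_d | forall j, `|x 0 j - node i 0 j| <= h].
have mP : mset P by exact: mset_cube.
apply: (@le_trans _ _ (integ Omega (\1_P))).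
  apply: le_integ => //; [exact: (intble_hatf conf Oi gh' Lcb)|exact: intble_indic|].
  move=> x Ox; case: (eqVneq (hatf i x) 0) => [->|xi]; first by rewrite indicE; case: (_ \in _).
  rewrite indicE mem_set ?hatf_le1// => l; apply: le_trans (hatf_near xi).
  by rewrite enormBC; have := le_entry_enorm (x - node i) 0 l; rewrite !mxE.
rewrite integ_indic// -(vol_cube (node i) (ltW h0)); apply: le_vol; last by move=> x [].
by rewrite lebesgue_cube ?ltry// ltW.
Qed.

(** Within g h / 2 of its node the hat function is at least 1/2; the cube of half side g h / (2 d)
    lies in that ball. *)
Lemma mass_ge : (g * h / d%:R) ^+ d / 2 <= mass i.
Proof.
have mO := @mset_polytope _ _ T; have fO := leb_polytope_fin T.
have dR : 0 < d%:R :> R by rewrite ltr0n.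
pose r := g * h / d%:R / 2; have r0 : 0 < r by rewrite !divr_gt0.
pose P := [set x : 'rV[R]_d | forall j, `|x 0 j - node i 0 j| <= r].
have mP : mset P by exact: mset_cube.
have Pn x : P x -> enorm (x - node i) <= g * h / 2.
  move=> Px; have -> : g * h / 2 = d%:R * r by rewrite /r; field; rewrite gt_eqF.
  by apply: enorm_le_coords => j; rewrite !mxE.
have PO : P `<=` Omega.
  move=> x /Pn h1; apply: node_ball; apply: le_lt_trans h1 _.
  by rewrite ltr_pdivrMr// ltr_pMr// ltr1n.
apply: (@le_trans _ _ (integ Omega (fun x => 2^-1 * \1_P x))).
  rewrite integZ//; last exact: intble_indic.
  rewrite integ_indic// setIidl// vol_cube ?(ltW r0)// /r mulrC.
  by rewrite mulrCA divff// mulr1.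
apply: le_integ => //; [exact/intbleZ/intble_indic|exact: (intble_hatf conf Oi gh' Lcb)|].
move=> x Ox; rewrite indicE; case: (boolP (x \in P)) => [/set_mem xP|_]; last first.
  by rewrite mulr0 hatf_ge0.
have := lip (node i) x; rewrite hatf_node// eqxx mulr1 ler_distl => /andP[+ _].
have : (g * h)^-1 * enorm (x - node i) <= 2^-1.
  by rewrite mulrC ler_pdivrMr// mulrC; exact: Pn.
rewrite -[true%:R]/(1 : R); lra.
Qed.

Lemma mass_gt0 : 0 < mass i.
Proof.
apply: lt_le_trans mass_ge; rewrite divr_gt0// exprn_gt0// divr_gt0// ltr0n//.
Qed.

End interior.

Lemma sum_mass_le : \sum_(i : I | `[< Omega (node i) >]) mass i <= vol Omega.
Proof.
have mO := @mset_polytope _ _ T; have fO := leb_polytope_fin T.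
have ih i : intble Omega (fun x => if `[< Omega (node i) >] then hatf i x else 0).
  case: asboolP => Oi; [exact: (intble_hatf conf Oi gh' Lcb)|exact: (intble_cst 0 mO fO)].
have -> : \sum_(i : I | `[< Omega (node i) >]) mass i =
    integ Omega (fun x => \sum_(i : I) if `[< Omega (node i) >] then hatf i x else 0).
  rewrite integ_sum// big_mkcond; apply: eq_bigr => i _; case: asboolP => // _.
  by rewrite integ0.
rewrite -[vol Omega]mul1r -integ_cst//; apply: le_integ => //; [exact: intble_sum|exact: intble_cst|].
move=> x Ox; rewrite -(sum_hatf conf (polytope_union Ox)); apply: ler_sum => i _.
by case: ifP => // _; exact: hatf_ge0.
Qed.

Lemma leb_finite_union (F : finType) (P : pred F) (S : F -> set 'rV[R]_d) :
  (leb (\big[setU/set0]_(i | P i) S i) <= \sum_(i | P i) leb (S i))%E.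
Proof.
elim/big_rec2 : _ => [|i A B _ AB]; first by rewrite [X in (X <= _)%E]outer_measure0.
apply: le_trans (outer_measureU2 _ _ _) _; exact: leeD.
Qed.

(** Node [i] is on the lower convex envelope of [v], and [p] is the slope of a supporting plane. *)
Definition contact (v : I -> R) i : Prop :=
  exists p : 'rV[R]_d, forall j : I, v i + dot p (node j - node i) <= v j.

(** [w] is [vmin] divided by h^d; the factor d compares cubes with balls, and the power of 2^d
    bounds d - 1 of the factors [mass i]. All powers of h cancel. *)
Definition abp_constant : R :=
  let w := (2 * (g / d%:R)) ^+ d in (d%:R * 2 / w) ^+ d * (2 ^+ d) ^+ d.-1.

(* The slopes of the planes touching from below at a node i fill a set of diameter at
   most h / vmin * mass i * G i by the direction bound, while together these sets cover a cube. *)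
Lemma discrete_abp (v G : I -> R) (D : R) (j0 : I) : 0 < D ->
  (forall i j : I, enorm (node i - node j) <= D) ->
  (forall i, ~ Omega (node i) -> 0 <= v i) ->
  (forall i, Omega (node i) -> contact v i ->
     \sum_j kap i j * v j <= mass i * G i) ->
  (forall i, 0 <= G i) -> v j0 < 0 ->
  (- v j0) ^+ d <= abp_constant * D ^+ d * \sum_(i : I | `[< Omega (node i) >]) mass i * G i ^+ d.
Proof.
move=> D0 hD v0 hG G0 vj; set m := - v j0; have m0 : 0 < m by rewrite oppr_gt0.
have dR : 0 < d%:R :> R by rewrite ltr0n.
(* Planes with slope in this cube vary by at most m / 2 over the domain, so they cannot touch at a
   node where [v] is nonnegative. *)
pose c := m / (2 * d%:R * D); have c0 : 0 < c by rewrite divr_gt0// !mulr_gt0.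
pose Q := [set p : 'rV[R]_d | forall j, `|p 0 j - (0 : 'rV[R]_d) 0 j| <= c].
pose S i := [set p : 'rV[R]_d | Q p /\ forall j : I, v i + dot p (node j - node i) <= v j].
have QS : Q `<=` \big[setU/set0]_(i : I | `[< Omega (node i) >]) S i.
  move=> p Qp.
  pose i := [arg min_(i < j0) (v i - dot p (node i))]%O.
  have hi (j : I) : v i - dot p (node i) <= v j - dot p (node j).
    by rewrite /i; case: arg_minP => // k _ hk; exact: hk.
  have Oi : Omega (node i).
    apply: contrapT => /v0 vi; have := hi j0.
    have pc : enorm p <= d%:R * c.
      by apply: enorm_le_coords => l; have := Qp l; rewrite mxE subr0.
    have : dot p (node i - node j0) <= d%:R * c * D.
      apply: le_trans (ler_norm _) _; apply: le_trans (cauchy_dot _ _) _.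
      by apply: ler_pM; rewrite ?enorm_ge0.
    have -> : d%:R * c * D = m / 2 by rewrite /c; field; rewrite !gt_eqF.
    rewrite dotBr /m; lra.
  rewrite (bigD1 i)/=; last exact/asboolP.
  by left; split => // j; have := hi j; rewrite dotBr; lra.
have vm : 0 < vmin by rewrite exprn_gt0// mulr_gt0// divr_gt0.
pose rho i := h / vmin * (mass i * G i).
have SI i : Omega (node i) -> (leb (S i) <= ((2 * rho i) ^+ d)%:E)%E.
  move=> Oi; have r0 : 0 <= rho i.
    by rewrite !mulr_ge0 ?invr_ge0 ?(ltW h0) ?(ltW vm)// ltW// mass_gt0.
  case: (pselect (S i !=set0)) => [[p0 [_ hp0]]|/set0P/negP/negPn/eqP ->]; last first.
    by rewrite [X in (X <= _)%E]outer_measure0 lee_fin exprn_ge0// mulr_ge0.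
  rewrite -(lebesgue_cube p0 r0); apply: le_lebesgue => p [_ hp] l.
  have := le_entry_enorm (p - p0) 0 l; rewrite !mxE => /le_trans; apply.
  rewrite /rho mulrAC ler_pdivlMr// mulrC -ler_pdivrMl// mulrC.
  have -> : h^-1 * (enorm (p - p0) * vmin) = vmin * enorm (p - p0) / h by ring.
  apply: le_trans (direction_bound Oi (p - p0)) _.
  apply: le_trans _ (hG i Oi (ex_intro _ p0 hp0)).
  (* Subtracting the supporting plane changes nothing, as constants and linear functions are
     annihilated; every summand off the node becomes nonnegative. *)
  have -> : \sum_j kap i j * v j = \sum_j kap i j * (v j - v i - dot p0 (node j - node i)).
    under [RHS]eq_bigr do rewrite !mulrBr; rewrite !sumrB sum_kapB// subr0 -mulr_suml.
    by rewrite sum_kap// mul0r subr0.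
  apply: ler_sum => j _; case: (eqVneq j i) => [->|ji]; first by rewrite !subrr !dot0r maxxx !subrr mulr0.
  apply: ler_wpM2l; first by apply: (kap_ge0 conf d0 acute vpos) => //; rewrite eq_sym.
  rewrite ge_max; have := hp j; have := hp0 j; rewrite dotBl => a1 a2.
  by apply/andP; split; lra.
have main : (2 * c) ^+ d <= \sum_(i : I | `[< Omega (node i) >]) (2 * rho i) ^+ d.
  rewrite -lee_fin -(lebesgue_cube 0 (ltW c0)).
  apply: le_trans (le_lebesgue QS) _; apply: le_trans (leb_finite_union _ _) _.
  rewrite -sumEFin; apply: lee_sum => i /asboolP; exact: SI.
have {main} : m ^+ d <= \sum_(i : I | `[< Omega (node i) >]) (d%:R * D * (2 * rho i)) ^+ d.
  have -> : m = d%:R * D * (2 * c) by rewrite /c; field; rewrite !gt_eqF.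
  rewrite exprMn; under eq_bigr do rewrite exprMn.
  by rewrite -mulr_sumr ler_wpM2l// exprn_ge0// mulr_ge0// ltW.
move=> /le_trans; apply; rewrite mulr_sumr; apply: ler_sum => i /asboolP Oi.
have mi := mass_gt0 Oi; have ml := mass_le Oi.
(* One factor [mass i] is kept as the weight of the sum; the other d - 1 are bounded by (2 h)^d. *)
apply: (@le_trans _ _ ((d%:R * D * (2 * (h / vmin))) ^+ d * ((2 * h) ^+ d) ^+ d.-1 * (mass i * G i ^+ d))).
  have -> : d%:R * D * (2 * rho i) = d%:R * D * (2 * (h / vmin)) * (mass i * G i) by rewrite /rho; ring.
  rewrite (exprMn _ (d%:R * D * (2 * (h / vmin)))) -[leRHS]mulrA; apply: ler_wpM2l.
    by rewrite exprn_ge0// !mulr_ge0 ?invr_ge0// ltW.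
  rewrite (exprMn _ (mass i)) mulrA; apply: ler_wpM2r; first by rewrite exprn_ge0.
  rewrite -[d in mass i ^+ d](prednK d0) exprSr; apply: ler_wpM2r; first exact: ltW.
  by apply: lerXn2r; rewrite ?nnegrE ?(ltW mi)// exprn_ge0// mulr_ge0// ltW.
rewrite ler_wpM2r ?mulr_ge0 ?exprn_ge0 ?(ltW mi)// le_eqVlt; apply/orP; left; apply/eqP.
rewrite /abp_constant /vmin; set w := (2 * (g / d%:R)) ^+ d.
have w0 : 0 < w by rewrite exprn_gt0// mulr_gt0// divr_gt0.
have -> : (2 * (g * h / d%:R)) ^+ d = w * h ^+ d.
  by rewrite /w -exprMn; congr (_ ^+ _); ring.
have -> : h / (w * h ^+ d) = w^-1 * (h^-1) ^+ d.-1.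
  rewrite -[in h ^+ d](prednK d0) exprS exprVn; field.
  by rewrite expf_neq0 ?gt_eqF.
set H := h^-1 ^+ d.-1; set n := d.-1; set a := d%:R * 2 / w.
have -> : d%:R * D * (2 * (w^-1 * H)) = a * D * H by rewrite /a; ring.
rewrite (exprMn _ (a * D) H) (exprMn _ a D) (exprMn _ 2 h) (exprMn _ (2 ^+ d)).
have hh : H ^+ d * (h ^+ d) ^+ n = 1.
  by rewrite /H -!exprM mulnC -exprMn mulVf ?expr1n// gt_eqF.
transitivity (a ^+ d * (2 ^+ d) ^+ n * D ^+ d * (H ^+ d * (h ^+ d) ^+ n)); first by ring.
by rewrite hh mulr1.
Qed.

End node_estimates.

(** * The nonlocal operator *)

Section distance.
Context (R : realType) (d : nat).
Implicit Types (x y z : 'rV[R]_d) (D Omega : set 'rV[R]_d).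

Lemma dist_le x z D : D z -> dist x D <= enorm (x - z).
Proof.
move=> Dz; apply: ge_inf; last by exists z.
by exists 0 => _ [w _ <-]; exact: enorm_ge0.
Qed.

Lemma dist_approx x D e : D !=set0 -> 0 < e ->
  exists2 z, D z & enorm (x - z) < dist x D + e.
Proof.
move=> [z0 Dz0] e0.
have hi : has_inf [set enorm (x - z) | z in D].
  by split; [exists (enorm (x - z0)), z0|exists 0 => _ [w _ <-]; exact: enorm_ge0].
by have [_ [z Dz <-] hz] := inf_adherent e0 hi; exists z.
Qed.

(** The infimum of the parameters outside [Omega] is the first exit time. *)
Lemma boundary_segment Omega x y : open Omega -> Omega x -> ~ Omega y ->
  exists2 t : R, 0 <= t <= 1 & boundary Omega (x + t *: (y - x)).
Proof.
move=> oO Ox ny; pose S := [set t : R | 0 <= t <= 1 /\ ~ Omega (x + t *: (y - x))].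
have S1 : S 1 by split; rewrite ?ler01 ?lexx// scale1r [x + _]addrC subrK.
have hi : has_inf S by split; [exists 1|exists 0 => t [/andP[]]].
pose t := inf S.
have t0 : 0 <= t by apply: lb_le_inf; [exists 1|move=> s [/andP[]]].
have t1 : t <= 1 by apply: ge_inf => //; exists 0 => s [/andP[]].
have N0 : 0 < enorm (y - x) + 1 by rewrite ltr_wpDl ?enorm_ge0.
have E (s : R) : x + s *: (y - x) - (x + t *: (y - x)) = (s - t) *: (y - x).
  by rewrite opprD addrACA subrr add0r scalerBl.
exists t; first by rewrite t0.
split.
  apply/closure_enorm => e e0.
  have [t00|t_gt0] := leP t 0.
    exists x => //; rewrite (_ : t = 0); last by apply/eqP; rewrite eq_le t00.
    by rewrite scale0r addr0 subrr enorm0.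
  pose s := Num.max 0 (t - e / (enorm (y - x) + 1)).
  have st : s < t by rewrite gt_max t_gt0/= ltrBlDr ltrDl divr_gt0.
  exists (x + s *: (y - x)).
    apply: contrapT => ns; have : t <= s.
      apply: ge_inf; first by exists 0 => u [/andP[]].
      by split => //; rewrite le_max lexx (le_trans (ltW st)).
    by rewrite leNgt st.
  rewrite E enormZ distrC gtr0_norm ?subr_gt0//.
  apply: (@le_lt_trans _ _ (e / (enorm (y - x) + 1) * enorm (y - x))).
    by rewrite ler_wpM2r ?enorm_ge0// lerBlDr -lerBlDl le_max lexx orbT.
  by rewrite mulrAC ltr_pdivrMr// ltr_pM2l// ltrDl.
move=> Ot0; have Ot : Omega (x + t *: (y - x)) by exact: interior_subset Ot0.
have [e e0 he] := (open_enorm Omega).1 oO _ Ot.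
have [s [s01 ns] st] := inf_adherent (divr_gt0 e0 N0) hi.
have ts : t <= s by apply: ge_inf => //; exists 0 => u [/andP[]].
apply: ns; apply: he; rewrite E enormZ ger0_norm ?subr_ge0//.
apply: (@le_lt_trans _ _ ((s - t) * (enorm (y - x) + 1))).
  by rewrite ler_wpM2l ?subr_ge0// lerDl.
by rewrite -ltr_pdivlMr// ltrBlDl.
Qed.

Lemma dist_ball Omega x y : open Omega -> Omega x -> enorm y < dist x (boundary Omega) -> Omega (x + y).
Proof.
move=> oO Ox; apply: contraTP => ny; rewrite -leNgt.
have [t /andP[t0 t1] bt] := boundary_segment oO Ox ny.
apply: le_trans (dist_le x bt) _.
rewrite [x + y]addrC addrK opprD addrA subrr add0r enormN enormZ ger0_norm//.
by rewrite ler_piMl ?enorm_ge0.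
Qed.

Lemma boundary_neq0 Omega : (0 < d)%N -> open Omega -> Omega !=set0 -> bounded_set Omega ->
  boundary Omega !=set0.
Proof.
move=> d0 oO [x Ox] /bounded_enorm[r r0 hr].
have [|t _ bt] := boundary_segment oO Ox (y := (r + 1) *: delta_mx 0 (Ordinal d0)).
  move=> /hr; rewrite enormZ enorm_delta mulr1 ger0_norm; last by rewrite addr_ge0// ltW.
  by rewrite gerDl ler10.
by exists (x + t *: ((r + 1) *: delta_mx 0 (Ordinal d0) - x)).
Qed.

Section theta.
Variables (Omega : set 'rV[R]_d) (r : R).
Hypotheses (oO : open Omega) (r0 : 0 < r).

Lemma theta_far x : r < dist x (boundary Omega) -> theta Omega r x = 1.
Proof. by rewrite /theta => ->. Qed.

(** The supremum is attained because the ball is open: for a given y, theta y equals t y' with an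
    admissible t slightly below theta and still |y'| < r. The last clause turns a ball inside
    [Omega] into a lower bound for theta. *)
Lemma theta_spec x : Omega x ->
  [/\ 0 < theta Omega r x, theta Omega r x <= 1,
      (forall y, enorm y < r -> Omega (x + theta Omega r x *: y) /\ Omega (x - theta Omega r x *: y)) &
      (forall s, 0 < s -> s <= r -> (forall y, enorm y < s -> Omega (x + y)) -> s / r <= theta Omega r x)].
Proof.
move=> Ox; have [rd|rd] := ltP r (dist x (boundary Omega)).
  rewrite theta_far//.
  split=> // [y yr|s s0 sr _]; last by rewrite ler_pdivrMr// mul1r.
  rewrite scale1r; split; first by apply: (dist_ball oO Ox); exact: lt_trans yr rd.
  by apply: (dist_ball oO Ox); rewrite enormN; exact: lt_trans yr rd.
have nr : (r < dist x (boundary Omega)) = false by rewrite ltNge rd.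
rewrite /theta nr; set S := [set t : R | _].
have uS : has_ubound S by exists 1 => t [/andP[]].
have Sball s : 0 < s -> s <= r -> (forall y, enorm y < s -> Omega (x + y)) -> S (s / r).
  move=> s0 sr hs; split; first by rewrite divr_gt0// ler_pdivrMr// mul1r.
  move=> y yr; have ys : enorm ((s / r) *: y) < s.
    by rewrite enormZ gtr0_norm ?divr_gt0// mulrAC ltr_pdivrMr// ltr_pM2l.
  by split; apply: hs; rewrite ?enormN.
have [s S_s] : S !=set0.
  have [e e0 he] := (open_enorm Omega).1 oO _ Ox.
  exists (Num.min e r / r); apply: Sball; rewrite ?lt_min ?e0 ?ge_min ?lexx ?orbT//.
  by move=> y; rewrite lt_min => /andP[ye _]; apply: he; rewrite addrAC subrr add0r.
have hs : has_sup S by split => //; exists s.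
have th0 : 0 < sup S by apply: lt_le_trans (ub_le_sup uS S_s); case: S_s => /andP[].
split=> // [|y yr|u u0 ur hu].
- by apply: ge_sup; [exists s|move=> t [/andP[]]].
- have e0 : 0 < sup S * (1 - enorm y / r) by rewrite mulr_gt0// subr_gt0 ltr_pdivrMr// mul1r.
  have [t [/andP[t0 t1] ht] tlt] := sup_adherent e0 hs.
  have E : sup S *: y = t *: ((sup S / t) *: y) by rewrite scalerA mulrC divfK// gt_eqF.
  rewrite E; apply: ht; rewrite enormZ gtr0_norm ?divr_gt0// mulrAC ltr_pdivrMr//.
  move: tlt; rewrite mulrBr mulr1 subKr mulrA ltr_pdivrMr//; by rewrite mulrC [t * r]mulrC mulrC.
by apply: ub_le_sup => //; exact: Sball.
Qed.

End theta.

Lemma continuous_bounded D (f : 'rV[R]_d -> R) : closed D -> bounded_set D ->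
  {within D, continuous f} -> exists c, forall x, D x -> `|f x| <= c.
Proof.
move=> cD bD cf; have kD : compact D by exact: bounded_closed_compact.
have /compact_bounded[M [_ HM]] := continuous_compact cf kD.
exists (`|M| + 1) => x Dx; apply: (HM (`|M| + 1)); last by exists x.
by rewrite ltr_pwDr// ler_norm.
Qed.

Lemma enorm_bounded D r : (forall x, D x -> enorm x <= r) -> bounded_set D.
Proof.
move=> Dr; exists r; split; first exact: num_real.
move=> M rM x /Dr xr; apply: (@le_trans _ _ (enorm x)); last exact: le_trans xr (ltW rM).
rewrite [`|x|]mx_normrE; apply: bigmax_le; first exact: enorm_ge0.
by move=> i _; exact: le_entry_enorm.
Qed.

Lemma closed_eball (c : 'rV[R]_d) r : closed [set x | enorm (x - c) <= r].
Proof.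
rewrite -[X in closed X]setCK; apply: open_closedC; apply/open_enorm => x /negP.
rewrite -ltNge => xr; exists (enorm (x - c) - r); first by rewrite subr_gt0.
move=> y yx; apply/negP; rewrite -ltNge -(ltrD2l (enorm (y - x))).
apply: (@lt_le_trans _ _ (enorm (x - c))); first by rewrite -ltrBrDr.
by rewrite (enormBC y x); exact: enorm_triangle.
Qed.

End distance.

(** * Positive definite matrices *)

Section positive_definite.
Context (R : realType).

(** Induction through the Schur complement, which is the form minimised over the first coordinate
    and so inherits positivity. *)
Lemma det_pd_gt0 d (M : 'M[R]_d) : M^T = M -> (forall x : 'rV[R]_d, x != 0 -> 0 < quad M x) ->
  0 < \det M.
Proof.
elim: d M => [|d IH] M sM pM; first by rewrite det_mx00.
rewrite -[d.+1]/(1 + d)%N in M sM pM *.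
pose a := M 0 0; pose v := ursubmx M; pose B := drsubmx M.
have ulE : ulsubmx M = a%:M.
  apply/matrixP => i j; rewrite !ord1 !mxE eqxx mulr1n /a; congr (M _ _); exact: val_inj.
have dlE : dlsubmx M = v^T by rewrite /v trmx_ursub sM.
have ME : M = block_mx a%:M v v^T B by rewrite -ulE -dlE submxK.
have quadE2 (s : R) (y : 'rV[R]_d) : quad M (row_mx s%:M y) =
    s ^+ 2 * a + 2 * s * (v *m y^T) 0 0 + quad B y.
  rewrite /quad ME mul_row_block tr_row_mx mul_row_col tr_scalar_mx !mxE.
  rewrite !big_ord1 !mxE !big_ord1 !mxE eqxx !mulr1n.
  have -> : \sum_j y 0 j * v^T j 0 = (v *m y^T) 0 0.
    by rewrite mxE; apply: eq_bigr => j _; rewrite !mxE mulrC.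
  rewrite !mxE; under [\sum_j (s%:M *m v + y *m B) 0 j * y^T j 0]eq_bigr do rewrite mxE mulrDl.
  rewrite big_split/= mul_scalar_mx.
  have -> : \sum_i (s *: v) 0 i * y^T i 0 = s * \sum_j v 0 j * y^T j 0.
    by rewrite mulr_sumr; apply: eq_bigr => i _; rewrite mxE mulrA.
  by ring.
have a0 : 0 < a.
  have := pM (row_mx 1%:M 0); rewrite quadE2 expr1n mul1r trmx0 mulmx0 mxE mulr0 addr0.
  have -> : quad B (0 : 'rV[R]_d) = 0 by rewrite /quad mul0mx mul0mx mxE.
  rewrite addr0; apply; apply/eqP => /(congr1 (@lsubmx _ 1 1 d)).
  rewrite row_mxKl linear0 => /matrixP/(_ 0 0)/eqP.
  by rewrite !mxE eqxx oner_eq0.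
pose S := B - a^-1 *: (v^T *m v).
have MF : M = block_mx a%:M 0 v^T 1%:M *m block_mx 1%:M (a^-1 *: v) 0 S.
  rewrite mulmx_block !mulmx1 !mulmx0 !mul0mx !mul1mx !addr0.
  by rewrite mul_scalar_mx scalerA mulfV ?gt_eqF// scale1r -scalemxAr /S addrCA subrr addr0.
rewrite MF det_mulmx det_lblock det_ublock !det1 mulr1 mul1r det_scalar1 mulr_gt0//.
apply: IH => [|y y0].
  rewrite /S linearB linearZ/= trmx_mul trmxK; congr (_ - _).
  by rewrite /B trmx_drsub sM.
have -> : quad S y = quad M (row_mx (- a^-1 * (v *m y^T) 0 0)%:M y).
  rewrite quadE2; set t := (v *m y^T) 0 0.
  have -> : quad S y = quad B y - a^-1 * t ^+ 2.
    rewrite /quad /S mulmxBr mulmxBl mxE [X in _ + X]mxE; congr (_ - _).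
    rewrite -scalemxAr -scalemxAl mxE; congr (_ * _).
    rewrite mulmxA -(mulmxA _ v) mxE big_ord1 expr2 /t; congr (_ * _).
    by rewrite !mxE; apply: eq_bigr => i _; rewrite !mxE mulrC.
  by field; rewrite gt_eqF.
apply: pM; apply: contraNneq y0 => /(congr1 (@rsubmx _ 1 1 d)).
by rewrite row_mxKr linear0 => ->.
Qed.

Lemma quad_sqr d (M : 'M[R]_d) (z : 'rV[R]_d) : M^T = M -> quad (M *m M) z = enorm (z *m M) ^+ 2.
Proof.
move=> sM; rewrite enorm_dot /quad mulmxA -mulmxA mxE; apply: eq_bigr => i _.
by congr (_ * _); rewrite -{1}sM -trmx_mul mxE.
Qed.

Lemma quad_conj d (N H : 'M[R]_d) (z : 'rV[R]_d) : quad H (z *m N) = quad (N *m H *m N^T) z.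
Proof. by rewrite /quad trmx_mul !mulmxA. Qed.

End positive_definite.

(** * The kernel and its second moments *)

Section kernel.
Context (R : realType) (d : nat) (phi : 'rV[R]_d -> R).
Hypothesis kphi : kernel_function phi.
Hypothesis d0 : (0 < d)%N.
Local Notation leb := (@lebesgue R d).

Definition uball : set 'rV[R]_d := [set z | enorm z < 1].

Lemma kernel_continuous : continuous phi.
Proof.
by case: kphi => _ /(_ 0%N) h _ _ _ x; have [] := h [::] isT x I.
Qed.

(** On the unit sphere a nonzero value would persist slightly outside, against the support
    condition. The open ball is what fits the open ball in [theta]. *)
Lemma kernel_out z : ~ uball z -> phi z = 0.
Proof.
move=> nz; apply/eqP; apply: contrapT => /negP p0; apply: nz.
have p1 : 0 < `|phi z| by rewrite normr_gt0.
have /continuous_enormP/(_ _ p1)[t t0 ht] := kernel_continuous (x := z).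
have sup1 w : phi w != 0 -> enorm w <= 1.
  by move=> w0; case: kphi => _ _ _ h _; apply: h; apply: subset_closure.
have z1 := sup1 z p0; rewrite /uball/= ltNge; apply/negP => z2.
pose s := t / (2 * (enorm z + 1)).
have N0 : 0 < enorm z + 1 by rewrite ltr_wpDl ?enorm_ge0.
have s0 : 0 < s by rewrite divr_gt0// mulr_gt0.
have : phi ((1 + s) *: z) != 0.
  have := ht ((1 + s) *: z); rewrite scalerDl scale1r addrAC subrr add0r enormZ gtr0_norm//.
  have -> : s * enorm z < t.
    rewrite /s mulrAC ltr_pdivrMr ?mulr_gt0// ltr_pM2l//.
    by have := enorm_ge0 z; lra.
  by move=> /(_ isT); apply: contraTneq => ->; rewrite sub0r normrN ltxx.
move=> /sup1; rewrite enormZ gtr0_norm ?addr_gt0//; nra.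
Qed.

Lemma open_uball : open uball.
Proof.
apply/open_enorm => x /= x1; exists (1 - enorm x); first by rewrite subr_gt0.
move=> y yx; rewrite -(subrK x y); apply: le_lt_trans (enormD _ _) _.
by rewrite -ltrBrDr.
Qed.

Lemma mset_uball : mset uball.
Proof. exact: open_measurable_row open_uball. Qed.

Lemma leb_uball : (leb uball < +oo)%E.
Proof. by apply: (@lebesgue_fin_enorm _ _ _ 0 1) => x /= /ltW; rewrite subr0. Qed.

Lemma kernel_bounded : exists2 c, 0 <= c & forall z, phi z <= c.
Proof.
have [|||c hc] := @continuous_bounded _ _ [set z : 'rV[R]_d | enorm (z - 0) <= 1] phi.
- exact: closed_eball.
- by apply: (@enorm_bounded _ _ _ 1) => x /=; rewrite subr0.
- exact/continuous_subspaceT/kernel_continuous.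
exists `|c| => // z; case: (pselect (uball z)) => [/ltW z1|/kernel_out -> //].
by apply: le_trans (ler_norm _) (le_trans (hc z _) (ler_norm _)); rewrite /= subr0.
Qed.

Lemma kernel_ge0 z : 0 <= phi z.
Proof. by case: kphi => h _ _ _ _; exact: h. Qed.

Lemma intble_kernel (f : 'rV[R]_d -> R) c : mfn uball f -> (forall z, uball z -> `|f z| <= c) ->
  intble uball (fun z => f z * phi z).
Proof.
move=> mf fc; have [C C0 hC] := kernel_bounded.
apply: (intbleM (c := C)); [exact: mset_uball| | |].
- by apply: mfn_continuous; [exact: open_uball|move=> x _; exact: kernel_continuous].
- by move=> x _; rewrite ger0_norm ?kernel_ge0.
- exact: intble_bounded mset_uball leb_uball mf fc.
Qed.

Lemma intble_kernelT (f : 'rV[R]_d -> R) c : mfn uball f -> (forall z, uball z -> `|f z| <= c) ->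
  intble setT (fun z => f z * phi z).
Proof.
move=> mf fc; apply: (intble_patch mset_uball measurableT) => //.
  by move=> x _ /kernel_out ->; rewrite mulr0.
exact: intble_kernel mf fc.
Qed.

Lemma integ_kernelT (f : 'rV[R]_d -> R) :
  integ setT (fun z => f z * phi z) = integ uball (fun z => f z * phi z).
Proof. by apply: integ_patch => // x _ /kernel_out ->; rewrite mulr0. Qed.

Lemma mfn_coord2 (k l : 'I_d) : mfn uball (fun z => z 0 k * z 0 l).
Proof.
apply: mfn_continuous; first exact: open_uball.
by move=> x _; apply: continuousM; exact: coord_continuous.
Qed.

Lemma coord2_le (k l : 'I_d) z : uball z -> `|z 0 k * z 0 l| <= 1.
Proof.
move=> /ltW z1; rewrite normrM -[leRHS]mulr1.
by apply: ler_pM => //; apply: le_trans (le_entry_enorm _ _ _) z1.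
Qed.

Definition moment (k l : 'I_d) : R := integ setT (fun z => z 0 k * z 0 l * phi z).

(** Radial symmetry makes moments invariant under orthogonal maps. Changing the sign of one
    coordinate kills the mixed moments, a transposition equates the pure ones, and the normalisation
    of the kernel then makes them 1. *)
Lemma moment_orthogonal (M : 'M[R]_d) k l : M \in unitmx -> `|\det M| = 1 ->
  (forall z : 'rV[R]_d, enorm (z *m M) = enorm z) ->
  moment k l = integ setT (fun z => (z *m M) 0 k * (z *m M) 0 l * phi z).
Proof.
move=> uM dM oM; have iF := intble_kernelT (mfn_coord2 k l) (coord2_le k l).
have [_ E] := integ_affine 0 uM iF; rewrite dM invr1 mul1r in E; rewrite /moment -E.
apply: eq_integ => z _; rewrite addr0; congr (_ * _).
by case: kphi => _ _ rad _ _; exact: rad.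
Qed.

Lemma moment_off k l : k != l -> moment k l = 0.
Proof.
move=> kl; pose D : 'rV[R]_d := \row_j (if j == k then -1 else 1).
pose M := diag_mx D.
have zM (z : 'rV[R]_d) j : (z *m M) 0 j = (if j == k then - z 0 j else z 0 j).
  by rewrite mul_mx_diag !mxE; case: eqP; rewrite ?mulrN1 ?mulr1.
have dM : `|\det M| = 1.
  rewrite det_diag normr_prod big1// => j _; rewrite mxE; case: eqP => _; rewrite ?normrN normr1//.
have uM : M \in unitmx by rewrite unitmxE unitfE -normr_eq0 dM oner_eq0.
have E : moment k l = - moment k l.
  rewrite {1}(@moment_orthogonal M)//; last first.
    move=> z; rewrite /enorm !big_ord1; congr Num.sqrt; apply: eq_bigr => j _.
    by rewrite zM; case: eqP => //; rewrite sqrrN.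
  rewrite -mulN1r /moment -integZ; [|exact: measurableT|exact: intble_kernelT (mfn_coord2 k l) (coord2_le k l)].
  by apply: eq_integ => z _; rewrite !zM eqxx eq_sym (negbTE kl); ring.
by move/eqP: E; rewrite -subr_eq0 opprK -mulr2n mulrn_eq0/= => /eqP.
Qed.

Lemma moment_swap k l : moment k k = moment l l.
Proof.
pose M : 'M[R]_d := tperm_mx k l.
have zM (z : 'rV[R]_d) : z *m M = xcol k l z by rewrite xcolE.
rewrite (@moment_orthogonal M).
- apply: eq_integ => z _; congr (_ * _); by rewrite zM !mxE perm.tpermL.
- exact: unitmx_perm.
- by rewrite det_perm normrX normrN1 expr1n.
move=> z; rewrite /enorm !big_ord1; congr Num.sqrt; rewrite zM.
rewrite (reindex_inj (@perm.perm_inj _ (perm.tperm k l)))/=.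
by apply: eq_bigr => j _; rewrite mxE perm.tpermK.
Qed.

Lemma momentE k l : moment k l = (k == l)%:R.
Proof.
have [<-|kl] := eqVneq k l; last exact: moment_off.
have int_kl i j := intble_kernelT (mfn_coord2 i j) (coord2_le i j).
have : \sum_i moment i i = d%:R.
  rewrite /moment -integ_sum; [|exact: measurableT|by []]; case: kphi => _ _ _ _ <-; apply: eq_integ => z _.
  by rewrite -mulr_suml enorm_dot.
rewrite (eq_bigr (fun=> moment k k)); last by move=> i _; exact: moment_swap.
rewrite sumr_const card_ord => E.
have dR : d%:R != 0 :> R by rewrite pnatr_eq0 -lt0n.
by apply: (mulfI dR); rewrite mulr1 mulr_natl.
Qed.

Lemma intble_quad (B : 'M[R]_d) : intble uball (fun z => quad B z * phi z).
Proof.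
apply: (intble_kernel (c := enorm B)).
  rewrite (_ : quad B = fun z => \sum_k \sum_l B k l * (z 0 k * z 0 l)); last first.
    by apply/funext => z; exact: quadE.
  apply: measurable_sum => k; apply: measurable_sum => l.
  by apply: measurable_funM; [exact: measurable_cst|exact: mfn_coord2].
move=> z /ltW z1; apply: le_trans (quad_le _ _) _; rewrite -[leRHS]mulr1 ler_wpM2l ?enorm_ge0//.
by rewrite expr_le1// enorm_ge0.
Qed.

Lemma integ_quad (B : 'M[R]_d) : integ uball (fun z => quad B z * phi z) = \tr B.
Proof.
have int_kl i j := intble_kernel (mfn_coord2 i j) (coord2_le i j).
have int_B i j : intble uball (fun z => B i j * (z 0 i * z 0 j * phi z)).
  exact: intbleZ mset_uball _.
transitivity (\sum_k \sum_l B k l * moment k l).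
  transitivity (integ uball (fun z => \sum_k \sum_l B k l * (z 0 k * z 0 l * phi z))).
    apply: eq_integ => z _; rewrite quadE mulr_suml; apply: eq_bigr => k _.
    by rewrite mulr_suml; apply: eq_bigr => l _; rewrite -[LHS]mulrA.
  rewrite integ_sum//; [|exact: mset_uball|by move=> k; apply: intble_sum => //; exact: mset_uball].
  apply: eq_bigr => k _; rewrite integ_sum//; last exact: mset_uball.
  by apply: eq_bigr => l _; rewrite integZ// ?/moment ?integ_kernelT//; exact: mset_uball.
apply: eq_bigr => k _; rewrite (bigD1 k)//= big1 ?addr0 ?momentE ?eqxx ?mulr1// => l lk.
by rewrite momentE eq_sym (negbTE lk) mulr0.
Qed.

End kernel.

Arguments uball {R d} _.

(** * The nonlocal operator at one point *)

Section nonlocal_operator.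
Context (R : realType) (d : nat) (phi : 'rV[R]_d -> R) (Omega : set 'rV[R]_d).
Hypothesis kphi : kernel_function phi.
Hypothesis d0 : (0 < d)%N.
Hypothesis oO : open Omega.

Definition bounded_continuous (v : 'rV[R]_d -> R) : Prop :=
  (forall y, Omega y -> {for y, continuous v}) /\ exists c, forall y, Omega y -> `|v y| <= c.

Lemma bounded_continuousD a v w : bounded_continuous v -> bounded_continuous w ->
  bounded_continuous (fun y => v y + a * w y).
Proof.
move=> [cv [b hb]] [cw [c hc]]; split.
  move=> y Oy; apply: continuousD; first exact: cv.
  by apply: continuousM; [exact: cst_continuous|exact: cw].
exists (b + `|a| * c) => y Oy; apply: le_trans (ler_normD _ _) _.
by rewrite lerD ?hb// normrM ler_wpM2l// hc.
Qed.

Variables (r eps : R) (M : 'M[R]_d) (x : 'rV[R]_d).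
Hypotheses (r0 : 0 < r) (eps0 : 0 < eps) (dM : 0 < \det M) (Ox : Omega x).
Hypothesis Mr : forall z, uball z -> enorm (eps *: (z *m M)) < r.

Local Notation th := (theta Omega r x).
Local Notation I v := (Ieps Omega phi r eps M v x).

(** The second difference after the substitution of eps M z for y, without its factor theta^-2. *)
Definition second_diff (v : 'rV[R]_d -> R) (z : 'rV[R]_d) : R :=
  v (x + th *: (eps *: (z *m M))) + v (x - th *: (eps *: (z *m M))) - 2 * v x.

Let th_spec := theta_spec oO r0 Ox.
Let th0 : 0 < th. Proof. by case: th_spec. Qed.
Let th_in z : uball z -> Omega (x + th *: (eps *: (z *m M))) /\ Omega (x - th *: (eps *: (z *m M))).
Proof. by move=> /Mr; case: th_spec => _ _ h _; exact: h. Qed.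

Lemma enorm_mulmx (w : 'rV[R]_d) (N : 'M[R]_d) : enorm (w *m N) <= d%:R * (d%:R * (enorm w * enorm N)).
Proof.
apply: enorm_le_coords => j; rewrite mxE; apply: norm_sum_le => k.
by rewrite normrM; apply: ler_pM => //; exact: le_entry_enorm.
Qed.

Let cont_comp (v : 'rV[R]_d -> R) (p : 'rV[R]_d) (N : 'M[R]_d) (z : 'rV[R]_d) : {for p + z *m N, continuous v} ->
  {for z, continuous (fun z : 'rV[R]_d => v (p + z *m N))}.
Proof.
move=> /continuous_enormP H; apply/continuous_enormP => e e0; have [t t0 ht] := H e e0.
pose C := d%:R * (d%:R * enorm N) + 1.
have C0 : 0 < C by rewrite /C ltr_wpDl// !mulr_ge0 ?enorm_ge0.
exists (t / C); first exact: divr_gt0.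
move=> y; rewrite ltr_pdivlMr// => yz; apply: ht.
rewrite opprD addrACA subrr add0r -mulmxBl; apply: le_lt_trans yz.
apply: le_trans (enorm_mulmx _ _) _; rewrite /C mulrDr mulr1.
have := enorm_ge0 (y - z); set E := enorm _; set F := enorm N; set D := d%:R.
by have -> : D * (D * (E * F)) = E * (D * (D * F)) by [ring]; lra.
Qed.

Lemma mfn_second_diff v : bounded_continuous v -> mfn uball (second_diff v).
Proof.
move=> [cv _].
have E : second_diff v = fun z => v (x + z *m (th *: (eps *: M))) + v (x + z *m (- th *: (eps *: M))) - 2 * v x.
  by apply/funext => z; rewrite /second_diff -!scalemxAr scaleNr.
apply: mfn_continuous; first exact: open_uball.
move=> z /th_in[P1 P2]; rewrite E; apply: continuousB; last exact: cst_continuous.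
apply: continuousD; apply: cont_comp; apply: cv; rewrite -!scalemxAr ?scaleNr//.
Qed.

Lemma second_diff_le v c : (forall y, Omega y -> `|v y| <= c) ->
  forall z, uball z -> `|second_diff v z| <= 4 * c.
Proof.
move=> vc z /th_in[/vc h1 /vc h2]; have := vc x Ox => h3.
apply: le_trans (ler_normB _ _) _; rewrite normrM [`|2|]ger0_norm//.
have := ler_normD (v (x + th *: (eps *: (z *m M)))) (v (x - th *: (eps *: (z *m M)))); lra.
Qed.

Lemma intble_second_diff v : bounded_continuous v -> intble uball (fun z => second_diff v z * phi z).
Proof.
move=> gv; have [_ [c hc]] := gv.
exact: (intble_kernel kphi (mfn_second_diff gv) (second_diff_le hc)).
Qed.

(** The substitution has Jacobian eps^d det M, which cancels the normalisation of the kernel up to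
    eps^2 and moves the integral to the unit ball. *)
Lemma IepsE v : bounded_continuous v ->
  I v = (th * eps) ^- 2 * integ uball (fun z => second_diff v z * phi z).
Proof.
move=> gv; have [_ [b hb]] := gv.
have uM : M \in unitmx by rewrite unitmxE unitfE gt_eqF.
pose N := eps^-1 *: invmx M.
have dN : \det N = eps ^- d / \det M by rewrite detZ det_inv exprVn.
have uN : N \in unitmx.
  by rewrite unitmxE unitfE dN mulf_neq0// ?invr_neq0 ?expf_neq0 ?gt_eqF.
pose c := th ^- 2 / (eps ^+ (d + 2) * \det M).
pose G z := c * (second_diff v z * phi z).
have i0 := intble_kernelT kphi (mfn_second_diff gv) (second_diff_le hb).
have iG : intble setT G by exact: (intbleZ c measurableT i0).
have EG : integ setT G = c * integ setT (fun z => second_diff v z * phi z).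
  exact: (integZ c measurableT i0).
have [_] := integ_affine 0 uN iG.
rewrite /Ieps (_ : (fun y => second_difference _ _ _ _ _ / _ * _) = fun y => G (y *m N + 0)); last first.
  apply/funext => y; rewrite addr0 /G /second_diff /second_difference /N -scalemxAr.
  by rewrite -scalemxAl mulmxKV// (scalerA eps) divff ?gt_eqF// scale1r /c; ring.
move=> ->; rewrite dN EG integ_kernelT// mulrA; congr (_ * _).
rewrite gtr0_norm ?divr_gt0 ?invr_gt0 ?exprn_gt0// /c exprD.
by field; rewrite !gt_eqF// ?exprn_gt0.
Qed.

Lemma eq_Ieps v w : bounded_continuous v -> bounded_continuous w ->
  (forall y, Omega y -> v y = w y) -> I v = I w.
Proof.
move=> gv gw vw; rewrite !IepsE//; congr (_ * _); apply: eq_integ => z /th_in[P1 P2].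
by rewrite /second_diff !vw.
Qed.

Lemma IepsD a v w : bounded_continuous v -> bounded_continuous w ->
  I (fun y => v y + a * w y) = I v + a * I w.
Proof.
move=> gv gw; have gvw := bounded_continuousD a gv gw; rewrite !IepsE//.
rewrite (eq_integ (g := fun z => second_diff v z * phi z + a * (second_diff w z * phi z))); last first.
  by move=> z _; rewrite /second_diff; ring.
rewrite integD; [|exact: mset_uball|exact: intble_second_diff|]; last first.
  by apply: intbleZ; [exact: mset_uball|exact: intble_second_diff].
rewrite integZ; [|exact: mset_uball|exact: intble_second_diff]; ring.
Qed.

Definition kernel_mass : R := integ uball phi.

Lemma intble_phi : intble uball phi.
Proof.
have i1 : intble uball (fun z => (fun=> 1) z * phi z).
  apply: (intble_kernel kphi (c := 1)); first exact: measurable_cst.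
  by move=> z _; rewrite normr1.
by apply: (eq_intble _ _ i1) => [|z _]; [exact: mset_uball|rewrite mul1r].
Qed.

Lemma kernel_mass_ge0 : 0 <= kernel_mass.
Proof. by apply: integ_ge0 => z _; exact: kernel_ge0 kphi z. Qed.

(** The source of all estimates of the operator: the moments turn [quad B] into a trace and (theta
    eps)^2 cancels. With B = 0 it gives maximum norm bounds; applied to v and to -v it gives the
    Taylor error. *)
Lemma Ieps_ge v (B : 'M[R]_d) c : bounded_continuous v ->
  (forall z, uball z -> (th * eps) ^+ 2 * quad B z - c <= second_diff v z) ->
  \tr B - c * kernel_mass / (th * eps) ^+ 2 <= I v.
Proof.
move=> gv hv; rewrite IepsE//.
have te : 0 < (th * eps) ^+ 2 by rewrite exprn_gt0// mulr_gt0.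
have mb := mset_uball; have iq := intble_quad kphi B; have ip := intble_phi.
have i1 : intble uball (fun z => (th * eps) ^+ 2 * (quad B z * phi z)) by exact: intbleZ.
have i2 : intble uball (fun z => c * phi z) by exact: intbleZ.
have : integ uball (fun z => (th * eps) ^+ 2 * (quad B z * phi z) - c * phi z) <=
    integ uball (fun z => second_diff v z * phi z).
  apply: le_integ => //; [exact: intbleB|exact: intble_second_diff|].
  by move=> z zb; rewrite mulrA -mulrBl ler_wpM2r ?(kernel_ge0 kphi)// hv.
rewrite integB// !integZ// integ_quad// -/kernel_mass => le1.
rewrite [leRHS]mulrC ler_pdivlMr// mulrBl divfK ?gt_eqF//.
by rewrite [\tr B * _]mulrC.
Qed.

Lemma Ieps_lower v c : bounded_continuous v -> (forall z, uball z -> - c <= second_diff v z) ->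
  - (c * kernel_mass / (th * eps) ^+ 2) <= I v.
Proof.
move=> gv hc; have := @Ieps_ge v 0 c gv; rewrite mxtrace0 sub0r; apply => z zb.
by rewrite [quad 0 z]/quad mulmx0 mul0mx mxE mulr0 sub0r hc.
Qed.

Lemma bounded_continuousN v : bounded_continuous v -> bounded_continuous (fun y => - v y).
Proof.
move=> gv; have := bounded_continuousD (-2) gv gv; congr bounded_continuous.
by apply/funext => y; ring.
Qed.

Lemma IepsN v : bounded_continuous v -> I (fun y => - v y) = - I v.
Proof.
move=> gv; have := IepsD (-2) gv gv.
rewrite (_ : (fun y => _) = (fun y => - v y)); first by move=> ->; ring.
by apply/funext => y; ring.
Qed.

Lemma Ieps_norm_le v E : bounded_continuous v -> (forall y, Omega y -> `|v y| <= E) ->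
  `|I v| <= 4 * E * kernel_mass / (th * eps) ^+ 2.
Proof.
move=> gv hE; have hE' y : Omega y -> `|- v y| <= E by rewrite normrN; exact: hE.
rewrite ler_norml; apply/andP; split.
  apply: Ieps_lower => // z zb; have := second_diff_le hE zb; rewrite ler_norml => /andP[] //.
rewrite -[leRHS]opprK lerNr -IepsN//; apply: Ieps_lower => [|z zb]; first exact: bounded_continuousN.
by have := second_diff_le hE' zb; rewrite ler_norml => /andP[].
Qed.

End nonlocal_operator.

(** * The discrete operator on nodal values and its monotonicity *)

Section nodal_operator.
Context (R : realType) (d : nat) (T : mesh R d).
Hypothesis conf : conforming T.
Hypothesis d0 : (0 < d)%N.
Local Notation I := 'I_(nnodes T).
Local Notation elt := (elements T).
Local Notation Omega := (polytope T).
Variables h g : R.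
Hypothesis h0 : 0 < h.
Hypothesis g0 : 0 < g.
Hypothesis hulls_le : forall K x y, K \in elt -> hull K x -> hull K y -> enorm (x - y) <= h.
Hypothesis hulls_ge : forall K, K \in elt -> exists c, forall x, enorm (x - c) <= g * h -> hull K x.
Hypothesis acute : face_weakly_acute T Omega.
Variables (phi : 'rV[R]_d -> R) (r eps lambda : R) (M : I -> 'M[R]_d).
Hypothesis kphi : kernel_function phi.
Hypotheses (r0 : 0 < r) (eps0 : 0 < eps) (lambda0 : 0 < lambda).
Hypothesis dM : forall i, Omega (node i) -> 0 < \det (M i).
Hypothesis Mr : forall i, Omega (node i) -> forall z, uball z -> enorm (eps *: (z *m M i)) < r.
Implicit Types (i : I) (c : I -> R).

Let oO : open Omega. Proof. exact: open_interior. Qed.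

Lemma bounded_polytope : bounded_set (closure Omega).
Proof.
rewrite closure_polytope//; apply: (@enorm_bounded _ _ _ (\sum_(i : I) enorm (node i))) => x.
exact: union_enorm.
Qed.

Lemma bounded_continuous_closure (v : 'rV[R]_d -> R) : {within closure Omega, continuous v} ->
  bounded_continuous Omega v.
Proof.
move=> cv; split; last first.
  have [c hc] := continuous_bounded (@closed_closure _ _) bounded_polytope cv.
  by exists c => y Oy; apply: hc; exact: subset_closure.
move=> y Oy; apply/continuous_enormP => e e0.
have [t t0 ht] := (continuous_within_enormP _ _).1 cv y (subset_closure Oy) e e0.
have [s s0 hs] := (open_enorm Omega).1 oO y Oy.
exists (Num.min s t); first by rewrite lt_min s0.
by move=> z; rewrite lt_min => /andP[zs zt]; apply: ht => //; apply: subset_closure; exact: hs.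
Qed.

Definition interp c (x : 'rV[R]_d) : R := \sum_(j : I) hatf j x * c j.

Lemma bounded_continuous_sum (F : I -> 'rV[R]_d -> R) c : (forall j, bounded_continuous Omega (F j)) ->
  bounded_continuous Omega (fun x => \sum_j F j x * c j).
Proof.
move=> hF; suff : forall s : seq I, bounded_continuous Omega (fun x => \sum_(j <- s) F j x * c j) by exact.
elim=> [|j s IH].
  split; last by exists 0 => y _; rewrite big_nil normr0.
  move=> y _; rewrite (_ : (fun x => _) = fun=> 0); first exact: cst_continuous.
  by apply/funext => x; rewrite big_nil.
have := bounded_continuousD (c j) IH (hF j); congr bounded_continuous.
by apply/funext => x; rewrite big_cons addrC mulrC.
Qed.

Lemma bounded_continuous_interp c : bounded_continuous Omega (interp c).
Proof.
by apply: bounded_continuous_sum => j; apply: bounded_continuous_closure; exact: continuous_hatf.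
Qed.

Lemma interp_node c i : interp c (node i) = c i.
Proof.
rewrite /interp (bigD1 i)//= hatf_node// eqxx mul1r big1 ?addr0// => j ji.
by rewrite hatf_node// (negbTE ji) mul0r.
Qed.

(** Acting on nodal values, so that nodewise minima of functions stay admissible arguments. *)
Definition nodal_operator c i : R :=
  lambda / 2 * ((mass i)^-1 * \sum_j kap i j * c j) + Ieps Omega phi r eps (M i) (interp c) (node i).

Lemma fe_bounded_continuous v : fe_space T Omega v -> bounded_continuous Omega v.
Proof. by case=> cv _; exact: bounded_continuous_closure. Qed.

Lemma Ieps_interp v i : fe_space T Omega v -> Omega (node i) ->
  Ieps Omega phi r eps (M i) v (node i) = Ieps Omega phi r eps (M i) (interp (fun j => v (node j))) (node i).
Proof.
move=> fv Oi; apply: (eq_Ieps kphi oO r0 eps0 (dM Oi) Oi (Mr Oi)).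
- exact: fe_bounded_continuous.
- exact: bounded_continuous_interp.
by move=> y Oy; rewrite (fe_spaceE conf fv (polytope_union Oy)).
Qed.

Lemma nodal_operatorD a c1 c2 i : Omega (node i) ->
  nodal_operator (fun j => c1 j + a * c2 j) i = nodal_operator c1 i + a * nodal_operator c2 i.
Proof.
move=> Oi; rewrite /nodal_operator.
have -> : interp (fun j => c1 j + a * c2 j) = fun y => interp c1 y + a * interp c2 y.
  by apply/funext => y; rewrite /interp mulr_sumr -big_split/=; apply: eq_bigr => j _; ring.
rewrite (IepsD kphi oO r0 eps0 (dM Oi) Oi (Mr Oi)); try exact: bounded_continuous_interp.
have -> : \sum_j kap i j * (c1 j + a * c2 j) = \sum_j kap i j * c1 j + a * \sum_j kap i j * c2 j.
  by rewrite mulr_sumr -big_split/=; apply: eq_bigr => j _; ring.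
ring.
Qed.

Lemma second_diff_in i z : Omega (node i) -> uball z ->
  Omega (node i + theta Omega r (node i) *: (eps *: (z *m M i))) /\
  Omega (node i - theta Omega r (node i) *: (eps *: (z *m M i))).
Proof.
move=> Oi zb; have [_ _ hth _] := theta_spec oO r0 Oi.
by apply: hth; exact: Mr.
Qed.

(** Hat functions are nonnegative, sum to 1 and reproduce linear functions, so a plane below the
    nodal values lies below the interpolant everywhere; its linear part cancels in the symmetric
    difference. *)
Lemma Ieps_contact c i : Omega (node i) -> contact c i ->
  0 <= Ieps Omega phi r eps (M i) (interp c) (node i).
Proof.
move=> Oi [p hp].
have := @Ieps_lower _ _ _ _ kphi d0 oO r eps (M i) (node i) r0 eps0 (dM Oi) Oi (Mr Oi) (interp c) 0
  (bounded_continuous_interp c).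
rewrite mul0r mul0r oppr0; apply => z zb.
have [P1 P2] := second_diff_in Oi zb; rewrite /second_diff interp_node.
have supp y : Omega y -> c i + dot p (y - node i) <= interp c y.
  move=> Oy; have Uy := polytope_union Oy.
  have -> : c i + dot p (y - node i) = \sum_(j : I) hatf j y * (c i + dot p (node j - node i)).
    under eq_bigr do rewrite mulrDr dotBr mulrBr; rewrite big_split/= sumrB -!mulr_suml sum_hatf// !mul1r.
    congr (_ + _); rewrite dotBr; congr (_ - _).
    rewrite -{1}(sum_hatf_node conf Uy) dot_sumr; apply: eq_bigr => j _.
    by rewrite dotZr.
  by apply: ler_sum => j _; rewrite ler_wpM2l ?hatf_ge0// hp.
have := supp _ P1; have := supp _ P2; rewrite addrAC subrr add0r addrAC subrr add0r dotNr; lra.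
Qed.

(* Off-diagonal entries are nonnegative and the interpolant is monotone. *)
Lemma nodal_operator_mono c1 c2 i : Omega (node i) -> (forall j, c1 j <= c2 j) -> c1 i = c2 i ->
  nodal_operator c1 i <= nodal_operator c2 i.
Proof.
move=> Oi c12 ci.
have Ed : c2 = fun j => c1 j + 1 * (c2 j - c1 j) by apply/funext => j; ring.
rewrite Ed nodal_operatorD// lerDl mul1r; set c := fun j => _.
have c_ge0 j : 0 <= c j by rewrite subr_ge0.
have cE : c i = 0 by rewrite /c ci subrr.
rewrite /nodal_operator addr_ge0//.
  rewrite !mulr_ge0 ?invr_ge0 ?(ltW lambda0)//; first by rewrite ltW// (mass_gt0 conf d0 h0 g0 hulls_ge).
  apply: sumr_ge0 => j _; case: (eqVneq j i) => [->|ji]; first by rewrite cE mulr0.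
  rewrite mulr_ge0//; apply: (kap_ge0 conf d0 acute) => //; last by rewrite eq_sym.
  by move=> K KT; exact: (vol_ohull_gt0 conf d0 h0 g0 hulls_ge).
apply: (Ieps_contact Oi); exists 0 => j.
by rewrite dot0l addr0 cE.
Qed.

Lemma nodal_operator_cst (C : R) i : Omega (node i) -> nodal_operator (fun=> C) i = 0.
Proof.
move=> Oi; rewrite /nodal_operator -mulr_suml sum_kap// mul0r !mulr0 add0r.
have P (b : R) : 0 <= Ieps Omega phi r eps (M i) (interp (fun=> b)) (node i).
  by apply: (Ieps_contact Oi); exists 0 => j; rewrite dot0l addr0.
apply/eqP; rewrite eq_le P andbT.
have := nodal_operatorD (-1) (fun=> 0) (fun=> C) Oi.
rewrite /nodal_operator -!mulr_suml sum_kap// !(mul0r, mulr0, add0r) => E.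
have := P (-1 * C); rewrite E.
have -> : Ieps Omega phi r eps (M i) (interp (fun=> 0)) (node i) = 0.
  have := nodal_operatorD (-1) (fun=> 0) (fun=> 0) Oi.
  rewrite /nodal_operator -!mulr_suml sum_kap// !(mul0r, mulr0, add0r) => E2; lra.
lra.
Qed.

End nodal_operator.

(** * The boundary barrier *)

Section power_inequalities.
Context (R : realType).

Lemma inv_power_tangent (x : R) (q : nat) : -1 < x -> 1 - q%:R * x <= ((1 + x) ^+ q)^-1.
Proof.
move=> x1; have p0 : 0 < 1 + x by lra.
elim: q => [|q IH]; first by rewrite mul0r subr0 expr0 invr1.
rewrite -[leRHS]mul1r ler_pdivlMr ?exprn_gt0// exprS.
have p1 : 0 < (1 + x) ^+ q by rewrite exprn_gt0.
rewrite -[leRHS]mul1r in IH; rewrite ler_pdivlMr// in IH.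
rewrite -natr1 in IH *.
have := sqr_ge0 x; have q0 : 0 <= q%:R :> R by [].
set u := (1 + x) ^+ q in p1 IH *; set n := q%:R in q0 IH *.
move=> x2; have h1 : (1 - (n + 1) * x) * (1 + x) = (1 - n * x) - (n + 1) * x ^+ 2 by ring.
rewrite mulrA h1 mulrBl; apply: le_trans IH; rewrite gerBl.
by apply: mulr_ge0 (mulr_ge0 _ x2) (ltW p1); lra.
Qed.

(** A second order gain is kept for negative x only: with y = -x one has 1 / (1 - y) >= 1 + y, then
    three terms of the binomial expansion. The gain is quadratic in q and the linear term is not, so
    a large exponent wins. *)
Lemma inv_power_convex (x : R) (q : nat) : -1 < x ->
  1 - q%:R * x + q%:R * (q%:R - 1) / 2 * Num.max 0 (- x) ^+ 2 <= ((1 + x) ^+ q)^-1.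
Proof.
move=> x1; case: (leP 0 (- x)) => [x0|x0]; last first.
  by rewrite expr0n/= mulr0 addr0 inv_power_tangent.
have p0 : 0 < 1 + x by lra.
pose y := - x; have y0 : 0 <= y by [].
have h : 1 + q%:R * y + q%:R * (q%:R - 1) / 2 * y ^+ 2 <= (1 + y) ^+ q.
  elim: q => [|q IH]; first by rewrite !mul0r !addr0 expr0.
  rewrite [(1 + y) ^+ _]exprS -natr1; apply: (@le_trans _ _ ((1 + y) * (1 + q%:R * y + q%:R * (q%:R - 1) / 2 * y ^+ 2))); last first.
    by apply: ler_wpM2l IH; rewrite addr_ge0.
  have -> : (1 + y) * (1 + q%:R * y + q%:R * (q%:R - 1) / 2 * y ^+ 2) =
    1 + (q%:R + 1) * y + (q%:R + 1) * ((q%:R + 1) - 1) / 2 * y ^+ 2 + q%:R * (q%:R - 1) / 2 * y ^+ 3 by field.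
  rewrite lerDl mulr_ge0 ?exprn_ge0// divr_ge0//; case: q {IH} => [|q]; first by rewrite mul0r.
  by rewrite mulr_ge0// subr_ge0 ler1n.
have -> : 1 - q%:R * x + q%:R * (q%:R - 1) / 2 * (- x) ^+ 2 = 1 + q%:R * y + q%:R * (q%:R - 1) / 2 * y ^+ 2.
  by rewrite /y; ring.
apply: le_trans h _; rewrite -exprVn lerXn2r ?nnegrE ?invr_ge0 ?(ltW p0)//.
  by rewrite addr_ge0.
by rewrite -[leRHS]mul1r ler_pdivlMr// /y; nra.
Qed.

End power_inequalities.

Section barrier.
Context (R : realType) (d : nat) (T : mesh R d).
Hypothesis conf : conforming T.
Hypothesis d0 : (0 < d)%N.
Local Notation I := 'I_(nnodes T).
Local Notation elt := (elements T).
Local Notation Omega := (polytope T).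
Variables h g : R.
Hypothesis h0 : 0 < h.
Hypothesis g0 : 0 < g.
Hypothesis hulls_le : forall K x y, K \in elt -> hull K x -> hull K y -> enorm (x - y) <= h.
Hypothesis hulls_ge : forall K, K \in elt -> exists c, forall x, enorm (x - c) <= g * h -> hull K x.
Hypothesis acute : face_weakly_acute T Omega.
Variables (phi : 'rV[R]_d -> R) (Q eps lambda : R) (M : I -> 'M[R]_d).
Local Notation r := (Q * eps).
Hypothesis kphi : kernel_function phi.
Hypotheses (Q0 : 0 < Q) (eps0 : 0 < eps) (lambda0 : 0 < lambda).
Hypothesis dM : forall i : I, Omega (node i) -> 0 < \det (M i).
Hypothesis Mr : forall i : I, Omega (node i) -> forall z, uball z -> enorm (eps *: (z *m M i)) < r.
Hypothesis ghr : g * h <= r.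

Let r0 : 0 < r. Proof. exact: mulr_gt0. Qed.
Let oO : open Omega. Proof. exact: open_interior. Qed.
Let vpos K : K \in elt -> 0 < vol (ohull K).
Proof. by move=> KT; exact: (vol_ohull_gt0 conf d0 h0 g0 hulls_ge). Qed.

(** The off-diagonal row sum of [kap] is at most this times h^(d - 2); [direction_const] is [vmin]
    without h^d. *)
Definition stiff_bound : R := g ^- 2 * 2 ^+ d.
Definition direction_const : R := (2 * (g / d%:R)) ^+ d.
(** The first summand comes from |theta eps M z| <= theta Q eps, the second from the interpolation
    error h^2 divided by (theta eps)^2 >= (g h / Q)^2. *)
Definition nonlocal_bound : R := kernel_mass phi * (2 * Q ^+ 2 + 2 * Q ^+ 2 / g ^+ 2).

(** Lower bound for the operator on |x - z|^(-2 q) in units of q rho^(-2 (q + 1)), rho being the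
    distance of the node from z. The factor 2^-d comes from mass <= (2 h)^d. It is affine and
    increasing in q, while the nonlocal loss is fixed. *)
Definition power_gain (q : nat) : R :=
  lambda / 2 * ((2 ^+ d)^-1 * ((q%:R - 1) / 2 * (direction_const ^+ 2 / stiff_bound) - stiff_bound))
  - nonlocal_bound.

Lemma kap_far (i j : I) : kap i j != 0 -> enorm (node j - node i) <= h.
Proof.
move=> kij; have [K /andP[KT sK]] : exists K, (K \in elt) && (stiff K i j != 0).
  apply/existsP; apply: contraNT kij; rewrite negb_exists => /forallP hK.
  by rewrite /kap big1// => K KT; have := hK K; rewrite KT/= negbK => /eqP.
case: (boolP (i \in K)) => iK; last by rewrite /stiff bgrad_out// dot0l mulr0 oppr0 eqxx in sK.
case: (boolP (j \in K)) => jK; last by rewrite /stiff (bgrad_out conf KT jK) dot0r mulr0 oppr0 eqxx in sK.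
by apply: (hulls_le KT); exact: hull_node.
Qed.

Section at_node.
Variables (i : I) (z : 'rV[R]_d) (q : nat).
Hypothesis Oi : Omega (node i).
Hypothesis zout : forall y, union T y -> y != z.
Hypothesis q0 : (0 < q)%N.
Let p := node i - z.
Let rho := enorm p.
Hypothesis hrho : h * stiff_bound <= direction_const * rho.

Let rho0 : 0 < rho.
Proof. by apply: enorm_gt0; rewrite subr_eq0; apply: zout; exact: union_node. Qed.

Let sq (y : 'rV[R]_d) := enorm (y - z) ^+ 2.
Let G (j : I) : R := (sq (node j) ^+ q)^-1.
(** Relative change of the squared distance to the pole, so that |y - z|^(-2 q) is rho^(-2 q) (1 + X
    y)^(-q). *)
Let X (y : 'rV[R]_d) := (sq y - rho ^+ 2) / rho ^+ 2.

Let rho2 : 0 < rho ^+ 2. Proof. by rewrite exprn_gt0. Qed.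

Let sqX y : sq y = rho ^+ 2 * (1 + X y).
Proof. by rewrite /X mulrDr mulr1 mulrC divfK ?gt_eqF// subrKC. Qed.

Let X1 y : union T y -> -1 < X y.
Proof.
move=> Uy; have : 0 < sq y.
  by rewrite exprn_gt0// enorm_gt0// subr_eq0 zout.
by rewrite sqX pmulr_rgt0//; lra.
Qed.

Let GX j : G j = (rho ^+ 2) ^- q * ((1 + X (node j)) ^+ q)^-1.
Proof. by rewrite /G sqX exprMn invfM. Qed.

Let Gi : G i = (rho ^+ 2) ^- q.
Proof. by []. Qed.

Let sq_shift y w : sq (y + w) = sq y + 2 * dot (y - z) w + enorm w ^+ 2.
Proof. by rewrite /sq -enormD_sqr addrAC. Qed.

Let m := h ^+ d.
Let m0 : 0 < m. Proof. by rewrite exprn_gt0. Qed.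
Let S0 : 0 < stiff_bound. Proof. by rewrite mulr_gt0 ?invr_gt0 ?exprn_gt0. Qed.
Let w0 : 0 < direction_const.
Proof. by rewrite exprn_gt0// mulr_gt0// divr_gt0// ltr0n. Qed.

Let sumS : \sum_(j | j != i) kap i j <= stiff_bound * m / h ^+ 2.
Proof.
apply: le_trans (sum_kap_le conf d0 h0 g0 hulls_le hulls_ge i) _.
rewrite /stiff_bound /m exprVn !exprMn le_eqVlt; apply/orP; left; apply/eqP.
by field; rewrite !gt_eqF.
Qed.

Let kge j : j != i -> 0 <= kap i j.
Proof. by move=> ji; apply: (kap_ge0 conf d0 acute vpos) => //; rewrite eq_sym. Qed.

Let vminE : vmin d h g = direction_const * m.
Proof. by rewrite /vmin /direction_const /m -exprMn; congr (_ ^+ _); ring. Qed.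

Let sumX : \sum_j kap i j * X (node j) <= stiff_bound * m / rho ^+ 2.
Proof.
have E j : kap i j * X (node j) = 2 / rho ^+ 2 * (kap i j * dot p (node j - node i)) +
    kap i j * enorm (node j - node i) ^+ 2 / rho ^+ 2.
  rewrite /X; have -> : sq (node j) = rho ^+ 2 + 2 * dot p (node j - node i) + enorm (node j - node i) ^+ 2.
    by rewrite -[X in sq X](subrK (node i)) addrC sq_shift.
  by field; rewrite gt_eqF.
under eq_bigr do rewrite E; rewrite big_split/= -mulr_sumr (sum_kapB conf d0 h0 g0 hulls_ge Oi) mulr0 add0r.
rewrite -mulr_suml ler_pM2r ?invr_gt0//.
rewrite (bigD1 i)//= subrr enorm0 expr0n mulr0 add0r.
apply: (@le_trans _ _ (\sum_(j | j != i) kap i j * h ^+ 2)).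
  apply: ler_sum => j ji; case: (eqVneq (kap i j) 0) => [->|kij]; first by rewrite !mul0r.
  by rewrite ler_wpM2l ?kge// lerXn2r ?nnegrE ?enorm_ge0 ?(ltW h0)// kap_far.
rewrite -mulr_suml -ler_pdivlMr ?exprn_gt0//.
Qed.

Let neg (t : R) := Num.max 0 (- t).

(** The direction bound, used towards the pole, makes the first moment of the negative parts of [X]
    large, while the row sum of [kap] bounds the total weight; Cauchy-Schwarz gives the second
    moment. [hrho] ensures that the curvature of the squared distance costs at most half of the
    first moment. *)
Let sum_neg : direction_const ^+ 2 / stiff_bound * m / rho ^+ 2 <= \sum_(j | j != i) kap i j * neg (X (node j)) ^+ 2.
Proof.
have dirb : 2 / rho ^+ 2 * (direction_const * m * rho / h) - h ^+ 2 / rho ^+ 2 * (stiff_bound * m / h ^+ 2) <=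
    \sum_(j | j != i) kap i j * neg (X (node j)).
  have := direction_bound conf d0 h0 g0 hulls_le hulls_ge acute Oi (- p).
  rewrite vminE enormN -/rho (bigD1 i)//= subrr dot0r maxxx mulr0 add0r => db.
  apply: (@le_trans _ _ (\sum_(j | j != i) kap i j * (2 / rho ^+ 2 * neg (dot p (node j - node i)) - h ^+ 2 / rho ^+ 2))).
    under eq_bigr do rewrite mulrBr mulrCA; rewrite sumrB -mulr_sumr -mulr_suml [_ * (h ^+ 2 / _)]mulrC.
    apply: lerB; last by rewrite ler_wpM2l ?divr_ge0 ?exprn_ge0 ?(ltW h0) ?(ltW rho0).
    rewrite ler_wpM2l ?divr_ge0 ?exprn_ge0 ?(ltW rho0)//.
    by under [leRHS]eq_bigr do rewrite /neg -dotNl.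
  apply: ler_sum => j ji; case: (eqVneq (kap i j) 0) => [->|kij]; first by rewrite !mul0r.
  rewrite ler_wpM2l ?kge//.
  have XE : X (node j) = 2 / rho ^+ 2 * dot p (node j - node i) + enorm (node j - node i) ^+ 2 / rho ^+ 2.
    rewrite /X; have -> : sq (node j) = rho ^+ 2 + 2 * dot p (node j - node i) + enorm (node j - node i) ^+ 2.
      by rewrite -[X in sq X](subrK (node i)) addrC sq_shift.
    by field; rewrite gt_eqF.
  have c0 : 0 < 2 / rho ^+ 2 by rewrite divr_gt0.
  have e1 : enorm (node j - node i) ^+ 2 / rho ^+ 2 <= h ^+ 2 / rho ^+ 2.
    by rewrite ler_pM2r ?invr_gt0// lerXn2r ?nnegrE ?enorm_ge0 ?(ltW h0)// kap_far.
  have e2 : 0 <= enorm (node j - node i) ^+ 2 / rho ^+ 2 by rewrite divr_ge0 ?exprn_ge0 ?enorm_ge0.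
  rewrite /neg XE le_max; case: (leP 0 (- dot p (node j - node i))) => hd.
    by apply/orP; right; move: e1 e2; set e3 := _ / _ => e1 e2; nra.
  by apply/orP; left; rewrite mulr0 sub0r oppr_le0 divr_ge0 ?exprn_ge0 ?(ltW h0) ?(ltW rho0).
(* Cauchy-Schwarz in the form n^2 >= 2 tau n - tau^2; [tau] is the quotient of the bounds for the
   first moment and for the total weight. *)
pose tau := direction_const / stiff_bound * (h / rho).
have tau0 : 0 < tau by rewrite mulr_gt0// divr_gt0.
apply: (@le_trans _ _ (\sum_(j | j != i) kap i j * (2 * tau * neg (X (node j)) - tau ^+ 2))); last first.
  apply: ler_sum => j ji; rewrite ler_wpM2l ?kge//.
  by have := sqr_ge0 (neg (X (node j)) - tau); set n := neg _; nra.
under eq_bigr do rewrite mulrBr mulrCA; rewrite sumrB -mulr_sumr -mulr_suml.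
have half : direction_const * m / (rho * h) <= \sum_(j | j != i) kap i j * neg (X (node j)).
  apply: le_trans dirb.
  have -> : 2 / rho ^+ 2 * (direction_const * m * rho / h) - h ^+ 2 / rho ^+ 2 * (stiff_bound * m / h ^+ 2) =
    direction_const * m / (rho * h) + (direction_const * rho - h * stiff_bound) * (m / (rho ^+ 2 * h)).
    by field; rewrite !gt_eqF.
  rewrite lerDl mulr_ge0 ?subr_ge0// divr_ge0 ?(ltW m0)// mulr_ge0 ?exprn_ge0 ?(ltW h0) ?(ltW rho0)//.
apply: (@le_trans _ _ (2 * tau * (direction_const * m / (rho * h)) - stiff_bound * m / h ^+ 2 * tau ^+ 2)).
  rewrite le_eqVlt; apply/orP; left; apply/eqP; rewrite /tau.
  by field; rewrite !gt_eqF.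
by apply: lerB; [rewrite ler_wpM2l// mulr_ge0// ltW|rewrite ler_wpM2r// exprn_ge0// ltW].
Qed.

Lemma laplacian_power_ge :
  (rho ^+ 2) ^- q.+1 * m * (q%:R * ((q%:R - 1) / 2 * (direction_const ^+ 2 / stiff_bound) - stiff_bound)) <=
  \sum_j kap i j * G j.
Proof.
have -> : \sum_j kap i j * G j = \sum_(j | j != i) kap i j * (G j - G i).
  under [RHS]eq_bigr do rewrite mulrBr; rewrite sumrB -mulr_suml.
  have := sum_kap conf i; rewrite !(bigD1 i (P := xpredT))//= => /eqP; rewrite addrC addr_eq0 => /eqP ->.
  by rewrite mulNr opprK addrC.
apply: (@le_trans _ _ (\sum_(j | j != i) kap i j * ((rho ^+ 2) ^- q *
    (- q%:R * X (node j) + q%:R * (q%:R - 1) / 2 * neg (X (node j)) ^+ 2)))); last first.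
  apply: ler_sum => j ji; rewrite ler_wpM2l ?kge// GX Gi -[X in _ <= _ - X]mulr1 -mulrBr.
  rewrite ler_wpM2l ?invr_ge0 ?exprn_ge0 ?(ltW rho0)//.
  have := inv_power_convex q (X1 (union_node conf j)); rewrite -/(neg _) => hc.
  move: hc; set U := _^-1; set V := neg _; set N := q%:R * (q%:R - 1) / 2; lra.
have Xi : X (node i) = 0 by rewrite /X /sq -/p -/rho subrr mul0r.
have sumX' : \sum_(j | j != i) kap i j * X (node j) <= stiff_bound * m / rho ^+ 2.
  by have := sumX; rewrite (bigD1 i)//= Xi mulr0 add0r.
have -> : \sum_(j | j != i) kap i j * ((rho ^+ 2) ^- q *
    (- q%:R * X (node j) + q%:R * (q%:R - 1) / 2 * neg (X (node j)) ^+ 2)) =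
    (rho ^+ 2) ^- q * (q%:R * ((q%:R - 1) / 2 * \sum_(j | j != i) kap i j * neg (X (node j)) ^+ 2
       - \sum_(j | j != i) kap i j * X (node j))).
  rewrite mulr_sumr -sumrB !mulr_sumr; apply: eq_bigr => j _; ring.
rewrite exprS invfM; set P := (rho ^+ 2) ^- q.
have P0 : 0 <= P by rewrite invr_ge0 exprn_ge0// ltW.
have q1 : 0 <= (q%:R - 1) / 2 :> R by rewrite divr_ge0// subr_ge0 ler1n.
have := ler_wpM2l q1 sum_neg; move: sumX'.
set A := \sum_(j | _) _; set B := \sum_(j | _) _ => sA sB.
apply: (@le_trans _ _ (P * (q%:R * ((q%:R - 1) / 2 * (direction_const ^+ 2 / stiff_bound * m / rho ^+ 2) -
    stiff_bound * m / rho ^+ 2)))).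
  by rewrite le_eqVlt; apply/orP; left; apply/eqP; set c := (rho ^+ 2)^-1; ring.
by apply: ler_wpM2l => //; apply: ler_wpM2l => //; apply: lerB.
Qed.

Let sum_sq y : union T y -> \sum_(j : I) hatf j y * sq (node j) <= sq y + h ^+ 2.
Proof.
move=> Uy; have -> : \sum_(j : I) hatf j y * sq (node j) = sq y + \sum_(j : I) hatf j y * enorm (node j - y) ^+ 2.
  have E j : hatf j y * sq (node j) =
      hatf j y * sq y + 2 * (hatf j y * dot (y - z) (node j - y)) + hatf j y * enorm (node j - y) ^+ 2.
    have -> : sq (node j) = sq (y + (node j - y)) by rewrite [y + _]addrC subrK.
    rewrite sq_shift; ring.
  under eq_bigr do rewrite E; rewrite !big_split/= -mulr_suml sum_hatf// mul1r -mulr_sumr.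
  have -> : \sum_(j : I) hatf j y * dot (y - z) (node j - y) = 0; last by rewrite mulr0 addr0.
  under eq_bigr do rewrite -dotZr; rewrite -dot_sumr.
  under eq_bigr do rewrite scalerBr; rewrite sumrB sum_hatf_node// -scaler_suml sum_hatf// scale1r subrr.
  by rewrite dot0r.
rewrite lerD2l -[leRHS]mul1r -(sum_hatf conf Uy) mulr_suml; apply: ler_sum => j _.
case: (eqVneq (hatf j y) 0) => [->|jy]; first by rewrite !mul0r.
rewrite ler_wpM2l ?hatf_ge0// lerXn2r ?nnegrE ?enorm_ge0 ?(ltW h0)//.
exact: (hatf_near conf hulls_le jy).
Qed.

(** The tangent inequality is applied at the nodes and interpolated; interpolation raises the
    squared distance by at most h^2. *)
Let interp_tangent y : union T y ->
  (rho ^+ 2) ^- q * (1 - q%:R * ((sq y + h ^+ 2 - rho ^+ 2) / rho ^+ 2)) <= interp G y.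
Proof.
move=> Uy; set P := (rho ^+ 2) ^- q.
have P0 : 0 <= P by rewrite invr_ge0 exprn_ge0// ltW.
apply: (@le_trans _ _ (\sum_(j : I) hatf j y * (P * (1 - q%:R * X (node j))))); last first.
  apply: ler_sum => j _; rewrite ler_wpM2l ?hatf_ge0// GX ler_wpM2l//.
  by apply: inv_power_tangent; apply: X1; exact: union_node.
have -> : \sum_(j : I) hatf j y * (P * (1 - q%:R * X (node j))) =
    P * (1 - q%:R * ((\sum_(j : I) hatf j y * sq (node j) - rho ^+ 2) / rho ^+ 2)).
  have E j : hatf j y * (P * (1 - q%:R * X (node j))) =
      hatf j y * (P * (1 + q%:R)) - P * q%:R / rho ^+ 2 * (hatf j y * sq (node j)).
    by rewrite /X; field; rewrite gt_eqF.
  under eq_bigr do rewrite E; rewrite sumrB -mulr_suml sum_hatf// mul1r -mulr_sumr.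
  by field; rewrite gt_eqF.
apply: ler_wpM2l => //; rewrite lerD2l lerN2 ler_wpM2l// ler_pM2r ?invr_gt0// lerD2r.
exact: sum_sq.
Qed.

Lemma nonlocal_power_ge :
  - ((rho ^+ 2) ^- q.+1 * q%:R * nonlocal_bound) <= Ieps Omega phi r eps (M i) (interp G) (node i).
Proof.
have [t0 t1 tin tge] := theta_spec oO r0 Oi.
(* Near the boundary theta may be as small as h / eps, and this bound keeps h / (theta eps)
   bounded. *)
have tgh : g * h / r <= theta Omega r (node i).
  apply: tge => //; first exact: mulr_gt0.
  by move=> y hy; apply: (node_ball conf h0 g0 hulls_ge Oi); rewrite addrC addKr.
set th := theta _ _ _ in t0 t1 tin tge tgh *.
set P := (rho ^+ 2) ^- q.+1.
have P0 : 0 <= P by rewrite invr_ge0 exprn_ge0// ltW.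
pose c := P * q%:R * (2 * (th * r) ^+ 2 + 2 * h ^+ 2).
have te : 0 < th * eps by exact: mulr_gt0.
apply: le_trans (@Ieps_lower _ _ _ _ kphi d0 oO r eps (M i) (node i) r0 eps0 (dM Oi) Oi (Mr Oi) (interp G) c
  (bounded_continuous_interp conf G) _).
  rewrite lerN2 -/th.
  have k0 := kernel_mass_ge0 kphi.
  have -> : c * kernel_mass phi / (th * eps) ^+ 2 =
      P * q%:R * (kernel_mass phi * (2 * Q ^+ 2 + 2 * (h ^+ 2 / (th * eps) ^+ 2))).
    by rewrite /c; field; rewrite !gt_eqF.
  rewrite /nonlocal_bound !ler_wpM2l ?mulr_ge0// lerD2l -mulrA ler_wpM2l//.
  rewrite ler_pdivlMr ?exprn_gt0// mulrAC ler_pdivrMr ?exprn_gt0// -!exprMn.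
  rewrite lerXn2r ?nnegrE ?mulr_ge0 ?(ltW h0) ?(ltW g0) ?(ltW Q0) ?(ltW t0) ?(ltW eps0)//.
  by move: tgh; rewrite ler_pdivrMr//; lra.
move=> w wb; have [P1 P2] := second_diff_in r0 Mr Oi wb.
rewrite /second_diff -/th; set s := th *: _ in P1 P2 *.
have s1 : enorm s <= th * r.
  by rewrite enormZ ger0_norm ?(ltW t0)// ler_wpM2l ?(ltW t0)// ltW// Mr.
have := interp_tangent (polytope_union P1); have := interp_tangent (polytope_union P2).
rewrite interp_node// Gi !sq_shift enormN dotNr.
have -> : sq (node i) = rho ^+ 2 by [].
have s2 : enorm s ^+ 2 <= (th * r) ^+ 2 by rewrite lerXn2r ?nnegrE ?enorm_ge0 ?mulr_ge0 ?(ltW t0) ?(ltW Q0) ?(ltW eps0).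
have cE : c = (rho ^+ 2) ^- q * (q%:R / rho ^+ 2 * (2 * (th * r) ^+ 2 + 2 * h ^+ 2)).
  by rewrite /c /P exprS invfM; set a := (rho ^+ 2)^-1; ring.
have Pq0 : 0 <= (rho ^+ 2) ^- q by rewrite invr_ge0 exprn_ge0// ltW.
have : 0 <= (rho ^+ 2) ^- q * (q%:R / rho ^+ 2 * (2 * (th * r) ^+ 2 - 2 * enorm s ^+ 2)).
  by rewrite mulr_ge0// mulr_ge0 ?divr_ge0 ?(ltW rho2)//; lra.
rewrite {c}cE; set Pq := (rho ^+ 2) ^- q; set e := dot _ _; set a := enorm s ^+ 2; set b := (th * r) ^+ 2.
have -> : (rho ^+ 2 + 2 * e + a + h ^+ 2 - rho ^+ 2) / rho ^+ 2 = (rho ^+ 2)^-1 * (2 * e + a + h ^+ 2) by rewrite mulrC; congr (_ * _); ring.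
have -> : (rho ^+ 2 + 2 * - e + a + h ^+ 2 - rho ^+ 2) / rho ^+ 2 = (rho ^+ 2)^-1 * (- 2 * e + a + h ^+ 2) by rewrite mulrC; congr (_ * _); ring.
set ir := (rho ^+ 2)^-1; nra.
Qed.

Lemma power_barrier : 1 <= power_gain q ->
  (rho ^+ 2) ^- q.+1 * q%:R <= nodal_operator phi r eps lambda M G i.
Proof.
move=> pg; apply: le_trans (lerD (_ : (rho ^+ 2) ^- q.+1 * q%:R * (1 + nonlocal_bound) <= _) nonlocal_power_ge).
  by rewrite le_eqVlt; apply/orP; left; apply/eqP; ring.
set P := (rho ^+ 2) ^- q.+1.
have P0 : 0 <= P by rewrite invr_ge0 exprn_ge0// ltW.
have mi := mass_gt0 conf d0 h0 g0 hulls_ge Oi.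
have := laplacian_power_ge; rewrite -/P; set b := _ - stiff_bound; set L := \sum_j _ => hL.
have pg' : 1 + nonlocal_bound <= lambda / 2 * ((2 ^+ d)^-1 * b) by move: pg; rewrite /power_gain -/b; lra.
have nb : 0 <= nonlocal_bound.
  by rewrite mulr_ge0 ?(kernel_mass_ge0 kphi)// addr_ge0 ?divr_ge0 ?mulr_ge0 ?exprn_ge0 ?(ltW Q0) ?(ltW g0).
have b0 : 0 <= b.
  rewrite leNgt; apply/negP => bn.
  have : lambda / 2 * ((2 ^+ d)^-1 * b) <= 0.
    by rewrite mulr_ge0_le0 ?divr_ge0 ?(ltW lambda0)// mulr_ge0_le0 ?invr_ge0 ?exprn_ge0 ?(ltW bn).
  lra.
apply: (@le_trans _ _ (P * q%:R * (lambda / 2 * ((2 ^+ d)^-1 * b)))).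
  by apply: ler_wpM2l pg'; rewrite mulr_ge0.
have -> : P * q%:R * (lambda / 2 * ((2 ^+ d)^-1 * b)) = lambda / 2 * (P * q%:R * b / 2 ^+ d) by ring.
apply: ler_wpM2l; first by rewrite divr_ge0// ltW.
rewrite ler_pdivrMr ?exprn_gt0// -[leRHS]mulrA ler_pdivlMl//.
have := mass_le conf h0 g0 hulls_le hulls_ge Oi; rewrite exprMn -/m => ml.
have : P * q%:R * b * mass i <= P * q%:R * b * (2 ^+ d * m).
  by apply: ler_wpM2l ml; rewrite !mulr_ge0.
move: hL; set D2 := 2 ^+ d => hL hm.
have : D2 * (P * m * (q%:R * b)) <= D2 * L by rewrite ler_pM2l// exprn_gt0.
rewrite [mass i * _]mulrC [L * _]mulrC; lra.
Qed.

End at_node.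
End barrier.

(** * Assembly of the barrier *)

Section barrier_theorem.
Context (R : realType) (d : nat) (T : mesh R d).
Hypothesis conf : conforming T.
Hypothesis d0 : (0 < d)%N.
Local Notation I := 'I_(nnodes T).
Local Notation elt := (elements T).
Local Notation Omega := (polytope T).
Variables h g : R.
Hypothesis h0 : 0 < h.
Hypothesis g0 : 0 < g.
Hypothesis hulls_le : forall K x y, K \in elt -> hull K x -> hull K y -> enorm (x - y) <= h.
Hypothesis hulls_ge : forall K, K \in elt -> exists c, forall x, enorm (x - c) <= g * h -> hull K x.
Hypothesis acute : face_weakly_acute T Omega.
Variables (phi : 'rV[R]_d -> R) (Q eps lambda : R) (M : I -> 'M[R]_d).
Local Notation r := (Q * eps).
Hypothesis kphi : kernel_function phi.
Hypotheses (Q0 : 0 < Q) (eps0 : 0 < eps) (lambda0 : 0 < lambda).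
Hypothesis dM : forall i : I, Omega (node i) -> 0 < \det (M i).
Hypothesis Mr : forall i : I, Omega (node i) -> forall z, uball z -> enorm (eps *: (z *m M i)) < r.
Hypothesis ghr : g * h <= r.
Local Notation L := (nodal_operator phi r eps lambda M).

(* A minimum of functions 1 - (c0 r / |x - z|)^(2 q) whose poles z lie outside the
   closure of the polytope, one for each node close to the boundary. *)
Lemma barrier (c0 : R) (q : nat) : 0 < c0 -> (0 < q)%N -> 1 <= power_gain g phi Q lambda q ->
  h * stiff_bound d g <= direction_const d g * (c0 * r) ->
  boundary Omega !=set0 ->
  (forall x, boundary Omega x -> exists2 z, enorm (z - x) <= r &
     forall y, enorm (y - z) < c0 * r -> ~ closure Omega y) ->
  exists b : I -> R, [/\ (forall j, 0 <= b j <= 1),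
    (forall i, Omega (node i) -> L b i <= 0) &
    (forall i, Omega (node i) -> dist (node i) (boundary Omega) <= r ->
       L b i <= - (c0 ^+ 2) ^+ q / 9 ^+ q.+1 / r ^+ 2)].
Proof.
move=> c00 q0 pg hsmall bne ext.
have r0 : 0 < r by exact: mulr_gt0.
have cr0 : 0 < c0 * r by exact: mulr_gt0.
pose strip (m : I) : bool := `[< dist (node m) (boundary Omega) <= r >].
(* A node of the strip has a boundary point within 2 r, as the infimum in [dist] need not be
   attained, and the pole is within r of that point: hence 3 r, and later the factor 9. *)
have /choice[z hz] : forall m : I, exists z : 'rV[R]_d, strip m ->
    enorm (node m - z) <= 3 * r /\ forall y, union T y -> c0 * r <= enorm (y - z).
  move=> m; case: (pselect (strip m)) => [/asboolP sm|nm]; last by exists 0.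
  have [x bx xm] := dist_approx (node m) bne r0.
  have [z zx zout] := ext x bx; exists z => _; split.
    have -> : node m - z = (node m - x) - (z - x) by rewrite opprB addrA subrK.
    by apply: le_trans (enormB _ _) _; lra.
  move=> y Uy; rewrite leNgt; apply/negP => /zout; rewrite closure_polytope//.
(* Normalises the functions to be nonnegative at distance at least c0 r from their pole. *)
pose K := ((c0 * r) ^+ 2) ^+ q.
have K0 : 0 < K by rewrite !exprn_gt0.
pose G (m j : I) : R := ((enorm (node j - z m) ^+ 2) ^+ q)^-1.
pose F (m j : I) : R := 1 + - K * G m j.
have rho_ge (m j : I) : strip m -> (c0 * r) ^+ 2 <= enorm (node j - z m) ^+ 2.
  move=> /hz[_ /(_ (node j) (union_node conf j))] hh.
  by rewrite lerXn2r// nnegrE ?enorm_ge0// ltW.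
have rho_gt0 (m j : I) : strip m -> 0 < enorm (node j - z m) ^+ 2.
  by move=> sm; apply: lt_le_trans (rho_ge m j sm); rewrite exprn_gt0.
have G0 (m j : I) : strip m -> 0 < G m j by move=> sm; rewrite invr_gt0 exprn_gt0// rho_gt0.
have F1 (m j : I) : strip m -> F m j <= 1 by move=> sm; rewrite /F gerDl mulNr oppr_le0 mulr_ge0 ?ltW// G0.
have F0 (m j : I) : strip m -> 0 <= F m j.
  move=> sm; have := rho_gt0 m j sm; rewrite /F /G mulNr subr_ge0 => hr.
  have hq := exprn_gt0 q hr; rewrite (ler_pdivrMr _ _ hq) mul1r.
  by rewrite lerXn2r ?nnegrE ?exprn_ge0 ?enorm_ge0 ?(ltW cr0)// rho_ge.
have LF (m i : I) : strip m -> Omega (node i) ->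
    L (F m) i <= - (K * ((enorm (node i - z m) ^+ 2) ^- q.+1 * q%:R)).
  move=> sm Oi; have [_ zm] := hz m sm.
  rewrite (nodal_operatorD conf lambda kphi r0 eps0 dM Mr (- K) (fun=> 1) (G m) Oi).
  rewrite (nodal_operator_cst conf d0 lambda kphi r0 eps0 dM Mr 1 Oi) add0r mulNr lerN2.
  apply: ler_wpM2l; first exact: ltW.
  apply: (power_barrier conf d0 h0 g0 hulls_le hulls_ge acute kphi Q0 eps0 lambda0 dM Mr ghr Oi _ q0 _ pg).
    move=> y /zm yz; apply/eqP => E; move: yz; rewrite E subrr enorm0; lra.
  apply: le_trans hsmall _; apply: ler_wpM2l; last exact: zm (union_node conf i).
  by rewrite /direction_const exprn_ge0// mulr_ge0// divr_ge0// ltW.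
pose b (j : I) : R := \big[Num.min/1]_(m | strip m) F m j.
have bF (m j : I) : strip m -> b j <= F m j by move=> sm; exact: bigmin_le_cond.
have b1 (j : I) : b j <= 1 by exact: bigmin_le_id.
have bE (j : I) : b j = 1 \/ exists2 m, strip m & b j = F m j.
  rewrite /b; elim/big_ind : _ => [|u v hu hv|m sm]; [by left| |by right; exists m].
  by case: (leP u v).
(* At each node the minimum touches one competitor from below, so monotonicity passes on that
   competitor's bound. *)
have mono (c : I -> R) (i : I) : Omega (node i) -> (forall j, b j <= c j) -> b i = c i -> L b i <= L c i.
  move=> Oi bc bi.
  exact: (nodal_operator_mono conf d0 h0 g0 hulls_ge acute kphi r0 eps0 lambda0 dM Mr Oi bc bi).
have LF0 (m i : I) : strip m -> Omega (node i) -> L (F m) i <= 0.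
  move=> sm Oi; apply: le_trans (LF m i sm Oi) _; rewrite oppr_le0 mulr_ge0 ?(ltW K0)//.
  by rewrite mulr_ge0// invr_ge0 exprn_ge0// ltW// rho_gt0.
exists b; split.
- move=> j; rewrite b1 andbT; case: (bE j) => [->|[m sm ->]]; [exact: ler01|exact: F0].
- move=> i Oi; case: (bE i) => [bi|[m sm bi]]; last first.
    by apply: le_trans (mono (F m) i Oi _ bi) (LF0 m i sm Oi) => j; exact: bF.
  rewrite -(nodal_operator_cst conf d0 lambda kphi r0 eps0 dM Mr 1 Oi).
  by apply: (mono (fun=> 1)).
move=> i Oi /asboolP si.
have bi1 : b i < 1.
  by apply: le_lt_trans (bF i i si) _; rewrite /F gtrDl mulNr oppr_lt0 mulr_gt0// G0.
case: (bE i) => [bi|[m sm bi]]; first by rewrite bi ltxx in bi1.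
apply: le_trans (mono (F m) i Oi (fun j => bF m j sm) bi) _; apply: le_trans (LF m i sm Oi) _.
(* The competitor that is minimal at node i has its pole at least as close as the pole attached to i
   itself, hence within 3 r. *)
have GG : G i i <= G m i.
  by have := bF i i si; rewrite bi /F lerD2l !mulNr lerN2 ler_pM2l.
have rm : enorm (node i - z m) ^+ 2 <= 9 * r ^+ 2.
  apply: (@le_trans _ _ (enorm (node i - z i) ^+ 2)); last first.
    have -> : 9 * r ^+ 2 = (3 * r) ^+ 2 by ring.
    by rewrite lerXn2r ?nnegrE ?enorm_ge0 ?mulr_ge0 ?(ltW Q0) ?(ltW eps0)//; case: (hz i si).
  have hi := exprn_gt0 q (rho_gt0 i i si); have hm := exprn_gt0 q (rho_gt0 m i sm).
  move: GG; rewrite /G lef_pV2 ?posrE ?hi ?hm//.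
  by rewrite ler_pXn2r// nnegrE exprn_ge0 ?enorm_ge0.
rewrite !mulNr lerN2.
have r2 : 0 < r ^+ 2 by rewrite exprn_gt0.
apply: (@le_trans _ _ (K * ((9 * r ^+ 2) ^- q.+1 * 1))).
  rewrite le_eqVlt; apply/orP; left; apply/eqP; rewrite /K; move: r2; set rr := Q * eps => r2.
  rewrite [(c0 * rr) ^+ 2]exprMn [(_ * rr ^+ 2) ^+ q]exprMn [(9 * _) ^+ _]exprMn [(rr ^+ 2) ^+ q.+1]exprS mulr1.
  have p1 : 0 < (rr ^+ 2) ^+ q by rewrite exprn_gt0.
  have p2 : 0 < 9 ^+ q.+1 :> R by rewrite exprn_gt0.
  by move: p1 p2 r2; set a := (rr ^+ 2) ^+ q; set c := 9 ^+ q.+1; set e := rr ^+ 2 => p1 p2 r2; field; rewrite !gt_eqF.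
apply: ler_wpM2l; first exact: ltW.
apply: ler_pM => //; first by rewrite invr_ge0 exprn_ge0// mulr_ge0// ltW.
- have hm := exprn_gt0 q.+1 (rho_gt0 m i sm).
  have h9 : 0 < (9 * r ^+ 2) ^+ q.+1 by rewrite exprn_gt0// mulr_gt0.
  rewrite lef_pV2 ?posrE ?hm ?h9//.
  by rewrite lerXn2r ?nnegrE ?exprn_ge0 ?enorm_ge0 ?mulr_ge0// ltW.
by rewrite ler1n.
Qed.

End barrier_theorem.

(** * Consistency *)

Section jensen.
Context (R : realType) (d : nat).

Lemma exp_tangent (s t : R) n : 0 <= s -> 0 <= t -> s ^+ n.+1 + n.+1%:R * s ^+ n * (t - s) <= t ^+ n.+1.
Proof.
move=> s0 t0; elim: n => [|n IH]; first by rewrite expr0 !expr1 mulr1 mul1r addrC subrK.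
have := ler_wpM2l t0 IH; rewrite -[t * t ^+ n.+1]exprS; apply: le_trans.
have -> : t * (s ^+ n.+1 + n.+1%:R * s ^+ n * (t - s)) =
    s ^+ n.+2 + n.+2%:R * s ^+ n.+1 * (t - s) + n.+1%:R * s ^+ n * (t - s) ^+ 2.
  by rewrite -[n.+2%:R]natr1 !(exprS s); ring.
by rewrite lerDl; apply: mulr_ge0 (sqr_ge0 _); rewrite mulr_ge0// exprn_ge0.
Qed.

(** The tangent of t^(n+1) at the weighted mean [s], integrated against the weight: its linear part
    integrates to zero. *)
Lemma jensen_power (D : set 'rV[R]_d) (w t : 'rV[R]_d -> R) (c : R) n : mset D -> (@lebesgue R d D < +oo)%E ->
  mfn D w -> (forall x, D x -> 0 <= w x <= 1) -> mfn D t -> (forall x, D x -> 0 <= t x <= c) ->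
  0 < integ D w ->
  integ D w * ((integ D w)^-1 * integ D (fun x => t x * w x)) ^+ n.+1 <= integ D (fun x => t x ^+ n.+1 * w x).
Proof.
move=> mD fD mw w01 mt tc; set mu := integ D w => mu0.
have iw : intble D w.
  by apply: (intble_bounded (c := 1)) => // x /w01 /andP[a b]; rewrite ger0_norm.
have it : intble D t.
  by apply: (intble_bounded (c := c)) => // x /tc /andP[a b]; rewrite ger0_norm.
have nw x : D x -> `|w x| <= 1 by move=> /w01 /andP[a b]; rewrite ger0_norm.
have itw : intble D (fun x => t x * w x) by apply: (intbleM (c := 1)).
have itn : intble D (fun x => t x ^+ n.+1 * w x).
  apply: (intbleM (c := 1)) => //; apply: (intble_bounded (c := c ^+ n.+1)) => //.
    exact: measurable_funX.
  move=> x Dx; have /andP[a b] := tc x Dx; rewrite ger0_norm ?exprn_ge0// lerXn2r ?nnegrE//.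
  exact: le_trans b.
set s := mu^-1 * _.
have s0 : 0 <= s.
  rewrite mulr_ge0 ?invr_ge0 ?(ltW mu0)//; apply: integ_ge0 => x Dx.
  by rewrite mulr_ge0//; [have /andP[] := tc x Dx|have /andP[] := w01 x Dx].
pose a := s ^+ n.+1 - n.+1%:R * s ^+ n * s; pose b := n.+1%:R * s ^+ n.
have i1 : intble D (fun x => a * w x) by exact: intbleZ.
have i2 : intble D (fun x => b * (t x * w x)) by exact: intbleZ.
have : integ D (fun x => a * w x + b * (t x * w x)) <= integ D (fun x => t x ^+ n.+1 * w x).
  apply: le_integ => //; first exact: intbleD.
  move=> x Dx; have /andP[t0 _] := tc x Dx; have /andP[w0 _] := w01 x Dx.
  have -> : a * w x + b * (t x * w x) = (s ^+ n.+1 + n.+1%:R * s ^+ n * (t x - s)) * w x by rewrite /a /b; ring.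
  by rewrite ler_wpM2r// exp_tangent.
rewrite integD// !integZ//; apply: le_trans.
have -> : integ D (fun x => t x * w x) = mu * s by rewrite /s mulVKf// gt_eqF.
rewrite -/mu le_eqVlt; apply/orP; left; apply/eqP; rewrite /a /b; ring.
Qed.

Lemma intble_setD_null (D N : set 'rV[R]_d) (f : 'rV[R]_d -> R) : mset D -> @lebesgue R d N = 0%E ->
  intble (D `\` N) f -> intble D f /\ integ D f = integ (D `\` N) f.
Proof.
move=> mD N0 iF; have mN := measurable_null N0.
have mDN : mset (D `\` N) by exact: measurableD.
pose f0 := f \_ (D `\` N).
have E1 x : (D `\` N) x -> f0 x = f x by move=> Dx; rewrite /f0 patchE mem_set.
have E0 x : ~ (D `\` N) x -> f0 x = 0 by move=> Dx; rewrite /f0 patchE memNset.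
have i0 : intble D f0.
  apply: (intble_patch mDN mD) => [x []//|x _ /E0//|].
  by apply: (eq_intble mDN _ iF) => x /E1.
have [i1 e1] := eq_intble_null mD N0 i0 (f := f) (fun x Dx nx => esym (E1 x (conj Dx nx))).
split=> //; rewrite e1 (@integ_patch _ _ (D `\` N) D); [exact: eq_integ|exact: subDsetl|by move=> x _ /E0].
Qed.

End jensen.

(** * Means of the coefficient matrix over stars *)

Section mean_coefficients.
Context (R : realType) (d : nat) (T : mesh R d).
Hypothesis conf : conforming T.
Hypothesis d0 : (0 < d)%N.
Local Notation I := 'I_(nnodes T).
Local Notation elt := (elements T).
Local Notation Omega := (polytope T).
Local Notation leb := (@lebesgue R d).
Variables h g : R.
Hypothesis h0 : 0 < h.
Hypothesis g0 : 0 < g.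
Hypothesis hulls_ge : forall K, K \in elt -> exists c, forall x, enorm (x - c) <= g * h -> hull K x.
Variable i : I.
Local Notation S := (star Omega i).

Lemma hatf_star x : hatf i x != 0 -> S x.
Proof. by move=> hx; apply: subset_closure; rewrite /= hat_hatf. Qed.

Lemma star_union : S `<=` union T.
Proof.
rewrite /star hat_hatf// closureE => x; apply; split; first exact: closed_union.
by move=> y /= hy; apply: contrapT => /(hatf_out i) E; rewrite E eqxx in hy.
Qed.

Lemma mset_star : mset S.
Proof. exact/closed_measurable_row/closed_closure. Qed.

Lemma mset_starI : mset (S `&` Omega).
Proof. by apply: measurableI; [exact: mset_star|exact: mset_polytope]. Qed.

Lemma leb_starI : (leb (S `&` Omega) < +oo)%E.
Proof. by apply: le_lt_trans (leb_polytope_fin T); apply: le_lebesgue => x []. Qed.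

(** The mean is normalised by the volume of the star but integrates over its part in [Omega]; the
    two sets agree off [faces]. *)
Lemma vol_starI : vol (S `&` Omega) = vol S.
Proof.
have mF : mset (faces T) by apply: measurable_null; exact: lebesgue_faces.
have one (D : set 'rV[R]_d) : mset D -> (leb D < +oo)%E -> vol D = integ (D `\` faces T) (fun=> 1).
  move=> mD fD; rewrite -[LHS]mul1r -(integ_cst 1 mD).
  have i1 : intble (D `\` faces T) (fun=> 1 : R).
    by apply: (intbleS _ mD (@subDsetl _ _ _)); [exact: measurableD|exact: intble_cst].
  by have [_ ->] := intble_setD_null mD (lebesgue_faces conf d0) i1.
rewrite one; [|exact: mset_starI|exact: leb_starI].
rewrite one; [|exact: mset_star|exact: leb_union_fin star_union].
congr integ; apply/seteqP; split=> x [Sx nf]; split=> //; first by case: Sx.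
split=> //; have [K KT xK] := union_faces conf (star_union Sx) nf.
exact: (ohull_polytope conf KT xK).
Qed.

Lemma vol_star_gt0 : 0 < vol (S `&` Omega).
Proof.
have [K KT iK] := node_element conf i.
apply: lt_le_trans (vol_ohull_gt0 conf d0 h0 g0 hulls_ge KT) _.
apply: le_vol; first exact: leb_starI.
move=> x xK; split; last exact: (ohull_polytope conf KT xK).
by apply: hatf_star; rewrite (hatfE conf i KT (ohull_hull conf KT xK)) gt_eqF// xK.
Qed.

Variables (A : 'rV[R]_d -> 'M[R]_d) (lambda Lambda : R) (N : set 'rV[R]_d).
Hypothesis lambda0 : 0 < lambda.
Hypothesis N0 : leb N = 0%E.
Hypothesis mA : forall k l, mfn Omega (fun x => A x k l).
Hypothesis symA : forall x, Omega x -> (A x)^T = A x.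
Hypothesis boundA : forall x, Omega x -> ~ N x -> forall xi : 'rV[R]_d,
  lambda * enorm xi ^+ 2 <= quad (A x) xi <= Lambda * enorm xi ^+ 2.

Lemma quad_delta2 (B : 'M[R]_d) k l (e : R) : B^T = B ->
  quad B (delta_mx 0 k + e *: delta_mx 0 l) = B k k + 2 * e * B k l + e ^+ 2 * B l l.
Proof.
move=> sB; rewrite /quad [(_ + _)^T]linearD/= [(_ *: _)^T]linearZ/= !trmx_delta !mulmxDl !mulmxDr -!scalemxAl -!scalemxAr.
have PE (X Y : 'M[R]_1) : (X + Y) 0 0 = X 0 0 + Y 0 0 by rewrite mxE.
have ZE a (X : 'M[R]_1) : (a *: X) 0 0 = a * X 0 0 by rewrite mxE.
have E a b : (delta_mx 0 a *m B *m delta_mx b 0 : 'M[R]_1) 0 0 = B a b.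
  by rewrite -rowE -colE !mxE.
rewrite !(PE, ZE) !E; have -> : B l k = B k l by rewrite -{1}sB mxE.
ring.
Qed.

(** Nonnegativity of the form at e_k + e_l and e_k - e_l bounds the mixed entry by the mean of the
    two diagonal ones. *)
Lemma entry_symmetric_le (B : 'M[R]_d) (L : R) : B^T = B ->
  (forall xi : 'rV[R]_d, 0 <= quad B xi <= L * enorm xi ^+ 2) -> forall k l, `|B k l| <= L.
Proof.
move=> sB hB k l.
have dg j : 0 <= B j j <= L.
  have := hB (delta_mx 0 j); rewrite enorm_delta expr1n mulr1.
  have := @quad_delta2 B j j 0 sB; rewrite scale0r addr0 => ->.
  by rewrite mulr0 mul0r expr0n/= mul0r !addr0.
have := hB (delta_mx 0 k + 1 *: delta_mx 0 l); have := hB (delta_mx 0 k + (-1) *: delta_mx 0 l).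
rewrite !quad_delta2// => /andP[h1 _] /andP[h2 _].
have /andP[a1 a2] := dg k; have /andP[b1 b2] := dg l.
by rewrite ler_norml; move: h1 h2; lra.
Qed.

Lemma quad_bounds x xi : Omega x -> ~ N x -> 0 <= quad (A x) xi <= Lambda * enorm xi ^+ 2.
Proof.
move=> Ox nx; have /andP[a ->] := boundA Ox nx xi; rewrite andbT; apply: le_trans a.
by rewrite mulr_ge0 ?exprn_ge0 ?enorm_ge0// ltW.
Qed.

Lemma entryA_le x k l : Omega x -> ~ N x -> `|A x k l| <= Lambda.
Proof. by move=> Ox nx; apply: entry_symmetric_le; [exact: symA|move=> xi; exact: quad_bounds]. Qed.

Local Notation W := ((S `&` Omega) `\` N).

Lemma mset_mean : mset W.
Proof. by apply: measurableD; [exact: mset_starI|exact: measurable_null]. Qed.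

Lemma leb_mean : (leb W < +oo)%E.
Proof. by apply: le_lt_trans leb_starI; apply: le_lebesgue; exact: subDsetl. Qed.

Lemma intble_entryA k l : intble W (fun x => A x k l).
Proof.
apply: (intble_bounded (c := Lambda)); [exact: mset_mean|exact: leb_mean| |].
  by apply: mfnS (mA k l); [exact: mset_polytope|move=> x [[]]].
by move=> x [[_ Ox] nx]; exact: entryA_le.
Qed.

Lemma vol_mean : vol W = vol (S `&` Omega).
Proof.
have i1 : intble W (fun=> 1 : R) by apply: intble_cst; [exact: mset_mean|exact: leb_mean].
have [_] := intble_setD_null mset_starI N0 i1.
by rewrite !integ_cst ?mul1r//; [exact: mset_mean|exact: mset_starI].
Qed.

Lemma mean_coefficientE k l :
  mean_coefficient Omega A i k l = (vol W)^-1 * integ W (fun x => A x k l).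
Proof.
rewrite mxE vol_mean vol_starI; congr (_ * _).
by have [_ ->] := intble_setD_null mset_starI N0 (intble_entryA k l).
Qed.

Lemma mean_coefficient_sym : (mean_coefficient Omega A i)^T = mean_coefficient Omega A i.
Proof.
apply/matrixP => k l; rewrite mxE !mean_coefficientE; congr (_ * _); apply: eq_integ => x [[_ Ox] _].
by rewrite -{1}(symA Ox) mxE.
Qed.

Lemma mean_coefficient_bounds xi :
  lambda * enorm xi ^+ 2 <= quad (mean_coefficient Omega A i) xi <= Lambda * enorm xi ^+ 2.
Proof.
have mW := mset_mean; have vW : 0 < vol W by rewrite vol_mean vol_star_gt0.
have iq : intble W (fun x => \sum_k \sum_l xi 0 k * xi 0 l * A x k l).
  apply: intble_sum => // k; apply: intble_sum => // l; apply: intbleZ => //; exact: intble_entryA.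
have -> : quad (mean_coefficient Omega A i) xi =
    (vol W)^-1 * integ W (fun x => \sum_k \sum_l xi 0 k * xi 0 l * A x k l).
  rewrite quadE integ_sum//; last first.
    by move=> k; apply: intble_sum => // l; apply: intbleZ => //; exact: intble_entryA.
  rewrite mulr_sumr; apply: eq_bigr => k _; rewrite integ_sum//; last first.
    by move=> l; apply: intbleZ => //; exact: intble_entryA.
  rewrite mulr_sumr; apply: eq_bigr => l _; rewrite integZ//; last exact: intble_entryA.
  by rewrite mean_coefficientE; ring.
have qE x : \sum_k \sum_l xi 0 k * xi 0 l * A x k l = quad (A x) xi.
  by rewrite quadE; apply: eq_bigr => k _; apply: eq_bigr => l _; ring.
have ic b : intble W (fun=> b : R) by apply: intble_cst => //; exact: leb_mean.
rewrite ler_pdivlMl// ler_pdivrMl//; apply/andP; split.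
  rewrite mulrC -(integ_cst _ mW); apply: le_integ => // x [[_ Ox] nx].
  by rewrite qE; have /andP[] := boundA Ox nx xi.
rewrite mulrC -(integ_cst _ mW); apply: le_integ => // x [[_ Ox] nx].
by rewrite qE; have /andP[] := boundA Ox nx xi.
Qed.

End mean_coefficients.

(** * The square root of the shifted mean coefficient *)

Section square_root.
Context (R : realType) (d : nat) (B M : 'M[R]_d) (lambda Lambda : R).
Hypotheses (lambda0 : 0 < lambda) (lL : lambda <= Lambda).
Hypothesis sqM : is_sqrtmx M (B - (lambda / 2)%:M).
Hypothesis boundB : forall xi : 'rV[R]_d,
  lambda * enorm xi ^+ 2 <= quad B xi <= Lambda * enorm xi ^+ 2.
Local Notation Q := (Num.sqrt (Lambda - lambda / 2)).

Lemma enorm_sqrtmx (xi : 'rV[R]_d) : enorm (xi *m M) ^+ 2 = quad B xi - lambda / 2 * enorm xi ^+ 2.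
Proof.
have [sM _ MM] := sqM; rewrite -quad_sqr// MM /quad mulmxBr mulmxBl mxE; congr (_ + _).
by rewrite mxE mul_mx_scalar -scalemxAl mxE enorm_dot; congr (- (_ * _)); rewrite mxE; apply: eq_bigr => k _; rewrite mxE.
Qed.

Lemma Q_gt0 : 0 < Q.
Proof.
by rewrite sqrtr_gt0; move: lambda0 lL; lra.
Qed.

Lemma enorm_sqrtmx_le (xi : 'rV[R]_d) : enorm (xi *m M) <= Q * enorm xi.
Proof.
have Q2 : Q ^+ 2 = Lambda - lambda / 2 by rewrite sqr_sqrtr//; move: lambda0 lL; lra.
rewrite -(@ler_pXn2r _ 2)// ?nnegrE ?mulr_ge0 ?enorm_ge0 ?sqrtr_ge0//.
rewrite enorm_sqrtmx exprMn Q2.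
have /andP[_] := boundB xi; lra.
Qed.

(** This is the purpose of Q: the map M has norm at most Q, so the open support of the rescaled
    kernel stays in the ball that defines [theta]. *)
Lemma enorm_sqrtmx_lt (eps : R) (z : 'rV[R]_d) : 0 < eps -> uball z -> enorm (eps *: (z *m M)) < Q * eps.
Proof.
move=> e0 z1; rewrite enormZ gtr0_norm// mulrC ltr_pM2r//.
by apply: le_lt_trans (enorm_sqrtmx_le z) _; rewrite gtr_pMr ?Q_gt0.
Qed.

Lemma quad_sqrtmx_gt0 (x : 'rV[R]_d) : x != 0 -> 0 < quad M x.
Proof.
move=> x0; have [sM pM _] := sqM; rewrite lt_def pM andbT; apply/eqP => q0.
pose w := x *m M.
have w0 : 0 < enorm w ^+ 2.
  rewrite enorm_sqrtmx; have /andP[+ _] := boundB x.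
  have : 0 < enorm x ^+ 2 by rewrite exprn_gt0// enorm_gt0.
  by move: lambda0; set a := enorm x ^+ 2; nra.
(* A nonnegative quadratic form vanishing at x is flat there in every direction. *)
have E (t : R) : quad M (x + t *: w) = 2 * t * enorm w ^+ 2 + t ^+ 2 * quad M w.
  rewrite /quad [(_ + _)^T]linearD/= [(_ *: _)^T]linearZ/= !mulmxDl !mulmxDr -!scalemxAl -!scalemxAr.
  have PE (X Y : 'M[R]_1) : (X + Y) 0 0 = X 0 0 + Y 0 0 by rewrite mxE.
  have ZE a (X : 'M[R]_1) : (a *: X) 0 0 = a * X 0 0 by rewrite mxE.
  rewrite !(PE, ZE) -/(quad M x) q0 -/(quad M w).
  have D : (x *m M *m w^T) 0 0 = enorm w ^+ 2.
    by rewrite enorm_dot mxE; apply: eq_bigr => k _; rewrite [w^T _ _]mxE.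
  have D' : (w *m M *m x^T) 0 0 = enorm w ^+ 2.
    by rewrite -D -[w *m M *m x^T]trmxK [in LHS]mxE !trmx_mul trmxK sM mulmxA.
  rewrite D D'; ring.
have c0 : 0 <= quad M w by exact: pM.
pose t := - enorm w ^+ 2 / (quad M w + 1).
have := pM (x + t *: w); rewrite E; set a := enorm w ^+ 2 in w0 t *; set b := quad M w in c0 t *.
have b1 : 0 < b + 1 by lra.
have tE : t * (b + 1) = - a by rewrite /t divfK// gt_eqF.
have tn : t < 0 by nra.
nra.
Qed.

Lemma det_sqrtmx_gt0 : 0 < \det M.
Proof. by have [sM _ _] := sqM; apply: det_pd_gt0 sM quad_sqrtmx_gt0. Qed.

End square_root.

(** * The essential supremum norm *)

Section maximum_norm.
Context (R : realType) (d : nat).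
Local Notation leb := (@lebesgue R d).
Implicit Types (D : set 'rV[R]_d) (v : 'rV[R]_d -> R).

Lemma ae_null (P : 'rV[R]_d -> Prop) : {ae leb, forall x, P x} ->
  exists2 N : set 'rV[R]_d, leb N = 0%E & forall x, ~ N x -> P x.
Proof. by move=> [N [_ N0 hN]]; exists N => // x; apply: contra_notP => nP; exact: hN. Qed.

Lemma lebesgue_open_gt0 D x : (0 < d)%N -> open D -> D x -> (0 < leb D)%E.
Proof.
move=> d0 oD Dx; have [e e0 eD] := (open_enorm D).1 oD x Dx.
have dR : 0 < d%:R :> R by rewrite ltr0n.
pose r := e / d%:R / 2; have r0 : 0 < r by rewrite !divr_gt0.
apply: (@lt_le_trans _ _ (leb [set y : 'rV[R]_d | forall j, `|y 0 j - x 0 j| <= r])).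
  by rewrite lebesgue_cube ?(ltW r0)// lte_fin exprn_gt0// mulr_gt0.
apply: le_lebesgue => y hy; apply: eD.
apply: le_lt_trans (enorm_le_coords (r := r) _) _; first by move=> j; rewrite !mxE; exact: hy.
by rewrite /r mulrA mulrCA divff ?gt_eqF// mulr1 ltr_pdivrMr//; lra.
Qed.

Lemma Linf_normE D v : (0 < d)%N ->
  Linf_norm D v = ess_sup leb (abse \o (EFin \o (v \_ D))).
Proof.
move=> d0; rewrite /Linf_norm unlock /= ifT//.
exact: (@lebesgue_open_gt0 _ 0 d0 openT).
Qed.

(** By continuity a violation at one point persists on a ball, which has positive measure. *)
Lemma Linf_norm_ge D v (W : R) : (0 < d)%N -> open D -> (forall x, D x -> {for x, continuous v}) ->
  (Linf_norm D v <= W%:E)%E -> forall x, D x -> `|v x| <= W.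
Proof.
move=> d0 oD cv; rewrite Linf_normE// => /ess_supP/ae_null[N N0 hN] x Dx.
rewrite leNgt; apply/negP => vW.
have e0 : 0 < `|v x| - W by rewrite subr_gt0.
have [t t0 ht] := (continuous_enormP v x).1 (cv x Dx) _ e0.
have [s s0 hs] := (open_enorm D).1 oD x Dx.
pose r := Num.min s t.
have r0 : 0 < r by rewrite lt_min s0.
have BN : [set y | enorm (y - x) < r] `<=` N.
  move=> y /=; rewrite /r lt_min => /andP[ys yt]; apply: contrapT => /hN.
  rewrite /= patchE mem_set; last exact: hs.
  rewrite lee_fin; apply/negP; rewrite -ltNge.
  have := ht y yt; have := ler_distD 0 (v x) (v y); rewrite !subr0 sub0r normrN distrC; have := lerB_dist (v x) (v y); rewrite [`|v x - v y|]distrC; lra.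
have oB : open [set y : 'rV[R]_d | enorm (y - x) < r].
  apply/open_enorm => y /= yr; exists (r - enorm (y - x)); first by rewrite subr_gt0.
  by move=> z zy; apply: le_lt_trans (enorm_triangle z y x) _; lra.
have := lebesgue_open_gt0 (x := x) d0 oB; rewrite /= subrr enorm0 => /(_ r0).
by rewrite ltNge => /negP; apply; rewrite -N0; exact: le_lebesgue.
Qed.

Lemma Linf_norm_le D v (W : R) : (0 < d)%N -> 0 <= W -> (forall x, D x -> `|v x| <= W) ->
  (Linf_norm D v <= W%:E)%E.
Proof.
move=> d0 W0 hv; rewrite Linf_normE//; apply/ess_supP; apply: nearW => x /=.
rewrite lee_fin patchE; case: ifPn => [|_]; last by rewrite normr0.
by rewrite inE; exact: hv.
Qed.

End maximum_norm.

(** * Consistency of the local part at a node *)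

Section consistency.
Context (R : realType) (d : nat) (T : mesh R d).
Hypothesis conf : conforming T.
Hypothesis d0 : (0 < d)%N.
Local Notation I := 'I_(nnodes T).
Local Notation elt := (elements T).
Local Notation Omega := (polytope T).
Local Notation leb := (@lebesgue R d).
Variables h g : R.
Hypothesis h0 : 0 < h.
Hypothesis g0 : 0 < g.
Hypothesis hulls_le : forall K x y, K \in elt -> hull K x -> hull K y -> enorm (x - y) <= h.
Hypothesis hulls_ge : forall K, K \in elt -> exists c, forall x, enorm (x - c) <= g * h -> hull K x.
Variable i : I.
Hypothesis Oi : Omega (node i).
Variables (u : 'rV[R]_d -> R) (W K3 : R).
Hypothesis Cu : Ck_on Omega 3 u.
Hypothesis hW : forall x, Omega x -> enorm (hess u x) <= W.
Hypothesis h3 : forall p a b c, Omega p -> `|third u p a b c| <= K3.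
Hypothesis h1 : forall k, exists c, forall x, Omega x -> `|partial k u x| <= c.

Let oO : open Omega. Proof. exact: open_interior. Qed.
Let mO : mset Omega. Proof. exact: mset_polytope. Qed.
Let fO : (leb Omega < +oo)%E. Proof. exact: leb_polytope_fin. Qed.
Let gh' : 0 <= (g * h)^-1. Proof. by rewrite invr_ge0 mulr_ge0// ltW. Qed.
Let Lcb K (j : I) : K \in elt -> enorm (bgrad K j) <= (g * h)^-1.
Proof. exact: (bgrad_bound conf h0 g0 hulls_ge). Qed.
Let mhat := mfn_hatf conf Oi gh' Lcb.
Let ihat := intble_hatf conf Oi gh' Lcb.
Let hat01 x : 0 <= hatf i x <= 1. Proof. by rewrite hatf_ge0// hatf_le1. Qed.
Let mu0 : 0 < mass i. Proof. exact: (mass_gt0 conf d0 h0 g0 hulls_ge Oi). Qed.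

Lemma mfn_dpart s : (size s <= 3)%N -> mfn Omega (dpart s u).
Proof. by move=> s3; apply: mfn_continuous => // x Ox; have [] := Cu s3 Ox. Qed.

Lemma fe_space0_hatf : fe_space0 T Omega (hatf i).
Proof.
split; first exact: fe_space_hatf.
move=> x [_ nx]; apply: (hatf_zero conf Oi) => Ox; apply: nx.
exact: (open_nbhs_nbhs (conj oO Ox)).
Qed.

Let mhess k l : mfn Omega (fun x => hess u x k l).
Proof.
rewrite (_ : (fun x => _) = dpart [:: k; l] u); first exact: mfn_dpart.
by apply/funext => x; rewrite mxE.
Qed.

Let hess_le x k l : Omega x -> `|hess u x k l| <= W.
Proof. by move=> Ox; apply: le_trans (le_entry_enorm _ _ _) (hW Ox). Qed.

(** Testing with the hat function and integrating by parts: the discrete Laplacian of the projection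
    is the weighted mean of the Laplacian of u, without any error. *)
Lemma galerkin_laplacian uG : galerkin_projection T Omega u uG ->
  \sum_j kap i j * uG (node j) = \sum_k integ Omega (fun x => hess u x k k * hatf i x).
Proof.
move=> [[fG _] hG]; have := hG _ fe_space0_hatf; rewrite integ_grad_hatf// => E.
apply/eqP; rewrite -eqr_opp E -sumrN; apply/eqP.
have ibp k : intble Omega (fun x => partial k u x * partial k (hatf i) x) /\
    integ Omega (fun x => partial k u x * partial k (hatf i) x) = - integ Omega (fun x => hess u x k k * hatf i x).
  have [c hc] := h1 k.
  have [|||||P1 ->] := @integration_by_parts _ _ _ conf d0 i _ Oi gh' Lcb (partial k u) k c W.
  - by move=> x Ox; have [_ /(_ isT)] := @Cu [:: k] isT x Ox; apply.
  - exact: hc.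
  - by move=> x Ox; have := hess_le k k Ox; rewrite mxE.
  - exact: (@mfn_dpart [:: k]).
  - exact: (@mfn_dpart [:: k; k]).
  by split=> //; congr (- _); apply: eq_integ => x _; rewrite mxE.
transitivity (\sum_k integ Omega (fun x => partial k u x * partial k (hatf i) x)).
  rewrite -integ_sum//; last by move=> k; have [] := ibp k.
  by apply: eq_integ => x _; apply: eq_bigr => k _; rewrite !mxE.
by apply: eq_bigr => k _; have [] := ibp k.
Qed.

Variables (A : 'rV[R]_d -> 'M[R]_d) (lambda Lambda : R) (N : set 'rV[R]_d).
Hypothesis lambda0 : 0 < lambda.
Hypothesis N0 : leb N = 0%E.
Hypothesis mA : forall k l, mfn Omega (fun x => A x k l).
Hypothesis symA : forall x, Omega x -> (A x)^T = A x.
Hypothesis boundA : forall x, Omega x -> ~ N x -> forall xi : 'rV[R]_d,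
  lambda * enorm xi ^+ 2 <= quad (A x) xi <= Lambda * enorm xi ^+ 2.

Local Notation D := (Omega `\` N).
Local Notation Am := (mean_coefficient Omega A i).
Let mD : mset D. Proof. by apply: measurableD => //; exact: measurable_null. Qed.
Let fD : (leb D < +oo)%E. Proof. by apply: le_lt_trans fO; apply: le_lebesgue; exact: subDsetl. Qed.
Let DO : D `<=` Omega. Proof. exact: subDsetl. Qed.

Let boundAm xi : lambda * enorm xi ^+ 2 <= quad Am xi <= Lambda * enorm xi ^+ 2.
Proof.
exact: (mean_coefficient_bounds conf d0 h0 g0 hulls_ge i lambda0 N0 mA symA boundA).
Qed.

Let entryAm k l : `|Am k l| <= Lambda.
Proof.
apply: entry_symmetric_le; first exact: (mean_coefficient_sym conf d0 i lambda0 N0 mA symA boundA).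
move=> xi; have /andP[a ->] := boundAm xi; rewrite andbT; apply: le_trans a.
by rewrite mulr_ge0 ?exprn_ge0 ?enorm_ge0// ltW.
Qed.

Let entryA x k l : D x -> `|A x k l| <= Lambda.
Proof. by move=> [Ox nx]; exact: (entryA_le lambda0 symA boundA). Qed.

Let iA k l : intble D (fun x => A x k l).
Proof.
apply: (intble_bounded (c := Lambda)) => //; first by apply: mfnS (mA k l).
by move=> x; exact: entryA.
Qed.

Lemma intble_coefficientM k l (w : 'rV[R]_d -> R) c : mfn Omega w -> (forall x, Omega x -> `|w x| <= c) ->
  intble D (fun x => A x k l * w x).
Proof.
move=> mw hw; apply: (intbleM (c := c)) => //; first by apply: mfnS mw.
by move=> x [Ox _]; exact: hw.
Qed.

Let hh k l x := hess u x k l * hatf i x.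
Let mhh k l : mfn Omega (hh k l).
Proof.
by apply: measurable_funM; [exact: mhess|exact: mhat].
Qed.
Let hhle k l x : Omega x -> `|hh k l x| <= W.
Proof.
move=> Ox; have /andP[a b] := hat01 x; rewrite /hh normrM [`|hatf _ _|]ger0_norm//.
by rewrite -[leRHS]mulr1 ler_pM// hess_le.
Qed.
Let ihh k l : intble D (hh k l).
Proof.
apply: (intble_bounded (c := W)) => //; first by apply: mfnS (mhh k l).
by move=> x [Ox _]; exact: hhle.
Qed.
Lemma intble_hessian_hatf k l : intble D (fun x => hess u x k l * hatf i x).
Proof. exact: ihh. Qed.

Let ihatD : intble D (hatf i). Proof. exact: intbleS ihat. Qed.
Let massD : mass i = integ D (hatf i).
Proof. by have [_] := intble_setD_null mO N0 ihatD. Qed.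

Definition oscillation : R := (mass i)^-1 * integ D (fun x => enorm (A x - Am) * hatf i x).

Let dev x := enorm (A x - Am).
Let dev_bound : exists c, forall x, D x -> 0 <= dev x <= c.
Proof.
exists (Num.sqrt (\sum_(k : 'I_d) \sum_(l : 'I_d) (2 * Lambda) ^+ 2)) => x Dx.
rewrite enorm_ge0/= ler_wsqrtr//; apply: ler_sum => k _; apply: ler_sum => l _.
rewrite -[leLHS]real_normK ?num_real//.
have L0 : 0 <= Lambda by apply: le_trans (normr_ge0 _) (entryAm k l).
rewrite lerXn2r ?nnegrE ?mulr_ge0// !mxE; apply: le_trans (ler_normB _ _) _.
by have := entryAm k l; have := entryA k l Dx; rewrite mxE; lra.
Qed.

Let mdev : mfn Omega dev.
Proof.
have mS : mfn Omega (fun x => \sum_k \sum_l (A x - Am) k l ^+ 2).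
  apply: measurable_sum => k; apply: measurable_sum => l; apply: measurable_funX.
  rewrite (_ : (fun x => _) = fun x => A x k l - Am k l); last by apply/funext => x; rewrite !mxE.
  by apply: measurable_funB; [exact: mA|exact: measurable_cst].
by apply: (measurableT_comp _ mS); apply: continuous_measurable_fun; exact: sqrt_continuous.
Qed.

Let mdevD : mfn D dev. Proof. by apply: mfnS mdev. Qed.

Let idevM : intble D (fun x => dev x * hatf i x).
Proof.
have [c hc] := dev_bound; apply: (intbleM (c := 1)) => //; first by apply: mfnS mhat.
  by move=> x _; have /andP[a b] := hat01 x; rewrite ger0_norm.
by apply: (intble_bounded (c := c)) => // x /hc /andP[a b]; rewrite ger0_norm.
Qed.

Lemma oscillation_ge0 : 0 <= oscillation.
Proof.
rewrite mulr_ge0 ?invr_ge0 ?(ltW mu0)//; apply: integ_ge0 => x _.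
by rewrite mulr_ge0 ?enorm_ge0 ?hatf_ge0.
Qed.

(** Jensen with the hat function as weight, which is then bounded by 1 on the star. The factor
    [mass i] is the weight that the Alexandroff estimate carries. *)
Lemma oscillation_power :
  mass i * oscillation ^+ d <= integ (star Omega i `&` Omega) (fun x => enorm (A x - Am) ^+ d).
Proof.
have [c hc] := dev_bound; have dE : d.-1.+1 = d by rewrite prednK.
have mh : mfn D (hatf i) by apply: mfnS mhat.
have w0 : 0 < integ D (hatf i) by rewrite -massD.
have := jensen_power d.-1 mD fD mh (fun x _ => hat01 x) mdevD hc w0.
rewrite dE -massD => J; apply: le_trans J _.
pose V := (star Omega i `&` Omega) `\` N.
have mV : mset V by apply: measurableD; [exact: mset_starI|exact: measurable_null].
have VD : V `<=` D by move=> x [[_ Ox] nx].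
have ib : intble V (fun x => dev x ^+ d).
  apply: (intble_bounded (c := c ^+ d)) => //.
  - by apply: le_lt_trans fD; exact: le_lebesgue.
  - by apply: measurable_funX; apply: mfnS mdev => // x [[]].
  move=> x /VD /hc /andP[a b]; rewrite ger0_norm ?exprn_ge0// lerXn2r ?nnegrE//.
  exact: le_trans b.
have [_ ->] := intble_setD_null (mset_starI i) N0 ib.
rewrite (integ_patch VD); last first.
  move=> x [Ox nx] nV; case: (eqVneq (hatf i x) 0) => [->|hx]; first by rewrite mulr0.
  by case: nV; split=> //; split=> //; exact: (hatf_star conf hx).
apply: le_integ => //.
  apply: (intbleM (c := 1)) => //; first by apply: mfnS mhat => // x [[]].
  by move=> x _; have /andP[a b] := hat01 x; rewrite ger0_norm.
move=> x _; have /andP[a b] := hat01 x.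
by rewrite -[leRHS]mulr1 ler_wpM2l// exprn_ge0// enorm_ge0.
Qed.

Lemma oscillation_term :
  `|(mass i)^-1 * (\sum_k \sum_l (integ D (fun x => A x k l * hh k l x) - Am k l * integ D (hh k l)))| <=
  W * oscillation.
Proof.
have iAh k l : intble D (fun x => A x k l * hh k l x) by exact: (intble_coefficientM k l (mhh k l) (@hhle k l)).
have i1 k l : intble D (fun x => A x k l * hh k l x - Am k l * hh k l x).
  by apply: intbleB => //; exact: intbleZ.
have i2 k : intble D (fun x => \sum_l (A x k l * hh k l x - Am k l * hh k l x)) by exact: intble_sum.
have i3 : intble D (fun x => \sum_k \sum_l (A x k l * hh k l x - Am k l * hh k l x)) by exact: intble_sum.
have -> : \sum_k \sum_l (integ D (fun x => A x k l * hh k l x) - Am k l * integ D (hh k l)) =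
    integ D (fun x => \sum_k \sum_l (A x k l * hh k l x - Am k l * hh k l x)).
  rewrite integ_sum//; apply: eq_bigr => k _; rewrite integ_sum//; apply: eq_bigr => l _.
  by rewrite integB ?integZ//; exact: intbleZ.
rewrite normrM [`|_^-1|]ger0_norm ?invr_ge0 ?(ltW mu0)// /oscillation mulrCA ler_wpM2l ?invr_ge0 ?(ltW mu0)//.
apply: le_trans (norm_integ mD i3) _; rewrite -integZ//; apply: le_integ => //.
- exact: intble_norm.
- exact: intbleZ.
move=> x [Ox _].
have -> : \sum_k \sum_l (A x k l * hh k l x - Am k l * hh k l x) =
    (\sum_k \sum_l (A x - Am) k l * hess u x k l) * hatf i x.
  rewrite mulr_suml; apply: eq_bigr => k _; rewrite mulr_suml; apply: eq_bigr => l _.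
  by rewrite /hh [(A x - Am) k l]mxE [(- Am) k l]mxE; ring.
have /andP[a _] := hat01 x; rewrite normrM [`|hatf _ _|]ger0_norm// mulrA ler_wpM2r//.
apply: le_trans (frobenius_cauchy _ _) _; rewrite mulrC ler_wpM2r ?enorm_ge0//; exact: hW.
Qed.

Lemma discrete_rhsE (f : 'rV[R]_d -> R) :
  (forall x, Omega x -> ~ N x -> \sum_k \sum_l A x k l * hess u x k l = f x) ->
  discrete_rhs Omega f i = (mass i)^-1 * \sum_k \sum_l integ D (fun x => A x k l * hh k l x).
Proof.
move=> fE; rewrite /discrete_rhs hat_hatf// mulrC; congr (_ * _).
have iAh k l : intble D (fun x => A x k l * hh k l x) by exact: (intble_coefficientM k l (mhh k l) (@hhle k l)).
have i2 k : intble D (fun x => \sum_l A x k l * hh k l x) by exact: intble_sum.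
have i3 : intble D (fun x => \sum_k \sum_l A x k l * hh k l x) by exact: intble_sum.
have E x : D x -> \sum_k \sum_l A x k l * hh k l x = f x * hatf i x.
  move=> [Ox nx]; rewrite -fE// mulr_suml; apply: eq_bigr => k _; rewrite mulr_suml; apply: eq_bigr => l _.
  by rewrite /hh mulrA.
have [_ ->] := intble_setD_null mO N0 (eq_intble mD E i3).
rewrite -(eq_integ E) integ_sum//; apply: eq_bigr => k _; rewrite integ_sum//.
Qed.

Lemma mean_hessian k l :
  `|(mass i)^-1 * integ D (hh k l) - hess u (node i) k l| <= d%:R * K3 * h.
Proof.
have B0 : 0 <= d%:R * K3 * h.
  by rewrite !mulr_ge0 ?(ltW h0)//; apply: le_trans (normr_ge0 _) (h3 k k l Oi).
pose c := hess u (node i) k l.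
have i1 : intble D (fun x => hh k l x - c * hatf i x) by apply: intbleB => //; exact: intbleZ.
have -> : (mass i)^-1 * integ D (hh k l) - c = (mass i)^-1 * integ D (fun x => hh k l x - c * hatf i x).
  by rewrite integB//; [rewrite integZ// -massD; field; rewrite gt_eqF|exact: intbleZ].
rewrite normrM [`|_^-1|]ger0_norm ?invr_ge0 ?(ltW mu0)// ler_pdivrMl//.
apply: le_trans (norm_integ mD i1) _.
rewrite massD mulrC -integZ//; apply: le_integ => //; [exact: intble_norm|exact: intbleZ|].
move=> x [Ox _]; case: (eqVneq (hatf i x) 0) => [hx|hx].
  by rewrite /hh hx !mulr0 subr0 normr0.
have /andP[a _] := hat01 x; have hx0 : 0 < hatf i x by rewrite lt_def hx.
rewrite /hh -mulrBl normrM [`|hatf _ _|]ger0_norm// ler_wpM2r//.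
have [K KT xK] := polytope_union Ox.
have iK : i \in K by apply: contraNT hx => iK; rewrite (hatfE conf i KT xK) blam_out.
(* [Omega] need not be convex; the segment to the node stays inside because the hat function remains
   positive along it. *)
have seg (t : R) : 0 <= t <= 1 -> Omega (node i + t *: (x - node i)).
  move=> t01; apply: (hatf_pos_polytope conf Oi).
  have sK := hull_segment conf KT (hull_node iK) xK t01.
  rewrite (hatfE conf i KT sK).
  have := blamB conf (node i) (node i + t *: (x - node i)) i KT; rewrite addrAC subrr add0r dotZr -(blamB conf)//.
  rewrite blam_vertex// eqxx -(hatfE conf i KT xK) => /eqP; rewrite subr_eq => /eqP ->.
  move: t01 hx0 => /andP[t0 t1]; case: (eqVneq t 1) => [-> |tn]; first by lra.
  have : t < 1 by rewrite lt_neqAle tn.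
  rewrite -[true%:R]/(1 : R); nra.
have hxi : enorm (x - node i) <= h by apply: (hulls_le KT) => //; exact: hull_node.
rewrite /c !mxE; apply: le_trans (dpart_lipschitz oO Cu _ seg _) _ => //.
- by move=> a' p Op; exact: (h3 a' k l Op).
by rewrite ler_wpM2l// mulr_ge0//; apply: le_trans (normr_ge0 _) (h3 k k l Oi).
Qed.

End consistency.

(** * Taylor error of the nonlocal operator *)

Section nonlocal_consistency.
Context (R : realType) (d : nat) (phi : 'rV[R]_d -> R) (Omega : set 'rV[R]_d).
Hypothesis kphi : kernel_function phi.
Hypothesis d0 : (0 < d)%N.
Hypothesis oO : open Omega.
Variables (Q eps : R) (M : 'M[R]_d) (x : 'rV[R]_d).
Hypotheses (Q0 : 0 < Q) (eps0 : 0 < eps) (dM : 0 < \det M) (Ox : Omega x).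
Local Notation r := (Q * eps).
Hypothesis Mr : forall z, uball z -> enorm (eps *: (z *m M)) < r.
Variables (u : 'rV[R]_d -> R) (H a : R).
Hypotheses (a0 : 0 <= a) (H0 : 0 <= H).
Hypothesis Cu : Ck_on Omega 3 u.
Hypothesis gu : bounded_continuous Omega u.
Hypothesis hH : forall p q, Omega p -> Omega q -> forall i j k,
  `|third u p i j k - third u q i j k| <= H * enorm (p - q) `^ a.

Definition taylor_error : R := 2 * d%:R ^+ 3 * H * kernel_mass phi * Q ^+ 2 * r * (2 * r) `^ a.

(** The Taylor remainder contains (theta r)^3, and division by (theta eps)^2 leaves a positive power
    of theta, so small values of theta near the boundary do no harm to this term. *)
Lemma Ieps_taylor :
  `|\tr (M *m hess u x *m M^T) - Ieps Omega phi r eps M u x| <= taylor_error.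
Proof.
have r0 : 0 < r by exact: mulr_gt0.
have [t0 t1 _ _] := theta_spec oO r0 Ox.
set th := theta Omega r x in t0 t1 *.
have tr0 : 0 < th * r by exact: mulr_gt0.
have te : 0 < th * eps by exact: mulr_gt0.
pose B := M *m hess u x *m M^T.
pose c := 2 * d%:R ^+ 3 * H * (th * r) ^+ 3 * (2 * r) `^ a.
have th_in (z : 'rV[R]_d) : uball z -> Omega (x + th *: (eps *: (z *m M))) /\ Omega (x - th *: (eps *: (z *m M))).
  by move=> zb; have [_ _ hth _] := theta_spec oO r0 Ox; apply: hth; exact: Mr.
have key (z : 'rV[R]_d) : uball z -> `|second_diff Omega r eps M x u z - (th * eps) ^+ 2 * quad B z| <= c.
  move=> zb; set y := th *: (eps *: (z *m M)).
  have yr : enorm y <= th * r by rewrite enormZ ger0_norm ?(ltW t0)// ler_wpM2l ?(ltW t0)// ltW// Mr.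
  have seg (t : R) : -1 <= t <= 1 -> Omega (x + t *: y).
    move=> /andP[t2 t3]; have tz : uball (t *: z).
      rewrite /uball/= enormZ; apply: le_lt_trans (_ : enorm z < 1) => //.
      by rewrite ler_piMl ?enorm_ge0// ler_norml t2.
    have [P1 _] := th_in _ tz; move: P1; rewrite /y -scalemxAl !scalerA.
    by congr Omega; congr (_ + _ *: _); ring.
  have := taylor_symmetric oO Cu a0 H0 hH seg.
  have -> : quad (hess u x) y = (th * eps) ^+ 2 * quad B z.
    rewrite /B -quad_conj /y scalerA /quad [(_ *: _)^T]linearZ/= -!scalemxAl -!scalemxAr scalerA !mxE.
    by rewrite expr2.
  rewrite /second_diff -/th -/y => hT; apply: le_trans hT _.
  rewrite /c; apply: ler_pM; rewrite ?mulr_ge0 ?exprn_ge0 ?enorm_ge0 ?powR_ge0//.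
    by rewrite ler_wpM2l ?mulr_ge0 ?exprn_ge0// lerXn2r ?nnegrE ?enorm_ge0// ltW.
  rewrite ge0_ler_powR// ?nnegrE ?mulr_ge0 ?enorm_ge0 ?(ltW Q0) ?(ltW eps0)//.
  by rewrite ler_pM2l//; apply: le_trans yr _; rewrite ler_piMl// ltW.
have ce : c * kernel_mass phi / (th * eps) ^+ 2 <= taylor_error.
  have -> : c * kernel_mass phi / (th * eps) ^+ 2 =
      (2 * d%:R ^+ 3 * H * kernel_mass phi * Q ^+ 2 * (2 * r) `^ a) * (th * r).
    by rewrite /c; field; rewrite !gt_eqF.
  have -> : taylor_error = (2 * d%:R ^+ 3 * H * kernel_mass phi * Q ^+ 2 * (2 * r) `^ a) * r.
    by rewrite /taylor_error; ring.
  rewrite ler_wpM2l ?mulr_ge0 ?exprn_ge0 ?powR_ge0 ?(kernel_mass_ge0 kphi) ?(ltW Q0)//.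
  by rewrite ler_piMl// ltW.
have lower := @Ieps_ge _ _ _ _ kphi d0 oO r eps M x r0 eps0 dM Ox Mr u B c gu.
have upper := @Ieps_ge _ _ _ _ kphi d0 oO r eps M x r0 eps0 dM Ox Mr (fun y => - u y) (- B) c (bounded_continuousN gu).
rewrite -/B -/th in lower upper *.
rewrite (IepsN kphi oO r0 eps0 dM Ox Mr gu) in upper.
have {}lower : \tr B - c * kernel_mass phi / (th * eps) ^+ 2 <= Ieps Omega phi r eps M u x.
  by apply: lower => z zb; have := key z zb; rewrite ler_norml => /andP[+ _]; lra.
have {}upper : \tr (- B) - c * kernel_mass phi / (th * eps) ^+ 2 <= - Ieps Omega phi r eps M u x.
  apply: upper => z zb; have := key z zb; rewrite ler_norml => /andP[_].
  have -> : quad (- B) z = - quad B z by rewrite /quad mulmxN mulNmx mxE.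
  rewrite /second_diff; lra.
rewrite ler_norml; move: lower upper ce; rewrite linearN/=; lra.
Qed.

End nonlocal_consistency.

(** * The discrete operator on the nodal error *)

Section operator_error.
Context (R : realType) (d : nat) (T : mesh R d).
Hypothesis conf : conforming T.
Hypothesis d0 : (0 < d)%N.
Local Notation I := 'I_(nnodes T).
Local Notation elt := (elements T).
Local Notation Omega := (polytope T).
Local Notation leb := (@lebesgue R d).
Variables h g : R.
Hypothesis h0 : 0 < h.
Hypothesis g0 : 0 < g.
Hypothesis hulls_le : forall K x y, K \in elt -> hull K x -> hull K y -> enorm (x - y) <= h.
Hypothesis hulls_ge : forall K, K \in elt -> exists c, forall x, enorm (x - c) <= g * h -> hull K x.
Variables (phi : 'rV[R]_d -> R) (eps lambda Lambda : R) (M : I -> 'M[R]_d).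
Local Notation Q := (Num.sqrt (Lambda - lambda / 2)).
Local Notation r := (Q * eps).
Hypothesis kphi : kernel_function phi.
Hypotheses (eps0 : 0 < eps) (lambda0 : 0 < lambda) (lL : lambda <= Lambda).
Variables (u uG uh f : 'rV[R]_d -> R) (W K3 H a E : R).
Hypotheses (a0 : 0 <= a) (H0 : 0 <= H).
Hypothesis Cu : Ck_on Omega 3 u.
Hypothesis gu : bounded_continuous Omega u.
Hypothesis hH : forall p q, Omega p -> Omega q -> forall i j k,
  `|third u p i j k - third u q i j k| <= H * enorm (p - q) `^ a.
Hypothesis hW : forall x, Omega x -> enorm (hess u x) <= W.
Hypothesis h3 : forall p i j k, Omega p -> `|third u p i j k| <= K3.
Hypothesis h1 : forall k, exists c, forall x, Omega x -> `|partial k u x| <= c.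
Variables (A : 'rV[R]_d -> 'M[R]_d) (N : set 'rV[R]_d).
Hypothesis N0 : leb N = 0%E.
Hypothesis mA : forall k l, mfn Omega (fun x => A x k l).
Hypothesis symA : forall x, Omega x -> (A x)^T = A x.
Hypothesis boundA : forall x, Omega x -> ~ N x -> forall xi : 'rV[R]_d,
  lambda * enorm xi ^+ 2 <= quad (A x) xi <= Lambda * enorm xi ^+ 2.
Hypothesis fE : forall x, Omega x -> ~ N x -> \sum_k \sum_l A x k l * hess u x k l = f x.
Hypothesis galerkin : galerkin_projection T Omega u uG.
Hypothesis hE : forall x, Omega x -> `|u x - uG x| <= E.
Hypothesis sqM : forall i, Omega (node i) -> is_sqrtmx (M i) (mean_coefficient Omega A i - (lambda / 2)%:M).
Hypothesis solution : discrete_solution Omega lambda Lambda eps phi M f uh.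

Let oO : open Omega. Proof. exact: open_interior. Qed.

Definition local_error : R := d%:R ^+ 2 * Lambda * (d%:R * K3 * h).

(** The mean coefficient is lambda / 2 times the identity plus M^2. The first part cancels exactly
    between the right-hand side and the Galerkin projection, so only the second has to be compared
    with the nonlocal operator, first by freezing the Hessian at the node and then by Taylor
    expansion. *)
Lemma operator_error i : Omega (node i) ->
  `|nodal_operator phi r eps lambda M (fun j => uh (node j) - uG (node j)) i| <=
  W * oscillation i A N + (local_error + taylor_error phi Q eps H a) +
  4 * E * kernel_mass phi / (theta Omega r (node i) * eps) ^+ 2.
Proof.
move=> Oi.
have Q0 : 0 < Q by exact: Q_gt0.
have r0 : 0 < r by exact: mulr_gt0.
have bAm (j : I) : Omega (node j) -> forall xi : 'rV[R]_d,
    lambda * enorm xi ^+ 2 <= quad (mean_coefficient Omega A j) xi <= Lambda * enorm xi ^+ 2.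
  by move=> _; exact: (mean_coefficient_bounds conf d0 h0 g0 hulls_ge j lambda0 N0 mA symA boundA).
have dM (j : I) : Omega (node j) -> 0 < \det (M j).
  by move=> Oj; exact: (det_sqrtmx_gt0 lambda0 (sqM Oj) (bAm j Oj)).
have Mr (j : I) : Omega (node j) -> forall z, uball z -> enorm (eps *: (z *m M j)) < r.
  by move=> Oj z; exact: (enorm_sqrtmx_lt lambda0 lL (sqM Oj) (bAm j Oj)).
have [[fuh _] /(_ i Oi) eqh] := solution; have [[fG _] _] := galerkin.
have gG := fe_bounded_continuous conf fG.
set mu := mass i; have mu0 : 0 < mu by exact: (mass_gt0 conf d0 h0 g0 hulls_ge Oi).
set Am := mean_coefficient Omega A i in bAm *.
pose P := Am - (lambda / 2)%:M.
have PE k l : P k l = Am k l - lambda / 2 * (k == l)%:R by rewrite !mxE mulr_natr.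
have sAm : Am^T = Am by exact: (mean_coefficient_sym conf d0 i lambda0 N0 mA symA boundA).
have Ple k l : `|P k l| <= Lambda.
  apply: entry_symmetric_le.
    by rewrite /P linearB/= sAm tr_scalar_mx.
  move=> xi; have -> : quad P xi = quad Am xi - lambda / 2 * enorm xi ^+ 2.
    by rewrite -(enorm_sqrtmx (sqM Oi)); have [sM _ MM] := sqM Oi; rewrite -quad_sqr// MM.
  have /andP[b1 b2] := bAm i Oi xi; have : 0 <= lambda * enorm xi ^+ 2 by rewrite mulr_ge0 ?exprn_ge0 ?enorm_ge0 ?ltW.
  by move: b1 b2; set e := enorm xi ^+ 2; lra.
pose c k l := hess u (node i) k l.
pose m k l := integ (Omega `\` N) (fun x => hess u x k l * hatf i x).
pose J k l := integ (Omega `\` N) (fun x => A x k l * (hess u x k l * hatf i x)).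
pose Iu := Ieps Omega phi r eps (M i) u (node i).
pose IG := Ieps Omega phi r eps (M i) uG (node i).
have T1 := oscillation_term conf d0 h0 g0 hulls_ge Oi Cu hW lambda0 N0 mA symA boundA.
rewrite -/mu -/Am in T1.
have T2 : `|\sum_k \sum_l P k l * (mu^-1 * m k l - c k l)| <= local_error.
  rewrite /local_error expr2 -!mulrA; apply: norm_sum_le => k; apply: norm_sum_le => l.
  rewrite normrM; apply: ler_pM => //.
  by have := mean_hessian conf d0 h0 g0 hulls_le hulls_ge Oi Cu hW h3 N0 k l; rewrite -mulrA.
have T3 : `|\sum_k \sum_l P k l * c k l - Iu| <= taylor_error phi Q eps H a.
  have -> : \sum_k \sum_l P k l * c k l = \tr (M i *m hess u (node i) *m (M i)^T).
    have [sM _ MM] := sqM Oi; rewrite sM -mulmxA mxtrace_mulC -mulmxA MM -/Am -/P.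
    rewrite /mxtrace; apply: eq_bigr => k _; rewrite mxE; apply: eq_bigr => l _.
    have -> : P l k = P k l by rewrite !PE eq_sym -{1}sAm mxE.
    by rewrite mulrC.
  exact: (Ieps_taylor kphi d0 oO Q0 eps0 (dM i Oi) Oi (Mr i Oi) a0 H0 Cu gu hH).
have T4 : `|Iu - IG| <= 4 * E * kernel_mass phi / (theta Omega r (node i) * eps) ^+ 2.
  have gv := bounded_continuousD (-1) gu gG.
  have -> : Iu - IG = Ieps Omega phi r eps (M i) (fun y => u y + -1 * uG y) (node i).
    by rewrite (IepsD kphi oO r0 eps0 (dM i Oi) Oi (Mr i Oi) (-1) gu gG) mulN1r.
  apply: (Ieps_norm_le kphi d0 oO r0 eps0 (dM i Oi) Oi (Mr i Oi) gv) => y Oy.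
  by rewrite mulN1r; exact: hE.
have LG : nodal_operator phi r eps lambda M (fun j => uG (node j)) i = lambda / 2 * (mu^-1 * \sum_k m k k) + IG.
  rewrite /nodal_operator -/mu (galerkin_laplacian conf d0 h0 g0 hulls_ge Oi Cu hW h1 galerkin).
  rewrite /IG (Ieps_interp conf kphi r0 eps0 dM Mr fG Oi); congr (_ * (_ * _) + _).
  apply: eq_bigr => k _; rewrite /m.
  by have [_ ->] := intble_setD_null (mset_polytope T) N0
    (intble_hessian_hatf conf h0 g0 hulls_ge Oi Cu hW N0 k k).
have Lh : nodal_operator phi r eps lambda M (fun j => uh (node j)) i = mu^-1 * \sum_k \sum_l J k l.
  rewrite -(discrete_rhsE conf h0 g0 hulls_ge Oi Cu hW lambda0 N0 mA symA boundA fE) -eqh.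
  by rewrite /discrete_operator discrete_laplacianE// (Ieps_interp conf kphi r0 eps0 dM Mr fuh Oi).
have -> : nodal_operator phi r eps lambda M (fun j => uh (node j) - uG (node j)) i =
    mu^-1 * (\sum_k \sum_l (J k l - Am k l * m k l)) +
    (\sum_k \sum_l P k l * (mu^-1 * m k l - c k l) + (\sum_k \sum_l P k l * c k l - Iu)) + (Iu - IG).
  rewrite (_ : (fun j => _) = fun j => uh (node j) + -1 * uG (node j)); last by apply/funext => j; rewrite mulN1r.
  rewrite (nodal_operatorD conf lambda kphi r0 eps0 dM Mr) // LG Lh.
  have S2 : \sum_k \sum_l P k l * (mu^-1 * m k l - c k l) =
      mu^-1 * \sum_k \sum_l Am k l * m k l - lambda / 2 * (mu^-1 * \sum_k m k k) - \sum_k \sum_l P k l * c k l.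
    rewrite !mulr_sumr -!sumrB; apply: eq_bigr => k _.
    rewrite mulr_sumr -addrA -opprD [X in _ - X]addrC opprD addrA -sumrB.
    have -> : lambda / 2 * (mu^-1 * m k k) = \sum_l lambda / 2 * (k == l)%:R * (mu^-1 * m k l).
      by rewrite (bigD1 k)//= eqxx mulr1 big1 ?addr0// => l lk; rewrite eq_sym (negbTE lk) mulr0 mul0r.
    by rewrite -sumrB; apply: eq_bigr => l _; rewrite PE; set e := _%:R; ring.
  have S1 : \sum_k \sum_l (J k l - Am k l * m k l) = \sum_k \sum_l J k l - \sum_k \sum_l Am k l * m k l.
    by rewrite -sumrB; apply: eq_bigr => k _; rewrite sumrB.
  rewrite S1 S2; ring.
apply: le_trans (ler_normD _ _) _; apply: lerD => //.
apply: le_trans (ler_normD _ _) _; apply: lerD => //.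
by apply: le_trans (ler_normD _ _) _; exact: lerD.
Qed.

End operator_error.

(** * Stability and the rate of convergence *)

Section stability.
Context (R : realType) (d : nat) (T : mesh R d).
Hypothesis conf : conforming T.
Hypothesis d0 : (0 < d)%N.
Local Notation I := 'I_(nnodes T).
Local Notation elt := (elements T).
Local Notation Omega := (polytope T).
Variables h g : R.
Hypothesis h0 : 0 < h.
Hypothesis g0 : 0 < g.
Hypothesis hulls_le : forall K x y, K \in elt -> hull K x -> hull K y -> enorm (x - y) <= h.
Hypothesis hulls_ge : forall K, K \in elt -> exists c, forall x, enorm (x - c) <= g * h -> hull K x.
Hypothesis acute : face_weakly_acute T Omega.
Variables (phi : 'rV[R]_d -> R) (r eps lambda : R) (M : I -> 'M[R]_d).
Hypothesis kphi : kernel_function phi.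
Hypotheses (r0 : 0 < r) (eps0 : 0 < eps) (lambda0 : 0 < lambda).
Hypothesis dM : forall i : I, Omega (node i) -> 0 < \det (M i).
Hypothesis Mr : forall i : I, Omega (node i) -> forall z, uball z -> enorm (eps *: (z *m M i)) < r.
Local Notation L := (nodal_operator phi r eps lambda M).

Lemma exp_superadditive (x y : R) n : 0 <= x -> 0 <= y -> x ^+ n.+1 + y ^+ n.+1 <= (x + y) ^+ n.+1.
Proof.
move=> x0 y0; elim: n => [|n IH]; first by rewrite !expr1.
rewrite [leRHS]exprS; apply: le_trans (ler_wpM2l (addr_ge0 x0 y0) IH).
rewrite mulrDl !mulrDr -!exprS.
have : 0 <= x * y ^+ n.+1 by rewrite mulr_ge0 ?exprn_ge0.
have : 0 <= y * x ^+ n.+1 by rewrite mulr_ge0 ?exprn_ge0.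
lra.
Qed.

(** The summand 1 makes the d-th power dominate [abp_constant]. In 4 / lambda one factor 2 undoes
    lambda / 2 and the other splits a sum of two loads. *)
Definition stability_constant (D : R) : R := (1 + abp_constant d g) * D * (4 / lambda).

Variables (b a : I -> R) (c2 beta S B D : R).
Hypothesis c20 : 0 < c2.
Hypothesis b01 : forall j, 0 <= b j <= 1.
Hypothesis Lb : forall i, Omega (node i) -> L b i <= 0.
Hypothesis Lb_strip : forall i, Omega (node i) -> dist (node i) (boundary Omega) <= r -> L b i <= - c2 / r ^+ 2.
Hypothesis a_ge0 : forall i, 0 <= a i.
Hypotheses (beta0 : 0 <= beta) (S0 : 0 <= S) (B0 : 0 <= B) (D0 : 0 < D).
Hypothesis diamD : forall i j : I, enorm (node i - node j) <= D.
Hypothesis sum_a : \sum_(i : I | `[< Omega (node i) >]) mass i * a i ^+ d <= B ^+ d.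

(** The load has a part [a] measured in l^d, a uniform part [beta] and a part [S] in the strip.
    Adding K times the barrier with K = S r^2 / c2 removes [S], at the cost of at most K, since the
    barrier is at most 1. *)
Lemma one_sided_bound e : (forall i, ~ Omega (node i) -> e i = 0) ->
  (forall i, Omega (node i) ->
     L e i <= a i + beta + (if dist (node i) (boundary Omega) <= r then S else 0)) ->
  forall j, - e j <= S * r ^+ 2 / c2 + stability_constant D * (B + beta * (1 + vol Omega)).
Proof.
move=> e0 Le j.
have dE : d.-1.+1 = d by rewrite prednK.
pose K := S * r ^+ 2 / c2.
have K0 : 0 <= K by rewrite divr_ge0 ?(ltW c20)// mulr_ge0// exprn_ge0// ltW.
pose v i := e i + K * b i.
have abp0 : 0 <= abp_constant d g.
  by rewrite mulr_ge0 ?exprn_ge0// divr_ge0 ?mulr_ge0// exprn_ge0// mulr_ge0// divr_ge0// ltW.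
have V0 : 0 <= vol Omega by exact: vol_ge0.
set Y := B + beta * (1 + vol Omega).
have Y0 : 0 <= Y by rewrite addr_ge0// mulr_ge0// addr_ge0.
have X0 : 0 <= stability_constant D * Y.
  by rewrite mulr_ge0// mulr_ge0 ?divr_ge0 ?(ltW lambda0)// mulr_ge0 ?(ltW D0)// addr_ge0.
have bj : K * b j <= K by rewrite ler_piMr//; have /andP[] := b01 j.
case: (leP 0 (v j)) => vj; first by move: vj; rewrite /v -/K; lra.
pose G i := 2 / lambda * (a i + beta).
have G0 i : 0 <= G i by rewrite mulr_ge0 ?addr_ge0// divr_ge0// ltW.
have Gcontact i : Omega (node i) -> contact v i -> \sum_j kap i j * v j <= mass i * G i.
  (* At a contact node the nonlocal term is nonnegative, so the bound on the operator bounds the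
     discrete Laplacian alone. *)
  move=> Oi cv; have Ic := Ieps_contact conf d0 kphi r0 eps0 dM Mr Oi cv.
  have mu0 : 0 < mass i by exact: (mass_gt0 conf d0 h0 g0 hulls_ge Oi).
  have Lv : L v i <= a i + beta.
    rewrite (nodal_operatorD conf lambda kphi r0 eps0 dM Mr K e b Oi).
    have := Le i Oi; case: ifP => hs.
      have := ler_wpM2l K0 (Lb_strip Oi hs).
      have -> : K * (- c2 / r ^+ 2) = - S by rewrite /K; field; rewrite !gt_eqF.
      lra.
    by have := ler_wpM2l K0 (Lb Oi); rewrite mulr0; lra.
  move: Lv; rewrite /nodal_operator; set s := \sum_j _ => Lv.
  have : lambda / 2 * ((mass i)^-1 * s) <= a i + beta by lra.
  rewrite mulrCA ler_pdivrMl// => hs.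
  have -> : mass i * G i = 2 / lambda * (mass i * (a i + beta)) by rewrite /G; ring.
  rewrite -ler_pdivrMl ?divr_gt0//; apply: le_trans hs.
  by rewrite invf_div mulrC.
have := discrete_abp conf d0 h0 g0 hulls_le hulls_ge acute D0 diamD _ Gcontact G0 vj.
have vb i : ~ Omega (node i) -> 0 <= v i.
  by move=> nO; rewrite /v e0// add0r mulr_ge0//; have /andP[] := b01 i.
move=> /(_ vb) hv.
have sumG : \sum_(i : I | `[< Omega (node i) >]) mass i * G i ^+ d <= (4 / lambda * Y) ^+ d.
  have Gd i : `[< Omega (node i) >] ->
      mass i * G i ^+ d <= (4 / lambda) ^+ d * (mass i * a i ^+ d + beta ^+ d * mass i).
    move=> /asboolP Oi; have mu0 : 0 < mass i by exact: (mass_gt0 conf d0 h0 g0 hulls_ge Oi).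
    rewrite [beta ^+ d * _]mulrC -mulrDr mulrCA ler_pM2l//.
    have -> : 4 / lambda = 2 / lambda * 2 by field; rewrite gt_eqF.
    rewrite /G [(2 / lambda * (_ + _)) ^+ d]exprMn [(2 / lambda * 2) ^+ d]exprMn -mulrA.
    apply: ler_wpM2l; first by rewrite exprn_ge0// divr_ge0// ltW.
    have ma : a i <= Num.max (a i) beta by rewrite le_max lexx.
    have mb : beta <= Num.max (a i) beta by rewrite le_max lexx orbT.
    have h2 : a i + beta <= 2 * Num.max (a i) beta by move: ma mb; set m := Num.max _ _; lra.
    apply: (@le_trans _ _ ((2 * Num.max (a i) beta) ^+ d)).
      by rewrite lerXn2r ?nnegrE ?addr_ge0 ?mulr_ge0 ?le_max ?a_ge0.
    rewrite exprMn ler_wpM2l ?exprn_ge0//.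
    by case: (leP (a i) beta) => _; [rewrite lerDr|rewrite lerDl]; rewrite exprn_ge0.
  apply: (@le_trans _ _ (\sum_(i : I | `[< Omega (node i) >])
      (4 / lambda) ^+ d * (mass i * a i ^+ d + beta ^+ d * mass i))); first by apply: ler_sum => i; exact: Gd.
  rewrite -mulr_sumr big_split/= -mulr_sumr [leRHS]exprMn.
  rewrite ler_wpM2l ?exprn_ge0 ?divr_ge0 ?(ltW lambda0)//.
  have B1 : beta * (1 + vol Omega) >= 0 by rewrite mulr_ge0// addr_ge0.
  have := exp_superadditive d.-1 B0 B1; rewrite dE; apply: le_trans; apply: lerD => //.
  rewrite exprMn ler_wpM2l ?exprn_ge0//.
  apply: le_trans (sum_mass_le conf h0 g0 hulls_ge) _.
  apply: (@le_trans _ _ (1 + vol Omega)); first by rewrite lerDr.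
  by rewrite ler_eXnr// lerDl.
have : (- v j) ^+ d <= (stability_constant D * Y) ^+ d.
  apply: le_trans hv _; apply: le_trans (ler_wpM2l _ sumG) _.
    by rewrite mulr_ge0// exprn_ge0// ltW.
  have -> : stability_constant D * Y = (1 + abp_constant d g) * D * (4 / lambda * Y) by rewrite /stability_constant; ring.
  rewrite [X in _ <= X]exprMn [((1 + abp_constant d g) * D) ^+ d]exprMn.
  apply: ler_wpM2r; first by rewrite exprn_ge0// mulr_ge0// divr_ge0// ltW.
  apply: ler_wpM2r; first by rewrite exprn_ge0// ltW.
  apply: (@le_trans _ _ (1 + abp_constant d g)); first by rewrite lerDr.
  by rewrite ler_eXnr// lerDl.
rewrite ler_pXn2r// ?nnegrE ?oppr_ge0 ?(ltW vj)// /v -/K; lra.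
Qed.

End stability.

(** * The error estimate on a fixed mesh *)

Section pointwise_estimate.
Context (R : realType) (d : nat) (T : mesh R d).
Hypothesis conf : conforming T.
Hypothesis d0 : (0 < d)%N.
Local Notation I := 'I_(nnodes T).
Local Notation elt := (elements T).
Local Notation Omega := (polytope T).
Local Notation leb := (@lebesgue R d).
Variables h g D : R.
Hypothesis h0 : 0 < h.
Hypothesis g0 : 0 < g.
Hypothesis hulls_le : forall K x y, K \in elt -> hull K x -> hull K y -> enorm (x - y) <= h.
Hypothesis hulls_ge : forall K, K \in elt -> exists c, forall x, enorm (x - c) <= g * h -> hull K x.
Hypothesis acute : face_weakly_acute T Omega.
Hypothesis D0 : 0 < D.
Hypothesis diamD : forall i j : I, enorm (node i - node j) <= D.
Variables (phi : 'rV[R]_d -> R) (eps lambda Lambda : R) (M : I -> 'M[R]_d).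
Local Notation Q := (Num.sqrt (Lambda - lambda / 2)).
Local Notation r := (Q * eps).
Hypothesis kphi : kernel_function phi.
Hypotheses (eps0 : 0 < eps) (lambda0 : 0 < lambda) (lL : lambda <= Lambda).
Hypothesis ghr : g * h <= r.
Variables (c0 : R) (q : nat).
Hypotheses (c00 : 0 < c0) (q0 : (0 < q)%N) (pg : 1 <= power_gain g phi Q lambda q).
Hypothesis hsmall : h * stiff_bound d g <= direction_const d g * (c0 * r).
Hypothesis bne : boundary Omega !=set0.
Hypothesis exterior : forall x, boundary Omega x -> exists2 z, enorm (z - x) <= r &
  forall y, enorm (y - z) < c0 * r -> ~ closure Omega y.
Variables (u uG uh f : 'rV[R]_d -> R) (W K3 H a E B : R).
Hypotheses (a0 : 0 <= a) (H0 : 0 <= H) (W0 : 0 <= W) (K30 : 0 <= K3) (E0 : 0 <= E) (B0 : 0 <= B).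
Hypothesis Cu : Ck_on Omega 3 u.
Hypothesis gu : bounded_continuous Omega u.
Hypothesis hH : forall p q, Omega p -> Omega q -> forall i j k,
  `|third u p i j k - third u q i j k| <= H * enorm (p - q) `^ a.
Hypothesis hW : forall x, Omega x -> enorm (hess u x) <= W.
Hypothesis h3 : forall p i j k, Omega p -> `|third u p i j k| <= K3.
Hypothesis h1 : forall k, exists c, forall x, Omega x -> `|partial k u x| <= c.
Variables (A : 'rV[R]_d -> 'M[R]_d) (N : set 'rV[R]_d).
Hypothesis N0 : leb N = 0%E.
Hypothesis mA : forall k l, mfn Omega (fun x => A x k l).
Hypothesis symA : forall x, Omega x -> (A x)^T = A x.
Hypothesis boundA : forall x, Omega x -> ~ N x -> forall xi : 'rV[R]_d,
  lambda * enorm xi ^+ 2 <= quad (A x) xi <= Lambda * enorm xi ^+ 2.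
Hypothesis fE : forall x, Omega x -> ~ N x -> \sum_k \sum_l A x k l * hess u x k l = f x.
Hypothesis galerkin : galerkin_projection T Omega u uG.
Hypothesis hE : forall x, Omega x -> `|u x - uG x| <= E.
Hypothesis sqM : forall i, Omega (node i) -> is_sqrtmx (M i) (mean_coefficient Omega A i - (lambda / 2)%:M).
Hypothesis solution : discrete_solution Omega lambda Lambda eps phi M f uh.
Hypothesis oscA : \sum_(i : I | `[< Omega (node i) >])
  integ (star Omega i `&` Omega) (fun x => enorm (A x - mean_coefficient Omega A i) ^+ d) <= B ^+ d.

(** Bound for I_eps (u - u_G) from theta eps >= g h / Q. As E carries h^2 |ln h|, it is of order |ln
    h|. *)
Definition strip_load : R := 4 * E * kernel_mass phi * Q ^+ 2 / (g * h) ^+ 2.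
Definition interior_load : R :=
  local_error d h Lambda K3 + taylor_error phi Q eps H a + 4 * E * kernel_mass phi / eps ^+ 2.
Definition nodal_error : R :=
  strip_load * r ^+ 2 / ((c0 ^+ 2) ^+ q / 9 ^+ q.+1) +
  stability_constant d g lambda D * (W * B + interior_load * (1 + vol Omega)).

Lemma pointwise_estimate x : Omega x -> `|u x - uh x| <= E + nodal_error.
Proof.
move=> Ox; have Q0 : 0 < Q by exact: Q_gt0.
have r0 : 0 < r by exact: mulr_gt0.
have bAm (j : I) : Omega (node j) -> forall xi : 'rV[R]_d,
    lambda * enorm xi ^+ 2 <= quad (mean_coefficient Omega A j) xi <= Lambda * enorm xi ^+ 2.
  by move=> _; exact: (mean_coefficient_bounds conf d0 h0 g0 hulls_ge j lambda0 N0 mA symA boundA).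
have dM (j : I) : Omega (node j) -> 0 < \det (M j).
  by move=> Oj; exact: (det_sqrtmx_gt0 lambda0 (sqM Oj) (bAm j Oj)).
have Mr (j : I) : Omega (node j) -> forall z, uball z -> enorm (eps *: (z *m M j)) < r.
  by move=> Oj z; exact: (enorm_sqrtmx_lt lambda0 lL (sqM Oj) (bAm j Oj)).
have [b [b01 Lb Lb_strip]] :=
  barrier conf d0 h0 g0 hulls_le hulls_ge acute kphi Q0 eps0 lambda0 dM Mr ghr c00 q0 pg hsmall bne exterior.
pose c2 := (c0 ^+ 2) ^+ q / 9 ^+ q.+1.
have c20 : 0 < c2 by rewrite divr_gt0 ?exprn_gt0.
have k0 := kernel_mass_ge0 kphi.
have S0 : 0 <= strip_load.
  by rewrite divr_ge0 ?mulr_ge0 ?exprn_ge0 ?mulr_ge0 ?(ltW g0) ?(ltW h0) ?(ltW Q0).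
pose av (i : I) := if `[< Omega (node i) >] then W * oscillation i A N else 0.
have av0 i : 0 <= av i.
  rewrite /av; case: asboolP => // Oi; rewrite mulr_ge0//.
  exact: (oscillation_ge0 conf d0 h0 g0 hulls_ge Oi).
have L0 : 0 <= Lambda by apply: le_trans lL; exact: ltW.
have beta0 : 0 <= interior_load.
  rewrite addr_ge0//; last by rewrite divr_ge0 ?mulr_ge0 ?exprn_ge0 ?(ltW eps0).
  rewrite addr_ge0//; first by rewrite /local_error !mulr_ge0 ?exprn_ge0 ?(ltW h0).
  by rewrite /taylor_error !mulr_ge0 ?exprn_ge0 ?powR_ge0 ?(ltW Q0) ?(ltW eps0).
have WB0 : 0 <= W * B by rewrite mulr_ge0.
have sum_a : \sum_(i : I | `[< Omega (node i) >]) mass i * av i ^+ d <= (W * B) ^+ d.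
  rewrite exprMn; apply: le_trans (ler_wpM2l (exprn_ge0 d W0) oscA).
  rewrite mulr_sumr; apply: ler_sum => i si; rewrite /av si exprMn mulrCA ler_wpM2l ?exprn_ge0//.
  move/asboolP : si => Oi.
  exact: (oscillation_power conf d0 h0 g0 hulls_ge Oi lambda0 N0 mA symA boundA).
pose e (j : I) := uh (node j) - uG (node j).
have [[fuh zuh] _] := solution; have [[fG zG] _] := galerkin.
have e0 i : ~ Omega (node i) -> e i = 0.
  move=> nO; have bi : boundary Omega (node i).
    split; first by rewrite closure_polytope//; exact: union_node.
    by move=> /interior_subset.
  by rewrite /e zuh// zG// subrr.
have Le i : Omega (node i) ->
    `|nodal_operator phi r eps lambda M e i| <=
    av i + interior_load + (if dist (node i) (boundary Omega) <= r then strip_load else 0).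
  move=> Oi; have := operator_error conf d0 h0 g0 hulls_le hulls_ge kphi eps0 lambda0 lL a0 H0 Cu gu hH hW h3 h1
    N0 mA symA boundA fE galerkin hE sqM solution Oi.
  rewrite -/e /av asboolT// => hL; apply: le_trans hL _.
  rewrite /interior_load; have p0 : 0 <= 4 * E * kernel_mass phi by rewrite !mulr_ge0.
  have q1 : 0 <= 4 * E * kernel_mass phi / eps ^+ 2 by rewrite divr_ge0// exprn_ge0// ltW.
  case: (leP (dist (node i) (boundary Omega)) r) => hd; last by rewrite theta_far// mul1r addr0; lra.
  have [t0 t1 _ tge] := theta_spec (@open_interior _ _) r0 Oi.
  set th := theta _ _ _ in t0 t1 tge *.
  suff : 4 * E * kernel_mass phi / (th * eps) ^+ 2 <= strip_load.
    by move: q1; set s1 := _ / eps ^+ 2; set s2 := _ / _ ^+ 2; lra.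
  have tgh : g * h / r <= th.
    apply: tge => //; first exact: mulr_gt0.
    by move=> y hy; apply: (node_ball conf h0 g0 hulls_ge Oi); rewrite addrC addKr.
  rewrite /strip_load -[leRHS]mulrA; apply: ler_wpM2l => //.
  have te : 0 < th * eps by exact: mulr_gt0.
  have gh : 0 < g * h by exact: mulr_gt0.
  rewrite -[leLHS]mul1r ler_pdivrMr ?exprn_gt0// mulrAC ler_pdivlMr ?exprn_gt0// mul1r -!exprMn.
  rewrite lerXn2r ?nnegrE ?(ltW gh)//; first by rewrite mulr_ge0// ltW.
  by move: tgh; rewrite ler_pdivrMr//; lra.
have Le_opp i : Omega (node i) -> nodal_operator phi r eps lambda M (fun j => - e j) i =
    - nodal_operator phi r eps lambda M e i.
  move=> Oi; have := nodal_operatorD conf lambda kphi r0 eps0 dM Mr (-2) e e Oi.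
  rewrite (_ : (fun j => _) = fun j => - e j); last by apply/funext => j; ring.
  by move=> ->; ring.
have bnd j : `|e j| <= nodal_error.
  have P1 := one_sided_bound conf d0 h0 g0 hulls_le hulls_ge acute kphi r0 eps0 lambda0 dM Mr
    c20 b01 Lb _ av0 beta0 S0 WB0 D0 diamD sum_a.
  have strip i : Omega (node i) -> dist (node i) (boundary Omega) <= r ->
      nodal_operator phi r eps lambda M b i <= - c2 / r ^+ 2.
    have -> : - c2 / r ^+ 2 = - (c0 ^+ 2) ^+ q / 9 ^+ q.+1 / r ^+ 2 by rewrite /c2 !mulNr.
    exact: Lb_strip.
  have {}P1 := P1 strip.
  rewrite ler_norml; apply/andP; split.
    rewrite lerNl; apply: P1 => // i Oi; apply: le_trans (Le i Oi); exact: ler_norm.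
  rewrite -[e j]opprK; apply: (P1 (fun j => - e j)) => i; first by move=> /e0 ->; rewrite oppr0.
  by move=> Oi; rewrite Le_opp//; apply: le_trans (Le i Oi); rewrite -normrN; exact: ler_norm.
have Ux := polytope_union Ox.
have -> : u x - uh x = (u x - uG x) - (uh x - uG x) by ring.
apply: le_trans (ler_normB _ _) _; apply: lerD; first exact: hE.
rewrite (fe_spaceE conf fuh Ux) (fe_spaceE conf fG Ux) -sumrB.
apply: le_trans (ler_norm_sum _ _ _) _.
rewrite -[nodal_error]mul1r -(sum_hatf conf Ux) mulr_suml; apply: ler_sum => j _.
by rewrite -mulrBr normrM ger0_norm ?hatf_ge0// ler_wpM2l ?hatf_ge0//; exact: bnd.
Qed.

End pointwise_estimate.

(** * Powers of the meshsize *)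

Section scaling.
Context (R : realType).

Lemma small_powR (t m : R) : 0 < t -> 0 < m ->
  exists2 h0, 0 < h0 & forall h, 0 < h -> h < h0 -> h `^ t <= m.
Proof.
move=> t0 m0; exists (m `^ t^-1); first exact: powR_gt0.
move=> h hp hh; have := ge0_ler_powR (ltW t0) _ _ (ltW hh).
rewrite !nnegrE ?powR_ge0 ?(ltW hp)// => /(_ isT isT).
by rewrite -powRrM mulVf ?gt_eqF// powRr1// ltW.
Qed.

(** [power_gain] is affine in q with positive slope [s]. *)
Lemma power_gain_large d (phi : 'rV[R]_d -> R) (g Q lambda : R) : 0 < g -> 0 < lambda -> (0 < d)%N ->
  exists2 q, (0 < q)%N & 1 <= power_gain g phi Q lambda q.
Proof.
move=> g0 l0 d0; have w0 : 0 < direction_const d g by rewrite exprn_gt0// mulr_gt0// divr_gt0// ltr0n.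
have S0 : 0 < stiff_bound d g by rewrite mulr_gt0 ?invr_gt0 ?exprn_gt0.
pose s := lambda / 2 * ((2 ^+ d)^-1 * (direction_const d g ^+ 2 / stiff_bound d g)) / 2.
pose m := lambda / 2 * ((2 ^+ d)^-1 * stiff_bound d g) + nonlocal_bound g phi Q.
have s0 : 0 < s by rewrite !divr_gt0// !mulr_gt0// ?invr_gt0 ?exprn_gt0// divr_gt0// exprn_gt0.
have E q : power_gain g phi Q lambda q = s * (q%:R - 1) - m by rewrite /power_gain /s /m; ring.
pose q := (Num.truncn ((1 + `|m|) / s)).+2; exists q => //.
rewrite E lerBrDr; apply: (@le_trans _ _ (1 + `|m|)); first by rewrite lerD2l ler_norm.
rewrite -ler_pdivrMl// mulrC /q -natr1 addrK; apply: ltW.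
by apply: truncnS_gt.
Qed.

Variables (d : nat) (T : mesh R d) (phi : 'rV[R]_d -> R).
Hypothesis kphi : kernel_function phi.
Variables (g D lambda Lambda c0 C2 C3 CA CG a h W H : R) (q : nat).
Hypotheses (g0 : 0 < g) (D0 : 0 < D) (lambda0 : 0 < lambda) (lL : lambda <= Lambda) (c00 : 0 < c0)
  (C20 : 0 < C2) (C30 : 0 <= C3) (CA0 : 0 <= CA) (CG0 : 0 <= CG) (a0 : 0 < a) (a1 : a <= 1).
Hypotheses (h0 : 0 < h) (h1 : h <= 1) (W0 : 0 <= W) (H0 : 0 <= H) (ln1 : 1 <= `|ln h|).

Local Notation Q := (Num.sqrt (Lambda - lambda / 2)).
Local Notation p := ((2 + 2 * a) / (3 + a)).
Local Notation s := (2 / (3 + a)).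
Local Notation c2 := ((c0 ^+ 2) ^+ q / 9 ^+ q.+1).
Local Notation k0 := (kernel_mass phi).

Definition total_constant : R :=
  CG + 4 * CG * k0 * Q ^+ 4 * C2 ^+ 2 / (g ^+ 2 * c2) +
  stability_constant d g lambda D * (CA +
    (d%:R ^+ 3 * Lambda * C3 + 2 * d%:R ^+ 3 * k0 * Q ^+ 3 * C2 * (2 * (Q * C2)) `^ a +
     4 * CG * k0 / C2 ^+ 2) * (1 + vol (polytope T))).

(** Every term carries h, h^2, eps^2, eps^(1 + alpha) or h^2 / eps^2, and each of these is at most a
    constant times h^p. The last two are equal to such multiples, which is what singles out the
    exponent of eps. Terms without logarithm are absorbed by |ln h| >= 1. *)
Lemma scaling :
  CG * h ^+ 2 * `|ln h| * W +
  nodal_error T h g D phi (C2 * h `^ s) lambda Lambda c0 q W (C3 * (H + W)) H a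
    (CG * h ^+ 2 * `|ln h| * W) (CA * h `^ p) <=
  total_constant * (h `^ p * `|ln h| * (H + W)).
Proof.
have A0 : 0 < a := a0; have A1 : a <= 1 := a1; have LN : 1 <= `|ln h| := ln1.
have b0 : 0 < 3 + a by lra.
set X := h `^ p; set l := `|ln h| in LN *; set y := h `^ s.
have hh : 0 < h <= 1 by rewrite h0.
have y0 : 0 < y by exact: powR_gt0.
have X0 : 0 < X by exact: powR_gt0.
have p1 : p <= 1 by rewrite ler_pdivrMr//; lra.
have F1 : h <= X.
  by rewrite -[leLHS](powRr1 (ltW h0)); exact: ger_powR.
have F2 : h ^+ 2 <= X.
  by apply: le_trans F1; rewrite expr2 ler_piMl// ltW.
have y2 : y ^+ 2 = h `^ (2 * s).
  by rewrite -powR_mulrn ?(ltW y0)// -powRrM mulrC.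
(* The barrier term; the comparison 4 >= 2 + 2 alpha is where alpha <= 1 enters. *)
have F3 : y ^+ 2 <= X.
  by rewrite y2; apply: ger_powR => //; rewrite mulrA ler_pM2r ?invr_gt0//; lra.
have F4 : y * y `^ a = X.
  rewrite /y -powRrM -powRD; last by rewrite gt_eqF ?implybT// addr_gt0 ?divr_gt0// mulr_gt0// divr_gt0.
  by congr powR; field; rewrite gt_eqF.
have F5 : h ^+ 2 / y ^+ 2 = X.
  rewrite y2 -powR_mulrn ?(ltW h0)// -powRB; last by rewrite (gt_eqF h0) implybT.
  by congr powR; field; rewrite gt_eqF.
have Q0 : 0 < Q by exact: Q_gt0.
have k00 := kernel_mass_ge0 kphi.
have L0 : 0 <= Lambda by apply: le_trans lL; exact: ltW.
have l0 : 0 <= l by lra.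
have HW0 : 0 <= H + W by rewrite addr_ge0.
have c20 : 0 < c2 by rewrite divr_gt0// ?exprn_gt0.
pose eta := X * l * (H + W).
have XlW : X * l * W <= eta by rewrite ler_wpM2l ?mulr_ge0 ?(ltW X0)// lerDr.
have XW : X * W <= eta.
  by rewrite /eta -mulrA ler_pM2l//; apply: (@le_trans _ _ (1 * (H + W))); [rewrite mul1r lerDr|rewrite ler_wpM2r].
have XHW : X * (H + W) <= eta.
  by rewrite /eta -mulrA ler_pM2l// -[leLHS]mul1r ler_wpM2r.
have XH : X * H <= eta by apply: le_trans XHW; rewrite ler_pM2l// lerDl.
have lW0 : 0 <= l * W by rewrite mulr_ge0.
set E := CG * h ^+ 2 * l * W.
have B1 : E <= CG * eta.
  have -> : E = CG * (h ^+ 2 * (l * W)) by rewrite /E; ring.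
  apply: ler_wpM2l => //; apply: le_trans XlW; rewrite -[leRHS]mulrA; exact: ler_wpM2r.
have B2 : strip_load h g phi lambda Lambda E * (Q * (C2 * y)) ^+ 2 / c2 <=
    4 * CG * k0 * Q ^+ 4 * C2 ^+ 2 / (g ^+ 2 * c2) * eta.
  have -> : strip_load h g phi lambda Lambda E * (Q * (C2 * y)) ^+ 2 / c2 =
      4 * CG * k0 * Q ^+ 4 * C2 ^+ 2 / (g ^+ 2 * c2) * (y ^+ 2 * (l * W)).
    rewrite /strip_load /E; set cc := c2 in c20 *; move: c20 => cc0; move: Q0; set QQ := Q => QQ0.
    by field; rewrite !gt_eqF.
  apply: ler_wpM2l.
    by rewrite divr_ge0 ?mulr_ge0 ?exprn_ge0 ?(ltW Q0) ?(ltW C20) ?(ltW g0)// ?invr_ge0 ?exprn_ge0// ltW.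
  by apply: le_trans XlW; rewrite -[leRHS]mulrA; exact: ler_wpM2r.
have B3 : W * (CA * X) <= CA * eta by rewrite mulrCA ler_wpM2l// mulrC.
have B4 : local_error d h Lambda (C3 * (H + W)) <= d%:R ^+ 3 * Lambda * C3 * eta.
  have -> : local_error d h Lambda (C3 * (H + W)) = d%:R ^+ 3 * Lambda * C3 * (h * (H + W)).
    by rewrite /local_error; ring.
  by rewrite ler_wpM2l ?mulr_ge0 ?exprn_ge0//; apply: le_trans XHW; rewrite ler_wpM2r.
have B5 : taylor_error phi Q (C2 * y) H a <=
    2 * d%:R ^+ 3 * k0 * Q ^+ 3 * C2 * (2 * (Q * C2)) `^ a * eta.
  have -> : taylor_error phi Q (C2 * y) H a =
      2 * d%:R ^+ 3 * k0 * Q ^+ 3 * C2 * (2 * (Q * C2)) `^ a * (X * H).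
    rewrite /taylor_error -F4; have -> : 2 * (Q * (C2 * y)) = (2 * (Q * C2)) * y by ring.
    by rewrite powRM ?mulr_ge0 ?(ltW Q0) ?(ltW C20) ?(ltW y0)//; ring.
  by rewrite ler_wpM2l ?mulr_ge0 ?exprn_ge0 ?powR_ge0 ?(ltW Q0) ?(ltW C20).
have B6 : 4 * E * k0 / (C2 * y) ^+ 2 <= 4 * CG * k0 / C2 ^+ 2 * eta.
  have -> : 4 * E * k0 / (C2 * y) ^+ 2 = 4 * CG * k0 / C2 ^+ 2 * (X * l * W).
    by rewrite -F5 /E; field; rewrite !gt_eqF.
  by rewrite ler_wpM2l ?mulr_ge0 ?invr_ge0 ?exprn_ge0 ?(ltW C20).
have st0 : 0 <= stability_constant d g lambda D.
  rewrite mulr_ge0 ?divr_ge0 ?(ltW lambda0)// mulr_ge0 ?(ltW D0)// addr_ge0//.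
  by rewrite mulr_ge0 ?exprn_ge0// divr_ge0 ?mulr_ge0// exprn_ge0// mulr_ge0// divr_ge0// ltW.
have V0 : 0 <= 1 + vol (polytope T) by rewrite addr_ge0// vol_ge0.
have split_total (x1 x2 x3 x4 x5 x6 st V : R) : (x1 + x2 + st * (x3 + (x4 + x5 + x6) * V)) * eta =
    x1 * eta + (x2 * eta + st * (x3 * eta + (x4 * eta + x5 * eta + x6 * eta) * V)) by ring.
rewrite /total_constant -/eta split_total; apply: lerD => //.
rewrite /nodal_error; apply: lerD => //; apply: ler_wpM2l => //; apply: lerD => //; apply: ler_wpM2r => //.
by rewrite /interior_load; apply: lerD => //; exact: lerD.
Qed.

End scaling.

(** * From the norms of the solution to pointwise bounds *)

Section regularity.
Context (R : realType) (d : nat) (Omega : set 'rV[R]_d) (u : 'rV[R]_d -> R) (a : R).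
Hypothesis d0 : (0 < d)%N.
Hypothesis oO : open Omega.

(** The supremum over an empty set would be -oo; an open nonempty set contains two distinct
    points. *)
Lemma holder_ge0 : Omega !=set0 -> (0 <= holder_seminorm3 Omega a u)%E.
Proof.
move=> [x Ox]; have [e e0 eO] := (open_enorm Omega).1 oO x Ox.
pose y := x + (e / 2) *: delta_mx 0 (Ordinal d0).
have Oy : Omega y.
  by apply: eO; rewrite addrC addKr enormZ enorm_delta mulr1 gtr0_norm ?divr_gt0//; lra.
pose v : R := Num.sqrt (\sum_i \sum_j \sum_k
  (dpart [:: i; j; k] u x - dpart [:: i; j; k] u y) ^+ 2) / enorm (x - y) `^ a.
apply: (@le_trans _ _ v%:E); first by rewrite lee_fin divr_ge0 ?sqrtr_ge0 ?powR_ge0.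
apply: ereal_sup_ubound; exists (x, y) => //; split=> //=.
apply/eqP => E; have : enorm (y - x) = 0 by rewrite E subrr enorm0.
rewrite /y [x + _]addrC addrK enormZ enorm_delta mulr1 gtr0_norm ?divr_gt0// => h.
by move: e0; lra.
Qed.

Lemma holder_third (H : R) : 0 <= H -> (holder_seminorm3 Omega a u <= H%:E)%E ->
  forall p q, Omega p -> Omega q -> forall i j k,
    `|third u p i j k - third u q i j k| <= H * enorm (p - q) `^ a.
Proof.
move=> H0 hH p q Op Oq i j k; case: (eqVneq p q) => [->|pq].
  by rewrite subrr normr0 mulr_ge0// powR_ge0.
have pq0 : 0 < enorm (p - q) `^ a by rewrite powR_gt0// enorm_gt0// subr_eq0.
pose F (i j k : 'I_d) := (dpart [:: i; j; k] u p - dpart [:: i; j; k] u q) ^+ 2.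
pose S := Num.sqrt (\sum_i \sum_j \sum_k F i j k).
have : ((S / enorm (p - q) `^ a)%:E <= H%:E)%E.
  by apply: le_trans hH; apply: ereal_sup_ubound; exists (p, q).
rewrite lee_fin ler_pdivrMr//; apply: le_trans.
have F0 i' j' k' : 0 <= F i' j' k' by exact: sqr_ge0.
rewrite /third -sqrtr_sqr ler_wsqrtr//.
have one (G : 'I_d -> R) l : (forall l, 0 <= G l) -> G l <= \sum_l G l.
  by move=> G0; rewrite (bigD1 l)//= lerDl sumr_ge0.
apply: (@le_trans _ _ (\sum_k F i j k)); first exact: (one (F i j)).
apply: (@le_trans _ _ (\sum_j \sum_k F i j k)).
  by apply: (one (fun j => \sum_k F i j k)) => l; exact: sumr_ge0.
apply: (one (fun i => \sum_j \sum_k F i j k)) => l.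
by apply: sumr_ge0 => m _; exact: sumr_ge0.
Qed.

Lemma continuous_hess_norm x : Ck_on Omega 3 u -> Omega x ->
  {for x, continuous (fun y => enorm (hess u y))}.
Proof.
move=> Cu Ox.
have sumc (I : finType) (F : I -> 'rV[R]_d -> R) : (forall i, {for x, continuous (F i)}) ->
    {for x, continuous (fun y => \sum_i F i y)}.
  move=> hF; suff : forall s : seq I, {for x, continuous (fun y => \sum_(i <- s) F i y)} by exact.
  elim=> [|i s IH].
    rewrite (_ : (fun y => _) = fun=> 0); first exact: cst_continuous.
    by apply/funext => y; rewrite big_nil.
  rewrite (_ : (fun y => _) = fun y => F i y + \sum_(i <- s) F i y).
    by apply: continuousD.
  by apply/funext => y; rewrite big_cons.
have cS : {for x, continuous (fun y => \sum_k \sum_l hess u y k l ^+ 2)}.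
  apply: (sumc 'I_d) => k; apply: (sumc 'I_d) => l.
  have ck : {for x, continuous (fun y => hess u y k l)}.
    rewrite (_ : (fun y => _) = dpart [:: k; l] u); first by have [] := Cu [:: k; l] isT x Ox.
    by apply/funext => y; rewrite mxE.
  rewrite (_ : (fun y => _) = fun y => hess u y k l * hess u y k l); first exact: continuousM.
  by apply/funext => y; rewrite expr2.
by apply: (continuous_comp cS); exact: sqrt_continuous.
Qed.

End regularity.

Theorem corollary6p8 (R : realType) (d : nat) (Omega : set 'rV[R]_d)
    (phi : 'rV[R]_d -> R) (lambda Lambda sigma kappa CA CG C2 alpha : R) :
  (2 <= d)%N ->
  open Omega -> connected Omega -> Omega !=set0 -> bounded_set Omega ->
  0 < lambda -> lambda <= Lambda ->
  kernel_function phi ->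
  0 < kappa -> 0 < C2 -> 0 < alpha -> alpha <= 1 ->
  exists C h0 : R, 0 < h0 /\
  forall (A : 'rV[R]_d -> 'M[R]_d) (f u : 'rV[R]_d -> R) (beta : R)
    (T : mesh R d) (M : 'I_(nnodes T) -> 'M[R]_d) (uG uh : 'rV[R]_d -> R),
  let h := meshsize T in
  let eps := C2 * h `^ (2 / (3 + alpha)) in
  (* data and solution of the boundary value problem *)
  coefficient_field Omega lambda Lambda A ->
  in_Ld Omega f ->
  C3alpha Omega alpha u ->
  {ae (@lebesgue R d), forall x, Omega x ->
     \sum_k \sum_l A x k l * hess u x k l = f x} ->
  (forall x, boundary Omega x -> u x = 0) ->
  (* mesh *)
  conforming T -> polytope T = Omega ->
  shape_regular T sigma -> quasi_uniform T kappa ->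
  face_weakly_acute T Omega ->
  h < h0 ->
  (* regularity of the coefficients *)
  (2 + 2 * alpha) / (3 + alpha) <= beta -> beta <= 1 ->
  coefficient_oscillation T Omega A <= CA * h `^ beta ->
  (* maximum norm estimate for the Galerkin projection *)
  galerkin_projection T Omega u uG ->
  (Linf_norm Omega (u \- uG)%R <=
    (CG * h ^+ 2 * `|ln h|)%:E * W2inf_seminorm Omega u)%E ->
  (* two-scale finite element solution *)
  (forall i, Omega (node i) ->
    is_sqrtmx (M i) (mean_coefficient Omega A i - (lambda / 2)%:M)) ->
  discrete_solution Omega lambda Lambda eps phi M f uh ->
  (Linf_norm Omega (u \- uh)%R <=
    (C * h `^ (2 * (1 + alpha) / (3 + alpha)) * `|ln h|)%:E *
    (holder_seminorm3 Omega alpha u + W2inf_seminorm Omega u))%E.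
Proof.
move=> d2 oO cO neO bO l0 lL kphi k0 C20 a0 a1.
have d0 : (0 < d)%N by exact: leq_trans d2.
(* The geometric constants are taken from one mesh [T0] of [Omega], fixed before the mesh of the
   statement. Without such a mesh the statement is vacuous and any constants do. *)
case: (pselect (exists T0 : mesh R d, conforming T0 /\ polytope T0 = Omega)) => [[T0 [conf0 PT0]]|nT]; last first.
  exists 0, 1; split=> // A f u beta T M uG uh h eps _ _ _ _ _ conf PT.
  by exfalso; apply: nT; exists T.
have element (T : mesh R d) : polytope T = Omega -> exists K, K \in elements T.
  by move=> PT; move: neO; rewrite -PT => -[x /polytope_union[K KT _]]; exists K.
(* No mesh of a nonempty set is shape regular with a nonpositive constant, so this case is vacuous
   too. *)
case: (ltP 0 sigma) => s0; last first.
  exists 0, 1; split=> // A f u beta T M uG uh h eps _ _ _ _ _ conf PT sr qu.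
  have [K KT] := element T PT; have [s1 _] := inball conf d0 k0 sr qu KT.
  by move: s1; rewrite ltNge s0.
pose g := kappa / (4 * sigma); have g0 : 0 < g by rewrite divr_gt0// mulr_gt0.
pose Q := Num.sqrt (Lambda - lambda / 2); have Q0 : 0 < Q by exact: Q_gt0.
have [c0 [rb [c00 rb0 ext]]] := exterior_balls conf0; rewrite PT0 in ext.
have [D1 D10 hD1] := bounded_enorm (bounded_polytope conf0); rewrite PT0 in hD1.
have {PT0}VT0 := congr1 (@vol R d) PT0.
pose D := 2 * D1; have D0 : 0 < D by rewrite mulr_gt0.
have hD x y : closure Omega x -> closure Omega y -> enorm (x - y) <= D.
  by move=> /hD1 h1 /hD1 h2; apply: le_trans (enormB _ _) _; rewrite /D; lra.
have hDO p q : Omega p -> Omega q -> enorm (p - q) <= D by move=> Op Oq; apply: hD; exact: subset_closure.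
have [C3 C30 hC3] := third_bounded oO neO (ltW a0) (ltW D0) hDO.
have [q q0 pg] := power_gain_large phi Q g0 l0 d0.
pose t := (1 + alpha) / (3 + alpha); pose s := 2 / (3 + alpha); pose p := (2 + 2 * alpha) / (3 + alpha).
have b0 : 0 < 3 + alpha by lra.
have t0 : 0 < t by rewrite divr_gt0//; lra.
have s00 : 0 < s by rewrite divr_gt0.
have ts : t + s = 1 by rewrite /t /s; field; rewrite gt_eqF.
have w0 : 0 < direction_const d g by rewrite exprn_gt0// mulr_gt0// divr_gt0// ltr0n.
have S0 : 0 < stiff_bound d g by rewrite mulr_gt0 ?invr_gt0 ?exprn_gt0.
have QC0 : 0 < Q * C2 by exact: mulr_gt0.
(* Since h / eps = h^t / C2 tends to 0, small h makes g h <= Q eps and gives the distance condition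
   of the barrier; the third threshold keeps Q eps below the scale of the exterior balls. *)
have [h1 h10 hh1] := @small_powR _ t (Q * C2 / g) t0 (divr_gt0 QC0 g0).
have [h2 h20 hh2] := @small_powR _ t (direction_const d g * (c0 * (Q * C2)) / stiff_bound d g) t0
  (divr_gt0 (mulr_gt0 w0 (mulr_gt0 c00 QC0)) S0).
have [h3 h30 hh3] := @small_powR _ s (rb / (Q * C2)) s00 (divr_gt0 rb0 QC0).
(* [total_constant] sees the mesh only through the volume of its polytope, which is that of [Omega].
   The hypotheses fix no sign for [CA] and [CG], so absolute values are used; the summand 1 makes C
   positive. *)
pose C := `|total_constant T0 phi g D lambda Lambda c0 C2 C3 `|CA| `|CG| alpha q| + 1.
exists C, (Num.min (Num.min h1 h2) (Num.min h3 (expR (-1)))).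
split; first by rewrite !lt_min h10 h20 h30 expR_gt0.
move=> A f u beta T M uG uh h eps [mA symA aeA] _ [Cu cu extu Hfin] aef u0 conf PT sr qu acute.
rewrite !lt_min => /andP[/andP[hlt1 hlt2] /andP[hlt3 hlte]] pbeta beta1 osc gal hE sqM sol.
have [K0 K0T] := element T PT.
have h0 : 0 < h by apply: lt_le_trans (diam_gt0 conf d0 K0T) _; exact: (@le_bigmax_cond _ _ _ 0 K0 (fun K => K \in elements T) (@diam R d T) K0T).
have hle1 : h <= 1 by apply: le_trans (ltW hlte) _; rewrite expR_le1; lra.
have ln1 : 1 <= `|ln h|.
  have : ln h < -1 by rewrite -[X in _ < X]expRK ltr_ln ?posrE ?expR_gt0.
  by move=> hl; rewrite -normrN; apply: le_trans (ler_norm _); lra.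
have hulls_le K x y : K \in elements T -> hull K x -> hull K y -> enorm (x - y) <= h by exact: le_meshsize.
have hulls_ge K : K \in elements T -> exists c, forall x, enorm (x - c) <= g * h -> hull K x.
  by move=> KT; have [_] := inball conf d0 k0 sr qu KT.
set X := h `^ p; have X0 : 0 < X by exact: powR_gt0.
have y0 : 0 < h `^ s by exact: powR_gt0.
have hts : h = h `^ t * h `^ s by rewrite -powRD ?ts ?powRr1 ?(ltW h0)// (gt_eqF h0) implybT.
have eps0 : 0 < eps by exact: mulr_gt0.
have C0 : 0 < C by rewrite ltr_wpDl.
have -> : h `^ (2 * (1 + alpha) / (3 + alpha)) = X by rewrite /X /p mulrDr mulr1.
have CX0 : 0 < C * X * `|ln h| by rewrite !mulr_gt0//; lra.
have [H HE] : exists H, holder_seminorm3 Omega alpha u = H%:E.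
  have := holder_ge0 u alpha d0 oO neO; move: Hfin; case: holder_seminorm3 => [H| |]//.
  by exists H.
have H0 : 0 <= H by have := holder_ge0 u alpha d0 oO neO; rewrite HE lee_fin.
rewrite HE; have W0 : (0 <= W2inf_seminorm Omega u)%E by exact: Lnorm_ge0.
(* An infinite seminorm makes the right-hand side infinite, since its factor is positive. *)
move EW : (W2inf_seminorm Omega u) => WW; rewrite EW in W0 hE *; case: WW EW W0 hE => [W| |] EW W0 hE //; last first.
  by rewrite addey// gt0_muley// leey.
rewrite lee_fin in W0.
move: osc gal hE sol; subst Omega => osc gal hE sol.
have [N1 N10 hN1] := ae_null aeA; have [N2 N20 hN2] := ae_null aef.
pose N := N1 `|` N2.
have N0 : @lebesgue R d N = 0%E.
  apply/eqP; rewrite eq_le outer_measure_ge0 andbT.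
  by apply: le_trans (outer_measureU2 _ _ _) _; rewrite [X in (X + _)%E]N10 [X in (_ + X)%E]N20 adde0.
have boundA x : polytope T x -> ~ N x -> forall xi : 'rV[R]_d,
    lambda * enorm xi ^+ 2 <= quad (A x) xi <= Lambda * enorm xi ^+ 2.
  by move=> Ox nx; apply: (hN1 x _ Ox) => n1; apply: nx; left.
have fE x : polytope T x -> ~ N x -> \sum_k \sum_l A x k l * hess u x k l = f x.
  by move=> Ox nx; apply: (hN2 x _ Ox) => n1; apply: nx; right.
have hW x : polytope T x -> enorm (hess u x) <= W.
  move=> Ox; have := @Linf_norm_ge _ _ _ (fun y => enorm (hess u y)) W d0 oO
    (fun y Oy => continuous_hess_norm Cu Oy).
  have -> : Linf_norm (polytope T) (fun y => enorm (hess u y)) = W%:E by exact: EW.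
  by move=> /(_ (lexx _) x Ox); rewrite ger0_norm// enorm_ge0.
have gu := bounded_continuous_closure conf cu.
have gG := fe_bounded_continuous conf gal.1.1.
pose E := `|CG| * h ^+ 2 * `|ln h| * W.
have E0 : 0 <= E by rewrite !mulr_ge0 ?(ltW h0).
have hE' x : polytope T x -> `|u x - uG x| <= E.
  move=> Ox; apply: (@Linf_norm_ge _ _ (polytope T) (u \- uG) E d0 oO) => //.
    by move=> y Oy; apply: continuousB; [exact: gu.1|exact: gG.1].
  apply: le_trans hE _; rewrite -EFinM lee_fin /E.
  by apply: ler_wpM2r => //; apply: ler_wpM2r => //; rewrite ler_wpM2r ?ler_norm// exprn_ge0// ltW.
have du k : exists c, forall x, polytope T x -> `|partial k u x| <= c.
  have [w [cw hw]] := extu [:: k] isT.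
  have [c hc] := continuous_bounded (@closed_closure _ _) (bounded_polytope conf) cw.
  by exists c => x Ox; have := hc x (subset_closure Ox); rewrite hw.
have hH := @holder_third _ _ _ u alpha H H0 _.
have {}hH : forall p q, polytope T p -> polytope T q -> forall i j k,
    `|third u p i j k - third u q i j k| <= H * enorm (p - q) `^ alpha.
  by apply: hH; rewrite HE.
have h3' : forall p i j k, polytope T p -> `|third u p i j k| <= C3 * (H + W).
  apply: (hC3 u H W Cu H0 hH) => p' k' l' Op'.
  by apply: le_trans (le_entry_enorm _ _ _) (hW _ Op').
have ghr : g * h <= Q * eps.
  have := hh1 h h0 hlt1; rewrite ler_pdivlMr// => e1.
  have -> : g * h = (h `^ t * g) * h `^ s by rewrite [RHS]mulrAC -hts mulrC.
  have -> : Q * eps = Q * C2 * h `^ s by exact: mulrA.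
  by apply: ler_wpM2r e1; exact: ltW.
have hsmall : h * stiff_bound d g <= direction_const d g * (c0 * (Q * eps)).
  have := hh2 h h0 hlt2; rewrite ler_pdivlMr// => e2.
  have -> : direction_const d g * (c0 * (Q * eps)) = (direction_const d g * (c0 * (Q * C2))) * h `^ s.
    by rewrite /eps; ring.
  have -> : h * stiff_bound d g = (h `^ t * stiff_bound d g) * h `^ s by rewrite [RHS]mulrAC -hts.
  by apply: ler_wpM2r e2; exact: ltW.
have rrb : Q * eps <= rb.
  by have := hh3 h h0 hlt3; rewrite ler_pdivlMr// /eps; lra.
have r0 : 0 < Q * eps by exact: mulr_gt0.
have bne := boundary_neq0 d0 oO neO bO.
have exterior x : boundary (polytope T) x -> exists2 z, enorm (z - x) <= Q * eps &
    forall y, enorm (y - z) < c0 * (Q * eps) -> ~ closure (polytope T) y.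
  by move=> bx; exact: ext.
have dT (i j : 'I_(nnodes T)) : enorm (node i - node j) <= D.
  by apply: hD; rewrite closure_polytope//; exact: union_node.
have oscA : \sum_(i : 'I_(nnodes T) | `[< polytope T (node i) >])
    integ (star (polytope T) i `&` polytope T) (fun x => enorm (A x - mean_coefficient (polytope T) A i) ^+ d) <=
    (`|CA| * X) ^+ d.
  move: osc; rewrite /coefficient_oscillation; set sm := \sum_(i | _) _ => osc.
  have sm0 : 0 <= sm.
    by apply: sumr_ge0 => i _; apply: integ_ge0 => x _; rewrite exprn_ge0 ?enorm_ge0.
  have -> : sm = (sm `^ d%:R^-1) ^+ d.
    by rewrite -powR_mulrn ?powR_ge0// -powRrM mulVf ?powRr1// pnatr_eq0 -lt0n.
  rewrite lerXn2r ?nnegrE ?powR_ge0// ?mulr_ge0 ?(ltW X0)//; apply: le_trans osc _.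
  (* For h <= 1 the larger exponent beta gives the smaller power. *)
  apply: (@le_trans _ _ (`|CA| * h `^ beta)); first by rewrite ler_wpM2r ?powR_ge0// ler_norm.
  by rewrite ler_wpM2l// ger_powR// h0.
have H30 : 0 <= C3 * (H + W) by rewrite mulr_ge0// addr_ge0.
have B0 : 0 <= `|CA| * X by rewrite mulr_ge0// ltW.
rewrite -EFinD -EFinM; apply: Linf_norm_le => //.
  by rewrite mulr_ge0 ?addr_ge0// ltW.
move=> x Ox; have := pointwise_estimate conf d0 h0 g0 hulls_le hulls_ge acute D0 dT kphi eps0 l0 lL ghr c00 q0 pg
  hsmall bne exterior (ltW a0) H0 W0 H30 E0 B0 Cu gu hH hW h3' du N0 mA symA boundA fE gal hE' sqM sol oscA Ox.
move=> pe; apply: le_trans pe _.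
have := scaling T kphi q g0 D0 l0 lL c00 C20 C30 (normr_ge0 CA) (normr_ge0 CG) a0 a1 h0 hle1 W0 H0 ln1.
rewrite -/s -/p -/X -/E => sc; apply: le_trans sc _.
rewrite -!mulrA; apply: ler_wpM2r.
  by rewrite !mulr_ge0 ?addr_ge0// ltW.
by rewrite /C /total_constant VT0; apply: ler_wpDr => //; exact: ler_norm.
Qed.
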